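(* Let $N\ge2$, $\lambda<\left(\frac{N-1}{2}\right)^2$, and $1<p\le\frac{N+2}{N-2}$ (with $1<p<\infty$ if $N=2$). Let $u\in H^1(\mathbb{B}^N)$ be a solution of $$-\Delta_{\mathbb{B}^N}u-\lambda u=|u|^{p-1}u\quad\text{in }\mathbb{B}^N.$$ Then $u(x)\to0$ and $|\nabla_{\mathbb{B}^N}u(x)|^2_{\mathbb{B}^N}\to0$ as $x\to\infty$ in $\mathbb{B}^N$ (i.e. as $|x|\to1$). In particular $u\in L^\infty(\mathbb{B}^N)$.
   Context: $\mathbb{B}^N=\{x\in\mathbb{R}^N:|x|<1\}$ is the ball model of hyperbolic space, with metric $g_{ij}=\left(\frac{2}{1-|x|^2}\right)^2\delta_{ij}$, volume $dV_{\mathbb{B}^N}=\left(\frac{2}{1-|x|^2}\right)^N dx$, and Laplace-Beltrami operator $\Delta_{\mathbb{B}^N}=\left(\frac{1-|x|^2}{2}\right)^2\Delta+(N-2)\frac{1-|x|^2}{2}\langle x,\nabla\cdot\rangle$. The norm of the hyperbolic gradient is given by $|\nabla_{\mathbb{B}^N}u|^2_{\mathbb{B}^N}=\left(\frac{1-|x|^2}{2}\right)^2|\nabla u|^2$, with $\nabla$ the Euclidean gradient. $H^1(\mathbb{B}^N)$ is the Sobolev space of this Riemannian manifold, with squared norm $\int_{\mathbb{B}^N}(|\nabla_{\mathbb{B}^N}u|^2_{\mathbb{B}^N}+u^2)\,dV_{\mathbb{B}^N}$. Solutions are understood in the weak sense; by standard elliptic theory they are in $C^2(\mathbb{B}^N)$.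 *)

(* Defs.v *)
From HB Require Import structures.
From mathcomp Require Import all_boot all_order all_algebra.
From mathcomp Require Import all_classical all_reals all_analysis.

Set Implicit Arguments.
Unset Strict Implicit.
Unset Printing Implicit Defensive.

Import Order.TTheory GRing.Theory Num.Theory.
Import numFieldNormedType.Exports.

Local Open Scope classical_set_scope.
Local Open Scope ring_scope.

(* Row vectors carry the sigma-algebra generated by the coordinates, i.e. the
   Borel sigma-algebra of R^n. *)
Section measurable_rV.
Context {R : realType} (n : nat).

Definition rV_coord (i : 'I_n) (x : 'rV[R]_n) : R := x ord0 i.

Let rV_set0 : g_sigma_preimage rV_coord set0.
Proof. exact: sigma_algebra0. Qed.

Let rV_setC A : g_sigma_preimage rV_coord A -> g_sigma_preimage rV_coord (~` A).
Proof. exact: sigma_algebraC. Qed.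

Let rV_bigcup (F : _^nat) : (forall i, g_sigma_preimage rV_coord (F i)) ->
  g_sigma_preimage rV_coord (\bigcup_i (F i)).
Proof. exact: sigma_algebra_bigcup. Qed.

HB.instance Definition _ :=
  @isMeasurable.Build (measure_tuple_display default_measure_display)
    'rV[R]_n (g_sigma_preimage rV_coord) rV_set0 rV_setC rV_bigcup.

End measurable_rV.

Lemma measurable_rV_coord (R : realType) n (i : 'I_n) :
  measurable_fun [set: 'rV[R]_n] (rV_coord i).
Proof.
move=> _ Y mY; rewrite setTI; apply: sub_sigma_algebra => /=.
rewrite -bigcup_seq/=; exists i => /=; first by rewrite mem_index_enum.
by exists Y => //; rewrite setTI.
Qed.

Lemma measurable_fun_rV d (T : measurableType d) (R : realType) n
    (f : T -> 'rV[R]_n) :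
  (forall i, measurable_fun [set: T] (rV_coord i \o f)) ->
  measurable_fun [set: T] f.
Proof.
move=> mf _ A mA; rewrite setTI.
have : preimage_set_system [set: T] f measurable (f @^-1` A).
  by exists A; rewrite ?setTI.
rewrite /measurable/= -g_sigma_preimage_comp; apply: smallest_sub.
  exact: sigma_algebra_measurable.
rewrite -bigcup_seq/= => B [i _ [Y mY <-]].
exact: mf.
Qed.

Section rV_cons.
Context {R : realType} (n : nat).

Definition rV_cons (x : R * 'rV[R]_n) : 'rV[R]_n.+1 :=
  \row_i (if unlift ord0 i is Some j then x.2 ord0 j else x.1).

Definition rV_uncons (v : 'rV[R]_n.+1) : R * 'rV[R]_n :=
  (v ord0 ord0, \row_j v ord0 (lift ord0 j)).

Lemma rV_consK : cancel rV_cons rV_uncons.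
Proof.
case=> a w; rewrite /rV_uncons mxE unlift_none; congr pair.
by apply/rowP => j; rewrite !mxE liftK.
Qed.

Lemma measurable_rV_cons : measurable_fun [set: (R * 'rV[R]_n)%type] rV_cons.
Proof.
apply: measurable_fun_rV => i.
case: (unliftP ord0 i) => [j|] ->.
  rewrite (_ : _ \o _ = rV_coord j \o snd); last first.
    by apply/funext => x /=; rewrite /rV_coord mxE liftK.
  by apply: measurableT_comp; [exact: measurable_rV_coord|exact: measurable_snd].
rewrite (_ : _ \o _ = fst); first exact: measurable_fst.
by apply/funext => x /=; rewrite /rV_coord mxE unlift_none.
Qed.

Lemma measurable_rV_uncons : measurable_fun [set: 'rV[R]_n.+1] rV_uncons.
Proof.
apply: measurable_fun_pair; first exact: measurable_rV_coord.
apply: measurable_fun_rV => j.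
rewrite (_ : _ \o _ = rV_coord (lift ord0 j)); first exact: measurable_rV_coord.
by apply/funext => x; rewrite /rV_coord /= mxE.
Qed.

End rV_cons.

Section lebesgue_rV_step.
Local Open Scope ereal_scope.
Context {R : realType} (n : nat).
Variable mu : {sigma_finite_measure set 'rV[R]_n -> \bar R}.

Definition rV_product : set 'rV[R]_n.+1 -> \bar R :=
  pushforward (@lebesgue_measure R \x mu) (@rV_cons R n).

Let mcons := @measurable_rV_cons R n.

Let rV_product0 : rV_product set0 = 0.
Proof. exact: measure0. Qed.

Let rV_product_ge0 A : 0 <= rV_product A.
Proof. exact: measure_ge0. Qed.

Let rV_product_sigma_additive : semi_sigma_additive rV_product.
Proof. exact: measure_semi_sigma_additive. Qed.

HB.instance Definition _ := isMeasure.Build _ _ _ rV_product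
  rV_product0 rV_product_ge0 rV_product_sigma_additive.

Let rV_product_sigma_finite : sigma_finite setT rV_product.
Proof.
have [F FT Foo] := sigma_finiteT (@lebesgue_measure R).
have [G GT Goo] := sigma_finiteT mu.
pose H k := let kk := odflt (0%N, 0%N) (unpickle k) in F kk.1 `*` G kk.2.
have mH k : measurable (H k).
  by apply: measurableX; [have [] := Foo (odflt (0%N, 0%N) (unpickle k)).1
                         |have [] := Goo (odflt (0%N, 0%N) (unpickle k)).2].
exists (fun k => @rV_uncons R n @^-1` H k).
  rewrite -preimage_bigcup; apply/esym/seteqP; split => // v _.
  have [k1 _ Fk] : (\bigcup_i F i) (rV_uncons v).1 by rewrite -FT.
  have [k2 _ Gk] : (\bigcup_i G i) (rV_uncons v).2 by rewrite -GT.
  by exists (pickle (k1, k2)) => //; rewrite /H pickleK.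
move=> k; split.
  rewrite -[X in measurable X]setTI.
  apply: measurable_rV_uncons; [exact: measurableT|exact: mH].
rewrite /rV_product /pushforward -comp_preimage.
rewrite (_ : _ \o _ = id); last by apply/funext => x; exact: rV_consK.
rewrite preimage_id product_measure1E//; last 2 first.
- by have [] := Foo (odflt (0%N, 0%N) (unpickle k)).1.
- by have [] := Goo (odflt (0%N, 0%N) (unpickle k)).2.
have [? ?] := Foo (odflt (0%N, 0%N) (unpickle k)).1.
have [? ?] := Goo (odflt (0%N, 0%N) (unpickle k)).2.
by rewrite lte_mul_pinfty// ge0_fin_numE.
Qed.

HB.instance Definition _ := Measure_isSigmaFinite.Build _ _ _ rV_product
  rV_product_sigma_finite.

End lebesgue_rV_step.

(* N-dimensional Lebesgue measure, as an iterated product of the measure on R. *)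
Fixpoint lebesgue_rV (R : realType) (n : nat) :
    {sigma_finite_measure set 'rV[R]_n -> \bar R} :=
  match n with
  | 0 => \d_(0 : 'rV[R]_0)
  | m.+1 => rV_product (lebesgue_rV R m)
  end.
Arguments lebesgue_rV {R n}.

Lemma lebesgue_rV_box (R : realType) n (A : 'I_n -> set R) :
  (forall i, measurable (A i)) ->
  lebesgue_rV [set x : 'rV[R]_n | forall i, A i (x ord0 i)] =
  (\prod_(i < n) lebesgue_measure (A i))%E.
Proof.
elim: n A => [A _|n IH A mA].
  rewrite big_ord0 /= diracE mem_set //=.
  by move=> [].
rewrite big_ord_recl /= /rV_product /pushforward -IH //.
rewrite -product_measure1E; [|exact: mA|]; last first.
  rewrite (_ : mkset _ = \bigcap_(i in [set: 'I_n]) (rV_coord i @^-1` A (lift ord0 i))).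
    apply: fin_bigcap_measurable => // i _.
    by rewrite -[X in measurable X]setTI; apply: measurable_rV_coord.
  by apply/seteqP; split => x /= H i; [move=> _|]; apply: H.
congr (product_measure1 _ _ _); apply/seteqP; split => -[a w] /=.
  move=> H; split; first by move: (H ord0); rewrite mxE unlift_none.
  by move=> i; move: (H (lift ord0 i)); rewrite mxE liftK.
move=> [Ha Hw] i; rewrite mxE.
by case: (unliftP ord0 i) => [j|] ->.
Qed.

Section calculus.
Context {R : realType} {N : nat}.
Implicit Types (x y : 'rV[R]_N) (f u : 'rV[R]_N -> R) (U : set 'rV[R]_N).

(* The library norm on row vectors is the sup norm; the Euclidean one is
   [enorm]. *)
Definition edot x y : R := \sum_(i < N) x ord0 i * y ord0 i.
Definition enorm x : R := Num.sqrt (edot x x).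

Definition partial (i : 'I_N) f : 'rV[R]_N -> R := 'D_(delta_mx ord0 i) f.
Definition grad f x : 'rV[R]_N := \row_i partial i f x.

Fixpoint class_C (k : nat) U f : Prop :=
  (forall x, U x -> {for x, continuous f}) /\
  match k with
  | 0 => True
  | k'.+1 => forall i, (forall x, U x -> derivable f x (delta_mx ord0 i)) /\
                       class_C k' U (partial i f)
  end.

(* smooth functions with compact support in U *)
Definition test_function U f : Prop :=
  (forall k, class_C k setT f) /\
  exists K, [/\ compact K, K `<=` U & forall x, ~ K x -> f x = 0].

Definition locally_integrable_rV U f : Prop :=
  measurable_fun U f /\
  forall K, compact K -> K `<=` U -> lebesgue_rV.-integrable K (EFin \o f).

(* G is the distributional Euclidean gradient of u on U *)
Definition weak_gradient U u (G : 'rV[R]_N -> 'rV[R]_N) : Prop :=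
  locally_integrable_rV U u /\
  forall i, locally_integrable_rV U (rV_coord i \o G) /\
    forall phi, test_function U phi ->
      \int[lebesgue_rV]_(x in U) (u x * partial i phi x) =
      - \int[lebesgue_rV]_(x in U) (rV_coord i (G x) * phi x).

End calculus.

Section hyperbolic_ball.
Context {R : realType} {N : nat}.
Implicit Types (x a b : 'rV[R]_N) (u : 'rV[R]_N -> R)
  (G : 'rV[R]_N -> 'rV[R]_N).

Definition hball : set 'rV[R]_N := [set x | enorm x < 1].

(* the metric is g_ij = conformal x ^+ 2 * delta_ij *)
Definition conformal x : R := 2 / (1 - enorm x ^+ 2).

(* density of the hyperbolic volume with respect to Lebesgue measure *)
Definition hvol x : R := conformal x ^+ N.

(* For a and b Euclidean gradients at x, the inner product in the metric g of
   the corresponding hyperbolic gradients. *)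
Definition hgrad_dot x a b : R := ((1 - enorm x ^+ 2) / 2) ^+ 2 * edot a b.

(* u is in H^1 of the hyperbolic ball, with weak Euclidean gradient G *)
Definition H1_grad u G : Prop :=
  weak_gradient hball u G /\
  (\int[lebesgue_rV]_(x in hball)
     ((hgrad_dot x (G x) (G x) + u x ^+ 2) * hvol x)%:E < +oo)%E.

Definition H1 u : Prop := exists G, H1_grad u G.

(* Weak form of - Delta u - lam * u = `|u| `^ (p - 1) * u. The Laplace-Beltrami
   operator is the divergence
     Delta f = conformal^-N * div (conformal^(N-2) * grad f)
             = conformal^-2 * (Euclidean Laplacian of f)
               + (N-2) * conformal^-1 * <x, grad f>,
   as the Euclidean gradient of conformal is conformal^2 * x, so that
   multiplying by phi * hvol and integrating by parts gives the identity
   below. *)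
Definition weak_solution (lam p : R) u : Prop :=
  exists G, H1_grad u G /\
  forall phi, test_function hball phi ->
    \int[lebesgue_rV]_(x in hball)
      ((hgrad_dot x (G x) (grad phi x) - lam * u x * phi x) * hvol x) =
    \int[lebesgue_rV]_(x in hball)
      (`|u x| `^ (p - 1) * u x * phi x * hvol x).

(* the filter of neighbourhoods of infinity in the ball, i.e. |x| -> 1 *)
Definition hinfty : set_system 'rV[R]_N :=
  filter_from [set r : R | r < 1] (fun r => [set x | r < enorm x < 1]).

#[global] Instance hinfty_filter : Filter hinfty.
Proof.
apply: filter_from_filter; first by exists 0 => /=.
move=> r s /= r1 s1; exists (Num.max r s) => /=; first by rewrite gt_max r1.
by move=> x /=; rewrite gt_max => /andP[/andP[-> ->] ->].
Qed.

(* Null sets for the hyperbolic volume and for Lebesgue measure on the ball are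
   the same. *)
Definition Linfty u : Prop :=
  measurable_fun hball u /\
  exists M : R, {ae lebesgue_rV, forall x, hball x -> `|u x| <= M}.

End hyperbolic_ball.

(* Main.v *)
(* Writing the metric as cfac^-2 times the Euclidean one, cfac x = (1 - |x|^2) / 2,
   the function v = cfac^(-(n-2)/2) u solves a Euclidean Poisson equation without
   first order term.  Rescaling v on a cube around x0 of size comparable to cfac x0
   gives a solution w of - Lap w = g on the unit cube, with |g| <= A (|w| + |w|^p)
   and A independent of x0, while the L^2 norms of w and of its gradient are bounded
   by the hyperbolic energy of u near x0.

   For such w: the Sobolev inequality (from the grid lines inequality) and a single
   Brezis-Kato step, with the power truncated at a level beyond which |w|^(2 kap) has
   small integral, give w in L^q with q large; hence g is in a Morrey space and the
   mollifications of w converge in C^1, with a bound that tends to 0 with the L^2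
   norms of the data; applying this to the derivatives of w gives C^2.

   Since the energy of u is finite, it vanishes near infinity, and so do u(x0) and
   the rescaled gradient, which is comparable to the hyperbolic gradient at x0. *)
From HB Require Import structures.
Require Import Defs.
From mathcomp Require Import all_boot all_order all_algebra.
From mathcomp Require Import all_classical all_reals all_analysis.
From mathcomp Require Import measurable_realfun lebesgue_measure lra ring.

Set Implicit Arguments.
Unset Strict Implicit.
Unset Printing Implicit Defensive.

Import Order.TTheory GRing.Theory Num.Theory.
Import numFieldNormedType.Exports.

Local Open Scope classical_set_scope.
Local Open Scope ring_scope.

(** * Lebesgue measure on R^n *)

Section rV_topology.
Context {R : realType} {n : nat}.
Implicit Types (x y : 'rV[R]_n) (e : R).

(** At the critical power the Sobolev inequality alone gains nothing: [|w|^(p-1)] lies only in a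
    scale-invariant space, and just its smallness can be used. Smallness has two sources. For decay
    it is the small energy near infinity, uniform in the center; for regularity it is a high
    truncation level [M], chosen for each solution. Hence the local estimate fixes its threshold
    [eps] before [M]. The exponent [kap], half of a Sobolev exponent, is constrained only by
    [kap * (n - 2) <= n] and [p + 1 <= 2 * kap]; this treats dimension two and the critical case
    alike. No Green function is needed. Once the first order term is gone, the equation is an
    identity between convolutions, tested against translates of radial kernels only. The derivative
    in [t] of the averaging kernel [moll t] is [t] times the Laplacian of a second kernel [pmoll t],
    so mollifications of [w] at two scales differ by potentials of [g], and C^1 bounds come from a
    geometric sum over scales. *)

Lemma rV_norm_ltP x e : 0 < e -> reflect (forall i, `|x ord0 i| < e) (`|x| < e).
Proof.
move=> e0; apply: (iffP idP).
  rewrite [X in X < _]mx_normrE => /bigmax_ltP[_ H] i.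
  exact: (H (ord0, i)).
move=> H; rewrite [X in X < _]mx_normrE; apply/bigmax_ltP; split => // -[i j] _ /=.
by rewrite ord1.
Qed.

Lemma rV_norm_leP x e : 0 <= e -> reflect (forall i, `|x ord0 i| <= e) (`|x| <= e).
Proof.
move=> e0; apply: (iffP idP).
  rewrite [X in X <= _]mx_normrE => /bigmax_leP[_ H] i.
  exact: (H (ord0, i)).
move=> H; rewrite [X in X <= _]mx_normrE; apply/bigmax_leP; split => // -[i j] _ /=.
by rewrite ord1.
Qed.

Lemma coord_le_norm x i : `|x ord0 i| <= `|x|.
Proof. by move: i; apply/rV_norm_leP. Qed.

Lemma open_rVP (A : set 'rV[R]_n) :
  open A <-> (forall x, A x -> exists2 e, 0 < e & forall y, `|y - x| < e -> A y).
Proof.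
rewrite openE; split => H x Ax.
  have /nbhs_ballP[e e0 He] := H _ Ax.
  by exists e => // y yx; apply: He; rewrite mx_norm_ball /ball_/= distrC.
have [e e0 He] := H _ Ax; apply/nbhs_ballP; exists e => // y.
by rewrite mx_norm_ball /ball_/= distrC => /He.
Qed.

(** The ball of the sup norm, which is a box: its Lebesgue measure is an explicit product, and all
    localizations below use such cubes instead of Euclidean balls. *)
Definition cube x (r : R) := [set y : 'rV[R]_n | `|y - x| < r].

Lemma measurable_cube x r : measurable (cube x r).
Proof.
have [r0|r0] := ltP 0 r; last first.
  rewrite (_ : cube x r = set0); first exact: measurable0.
  by apply/seteqP; split => // y; rewrite /cube/= ltNge (le_trans r0).
rewrite (_ : cube x r = \bigcap_(i in [set: 'I_n])
   (rV_coord i @^-1` [set t : R | `|t - x ord0 i| < r])).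
  apply: fin_bigcap_measurable => // i _.
  rewrite -[X in measurable X]setTI; apply: measurable_rV_coord => //.
  apply: open_measurable.
  rewrite (_ : mkset _ = ball (x ord0 i : R) r); first exact: ball_open.
  by apply/seteqP; split => t /=; rewrite /ball/= distrC.
apply/seteqP; split => y /=.
  by move=> /(rV_norm_ltP _ r0) H i _; have := H i; rewrite !mxE.
by move=> H; apply/(rV_norm_ltP _ r0) => i; rewrite !mxE; exact: H.
Qed.

(** A countable base of the topology. It makes open sets measurable for the sigma-algebra generated
    by the coordinates, and later turns local almost everywhere statements into global ones. *)
Lemma rational_cube x d : 0 < d -> exists q : 'rV[rat]_n * nat,
  cube (map_mx ratr q.1) q.2.+1%:R^-1 x /\ cube (map_mx ratr q.1) q.2.+1%:R^-1 `<=` cube x d.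
Proof.
move=> d0; have [k] : exists k : nat, 0 + k.+1%:R^-1 < d / 2 by apply: ltr_add_invr; rewrite divr_gt0.
rewrite add0r => ke; have k0 : 0 < k.+1%:R^-1 :> R by rewrite invr_gt0.
have /choice[q qx] : forall i, exists q : rat, `|x ord0 i - ratr q| < k.+1%:R^-1.
  move=> i; have [q] : exists q : rat, ratr q \in `](x ord0 i - k.+1%:R^-1), (x ord0 i)[.
    by apply: rat_in_itvoo; rewrite ltrBlDr ltrDl.
  rewrite in_itv/= => /andP[q1 q2]; exists q.
  by rewrite ger0_norm ?subr_ge0 1?ltW // ltrBlDr -ltrBlDl.
exists (\row_i q i, k) => /=; set c := map_mx _ _.
have xc : `|x - c| < k.+1%:R^-1 by apply/rV_norm_ltP => // i; rewrite !mxE.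
split=> // y; rewrite /cube/= => yc; have := ler_distD c y x; move=> /le_lt_trans; apply.
by rewrite (splitr d) ltrD// ?(lt_trans _ ke)// distrC.
Qed.

Lemma open_measurable_rV (A : set 'rV[R]_n) : open A -> measurable A.
Proof.
move=> /open_rVP oA; pose C (q : 'rV[rat]_n * nat) := cube (map_mx ratr q.1) q.2.+1%:R^-1.
(* Codes that name no pair, and cubes that are not inside [A], contribute the empty set. *)
pose F (k : nat) := if (unpickle k : option ('rV[rat]_n * nat)) is Some q
  then (if `[< C q `<=` A >] then C q else set0) else set0.
have -> : A = \bigcup_k F k.
  apply/seteqP; split => [x Ax|x [k _]]; last first.
    by rewrite /F; case: unpickle => // q; case: asboolP => // + xq; apply.
  have [e e0 He] := oA _ Ax; have [q [qx qe]] := rational_cube x e0.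
  exists (pickle q) => //; rewrite /F pickleK; case: asboolP => // -[] y /qe; exact: He.
apply: bigcupT_measurable => k; rewrite /F; case: unpickle => // q.
by case: asboolP => // _; exact: measurable_cube.
Qed.

End rV_topology.

Section rV_borel.
Context {R : realType} {n : nat}.
Implicit Types (x y : 'rV[R]_n) (e : R).

Lemma continuous_measurable_rV (f : 'rV[R]_n -> R) (U : set 'rV[R]_n) : open U ->
  (forall x, U x -> {for x, continuous f}) -> measurable_fun U f.
Proof.
move=> oU cf; apply: (measurability _ (RGenOInfty.measurableE R)).
move=> _ [_ [a ->] <-]; apply: open_measurable_rV.
rewrite openE => x [Ux xa] /=; apply: filterI.
  by apply: (open_nbhs_nbhs (conj oU Ux)).
apply: (cf x Ux); apply: open_nbhs_nbhs; split; last exact: xa.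
exact: interval_open.
Qed.

Lemma continuousT_measurable_rV (f : 'rV[R]_n -> R) : continuous f ->
  measurable_fun setT f.
Proof. move=> cf; apply: continuous_measurable_rV => [|x _]; [exact: openT|exact: cf]. Qed.

Lemma open_cube x r : open (cube x r).
Proof.
apply/open_rVP => y yx; exists (r - `|y - x|); first by rewrite subr_gt0.
move=> z; rewrite ltrBrDr => zy; apply: le_lt_trans zy.
by rewrite -(subrKA y z (- x)) ler_normD.
Qed.

Lemma lebesgue_cube x r : 0 < r -> lebesgue_rV (cube x r) = ((2 * r) ^+ n)%:E.
Proof.
move=> r0; rewrite (_ : cube x r = [set y : 'rV[R]_n | forall i, (fun i => `](x ord0 i - r), (x ord0 i + r)[%classic) i (y ord0 i)]).
  rewrite (@lebesgue_rV_box R n (fun i => `](x ord0 i - r), (x ord0 i + r)[%classic)); last by move=> i; exact: measurable_itv.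
  rewrite (eq_bigr (fun=> (2 * r)%:E)).
    by rewrite big_const_ord; elim: n => [|m IH] /=; rewrite ?expr0// IH exprS.
  move=> i _; rewrite lebesgue_measure_itv/= lte_fin ifT; last lra.
  by rewrite -EFinB; congr EFin; ring.
apply/seteqP; split => y /=.
  move=> /rV_norm_ltP H i; move: (H r0 i); rewrite !mxE in_itv/= ltr_norml.
  by move=> /andP[? ?]; apply/andP; split; lra.
move=> H; apply/rV_norm_ltP => // i; move: (H i); rewrite !mxE in_itv/= ltr_norml.
by move=> /andP[? ?]; apply/andP; split; lra.
Qed.

Lemma compact_cube (K : set 'rV[R]_n) : compact K -> exists2 r, 0 < r & K `<=` cube 0 r.
Proof.
move=> /compact_bounded[M [_ HM]]; exists (`|M| + 2); first by rewrite ltr_wpDl.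
move=> x Kx; rewrite /cube/= subr0; apply: (@le_lt_trans _ _ (`|M| + 1)); last by rewrite ltrD2l ltr1n.
by apply: (HM (`|M| + 1)) => //; rewrite (le_lt_trans (ler_norm _)) // ltrDl.
Qed.

Lemma closed_cube_compact x r : compact [set y : 'rV[R]_n | `|y - x| <= r].
Proof.
have -> : [set y : 'rV[R]_n | `|y - x| <= r] = closed_ball_ Num.norm x r.
  by apply/seteqP; split => y /=; rewrite distrC.
apply: bounded_closed_compact; last exact: closed_closed_ball_.
exists (`|x| + r); split => [|M xM y /=]; first exact: num_real.
rewrite /closed_ball_/= distrC => yx; rewrite -(subrK x y); apply: le_trans (ler_normD _ _) _.
by rewrite addrC; apply: le_trans (ltW xM); rewrite lerD2l.
Qed.

End rV_borel.

(** * Tonelli's theorem and affine changes of variables *)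

Section rV_integral.
Context {R : realType}.
Local Open Scope ereal_scope.
Local Notation leb := (@lebesgue_measure R).

Lemma rV_tonelli n (f : 'rV[R]_n.+1 -> \bar R) : measurable_fun setT f ->
  (forall x, 0 <= f x) ->
  \int[lebesgue_rV]_x f x = \int[leb]_t \int[lebesgue_rV]_y f (rV_cons (t, y)).
Proof.
move=> mf f0.
have mc : measurable_fun [set: (measurableTypeR R * 'rV[R]_n)%type] (@rV_cons R n).
  exact: measurable_rV_cons.
have := ge0_integral_pushforward mc
  (leb \x lebesgue_rV) measurableT mf (fun x _ => f0 x).
rewrite preimage_setT fubini_tonelli1//; last 2 first.
- by apply: measurableT_comp => //; exact: measurable_rV_cons.
- by move=> x; exact: f0.
Qed.

Lemma rV_tonelli_swap n (f : 'rV[R]_n.+1 -> \bar R) : measurable_fun setT f ->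
  (forall x, 0 <= f x) ->
  \int[lebesgue_rV]_x f x = \int[lebesgue_rV]_y \int[leb]_t f (rV_cons (t, y)).
Proof.
move=> mf f0; rewrite rV_tonelli//.
rewrite (fubini_tonelli (m1 := leb) (m2 := lebesgue_rV) (f \o @rV_cons R n))//; last first.
  by move=> x; exact: f0.
by apply: measurableT_comp => //; exact: measurable_rV_cons.
Qed.

Lemma measurable_rV_cons1 n (t : R) :
  measurable_fun setT (fun y : 'rV[R]_n => rV_cons (t, y)).
Proof.
apply: measurableT_comp; first exact: measurable_rV_cons.
exact: measurable_pair1.
Qed.

Lemma measurable_rV_cons2 n (y : 'rV[R]_n) :
  measurable_fun setT (fun t : R => rV_cons (t, y)).
Proof.
apply: measurableT_comp; first exact: measurable_rV_cons.
exact: measurable_pair2.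
Qed.

Lemma measurable_rV_inner n (f : 'rV[R]_n.+1 -> \bar R) : measurable_fun setT f ->
  (forall x, 0 <= f x) ->
  measurable_fun setT (fun y => \int[leb]_t f (rV_cons (t, y))).
Proof.
move=> mf f0.
apply: (@measurable_fun_fubini_tonelli_G _ _ _ _ _ leb (f \o @rV_cons R n)) => [|x]; last exact: f0.
by apply: measurableT_comp => //; exact: measurable_rV_cons.
Qed.

Lemma measurable_rV_outer n (f : 'rV[R]_n.+1 -> \bar R) : measurable_fun setT f ->
  (forall x, 0 <= f x) ->
  measurable_fun setT (fun t => \int[lebesgue_rV]_y f (rV_cons (t, y))).
Proof.
move=> mf f0.
apply: (@measurable_fun_fubini_tonelli_F _ _ _ _ _ lebesgue_rV (f \o @rV_cons R n)) => [|x]; last exact: f0.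
by apply: measurableT_comp => //; exact: measurable_rV_cons.
Qed.

Lemma measurable_affine (a r : R) : measurable_fun setT (fun t : R => (a + r * t)%R).
Proof. by apply: measurable_funD => //; exact: mulrl_measurable. Qed.

(** The rescaled pushforward of Lebesgue measure has the right value on half-open intervals, and
    Lebesgue measure is determined by these values. *)
Lemma lebesgue_affine (a r : R) (A : set R) : (0 < r)%R -> measurable A ->
  r%:E * leb ((fun t => a + r * t)%R @^-1` A) = leb A.
Proof.
move=> r0 mA; pose k := NngNum (ltW r0).
pose phi := (fun t : R => a + r * t)%R : measurableTypeR R -> measurableTypeR R.
have mphi : measurable_fun setT phi by exact: measurable_affine.
have [m mE] : exists m : {measure set (measurableTypeR R) -> \bar R},
    forall B, m B = leb (phi @^-1` B).
  by unshelve refine (ex_intro _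
    (pushforward leb phi : {measure set (measurableTypeR R) -> \bar R}) _).
rewrite -[leb (_ @^-1` _)]/(leb (phi @^-1` A)) -mE.
apply/esym/(@lebesgue_measure_unique _ (mscale k m)) => //.
move=> _ [[c b] _ <-].
transitivity (r%:E * leb (phi @^-1` `]c, b]%classic)); last by rewrite -mE.
rewrite (_ : _ @^-1` _ = `](c - a) / r, (b - a) / r]%classic)%R.
  rewrite !lebesgue_measure_itv /= !lte_fin ltr_pM2r ?invr_gt0// ltrD2r.
  case: ltP => cb; last by rewrite mule0.
  by rewrite -!EFinB -EFinM; congr EFin; field; rewrite gt_eqF.
apply/seteqP; split => t /=; rewrite /phi !in_itv/= ltr_pdivrMr// ler_pdivlMr//.
  by rewrite ltrBlDl lerBrDl [(t * r)%R]mulrC.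
by rewrite ltrBlDl lerBrDl [(t * r)%R]mulrC.
Qed.

Lemma ge0_integral_affine1 (a r : R) (f : R -> \bar R) : (0 < r)%R ->
  measurable_fun setT f -> (forall t, 0 <= f t) ->
  r%:E * \int[leb]_t f (a + r * t)%R = \int[leb]_t f t.
Proof.
move=> r0 mf f0; pose k := NngNum (ltW r0).
pose phi := (fun t : R => a + r * t)%R : measurableTypeR R -> measurableTypeR R.
have mphi : measurable_fun setT phi by exact: measurable_affine.
have := ge0_integral_pushforward mphi leb measurableT mf (fun x _ => f0 x).
rewrite preimage_setT => <-.
rewrite -[r%:E]/((k%:num)%:E) -ge0_integral_mscale//.
by apply: eq_measure_integral => A mA _; exact: (lebesgue_affine a r0 mA).
Qed.

Lemma measurable_rV_affine n (a : 'rV[R]_n) (r : R) :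
  measurable_fun setT (fun x : 'rV[R]_n => a + r *: x)%R.
Proof.
apply: measurable_fun_rV => i; rewrite (_ : _ \o _ = (fun x => a ord0 i + r * rV_coord i x)%R).
  exact: (measurableT_comp (measurable_affine _ _) (measurable_rV_coord i)).
by apply/funext => x; rewrite /rV_coord /= !mxE.
Qed.

(** By induction on the dimension: the measure is an iterated product, so the first coordinate is
    changed by the one-variable formula and contributes one factor [r]. *)
Lemma ge0_integral_affine n (a : 'rV[R]_n) (r : R) (f : 'rV[R]_n -> \bar R) : (0 < r)%R ->
  measurable_fun setT f -> (forall x, 0 <= f x) ->
  (r ^+ n)%:E * \int[lebesgue_rV]_x f (a + r *: x)%R = \int[lebesgue_rV]_x f x.
Proof.
elim: n a f => [|n IH] a f r0 mf f0.
  rewrite expr0 mul1e; apply: eq_integral => x _; congr f.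
  by apply/rowP => -[].
have mfa : measurable_fun setT (f \o (fun x : 'rV[R]_n.+1 => a + r *: x)%R).
  by apply: measurableT_comp => //; exact: measurable_rV_affine.
rewrite rV_tonelli//= [in RHS]rV_tonelli//=.
pose a' := \row_j a ord0 (lift ord0 j).
have E t y : (a + r *: rV_cons (t, y))%R = rV_cons (a ord0 ord0 + r * t, a' + r *: y)%R.
  by apply/rowP => i; rewrite !mxE; case: (unliftP ord0 i) => [j|] -> //=; rewrite ?mxE.
rewrite -[RHS](@ge0_integral_affine1 (a ord0 ord0) r _ r0); last 2 first.
- exact: measurable_rV_outer.
- by move=> t /=; apply: integral_ge0 => y _; exact: f0.
rewrite exprS EFinM -muleA; congr (_ * _).
transitivity (\int[leb]_t ((r ^+ n)%:E * \int[lebesgue_rV]_y f (a + r *: rV_cons (t, y))%R)).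
  rewrite ge0_integralZl//.
  - exact: (measurable_rV_outer mfa (fun x => f0 _)).
  - by move=> t _; apply: integral_ge0 => y _; exact: f0.
  - by rewrite lee_fin exprn_ge0// ltW.
apply: eq_integral => t _; rewrite -(IH a' (fun y => f (rV_cons (a ord0 ord0 + r * t, y)%R)))//.
  by congr (_ * _); apply: eq_integral => y _; rewrite E.
by apply: measurableT_comp => //; exact: measurable_rV_cons1.
Qed.

End rV_integral.

(** * The grid lines inequality *)

Section holder.
Local Open Scope ereal_scope.
Context d {T : measurableType d} {R : realType} (mu : {measure set T -> \bar R}).

Lemma young_poweR (x y : \bar R) (a b : R) : 0 <= x -> 0 <= y ->
  (0 < a)%R -> (0 < b)%R -> (a + b = 1)%R ->
  x `^ a * y `^ b <= a%:E * x + b%:E * y.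
Proof.
case: x => [x| |]//; case: y => [y| |]// x0 y0 a0 b0 ab; last 3 first.
- by rewrite gt0_muley ?lte_fin// addey ?leey// -EFinM.
- by rewrite gt0_muley ?lte_fin// addye ?leey// -EFinM.
- by rewrite !gt0_muley ?lte_fin// leey.
rewrite !poweR_EFin -!EFinM -EFinD lee_fin.
have := @conjugate_powR R (x `^ a)%R (y `^ b)%R (a^-1)%R (b^-1)%R (powR_ge0 _ _) (powR_ge0 _ _).
rewrite !invr_gt0 !invrK => /(_ a0 b0 ab) /le_trans; apply.
by rewrite -!powRrM !mulfV ?gt_eqF// !powRr1// [(x * a)%R]mulrC [(y * b)%R]mulrC.
Qed.

(** Stated for extended real functions, because the marginals to which it is applied may be
    infinite. After the degenerate cases, where an integral is 0 or infinite, it is the pointwise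
    Young inequality for the functions divided by their integrals. *)
Lemma holder_poweR (f g : T -> \bar R) (a b : R) :
  measurable_fun setT f -> measurable_fun setT g ->
  (forall x, 0 <= f x) -> (forall x, 0 <= g x) ->
  (0 < a)%R -> (0 < b)%R -> (a + b = 1)%R ->
  \int[mu]_x (f x `^ a * g x `^ b) <=
  (\int[mu]_x f x) `^ a * (\int[mu]_x g x) `^ b.
Proof.
move=> mf mg f0 g0 a0 b0 ab.
have mpow (h : T -> \bar R) c : measurable_fun setT h ->
    measurable_fun setT (fun x => h x `^ c).
  by move=> mh; exact: (measurableT_comp (measurable_poweR c) mh).
have mfg : measurable_fun setT (fun x => f x `^ a * g x `^ b).
  by apply: emeasurable_funM; exact: mpow.
have zero (h k : T -> \bar R) c e : measurable_fun setT h -> measurable_fun setT k ->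
    (forall x, 0 <= h x) -> (0 < c)%R -> \int[mu]_x h x = 0 ->
    \int[mu]_x (h x `^ c * k x `^ e) = 0.
  move=> mh mk h0 c0 hi.
  have /ae_eq_integral_abs : \int[mu]_x `|h x| = 0.
    by rewrite -hi; apply: eq_integral => x _; rewrite gee0_abs.
  move=> /(_ measurableT mh) hae.
  rewrite (ae_eq_integral (cst 0)) ?integral0//.
    by apply: emeasurable_funM; exact: mpow.
  apply: filterS hae => x /(_ I) hx _.
  by rewrite hx poweR0r ?gt_eqF// mul0e.
have [fi0|fi0] := eqVneq (\int[mu]_x f x) 0.
  by rewrite (zero f g)// mule_ge0// poweR_ge0.
have [gi0|gi0] := eqVneq (\int[mu]_x g x) 0.
  under eq_integral do rewrite muleC.
  by rewrite (zero g f)// mule_ge0// poweR_ge0.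
have fgt0 : 0 < \int[mu]_x f x by rewrite lt0e fi0 integral_ge0.
have ggt0 : 0 < \int[mu]_x g x by rewrite lt0e gi0 integral_ge0.
case: (eqVneq (\int[mu]_x f x) +oo) => [->|fy].
  by rewrite poweRyr ?gt_eqF// gt0_mulye ?leey// poweR_gt0.
case: (eqVneq (\int[mu]_x g x) +oo) => [->|gy].
  by rewrite poweRyr ?gt_eqF// gt0_muley ?leey// poweR_gt0.
have fE : \int[mu]_x f x = (fine (\int[mu]_x f x))%:E.
  by rewrite fineK// ge0_fin_numE ?ltey// ltW.
have gE : \int[mu]_x g x = (fine (\int[mu]_x g x))%:E.
  by rewrite fineK// ge0_fin_numE ?ltey// ltW.
move: fgt0 ggt0; rewrite fE gE !lte_fin.
move: (fine (\int[mu]_x f x)) (fine (\int[mu]_x g x)) fE gE => A B fE gE A0 B0.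
rewrite !poweR_EFin -EFinM.
(* The weights [a / A] and [b / B] in the pointwise bound [H] are chosen so that its right-hand side
   integrates to [C * (a + b) = C]. *)
pose C := (A `^ a * B `^ b)%R.
have C0 : (0 < C)%R by rewrite mulr_gt0// powR_gt0.
have H x : f x `^ a * g x `^ b <= C%:E * ((a / A)%:E * f x + (b / B)%:E * g x).
  have fA : f x = A%:E * (A^-1%:E * f x).
    by rewrite muleA -EFinM mulfV ?gt_eqF// mul1e.
  have gB : g x = B%:E * (B^-1%:E * g x).
    by rewrite muleA -EFinM mulfV ?gt_eqF// mul1e.
  have aE : (a / A)%:E * f x = a%:E * (A^-1%:E * f x) by rewrite muleA -EFinM.
  have bE : (b / B)%:E * g x = b%:E * (B^-1%:E * g x) by rewrite muleA -EFinM.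
  rewrite aE bE; have X0 : 0 <= A^-1%:E * f x by rewrite mule_ge0// lee_fin invr_ge0 ltW.
  have Y0 : 0 <= B^-1%:E * g x by rewrite mule_ge0// lee_fin invr_ge0 ltW.
  move: X0 Y0 fA gB; set X := A^-1%:E * f x; set Y := B^-1%:E * g x => X0 Y0 -> ->.
  have [A0' B0'] : 0 <= A%:E /\ 0 <= B%:E by rewrite !lee_fin !ltW.
  rewrite (poweRM a A0' X0) (poweRM b B0' Y0) muleACA !poweR_EFin -EFinM.
  by apply: lee_wpmul2l; [rewrite lee_fin ltW|exact: young_poweR].
apply: (@le_trans _ _ (\int[mu]_x (C%:E * ((a / A)%:E * f x + (b / B)%:E * g x)))).
  apply: ge0_le_integral => //.
  - by move=> x _; rewrite mule_ge0// poweR_ge0.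
  - by apply: measurable_funeM; apply: emeasurable_funD; exact: measurable_funeM.
have aA : (0 <= a / A)%R by rewrite divr_ge0 ?ltW.
have bB : (0 <= b / B)%R by rewrite divr_ge0 ?ltW.
rewrite ge0_integralZl//; last 3 first.
- by apply: emeasurable_funD; exact: measurable_funeM.
- by move=> x _; rewrite adde_ge0// mule_ge0// lee_fin.
- by rewrite lee_fin ltW.
rewrite ge0_integralD//; last 4 first.
- by move=> x _; rewrite mule_ge0// lee_fin.
- exact: measurable_funeM.
- by move=> x _; rewrite mule_ge0// lee_fin.
- exact: measurable_funeM.
have -> : \int[mu]_x ((a / A)%:E * f x) = (a / A * A)%:E.
  by rewrite ge0_integralZl// fE EFinM.
have -> : \int[mu]_x ((b / B)%:E * g x) = (b / B * B)%:E.
  by rewrite ge0_integralZl// gE EFinM.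
rewrite -EFinD -EFinM lee_fin.
by rewrite -!mulrA !mulVf ?gt_eqF// !mulr1 ab mulr1.
Qed.

Lemma emeasurable_prod (I : eqType) (s : seq I) (h : I -> T -> \bar R) :
  (forall i, i \in s -> measurable_fun setT (h i)) ->
  measurable_fun setT (fun x => \prod_(i <- s) h i x).
Proof.
elim: s => [|i s IH] mh.
  by under eq_fun do rewrite big_nil; exact: measurable_cst.
under eq_fun do rewrite big_cons; apply: emeasurable_funM.
  by apply: mh; rewrite inE eqxx.
by apply: IH => j js; apply: mh; rewrite inE js orbT.
Qed.

(** Peel off one factor and apply the inequality for two functions with weights [w i] and
    [q = 1 - w i]; the remaining weights, divided by [q], again sum to 1. The values 0 and 1 of
    [w i] are set apart because [holder_poweR] needs two positive weights. *)
Lemma holder_prod (I : eqType) (s : seq I) (g : I -> T -> \bar R) (w : I -> R) :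
  (forall i, i \in s -> measurable_fun setT (g i)) ->
  (forall i x, 0 <= g i x) -> (forall i, (0 <= w i)%R) ->
  (\sum_(i <- s) w i = 1)%R ->
  \int[mu]_x (\prod_(i <- s) g i x `^ w i) <=
  \prod_(i <- s) (\int[mu]_x g i x) `^ w i.
Proof.
move=> mg g0; elim: s w mg => [|i s IH] w mg w0.
  by rewrite big_nil => /esym/eqP; rewrite oner_eq0.
rewrite big_cons => ws.
under eq_integral do rewrite big_cons.
rewrite big_cons.
have mgs j : j \in s -> measurable_fun setT (g j).
  by move=> js; apply: mg; rewrite inE js orbT.
have [wi0|wi0] := eqVneq (w i) 0%R.
  under eq_integral do rewrite wi0 poweRe0 mul1e.
  by rewrite wi0 poweRe0 mul1e IH//; rewrite wi0 add0r in ws.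
have wi_gt0 : (0 < w i)%R by rewrite lt0r wi0 w0.
have [wi1|wi1] := eqVneq (w i) 1%R.
  have ws0 : (\sum_(j <- s) w j = 0)%R by move: ws; rewrite wi1; lra.
  have wz j : j \in s -> w j = 0%R.
    move=> js; apply/eqP; move/eqP: ws0; rewrite psumr_eq0//.
    by move=> /allP/(_ _ js).
  have P1 (h : I -> \bar R) : \prod_(j <- s) h j `^ w j = 1.
    by rewrite big_seq big1// => j js; rewrite wz// poweRe0.
  rewrite wi1 P1 mule1 poweRe1 ?integral_ge0//.
  rewrite (eq_integral (g i))// => x _.
  by rewrite P1 mule1 poweRe1.
pose q := (1 - w i)%R.
have sw : (\sum_(j <- s) w j = q)%R by rewrite /q -ws; ring.
have q0 : (0 < q)%R.
  rewrite lt0r -{2}sw sumr_ge0// andbT /q subr_eq0 eq_sym//.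
have prodE (h : I -> \bar R) : (forall j, 0 <= h j) ->
    \prod_(j <- s) h j `^ w j = (\prod_(j <- s) h j `^ (w j / q)) `^ q.
  move=> h0; elim: (s) => [|j r IHr]; first by rewrite !big_nil poweR1r.
  rewrite !big_cons poweRM ?poweR_ge0 ?prode_ge0//; last first.
    by move=> *; exact: poweR_ge0.
  by rewrite IHr -poweRrM divfK ?gt_eqF.
under eq_integral do rewrite prodE//.
rewrite [in leRHS]prodE; last by move=> j; exact: integral_ge0.
apply: (le_trans (holder_poweR _ _ _ _ _ _ _)) => //.
- by apply: mg; rewrite inE eqxx.
- apply: emeasurable_prod => j js.
  by apply: (measurableT_comp (measurable_poweR _)); exact: mgs.
- by move=> x; apply: prode_ge0 => *; exact: poweR_ge0.
- by rewrite /q; ring.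
- apply: lee_wpmul2l; first exact: poweR_ge0.
  have pos (h : I -> \bar R) : 0 <= \prod_(j <- s) h j `^ (w j / q).
    by apply: prode_ge0 => *; exact: poweR_ge0.
  apply: gt0_ler_poweR; rewrite ?in_itv/= ?leey ?andbT ?pos//; first exact: ltW.
    by apply: integral_ge0 => x _; exact: pos.
  apply: IH => // [j|]; first by rewrite divr_ge0// ltW.
  by rewrite -mulr_suml sw mulfV// gt_eqF.
Qed.

End holder.

Section gridlines.
Context {R : realType}.
Local Open Scope ereal_scope.
Local Notation leb := (@lebesgue_measure R).

Definition upd n (x : 'rV[R]_n) (i : 'I_n) (s : R) : 'rV[R]_n :=
  \row_j (if j == i then s else x ord0 j).

Lemma upd_cons0 n (t : R) (y : 'rV[R]_n) s : upd (rV_cons (t, y)) ord0 s = rV_cons (s, y).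
Proof.
apply/rowP => j; rewrite !mxE; case: (unliftP ord0 j) => [k|] ->.
  by rewrite eq_sym (negbTE (neq_lift _ _)).
by rewrite eqxx.
Qed.

Lemma upd_consS n (t : R) (y : 'rV[R]_n) i s :
  upd (rV_cons (t, y)) (lift ord0 i) s = rV_cons (t, upd y i s).
Proof.
apply/rowP => j; rewrite !mxE; case: (unliftP ord0 j) => [k|] -> /=.
  by rewrite (inj_eq lift_inj) !mxE.
by [].
Qed.

Lemma measurable_upd n (i : 'I_n) :
  measurable_fun setT (fun xs : 'rV[R]_n * R => upd xs.1 i xs.2).
Proof.
apply: measurable_fun_rV => j; have [->|ji] := eqVneq j i.
  rewrite (_ : _ \o _ = snd); first exact: measurable_snd.
  by apply/funext => x; rewrite /rV_coord /= mxE eqxx.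
rewrite (_ : _ \o _ = rV_coord j \o fst).
  by apply: measurableT_comp; [exact: measurable_rV_coord|exact: measurable_fst].
by apply/funext => x; rewrite /rV_coord /= mxE (negbTE ji).
Qed.

(** Kept as a function on the whole space, constant in the coordinate [i], so that the marginals in
    all directions can be multiplied pointwise. *)
Definition marginal n (i : 'I_n) (f : 'rV[R]_n -> \bar R) (x : 'rV[R]_n) : \bar R :=
  \int[leb]_s f (upd x i s).

Lemma measurable_marginal n (i : 'I_n) (f : 'rV[R]_n -> \bar R) :
  measurable_fun setT f -> (forall x, 0 <= f x) -> measurable_fun setT (marginal i f).
Proof.
move=> mf f0.
apply: (@measurable_fun_fubini_tonelli_F _ _ _ _ _ leb
  (f \o (fun xs : 'rV[R]_n * R => upd xs.1 i xs.2))) => [|x]; last exact: f0.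
by apply: measurableT_comp => //; exact: measurable_upd.
Qed.

Lemma marginal_ge0 n (i : 'I_n) (f : 'rV[R]_n -> \bar R) x :
  (forall x, 0 <= f x) -> 0 <= marginal i f x.
Proof. by move=> f0; exact: integral_ge0. Qed.

(* Induction on n: integrate the first variable and apply Hoelder with weights
   1 - n p, p, ..., p; the marginals of F are the integrals of those of f. *)
Lemma gridlines n (f : 'rV[R]_n -> \bar R) (p : R) :
  measurable_fun setT f -> (forall x, 0 <= f x) -> (0 <= p)%R ->
  (0 <= 1 + p - n%:R * p)%R ->
  \int[lebesgue_rV]_x (f x `^ (1 + p - n%:R * p) * \prod_(i < n) marginal i f x `^ p) <=
  (\int[lebesgue_rV]_x f x) `^ (1 + p).
Proof.
elim: n f => [|n IH] f mf f0 p0 c0.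
  under eq_integral do rewrite big_ord0 mule1.
  rewrite mul0r subr0 /= !integral_dirac//.
    by rewrite !diracT !mul1e.
  by exact: (measurableT_comp (measurable_poweR _) mf).
have c'E : (1 + p - n.+1%:R * p = 1 - n%:R * p)%R by rewrite -natr1; ring.
rewrite c'E in c0 *.
pose F y := \int[leb]_t f (rV_cons (t, y)).
have mF : measurable_fun setT F by exact: measurable_rV_inner.
have F0 y : 0 <= F y by exact: integral_ge0.
have mpow (S : Type) d (Q : measurableType d) (h : Q -> \bar R) c : measurable_fun setT h ->
    measurable_fun setT (fun x => h x `^ c).
  by move=> mh; exact: (measurableT_comp (measurable_poweR c) mh).
have mH : measurable_fun setT (fun x =>
    f x `^ (1 - n%:R * p) * \prod_(i < n.+1) marginal i f x `^ p).
  apply: emeasurable_funM; first exact: (mpow R).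
  by apply: emeasurable_prod => i _; apply: (mpow R); exact: measurable_marginal.
rewrite rV_tonelli_swap//; last first.
  move=> x; rewrite mule_ge0 ?poweR_ge0// prode_ge0// => i _.
  exact: poweR_ge0.
have -> : \int[lebesgue_rV]_x f x = \int[lebesgue_rV]_y F y.
  by rewrite rV_tonelli_swap.
have cp : (0 <= 1 + p - n%:R * p)%R by rewrite (le_trans c0)//; lra.
apply: le_trans (IH F mF F0 p0 cp).
apply: ge0_le_integral => //.
- move=> y _; apply: integral_ge0 => t _; rewrite mule_ge0 ?poweR_ge0//.
  by apply: prode_ge0 => i _; exact: poweR_ge0.
- apply: measurable_rV_inner mH _ => x; rewrite mule_ge0 ?poweR_ge0//.
  by apply: prode_ge0 => i _; exact: poweR_ge0.
- apply: emeasurable_funM; first exact: (mpow R).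
  by apply: emeasurable_prod => i _; apply: (mpow R); exact: measurable_marginal.
move=> y _.
(* The factors of Hoelder's inequality in the variable [t], for fixed [y]: [None] stands for the
   function itself and [Some j] for its marginal in the direction [j] of [y]. *)
pose g (o : option 'I_n) (t : R) : \bar R :=
  if o is Some j then \int[leb]_s f (rV_cons (t, upd y j s)) else f (rV_cons (t, y)).
pose w (o : option 'I_n) : R := if o is Some j then p else (1 - n%:R * p)%R.
have m2 j : measurable_fun setT (fun ts : R * R => f (rV_cons (ts.1, upd y j ts.2))).
  apply: (measurableT_comp mf).
  apply: (measurableT_comp (@measurable_rV_cons R n)).
  apply: measurable_fun_pair; first exact: measurable_fst.
  apply: (measurableT_comp (f := fun s => upd y j s)); last exact: measurable_snd.
  exact: (measurableT_comp (measurable_upd j) (measurable_pair1 y)).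
have mg o : measurable_fun setT (g o).
  case: o => [j|]; last by apply: (measurableT_comp mf); exact: measurable_rV_cons2.
  exact: (@measurable_fun_fubini_tonelli_F _ _ _ _ _ leb _ (m2 j) (fun x => f0 _)).
have g0 o t : 0 <= g o t by case: o => [j|] //=; exact: integral_ge0.
pose h o := \int[leb]_t g o t.
have step : \int[leb]_t \prod_(o <- None :: map Some (enum 'I_n)) g o t `^ w o <=
    \prod_(o <- None :: map Some (enum 'I_n)) h o `^ w o.
  apply: holder_prod => //; first by move=> o _; exact: mg.
    by case=> [j|].
  rewrite big_cons big_map big_enum /= sumr_const card_ord -mulr_natl; ring.
have pE (k : option 'I_n -> \bar R) : \prod_(o <- None :: map Some (enum 'I_n)) k o `^ w o =
    k None `^ (1 - n%:R * p) * \prod_(j < n) k (Some j) `^ p.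
  by rewrite big_cons big_map big_enum.
(* The marginal in the first direction is [F y], which does not depend on [t] and leaves the
   integral; the weights of the other factors sum to 1. *)
have E t : f (rV_cons (t, y)) `^ (1 - n%:R * p) *
      \prod_(i < n.+1) marginal i f (rV_cons (t, y)) `^ p =
    F y `^ p * \prod_(o <- None :: map Some (enum 'I_n)) g o t `^ w o.
  rewrite big_ord_recl muleCA pE /marginal; congr (_ `^ _ * (_ * _)).
    by apply: eq_integral => s _; rewrite upd_cons0.
  apply: eq_bigr => i _; congr (_ `^ _).
  by apply: eq_integral => s _; rewrite upd_consS.
pose G t := \prod_(o <- None :: map Some (enum 'I_n)) g o t `^ w o.
have mG : measurable_fun setT G.
  by apply: emeasurable_prod => o _; apply: (mpow R); exact: mg.
have G0 t : 0 <= G t by apply: prode_ge0 => o _; exact: poweR_ge0.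
have EZ : \int[leb]_t (F y `^ p * G t) = F y `^ p * \int[leb]_t G t.
  by apply: ge0_integralZl => //; exact: poweR_ge0.
apply: (@le_trans _ _ (\int[leb]_t (F y `^ p * G t))).
  by rewrite le_eqVlt; apply/orP; left; apply/eqP; apply: eq_integral => t _; exact: E.
rewrite {}EZ.
rewrite (_ : 1 + p - n%:R * p = p + (1 - n%:R * p))%R; last by ring.
rewrite poweRD; last first.
  apply: add_neq0_poweRD_def; rewrite gt_eqF//.
  have [->|pn0] := eqVneq p 0%R; first by rewrite mulr0; lra.
  by rewrite ltr_wpDr// lt0r pn0.
rewrite -muleA; apply: lee_wpmul2l; first exact: poweR_ge0.
apply: (le_trans step); rewrite pE le_eqVlt; apply/orP; left; apply/eqP.
have hS j : h (Some j) = marginal j F y.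
  exact: (fubini_tonelli (m1 := leb) (m2 := leb) _ (m2 j) (fun x => f0 _)).
have hP : \prod_(j < n) h (Some j) `^ p = \prod_(j < n) marginal j F y `^ p.
  by apply: eq_bigr => j _; rewrite hS.
by apply: (@f_equal2 _ _ _ (@mule R)); [reflexivity|exact: hP].
Qed.

End gridlines.

(** * Functions of class C^k and convolutions *)

Section dominated.
Context d {T : measurableType d} {R : realType} (mu : {measure set T -> \bar R}).

Lemma dominated_cvg_Rintegral (F : nat -> T -> R) (f G : T -> R) :
  (forall m, measurable_fun setT (F m)) -> measurable_fun setT f ->
  mu.-integrable setT (EFin \o G) ->
  {ae mu, forall y, F m y @[m --> \oo] --> f y} ->
  (forall m y, `|F m y| <= G y) ->
  [/\ mu.-integrable setT (EFin \o f),
      \int[mu]_y F m y @[m --> \oo] --> \int[mu]_y f y &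
      (\int[mu]_y `|F m y - f y|)%R @[m --> \oo] --> (0 : R)].
Proof.
move=> mF mf LG Ff FG.
have mF' m : measurable_fun setT (EFin \o F m) by exact/measurable_EFinP.
have mf' : measurable_fun setT (EFin \o f) by exact/measurable_EFinP.
have Ff' : {ae mu, forall y, setT y -> (EFin \o F m) y @[m --> \oo] --> (EFin \o f) y}.
  by apply: filterS Ff => y Fy _; apply: cvg_EFin => //; exact: nearW.
have FG' : {ae mu, forall y m, setT y -> (`|(EFin \o F m) y| <= (EFin \o G) y)%E}.
  by apply: aeW => y m _ /=; rewrite lee_fin.
have [Lf D0 D] := dominated_convergence measurableT mF' mf' Ff' LG FG'.
split => //.
  by move: D; rewrite -[X in _ --> X -> _](fineK (integrable_fin_num measurableT Lf)) => /fine_cvg.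
by move: D0 => /(@fine_cvg _ _ _ _ _ 0%R).
Qed.

End dominated.

Section continuity_rV.
Context {R : realType} {n : nat}.
Implicit Types (F : 'rV[R]_n -> R) (x : 'rV[R]_n).

Lemma cont_rVP F x : {for x, continuous F} <->
  (forall e, 0 < e -> exists2 d, 0 < d & forall y, `|y - x| < d -> `|F y - F x| < e).
Proof.
split=> [cF e e0|H A].
  have /nbhs_ballP[d d0 dF] := cF _ (nbhsx_ballx (F x) e e0).
  exists d => // y yx; have := dF y; rewrite mx_norm_ball /ball_/= distrC => /(_ yx).
  by rewrite /ball/= distrC.
move=> /nbhs_ballP[e e0 eA]; have [d d0 dF] := H e e0.
apply/nbhs_ballP; exists d => // y; rewrite mx_norm_ball /ball_/= distrC => /dF Fy.
by apply: eA; rewrite /ball/= distrC.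
Qed.

(** Integrals depending on a parameter are handled by dominated convergence, which is a statement
    about sequences. *)
Lemma continuous_seq F x :
  (forall u : nat -> 'rV[R]_n, (forall m, `|u m - x| < m.+1%:R^-1) -> F (u m) @[m --> \oo] --> F x) ->
  {for x, continuous F}.
Proof.
move=> H; apply/cont_rVP => e e0.
apply: contrapT => N.
have /choice[u ux] : forall m : nat, exists y, `|y - x| < m.+1%:R^-1 /\ e <= `|F y - F x|.
  move=> m; apply: contrapT => /forallNP Hm; apply: N.
  exists m.+1%:R^-1 => [|y yx]; first by rewrite invr_gt0.
  by have := Hm y; rewrite yx ltNge => /not_andP[//|/negP].
have := H u (fun m => (ux m).1) => /cvgrPdist_lt/(_ e e0)[M _ /(_ M)].
by rewrite /= leqnn distrC ltNge (ux M).2 => /(_ isT).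
Qed.

Lemma continuous_at_seq F x (u : nat -> 'rV[R]_n) : {for x, continuous F} ->
  (forall m, `|u m - x| < m.+1%:R^-1) -> F (u m) @[m --> \oo] --> F x.
Proof.
move=> /cont_rVP cF ux; apply/cvgrPdist_lt => e e0.
have [d d0 dF] := cF e e0; have [M] := ltr_add_invr d0; rewrite add0r => Me.
exists M => // m /= Mm; rewrite distrC; apply/dF/(lt_trans (ux m)).
by apply: le_lt_trans Me; rewrite lef_pV2 ?posrE// ler_nat.
Qed.

End continuity_rV.

Section derive_alg.
Context {R : realType} {V : normedModType R}.
Implicit Types (f g : V -> R) (x v : V).

Lemma is_derive_mul f g x v (df dg : R) : is_derive x v f df -> is_derive x v g dg ->
  is_derive x v (fun y => f y * g y) (f x * dg + df * g x).
Proof.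
by move=> hf hg; apply: (is_derive_eq (is_deriveM hf hg)); rewrite /GRing.scale/= [g x * _]mulrC.
Qed.

Lemma is_derive_add f g x v (df dg : R) : is_derive x v f df -> is_derive x v g dg ->
  is_derive x v (fun y => f y + g y) (df + dg).
Proof. by move=> hf hg; exact: is_deriveD. Qed.

Lemma is_derive_const (c : R) x v : is_derive x v (fun=> c) 0.
Proof. exact: is_derive_cst. Qed.

Lemma is_derive_ext f g x v df : (forall y, f y = g y) -> is_derive x v f df ->
  is_derive x v g df.
Proof. by move=> /funext ->. Qed.

Lemma is_derive_sum1 (I : Type) (r : seq I) (h : I -> V -> R) (dh : I -> R) x v :
  (forall i, is_derive x v (h i) (dh i)) ->
  is_derive x v (fun y => \sum_(i <- r) h i y) (\sum_(i <- r) dh i).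
Proof.
move=> H; elim: r => [|i r IH].
  rewrite big_nil; under eq_fun do rewrite big_nil; exact: is_derive_const.
by rewrite big_cons; under eq_fun do rewrite big_cons; exact: is_derive_add.
Qed.

End derive_alg.

(** * Directional derivatives as derivatives along lines *)

Section directional.
Context {R : realType} {n : nat}.
Implicit Types (f g : 'rV[R]_n -> R) (x v : 'rV[R]_n) (U : set 'rV[R]_n).

Lemma is_derive_line0 (V : normedModType R) (f : V -> R) (x v : V) d :
  is_derive x v f d <-> is_derive (0 : R) 1 (fun h : R => f (h *: v + x)) d.
Proof.
have E : 'D_v f x = 'D_1 (fun h : R => f (h *: v + x)) 0.
  rewrite /derive; suff -> : (fun h : R => h^-1 *: ((f \o shift x) (h *: v) - f x)) =
    (fun h : R => h^-1 *: (((fun h : R => f (h *: v + x)) \o shift 0) (h *: (1 : R)) -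
      f (0 *: v + x))) by [].
  by apply/funext => h /=; rewrite addr0 scale0r add0r /GRing.scale/= mulr1.
split=> -[fx fe]; split.
- exact/(derivable1P f x v).
- by rewrite -E.
- exact/(derivable1P f x v).
- by rewrite E.
Qed.

Lemma is_derive_line f x v (t : R) d :
  is_derive t 1 (fun h : R => f (h *: v + x)) d <-> is_derive (t *: v + x) v f d.
Proof.
rewrite is_derive_line0 [X in _ <-> X]is_derive_line0.
suff -> : (fun h : R => f (h *: v + (t *: v + x))) =
    (fun h : R => (fun h : R => f (h *: v + x)) (h *: (1 : R) + t)) by [].
by apply/funext => h /=; rewrite scalerDl addrA /GRing.scale/= mulr1.
Qed.

Lemma is_derive_comp1 (b : R -> R) f x v (db df : R) :
  is_derive (f x) 1 b db -> is_derive x v f df -> is_derive x v (b \o f) (db * df).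
Proof.
move=> hb /is_derive_line0 hf; apply/is_derive_line0.
apply: (@is_derive1_comp _ b (fun h : R => f (h *: v + x))) => //.
by rewrite scale0r add0r.
Qed.

Lemma is_derive_near f g U x v df : open U -> U x -> (forall y, U y -> f y = g y) ->
  is_derive x v f df -> is_derive x v g df.
Proof.
move=> oU Ux fg; apply: near_eq_is_derive; near=> y; apply: fg; near: y.
exact: open_nbhs_nbhs.
Unshelve. all: by end_near. Qed.

Lemma is_derive_coord x i j :
  is_derive x (delta_mx ord0 j) (fun y : 'rV[R]_n => y ord0 i) (i == j)%:R.
Proof.
apply/is_derive_line0.
have -> : (fun h : R => (h *: delta_mx ord0 j + x) ord0 i) =
    (fun h : R => (i == j)%:R * h + x ord0 i).
  by apply/funext => h; rewrite !mxE eqxx /= mulrC.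
apply: (is_derive_eq (is_deriveD (is_deriveM (is_derive_cst _ _ _) (is_derive_id _ _)) (is_derive_cst _ _ _))).
by rewrite /GRing.scale/= mulr1 mulr0 !addr0.
Qed.

Lemma partial_is_derive f i x df : is_derive x (delta_mx ord0 i) f df -> partial i f x = df.
Proof. by move=> h; rewrite /partial derive_val. Qed.

End directional.

(** * Closure properties of the classes C^k *)

Section class_C_theory.
Context {R : realType} {n : nat}.
Implicit Types (f g : 'rV[R]_n -> R) (x v : 'rV[R]_n) (U V : set 'rV[R]_n) (k : nat).

Lemma class_C_cont k U f x : class_C k U f -> U x -> {for x, continuous f}.
Proof. by case: k => [|k] /= [H _]; exact: H. Qed.

Lemma class_C_derive k U f x i : class_C k.+1 U f -> U x ->
  is_derive x (delta_mx ord0 i) f (partial i f x).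
Proof. by move=> [_ /(_ i)[+ _]] Ux => /(_ x Ux); exact: derivableP. Qed.

Lemma class_C_partial k U f i : class_C k.+1 U f -> class_C k U (partial i f).
Proof. by move=> [_ /(_ i)[]]. Qed.

Lemma class_CW k U f : class_C k.+1 U f -> class_C k U f.
Proof.
elim: k f => [|k IH] f; first by case.
move=> [cf df]; split => // i; have [dfi Cfi] := df i; split => //.
exact: IH.
Qed.

Lemma class_C_le k m U f : (k <= m)%N -> class_C m U f -> class_C k U f.
Proof.
move=> /subnKC <-; elim: (m - k)%N => [|d IH]; first by rewrite addn0.
by rewrite addnS => /class_CW.
Qed.

Lemma cont_ext U f g : open U -> (forall x, U x -> f x = g x) ->
  (forall x, U x -> {for x, continuous f}) -> forall x, U x -> {for x, continuous g}.
Proof.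
move=> /open_rVP oU fg cf x Ux; apply/cont_rVP => e e0.
have [r r0 rU] := oU x Ux; have /cont_rVP/(_ e e0)[d d0 dF] := cf x Ux.
exists (Num.min r d) => [|y]; first by rewrite lt_min r0.
by rewrite lt_min => /andP[/rU Uy /dF]; rewrite !fg.
Qed.

Lemma class_C_ext k U f g : open U -> (forall x, U x -> f x = g x) ->
  class_C k U f -> class_C k U g.
Proof.
move=> oU; elim: k f g => [|k IH] f g fg [cf Cf].
  by split => //; exact: cont_ext cf.
split; first exact: cont_ext cf.
move=> i; have [df Cfi] := Cf i.
have D x (Ux : U x) : is_derive x (delta_mx ord0 i) g (partial i f x).
  by apply: (is_derive_near oU Ux fg); exact: derivableP (df x Ux).
split; first by move=> x Ux; have [] := D x Ux.
by apply: IH Cfi => x Ux; rewrite (partial_is_derive (D x Ux)).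
Qed.

Lemma class_CS k U f (df : 'I_n -> 'rV[R]_n -> R) : open U ->
  (forall x, U x -> {for x, continuous f}) ->
  (forall i x, U x -> is_derive x (delta_mx ord0 i) f (df i x)) ->
  (forall i, class_C k U (df i)) -> class_C k.+1 U f.
Proof.
move=> oU cf Df Cdf; split => // i; split.
  by move=> x Ux; have [] := Df i x Ux.
by apply: class_C_ext (Cdf i) => // x Ux; rewrite (partial_is_derive (Df i x Ux)).
Qed.

Lemma class_C_sub k U V f : V `<=` U -> class_C k U f -> class_C k V f.
Proof.
move=> VU; elim: k f => [|k IH] f [cf Cf]; split.
- by move=> x /VU; exact: cf.
- by [].
- by move=> x /VU; exact: cf.
- by move=> i; have [d C] := Cf i; split; [move=> x /VU; exact: d|exact: IH].
Qed.

(** Used to extend by zero across the boundary of a support and to glue local representatives: near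
    each point a different open set and a different formula may be used. *)
Lemma class_C_local k U f : (forall x, U x -> exists V, [/\ open V, V x & class_C k V f]) ->
  class_C k U f.
Proof.
elim: k f => [|k IH] f H; split => //.
- by move=> x /H[V [oV Vx /class_C_cont]]; exact.
- by move=> x /H[V [oV Vx /class_C_cont]]; exact.
move=> i; split; first by move=> x /H[V [oV Vx /class_C_derive]] /(_ x i Vx)[].
apply: IH => x /H[V [oV Vx /class_C_partial]] /(_ i) C; exists V; split => //.
Qed.

Lemma class_C_cst k U (c : R) : open U -> class_C k U (fun=> c).
Proof.
move=> oU; elim: k c => [|k IH] c; first by split => // x _; exact: cst_continuous.
apply: (@class_CS _ _ _ (fun _ _ => 0)) => //.
by move=> x _; exact: cst_continuous.
Qed.

Lemma class_CD k U f g : open U -> class_C k U f -> class_C k U g ->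
  class_C k U (fun x => f x + g x).
Proof.
move=> oU; elim: k f g => [|k IH] f g Cf Cg.
  by split => // x Ux; apply: continuousD; [exact: (class_C_cont Cf Ux)|exact: (class_C_cont Cg Ux)].
apply: (@class_CS _ _ _ (fun i x => partial i f x + partial i g x)) => //.
- by move=> x Ux; apply: continuousD; [exact: (class_C_cont Cf Ux)|exact: (class_C_cont Cg Ux)].
- by move=> i x Ux; apply: is_derive_add; [exact: (class_C_derive i Cf Ux)|exact: (class_C_derive i Cg Ux)].
- by move=> i; apply: IH; exact: class_C_partial.
Qed.

Lemma class_CM k U f g : open U -> class_C k U f -> class_C k U g ->
  class_C k U (fun x => f x * g x).
Proof.
move=> oU; elim: k f g => [|k IH] f g Cf Cg.
  by split => // x Ux; apply: continuousM; [exact: (class_C_cont Cf Ux)|exact: (class_C_cont Cg Ux)].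
apply: (@class_CS _ _ _ (fun i x => f x * partial i g x + partial i f x * g x)) => //.
- by move=> x Ux; apply: continuousM; [exact: (class_C_cont Cf Ux)|exact: (class_C_cont Cg Ux)].
- by move=> i x Ux; apply: is_derive_mul; [exact: (class_C_derive i Cf Ux)|exact: (class_C_derive i Cg Ux)].
- by move=> i; apply: class_CD => //; apply: IH;
    solve [exact: class_C_partial|exact: class_CW].
Qed.

Lemma class_C_sum (I : Type) (r : seq I) k U (h : I -> 'rV[R]_n -> R) : open U ->
  (forall i, class_C k U (h i)) -> class_C k U (fun x => \sum_(i <- r) h i x).
Proof.
move=> oU H; elim: r => [|i r IH].
  under eq_fun do rewrite big_nil; exact: class_C_cst.
by under eq_fun do rewrite big_cons; exact: class_CD.
Qed.

Lemma class_C_coord k U i : open U -> class_C k U (fun x => x ord0 i).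
Proof.
move=> oU; case: k => [|k]; first by split => // x _; exact: coord_continuous.
apply: (@class_CS _ _ _ (fun j _ => (i == j)%:R)) => //.
- by move=> x _; exact: coord_continuous.
- by move=> j x _; exact: is_derive_coord.
- by move=> j; exact: class_C_cst.
Qed.

(* A tower of successive derivatives stands for a smooth function of one
   variable; smoothness of compositions is then a single induction. *)
Lemma class_C_comp k U (J : set R) (b : nat -> R -> R) f m : open U ->
  (forall j t, J t -> is_derive t 1 (b j) (b j.+1 t)) ->
  class_C k U f -> (forall x, U x -> J (f x)) -> class_C k U (b m \o f).
Proof.
move=> oU hb Cf fJ.
have cb j x : U x -> {for x, continuous (b j \o f)}.
  move=> Ux; apply: continuous_comp; first exact: (class_C_cont Cf Ux).
  have [/derivable1_diffP/differentiable_continuous + _] := hb j (f x) (fJ _ Ux).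
  exact.
elim: k m Cf => [|k IH] m Cf; first by split => // x Ux; exact: cb.
apply: (@class_CS _ _ _ (fun i x => (b m.+1 \o f) x * partial i f x)) => //.
- by move=> x Ux; exact: cb.
- move=> i x Ux; apply: is_derive_comp1; first exact/hb/fJ.
  exact: (class_C_derive i Cf Ux).
- move=> i; apply: class_CM => //; last exact: class_C_partial.
  by apply: IH; exact: class_CW.
Qed.

End class_C_theory.

(** * Convolution with a kernel of bounded support *)

Section kernels.
Context {R : realType} {n : nat}.
Implicit Types (x y z v : 'rV[R]_n) (f g k : 'rV[R]_n -> R).

Definition conv (k f : 'rV[R]_n -> R) x : R := \int[lebesgue_rV]_y (f y * k (x - y)).

Definition L1 (f : 'rV[R]_n -> R) := lebesgue_rV.-integrable setT (EFin \o f).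

(** Vanishing is asked on the open set [r < |x|] only, so the property passes to partial derivatives
    with the same radius. *)
Definition supp_in (r : R) (k : 'rV[R]_n -> R) := forall x, r < `|x| -> k x = 0.

Lemma L1_measurable f : L1 f -> measurable_fun setT f.
Proof. by move=> Lf; apply/measurable_EFinP; exact: (measurable_int lebesgue_rV). Qed.

Lemma L1Z (c : R) f : L1 f -> L1 (fun x => c * f x).
Proof. by move=> Lf; exact: (integrableZl measurableT c Lf). Qed.

Lemma L1_norm f : L1 f -> L1 (fun x => `|f x|).
Proof. by move=> Lf; exact: (integrable_norm Lf). Qed.

Lemma L1D f g : L1 f -> L1 g -> L1 (fun x => f x + g x).
Proof. by move=> Lf Lg; exact: (integrableD measurableT Lf Lg). Qed.

Lemma L1B f g : L1 f -> L1 g -> L1 (fun x => f x - g x).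
Proof. by move=> Lf Lg; exact: (integrableB measurableT Lf Lg). Qed.

Lemma L1_sum (I : Type) (r : seq I) (F : I -> 'rV[R]_n -> R) :
  (forall i, L1 (F i)) -> L1 (fun x => \sum_(i <- r) F i x).
Proof.
move=> H; elim: r => [|i r IH].
  by under eq_fun do rewrite big_nil; exact: integrable0.
by under eq_fun do rewrite big_cons; exact: L1D.
Qed.

Lemma L1_le f g : measurable_fun setT (f : _ -> R) -> (forall x, `|f x| <= g x) -> L1 g -> L1 f.
Proof.
move=> mf fg; apply: le_integrable => //; first exact/measurable_EFinP.
move=> x _; rewrite !abse_EFin lee_fin.
by apply: le_trans (fg x) (ler_norm _).
Qed.

Lemma supp_in_bounded r (k : 'rV[R]_n -> R) : continuous k -> supp_in r k ->
  exists2 C : R, 0 < C & forall x, `|k x| <= C.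
Proof.
move=> ck sk.
have /compact_bounded[M [_ HM]] : compact (k @` [set y | `|y - 0| <= r]).
  apply: continuous_compact; last exact: closed_cube_compact.
  by apply: continuous_subspaceT; exact: ck.
exists (`|M| + 1); first by rewrite ltr_wpDl.
move=> x; have [xr|xr] := leP `|x| r.
  apply: (HM (`|M| + 1)); first by rewrite (le_lt_trans (ler_norm _)) // ltrDl.
  by exists x => //=; rewrite subr0.
by rewrite sk// normr0 addr_ge0.
Qed.

Lemma L1_bounded_mul f g (C : R) : L1 f -> measurable_fun setT g -> (forall x, `|g x| <= C) ->
  L1 (fun x => f x * g x).
Proof.
move=> Lf mg gC; have : lebesgue_rV.-integrable setT (fun x => (C * f x)%:E).
  by under eq_fun do rewrite EFinM; exact: integrableZl.
apply: le_integrable => //.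
  by apply/measurable_EFinP/measurable_funM => //; exact: L1_measurable.
move=> x _; rewrite !abse_EFin lee_fin !normrM mulrC ler_wpM2r//.
exact: le_trans (gC x) (ler_norm _).
Qed.

Lemma L1_continuous r k : continuous k -> supp_in r k -> L1 k.
Proof.
move=> ck sk; have [C C0 kC] := supp_in_bounded ck sk.
have -> : k = (fun x => \1_(cube (0 : 'rV[R]_n) (`|r| + 1)) x * k x).
  apply/funext => x; rewrite indicE; case: (boolP (x \in _)) => [|xr]; first by rewrite mul1r.
  rewrite mul0r; apply: sk; rewrite ltNge; apply: contra xr => xr.
  rewrite inE /cube/= subr0; apply: le_lt_trans xr _.
  by rewrite (le_lt_trans (ler_norm _)) // ltrDl.
apply: (L1_bounded_mul _ _ kC); last exact: continuousT_measurable_rV.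
apply/integrableP; split; first by apply/measurable_EFinP; exact: measurable_indic (measurable_cube _ _).
under eq_integral do rewrite abse_EFin ger0_norm//.
rewrite integral_indic ?setIT//; last exact: measurable_cube.
by rewrite -[X in (X < _)%E]/(lebesgue_rV _) lebesgue_cube ?ltry// ltr_wpDl.
Qed.

Lemma measurable_sub_rV x : measurable_fun setT (fun y : 'rV[R]_n => x - y).
Proof.
apply: measurable_fun_rV => i.
rewrite (_ : _ \o _ = (fun y => x ord0 i - rV_coord i y)).
  by apply: measurable_funB => //; exact: measurable_rV_coord.
by apply/funext => y; rewrite /rV_coord /= !mxE.
Qed.

Lemma measurable_comp_sub k x : measurable_fun setT k ->
  measurable_fun setT (fun y : 'rV[R]_n => (k (x - y) : R)).
Proof. by move=> mk; exact: (measurableT_comp mk (measurable_sub_rV x)). Qed.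

Lemma conv_L1 k f (C : R) x : L1 f -> measurable_fun setT k -> (forall z, `|k z| <= C) ->
  L1 (fun y => f y * k (x - y)).
Proof.
by move=> Lf mk kC; apply: (L1_bounded_mul (C := C)) => //; exact: measurable_comp_sub.
Qed.

Lemma is_derive_under (Theta : R -> 'rV[R]_n -> R) (dTheta : R -> 'rV[R]_n -> R)
    (G : 'rV[R]_n -> R) (a u v : R) : u < a < v ->
  (forall h, u < h < v -> L1 (Theta h)) ->
  (forall h y, u < h < v -> is_derive h 1 (Theta ^~ y) (dTheta h y)) ->
  L1 G -> (forall h y, u < h < v -> `|dTheta h y| <= G y) ->
  is_derive a 1 (fun h => \int[lebesgue_rV]_y Theta h y) (\int[lebesgue_rV]_y dTheta a y).
Proof.
move=> auv LT dT LG TG.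
have G0 y : 0 <= G y by apply: le_trans (TG a y auv).
have auv' : `]u, v[%classic a by rewrite /= in_itv.
have pE h y : `]u, v[%classic h -> partial1of2 Theta h y = dTheta h y.
  rewrite /= in_itv/= => /(dT h y) [_ <-].
  by rewrite partial1of2E.
have D h y : `]u, v[%classic h -> [set: 'rV[R]_n] y -> derivable (Theta ^~ y) h 1.
  by rewrite /= in_itv/= => /(dT h y) [].
have L h : `]u, v[%classic h -> lebesgue_rV.-integrable setT (EFin \o Theta h).
  by rewrite /= in_itv/=; exact: LT.
have B h y : `]u, v[%classic h -> [set: 'rV[R]_n] y -> `|partial1of2 Theta h y| <= G y.
  by move=> huv _; rewrite pE//; apply: TG; move: huv; rewrite /= in_itv.
split; first exact: (derivable_under_integral measurableT auv' L D G0 LG B).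
rewrite -derive1E (differentiation_under_integral measurableT auv' L D G0 LG B).
by apply: eq_Rintegral => y _; rewrite pE.
Qed.

Lemma is_derive_conv k dk f (C : R) x v : L1 f ->
  measurable_fun setT k -> (forall z, `|k z| <= C) -> (forall z, `|dk z| <= C) ->
  (forall z, is_derive z v k (dk z)) ->
  is_derive x v (conv k f) (conv dk f x).
Proof.
move=> Lf mk kC dkC kd; apply/is_derive_line0.
have := @is_derive_under (fun h y => f y * k (h *: v + x - y))
  (fun h y => f y * dk (h *: v + x - y)) (fun y => C * `|f y|) 0 (-1) 1.
rewrite /conv scale0r add0r; apply.
- by rewrite ltrN10 ltr01.
- by move=> h _; exact: conv_L1 kC.
- move=> h y _; apply: (is_derive_eq (is_deriveM (is_derive_cst _ _ _) _)); last first.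
    by rewrite /GRing.scale/= mulr0 addr0.
  under eq_fun do rewrite -addrA; apply/is_derive_line; rewrite addrA.
  exact: kd.
- exact/L1Z/L1_norm.
- by move=> h y _; rewrite normrM mulrC ler_wpM2r.
Qed.

Lemma continuous_conv k f (C : R) : L1 f -> continuous k -> (forall z, `|k z| <= C) ->
  continuous (conv k f).
Proof.
move=> Lf ck kC x; apply: continuous_seq => u ux.
have mk := continuousT_measurable_rV ck.
have L y : L1 (fun z => f z * k (y - z)) by exact: conv_L1 kC.
have [//|||_ + _] := @dominated_cvg_Rintegral _ _ _ lebesgue_rV
  (fun m y => f y * k (u m - y)) (fun y => f y * k (x - y)) (fun y => C * `|f y|)
  (fun m => L1_measurable (L (u m))) (L1_measurable (L x)).
- exact/L1Z/L1_norm.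
- apply: aeW => y; apply: cvgM; first exact: cvg_cst.
  apply: (@continuous_at_seq _ _ k (x - y) (fun m => u m - y)); first exact: ck.
  by move=> m; rewrite opprB addrA subrK.
- by move=> m y; rewrite normrM mulrC ler_wpM2r.
by [].
Qed.

Lemma supp_in_partial r k i : supp_in r k -> supp_in r (partial i k).
Proof.
move=> sk x rx; apply: partial_is_derive.
apply: (@is_derive_near _ _ (fun=> 0) _ [set y | r < `|y|]).
- apply/open_rVP => y /= ry; exists (`|y| - r) => [|z]; first by rewrite subr_gt0.
  rewrite ltrBrDr addrC -ltrBrDr; move/lt_le_trans; apply.
  by rewrite distrC lerBlDr -[X in `|X| <= _](subrK z y) addrC ler_normD.
- by [].
- by move=> y /= /sk ->.
Qed.

(** Every derivative falls on the kernel, so [f] need only be integrable. *)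
Lemma class_C_conv m r k f : L1 f -> class_C m setT k -> supp_in r k ->
  class_C m setT (conv k f).
Proof.
move=> Lf; elim: m k => [|m IH] k Ck sk.
  have ck : continuous k by move=> x; exact: (class_C_cont Ck).
  have [C C0 kC] := supp_in_bounded ck sk.
  by split => // x _; exact: continuous_conv kC x.
have ck : continuous k by move=> x; exact: (class_C_cont Ck).
have [C C0 kC] := supp_in_bounded ck sk.
apply: (@class_CS _ _ _ _ _ (fun i => conv (partial i k) f)) => //.
- exact: openT.
- by move=> x _; exact: continuous_conv kC x.
- move=> i x _.
  have cdk : continuous (partial i k) by move=> z; exact: (class_C_cont (class_C_partial i Ck)).
  have [C' C'0 kC'] := supp_in_bounded cdk (supp_in_partial i sk).
  apply: (@is_derive_conv _ _ _ (Num.max C C')) => //.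
  + exact: continuousT_measurable_rV.
  + by move=> z; rewrite le_max kC.
  + by move=> z; rewrite le_max kC' orbT.
  + by move=> z; exact: (class_C_derive i Ck).
- move=> i; apply: IH; [exact: class_C_partial|exact: supp_in_partial].
Qed.

Lemma partial_conv m r k f i x : L1 f -> class_C m.+1 setT k -> supp_in r k ->
  partial i (conv k f) x = conv (partial i k) f x.
Proof.
move=> Lf Ck sk; apply: partial_is_derive.
have ck : continuous k by move=> z; exact: (class_C_cont Ck).
have [C C0 kC] := supp_in_bounded ck sk.
have cdk : continuous (partial i k) by move=> z; exact: (class_C_cont (class_C_partial i Ck)).
have [C' C'0 kC'] := supp_in_bounded cdk (supp_in_partial i sk).
apply: (@is_derive_conv _ _ _ (Num.max C C')) => //.
+ exact: continuousT_measurable_rV.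
+ by move=> z; rewrite le_max kC.
+ by move=> z; rewrite le_max kC' orbT.
+ by move=> z; exact: (class_C_derive i Ck).
Qed.

End kernels.

(** * Kernels *)

Section one_variable.
Context {R : realType}.
Implicit Types (h H F : R -> R) (t : R).

Lemma is_derive_eps (V : normedModType R) (f : V -> R) (x v : V) (df : R) :
  (forall e, 0 < e -> exists2 d, 0 < d &
    forall h : R, h != 0 -> `|h| < d -> `|h^-1 * (f (h *: v + x) - f x) - df| < e) ->
  is_derive x v f df.
Proof.
move=> H.
have C : h^-1 *: ((f \o shift x) (h *: v) - f x) @[h --> 0^'] --> df.
  apply/cvgrPdist_lt => e e0; have [d d0 dH] := H e e0.
  exists d => //= h /=; rewrite sub0r normrN => hd h0; rewrite distrC.
  exact: dH.
by split; [exact: (cvgP _ C)|exact: cvg_lim].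
Qed.

Lemma is_derive_eps_conv (V : normedModType R) (f : V -> R) (x v : V) (df : R) :
  is_derive x v f df ->
  (forall e, 0 < e -> exists2 d, 0 < d &
    forall h : R, h != 0 -> `|h| < d -> `|h^-1 * (f (h *: v + x) - f x) - df| < e).
Proof.
move=> [fx <-] e e0; have /cvgrPdist_lt/(_ e e0)[d /= d0 dH] := fx.
by exists d => // h h0 hd; have := dH h; rewrite /= sub0r normrN distrC => /(_ hd h0).
Qed.

Lemma is_derive_cont (f : R -> R) t df : is_derive t 1 f df -> {for t, continuous f}.
Proof. by move=> [/derivable1_diffP/differentiable_continuous + _]; exact. Qed.

Lemma mvt_point (f df : R -> R) (a b : R) : a < b ->
  (forall t, a <= t <= b -> is_derive t 1 f (df t)) ->
  exists2 c, a <= c <= b & f b - f a = df c * (b - a).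
Proof.
move=> ab fd.
have fd' x : x \in `]a, b[ -> is_derive x 1 f (df x).
  by rewrite in_itv/= => /andP[? ?]; apply: fd; rewrite !ltW.
have cf : {within `[a, b], continuous f}.
  by apply: derivable_within_continuous => x; rewrite in_itv/= => /fd[].
have [c + ->] := MVT ab fd' cf; rewrite in_itv/= => /andP[ac cb].
by exists c => //; rewrite !ltW.
Qed.

Lemma mvt_abs (f df : R -> R) (a b C : R) : a <= b ->
  (forall t, a <= t <= b -> is_derive t 1 f (df t)) ->
  (forall t, a <= t <= b -> `|df t| <= C) -> `|f b - f a| <= C * (b - a).
Proof.
rewrite le_eqVlt => /predU1P[->|ab] fd dC; first by rewrite !subrr normr0 mulr0.
have [c cab ->] := mvt_point ab fd.
by rewrite normrM [X in _ * X]gtr0_norm ?subr_gt0// ler_pM2r ?subr_gt0// dC.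
Qed.

Lemma mvt_ge (f df : R -> R) (a b c : R) : a <= b ->
  (forall t, a <= t <= b -> is_derive t 1 f (df t)) ->
  (forall t, a <= t <= b -> c <= df t) -> c * (b - a) <= f b - f a.
Proof.
rewrite le_eqVlt => /predU1P[->|ab] fd dC; first by rewrite !subrr mulr0.
have [x xab ->] := mvt_point ab fd.
by rewrite ler_pM2r ?subr_gt0// dC.
Qed.

Lemma is_derive_opp_arg (f : R -> R) t df : is_derive (- t) 1 f df ->
  is_derive t 1 (fun s => - f (- s)) df.
Proof.
move=> fd; apply: (is_derive_eq (is_deriveN (@is_derive1_comp _ f (fun s => - s) t df (- 1) fd _))).
  by rewrite mulrN1 opprK.
Qed.

(** The fundamental theorem gives a derivative only to the right of the base point [- M] of the
    integral. The primitives [HM M], normalized at 0, agree where both are defined, and [M] is taken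
    to be [|t| + 1] at the point [t]. *)
Lemma antiderivative (h : R -> R) : continuous h ->
  exists2 H : R -> R, H 0 = 0 & forall t, is_derive t 1 H (h t).
Proof.
move=> ch.
have ih a b : lebesgue_measure.-integrable `[a, b] (EFin \o h).
  apply: continuous_compact_integrable; first exact: segment_compact.
  by apply: continuous_subspaceT.
pose J a t := \int[lebesgue_measure]_(x in `[a, t]) h x.
have JD a t : a < t -> is_derive t 1 (J a) (h t).
  move=> at_; have tt1 : t < t + 1 by rewrite ltrDl.
  have [D E] := continuous_FTC1_closed tt1 (ih a (t + 1)) at_ (ch t).
  by split; [exact: D|rewrite -derive1E; exact: E].
pose HM M t := J (- M) t - J (- M) 0.
have HD M t : - M < t -> is_derive t 1 (HM M) (h t).
  move=> Mt; apply: (is_derive_eq (is_deriveB (JD _ _ Mt) (is_derive_cst _ _ _))).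
  by rewrite subr0.
have HMM M M' t : `|t| < M -> `|t| < M' -> HM M t = HM M' t.
  move=> tM tM'; have M0 := le_lt_trans (normr_ge0 _) tM; have M'0 := le_lt_trans (normr_ge0 _) tM'.
  move: tM tM'; rewrite !ltr_norml => /andP[Mt _] /andP[M't _].
  pose D s := HM M s - HM M' s.
  have DD s : Num.min 0 t <= s <= Num.max 0 t -> is_derive s 1 D 0.
    move=> /andP[]; rewrite ge_min => /orP ts _.
    apply: (is_derive_eq (is_deriveB (HD M s _) (HD M' s _))); last by rewrite subrr.
    - by case: ts => ts; [apply: lt_le_trans ts; rewrite oppr_lt0|exact: lt_le_trans ts].
    - by case: ts => ts; [apply: lt_le_trans ts; rewrite oppr_lt0|exact: lt_le_trans ts].
  have D0 : D 0 = 0 by rewrite /D /HM !subrr.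
  have : `|D (Num.max 0 t) - D (Num.min 0 t)| <= 0 * (Num.max 0 t - Num.min 0 t).
    apply: (mvt_abs _ DD); first by case: (leP 0 t) => // /ltW.
    by move=> s _; rewrite normr0.
  rewrite mul0r normr_le0 subr_eq0.
  by case: leP => _ /eqP; rewrite D0 /D => /eqP; rewrite ?subr_eq0 1?eq_sym ?subr_eq0 => /eqP.
exists (fun t => HM (`|t| + 1) t); first by rewrite /HM subrr.
move=> t; have := HD (`|t| + 2) t.
have tt : - (`|t| + 2) < t by have := ler_norm (- t); rewrite normrN; lra.
move=> /(_ tt); apply: near_eq_is_derive.
near=> s; apply: HMM; last by rewrite ltrDl.
have : `|t - s| < 1 by near: s; apply: (@cvgr_dist_lt _ _ _ _ _ _ _ (cvg_id)).
have := ler_normB t (t - s); rewrite opprB addrC subrK; lra.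
Unshelve. all: by end_near. Qed.

Lemma antideriv_reflect h H : (forall t, h (- t) = h t) -> H 0 = 0 ->
  (forall t, is_derive t 1 H (h t)) -> forall t, H (- t) = - H t.
Proof.
move=> he H0 Hd.
pose D s := H s + H (- s).
have DD (s : R) : is_derive s 1 D 0.
  have := is_derive_opp_arg (Hd (- s)); rewrite he => h1.
  rewrite (_ : D = (fun s => H s - - H (- s))).
    exact: (is_derive_eq (is_deriveB (Hd s) h1) (subrr _)).
  by apply/funext => y; rewrite opprK.
have P t : 0 <= t -> H (- t) = - H t.
  move=> t0; have Z (s : R) : 0 <= s <= t -> `|0 : R| <= 0 by rewrite normr0.
  have := @mvt_abs D (fun=> 0) 0 t 0 t0 (fun s _ => DD s) Z.
  rewrite mul0r normr_le0 subr_eq0 /D oppr0 H0 addr0 addrC addr_eq0 => /eqP.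
  by [].
move=> t; have [/P//|/ltW t0] := leP 0 t.
by have := P (- t); rewrite oppr_ge0 opprK => /(_ t0) ->; rewrite opprK.
Qed.

(** * Primitives of even, increasing and doubling weights *)

Section even_weight.
Variables (h H F : R -> R) (D : R).
Hypotheses (he : forall t, h (- t) = h t) (h0 : forall t, 0 <= h t) (D0 : 0 <= D)
  (hi : forall s t, 0 <= s -> s <= t -> h s <= h t)
  (hd : forall t, 0 <= t -> h t <= D * h (t / 2)).
Hypotheses (H0 : H 0 = 0) (Hd : forall t, is_derive t 1 H (h t)).
Hypotheses (F0 : F 0 = 0) (Fd : forall t, is_derive t 1 F (h t ^+ 2)).

Let H_ge0 t : 0 <= t -> 0 <= H t.
Proof.
move=> t0; have := @mvt_ge H h 0 t 0 t0 (fun s _ => Hd s) (fun s _ => h0 s).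
by rewrite H0 mul0r subr0.
Qed.

Let F_ge0 t : 0 <= t -> 0 <= F t.
Proof.
move=> t0; have := @mvt_ge F _ 0 t 0 t0 (fun s _ => Fd s) (fun s _ => sqr_ge0 _).
by rewrite F0 mul0r subr0.
Qed.

Let H_opp := antideriv_reflect he H0 Hd.

Let F_opp t : F (- t) = - F t.
Proof. by apply: (@antideriv_reflect (fun s => h s ^+ 2)) => // s; rewrite he. Qed.

Lemma even_weight_le t : `|H t| <= `|t| * h t.
Proof.
wlog t0 : t / 0 <= t.
  move=> W; have [/W//|/ltW t0] := leP 0 t.
  by have := W (- t); rewrite oppr_ge0 H_opp he !normrN; exact.
rewrite !ger0_norm ?H_ge0//.
have := @mvt_abs H h 0 t (h t) t0 (fun s _ => Hd s).
rewrite H0 !subr0 mulrC => /(_ _)/(le_trans (ler_norm _)); apply.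
by move=> s /andP[s0 st]; rewrite ger0_norm// hi.
Qed.

(** On [[t / 2, t]] the primitive grows by at least [t / 2 * h (t / 2)], and doubling compares
    [h (t / 2)] with [h t]. With [even_weight_le], [H t] is comparable to [t * h t]. *)
Lemma even_weight_ge t : `|t| * h t <= 2 * D * `|H t|.
Proof.
wlog t0 : t / 0 <= t.
  move=> W; have [/W//|/ltW t0] := leP 0 t.
  by have := W (- t); rewrite oppr_ge0 H_opp he !normrN; exact.
rewrite !ger0_norm ?H_ge0//.
have t2 : t / 2 <= t by lra.
have t20 : 0 <= t / 2 by lra.
have := @mvt_ge H h (t / 2) t (h (t / 2)) t2 (fun s _ => Hd s).
move=> /(_ (fun s st => hi t20 (andP st).1)) Hge.
have HH := H_ge0 t20.
apply: le_trans (ler_wpM2l t0 (hd t0)) _.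
rewrite mulrCA -mulrA [in leRHS]mulrCA; apply: ler_wpM2l => //.
by have := h0 (t / 2); move: Hge HH; lra.
Qed.

(** For fixed [t > 0], the function [h t * H s - F s] has derivative [h s * (h t - h s)], which is
    nonnegative on [[0, t]]. This is the bound that keeps the cutoff terms of the Caccioppoli
    inequality under control. *)
Lemma even_weight_sq t : `|F t| <= h t * `|H t|.
Proof.
wlog t0 : t / 0 <= t.
  move=> W; have [/W//|/ltW t0] := leP 0 t.
  by have := W (- t); rewrite oppr_ge0 H_opp F_opp he !normrN; exact.
rewrite !ger0_norm ?H_ge0 ?F_ge0//.
have := @mvt_ge (fun s => h t * H s - F s) (fun s => h t * h s - h s ^+ 2) 0 t 0 t0.
rewrite H0 F0 mul0r mulr0 !subr0 subr_ge0; apply.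
by move=> s /andP[s0 st]; rewrite expr2 -mulrBl mulr_ge0// subr_ge0 hi.
Qed.

End even_weight.

Lemma powR_abs_continuous (a : R) : 0 < a -> continuous (fun s : R => `|s| `^ a).
Proof.
move=> a0 s; have [->|s0] := eqVneq s 0.
  apply/cvgrPdist_lt => e e0; rewrite normr0 powR0 ?gt_eqF//.
  have d0 : 0 < e `^ a^-1 by rewrite powR_gt0.
  exists (e `^ a^-1) => // t /=; rewrite !sub0r !normrN (ger0_norm (powR_ge0 _ _)) => td.
  have := gt0_ltr_powR a0 (normr_ge0 t) (ltW d0) td.
  by rewrite -powRrM mulVf ?gt_eqF// powRr1// ltW.
apply: (@continuous_comp _ _ _ (fun s : R => `|s|) (fun s => s `^ a)).
  exact: norm_continuous.
by apply: is_derive_cont; apply: is_derive1_powR; rewrite normr_gt0.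
Qed.

End one_variable.

(** * A smooth bump whose derivatives are all explicit *)

Section bump.
Context {R : realType}.
Implicit Types (q : {poly R}) (t s : R).

(** The functions [q(1/t) exp(-1/t)], extended by zero to [t <= 0], form a family stable under
    differentiation: the polynomial [q] is replaced by [X^2 (q - q')]. The successive derivatives of
    the bump are thus one family indexed by polynomials. *)
Definition flat q t : R := if 0 < t then q.[t^-1] * expR (- t^-1) else 0.

Lemma poly_bound q : exists2 A : R, 0 < A &
  forall x, 1 <= x -> `|q.[x]| <= A * x ^+ size q.
Proof.
elim/poly_ind: q => [|q c [A A0 IH]].
  by exists 1 => // x x1; rewrite horner0 normr0 mul1r exprn_ge0// (le_trans _ x1).
exists (A + `|c|) => [|x x1]; first by rewrite ltr_wpDr.
have x0 : 0 <= x by rewrite (le_trans _ x1).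
rewrite !hornerE size_MXaddC; case: ifPn => [/andP[/eqP -> /eqP ->]|_].
  by rewrite horner0 mul0r addr0 !normr0 addr0 mulr_ge0 ?exprn_ge0// ltW.
apply: le_trans (ler_normD _ _) _; rewrite mulrDl; apply: lerD.
  rewrite normrM (ger0_norm x0) exprSr mulrA; apply: ler_wpM2r => //; exact: IH.
by rewrite ler_peMr// exprn_ege1.
Qed.

(** The exponential beats every power of [1/t]. A quadratic bound is what makes the derivative at 0
    exist and vanish. *)
Lemma flat_sq q : exists2 C : R, 0 < C & forall t, `|t| <= 1 -> `|flat q t| <= C * t ^+ 2.
Proof.
have [A A0 HA] := poly_bound q.
(* The term of degree [m.+1], two more than [size q], is kept from the exponential series; the two
   extra powers become the factor [t ^+ 2]. *)
pose m := (size q).+1.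
exists (A * (m.+1)`!%:R) => [|t t1]; first by rewrite mulr_gt0// ltr0n fact_gt0.
rewrite /flat; case: ifPn => t0; last first.
  by rewrite normr0 mulr_ge0 ?sqr_ge0// mulr_ge0 ?ltW.
have t1' : 1 <= t^-1 by rewrite invf_ge1// -(gtr0_norm t0).
have ti0 : 0 < t^-1 by rewrite invr_gt0.
rewrite normrM (gtr0_norm (expR_gt0 _)).
apply: le_trans (ler_wpM2r (expR_ge0 _) (HA _ t1')) _.
rewrite -!mulrA ler_pM2l// expRN.
have E := le_trans (_ : _ <= 1 + _) (expR_ge1Dxn m (ltW ti0)).
have {E} : t^-1 ^+ m.+1 / (m.+1)`!%:R <= expR t^-1 by apply: E; rewrite lerDr.
have f0 : (0 : R) < (m.+1)`!%:R by rewrite ltr0n fact_gt0.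
rewrite ler_pdivrMr// => E.
rewrite ler_pdivrMr ?expR_gt0//.
have -> : t^-1 ^+ size q = t ^+ 2 * t^-1 ^+ m.+1.
  rewrite /m -[(size q).+2]addn2 exprD mulrCA -exprMn divff ?gt_eqF//.
  by rewrite expr1n mulr1.
apply: le_trans (ler_wpM2l (sqr_ge0 t) E) _.
by rewrite le_eqVlt; apply/orP; left; apply/eqP; ring.
Qed.

Definition flat_next q : {poly R} := 'X^2 * (q - q^`()).

Lemma is_derive_flat q t : is_derive t 1 (flat q) (flat (flat_next q) t).
Proof.
have [t0|t0|->] := ltgtP t 0.
- have -> : flat (flat_next q) t = 0 by rewrite /flat ltNge ltW.
  apply: (@near_eq_is_derive _ _ _ (fun=> 0)).
  near=> s; rewrite /flat ltNge ifN// negbK.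
  by apply: ltW; near: s; exact: lt_nbhsl.
- have E : flat (flat_next q) t = (flat_next q).[t^-1] * expR (- t^-1) by rewrite /flat t0.
  apply: (@near_eq_is_derive _ _ _ (fun s => q.[s^-1] * expR (- s^-1))).
    near=> s; rewrite /flat ifT//.
    by near: s; exact: lt_nbhsr.
  have dV : is_derive t 1 (fun s : R => s^-1) (- t ^- 2).
    have tn : id t != 0 by rewrite gt_eqF.
    by apply: (is_derive_eq (is_deriveV tn (is_derive_id _ _))); rewrite /GRing.scale/= mulr1.
  have dq : is_derive t^-1 1 (horner q) (q^`()).[t^-1].
    split; first exact: derivable_horner.
    by rewrite -derive1E -derivE.
  have d1 := is_derive1_comp dq dV.
  have d2 := is_derive1_comp (is_derive_expR _) (is_deriveN dV).
  apply: (is_derive_eq (is_deriveM d1 d2)).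
  rewrite E /GRing.scale/= /flat_next !hornerE/=.
  by rewrite exprVn; ring.
have F0 : flat q 0 = 0 by rewrite /flat ltxx.
have -> : flat (flat_next q) 0 = 0 by rewrite /flat ltxx.
have [C C0 HC] := flat_sq q.
apply: is_derive_eps => e e0; exists (Num.min 1 (e / C)) => [|h h0].
  by rewrite lt_min ltr01 divr_gt0.
rewrite lt_min => /andP[h1 he].
rewrite F0 !subr0 addr0 /GRing.scale/= mulr1 normrM normfV.
have ha : 0 < `|h| by rewrite normr_gt0.
rewrite mulrC ltr_pdivrMr//; apply: le_lt_trans (HC h (ltW h1)) _.
by rewrite -(real_normK (num_real h)) expr2 mulrA ltr_pM2r// mulrC -ltr_pdivlMr.
Unshelve. all: by end_near. Qed.

Definition bump_poly j : {poly R} := iter j flat_next 1.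

Definition bump j s : R := (-1) ^+ j * flat (bump_poly j) (1 - s).

Lemma is_derive_bump j s : is_derive s 1 (bump j) (bump j.+1 s).
Proof.
have d1 : is_derive s 1 (fun s : R => 1 - s) (-1).
  by apply: (is_derive_eq (is_deriveB (is_derive_cst _ _ _) (is_derive_id _ _))); rewrite sub0r.
have d2 := @is_derive1_comp _ (flat (bump_poly j)) (fun s : R => 1 - s) s _ _ (is_derive_flat _ _) d1.
rewrite (_ : bump j = cst ((-1) ^+ j) * (flat (bump_poly j) \o (fun s : R => 1 - s)))//.
apply: (is_derive_eq (is_deriveM (is_derive_cst _ _ _) d2)).
by rewrite /bump exprS /GRing.scale/= mulr0 addr0; ring.
Qed.

Lemma bump_eq0 j s : 1 <= s -> bump j s = 0.
Proof. by move=> s1; rewrite /bump /flat ltNge subr_le0 s1 mulr0. Qed.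

Lemma bump0_ge0 s : 0 <= bump 0 s.
Proof. by rewrite /bump/= expr0 mul1r /flat; case: ifP => // _; rewrite hornerE mulr_ge0 ?expR_ge0. Qed.

Lemma bump1E s : s < 1 -> - bump 1 s = (1 - s) ^- 2 * expR (- (1 - s)^-1).
Proof.
move=> s1; rewrite /bump/= expr1 mulN1r opprK /flat subr_gt0 s1 /flat_next.
by rewrite derivC subr0 mulr1 hornerXn exprVn.
Qed.

Lemma bump1_le0 s : bump 1 s <= 0.
Proof.
have [s1|s1] := ltP s 1; last by rewrite bump_eq0.
by rewrite -oppr_ge0 bump1E// mulr_ge0 ?expR_ge0// invr_ge0 sqr_ge0.
Qed.

Lemma bump_continuous j : continuous (bump j).
Proof. by move=> s; exact: is_derive_cont (is_derive_bump j s). Qed.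

Lemma bump_bounded j : exists2 C : R, 0 < C & forall s, 0 <= s -> `|bump j s| <= C.
Proof.
have /compact_bounded[M [_ HM]] : compact (bump j @` `[0, 1]).
  apply: continuous_compact; last exact: segment_compact.
  by apply: continuous_subspaceT; exact: bump_continuous.
exists (`|M| + 1) => [|s s0]; first by rewrite ltr_wpDl.
have [s1|s1] := leP s 1; last by rewrite bump_eq0 ?(ltW s1)// normr0 addr_ge0.
apply: (HM (`|M| + 1)); first by rewrite (le_lt_trans (ler_norm _)) // ltrDl.
by exists s => //=; rewrite in_itv/= s0.
Qed.

End bump.

(** * Radial kernels and their Laplacians *)

Section euclidean_kernel.
Context {R : realType} {n : nat}.
Implicit Types (x y z : 'rV[R]_n) (t s : R) (j : nat).

(* bump j is the j-th derivative of s |-> exp (- 1 / (1 - s)), extended by 0 to s >= 1. *)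
Definition ker j t z : R := bump j (edot z z / t ^+ 2).

Lemma edot_ge0 z : 0 <= edot z z.
Proof. by apply: sumr_ge0 => i _; rewrite -expr2 sqr_ge0. Qed.

Lemma edot_coord_le z i : z ord0 i ^+ 2 <= edot z z.
Proof.
rewrite /edot (bigD1 i)//= -expr2 lerDl; apply: sumr_ge0 => k _.
by rewrite -expr2 sqr_ge0.
Qed.

Lemma norm_sqr_le_edot z : `|z| ^+ 2 <= edot z z.
Proof.
suff : `|z| <= Num.sqrt (edot z z).
  move=> H; rewrite -[leRHS](sqr_sqrtr (edot_ge0 z)) ler_pXn2r// nnegrE ?sqrtr_ge0//.
apply/rV_norm_leP => [|i]; first exact: sqrtr_ge0.
by rewrite -sqrtr_sqr ler_wsqrtr// edot_coord_le.
Qed.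

Lemma edot_le_norm z : edot z z <= n%:R * `|z| ^+ 2.
Proof.
rewrite /edot mulr_natl -[X in _ *+ X]card_ord -sumr_const; apply: ler_sum => i _.
rewrite -expr2 -(real_normK (num_real (z ord0 i))) ler_pXn2r ?nnegrE//.
exact: coord_le_norm.
Qed.

Lemma is_derive_edot z i :
  is_derive z (delta_mx ord0 i) (fun z => edot z z) (2 * z ord0 i).
Proof.
have H k : is_derive z (delta_mx ord0 i) (fun y : 'rV[R]_n => y ord0 k * y ord0 k)
    (z ord0 k * (k == i)%:R + (k == i)%:R * z ord0 k).
  by apply: is_derive_mul; exact: is_derive_coord.
apply: (is_derive_eq (is_derive_sum1 _ H)).
rewrite (bigD1 i)//= eqxx big1 => [|k /negbTE ->]; last by rewrite mulr0 mul0r addr0.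
by rewrite (_ : true%:R = 1 :> R)//; ring.
Qed.

Lemma class_C_edot k U : open U -> class_C k U (fun z => edot z z).
Proof.
move=> oU; apply: class_C_sum => // i.
by apply: class_CM => //; exact: class_C_coord.
Qed.

Lemma class_C_ker k j t : class_C k setT (ker j t).
Proof.
apply: (@class_C_comp _ _ k setT setT bump _ j openT).
- by move=> i s _; exact: is_derive_bump.
- apply: class_CM; [exact: openT|exact/class_C_edot/openT|exact/class_C_cst/openT].
- by [].
Qed.

Lemma is_derive_ker j t z i :
  is_derive z (delta_mx ord0 i) (ker j t) (ker j.+1 t z * (2 * z ord0 i / t ^+ 2)).
Proof.
apply: (@is_derive_comp1 _ _ (bump j) (fun z => edot z z / t ^+ 2)).
  exact: is_derive_bump.
apply: (is_derive_eq (is_derive_mul (is_derive_edot z i) (is_derive_const _ _ _))).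
by rewrite mulr0 add0r.
Qed.

Lemma partial_ker j t i : partial i (ker j t) =
  (fun z => ker j.+1 t z * (2 * z ord0 i / t ^+ 2)).
Proof. by apply/funext => z; exact: partial_is_derive (is_derive_ker j t z i). Qed.

Lemma ker_eq0 j t z : 0 < t -> t <= `|z| -> ker j t z = 0.
Proof.
move=> t0 tz; apply: bump_eq0; rewrite ler_pdivlMr ?exprn_gt0// mul1r.
apply: le_trans (norm_sqr_le_edot z).
by rewrite !expr2; apply: ler_pM => //; exact: ltW.
Qed.

Lemma supp_in_ker j t : 0 < t -> supp_in t (ker j t).
Proof. by move=> t0 z /ltW; exact: ker_eq0. Qed.

Lemma ker_even j t z : ker j t (- z) = ker j t z.
Proof.
rewrite /ker; congr bump; congr (_ / _); apply: eq_bigr => i _.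
by rewrite !mxE mulrNN.
Qed.

Lemma ker_scale j t r z : r != 0 -> ker j (r * t) (r *: z) = ker j t z.
Proof.
move=> r0; rewrite /ker; congr bump.
have -> : edot (r *: z) (r *: z) = r ^+ 2 * edot z z.
  by rewrite /edot mulr_sumr; apply: eq_bigr => i _; rewrite !mxE; ring.
by rewrite exprMn -mulf_div divff ?mul1r// sqrf_eq0.
Qed.

Lemma ker0_ge0 t z : 0 <= ker 0 t z. Proof. exact: bump0_ge0. Qed.

Lemma ker1_le0 t z : ker 1 t z <= 0. Proof. exact: bump1_le0. Qed.

Lemma ker_bounded j : exists2 C : R, 0 < C & forall t z, 0 < t -> `|ker j t z| <= C.
Proof.
have [C C0 HC] := @bump_bounded R j; exists C => // t z t0.
by apply: HC; rewrite divr_ge0 ?edot_ge0 ?exprn_ge0 ?ltW.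
Qed.

Lemma edot_ker_le j t z : 0 < t -> edot z z * `|ker j t z| <= t ^+ 2 * `|ker j t z|.
Proof.
move=> t0; have [tz|tz] := leP (t ^+ 2) (edot z z); last by rewrite ler_wpM2r// ltW.
by rewrite /ker bump_eq0 ?normr0 ?mulr0// ler_pdivlMr ?exprn_gt0// mul1r.
Qed.

(** The Laplacian of [ker j t] in closed form, by the chain rule for a function of [|z|^2 / t^2].
    Its size is of order [t ^- 2], since [|z|^2 <= t^2] on the support. *)
Definition lap_ker j t z : R :=
  4 * edot z z / t ^+ 4 * ker j.+2 t z + 2 * n%:R / t ^+ 2 * ker j.+1 t z.

Lemma is_derive_partial_ker j t z i :
  is_derive z (delta_mx ord0 i) (partial i (ker j t))
    (4 * (z ord0 i * z ord0 i) / t ^+ 4 * ker j.+2 t z + 2 / t ^+ 2 * ker j.+1 t z).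
Proof.
rewrite partial_ker.
have h1 : is_derive z (delta_mx ord0 i) (fun z : 'rV[R]_n => 2 * z ord0 i / t ^+ 2) (2 / t ^+ 2).
  have := is_derive_mul (is_derive_mul (is_derive_const 2 z _) (is_derive_coord z i i)) (is_derive_const (t ^+ 2)^-1 z _).
  by move=> /is_derive_eq; apply; rewrite eqxx (_ : true%:R = 1 :> R)//; ring.
apply: (is_derive_eq (is_derive_mul (is_derive_ker j.+1 t z i) h1)).
by rewrite -(exprVn t 4) -(exprVn t 2); ring.
Qed.

Lemma lap_kerE j t z : lap_ker j t z = \sum_i partial i (partial i (ker j t)) z.
Proof.
rewrite (eq_bigr _ (fun i _ => partial_is_derive (is_derive_partial_ker j t z i))).
rewrite big_split /= sumr_const card_ord -mulr_suml -mulr_suml -mulr_sumr.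
by rewrite /lap_ker /edot -[_ *+ n]mulr_natl; ring.
Qed.

Lemma lap_ker_bounded j : exists2 C : R, 0 < C & forall t z, 0 < t -> `|lap_ker j t z| <= C / t ^+ 2.
Proof.
have [C1 C10 H1] := ker_bounded j.+1; have [C2 C20 H2] := ker_bounded j.+2.
exists (4 * C2 + 2 * n%:R * C1); first by rewrite ltr_pwDl// ?mulr_gt0// mulr_ge0// ltW.
move=> t z t0; apply: le_trans (ler_normD _ _) _; rewrite [leRHS]mulrDl; apply: lerD.
  rewrite normrM ger0_norm; last by rewrite divr_ge0 ?mulr_ge0 ?edot_ge0 ?exprn_ge0 ?ltW.
  rewrite (_ : 4 * edot z z / t ^+ 4 * _ = 4 / t ^+ 4 * (edot z z * `|ker j.+2 t z|)); last by ring.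
  have t4 : 0 <= 4 / t ^+ 4 by rewrite divr_ge0 ?exprn_ge0 ?ltW.
  apply: le_trans (ler_wpM2l t4 (edot_ker_le _ _ t0)) _.
  rewrite (_ : 4 / t ^+ 4 * _ = 4 / t ^+ 2 * `|ker j.+2 t z|); last by field; rewrite gt_eqF.
  rewrite mulrAC; apply: ler_wpM2r; first by rewrite invr_ge0 exprn_ge0// ltW.
  by apply: ler_wpM2l => //; exact: H2.
rewrite normrM ger0_norm; last by rewrite divr_ge0 ?mulr_ge0 ?exprn_ge0//; exact: ltW.
rewrite mulrAC; apply: ler_wpM2r; first by rewrite invr_ge0 exprn_ge0// ltW.
by apply: ler_wpM2l; [rewrite mulr_ge0|exact: H1].
Qed.

(* This identity is why mollifying with ker 1 only requires the equation for w to
   be tested against ker 0. *)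
Lemma is_derive_ker_scale t z : t != 0 ->
  is_derive t 1 (fun t => - 2 * (t ^- n * ker 1 t z)) (t * (t ^- n * lap_ker 0 t z)).
Proof.
move=> t0.
have dt k : is_derive t 1 (fun t => t ^- k) (- k%:R * t ^- k / t).
  have tk : (fun t : R => t ^+ k) t != 0 by rewrite expf_neq0.
  have dX : is_derive t 1 (fun t : R => t ^+ k) (k%:R * t ^+ k.-1).
    split; first exact: exprn_derivable.
    by rewrite exp_derive /GRing.scale/= mulr1.
  apply: (is_derive_eq (@is_deriveV _ (fun t : R => t ^+ k) t _ 1 tk dX)); rewrite /GRing.scale/=.
  case: k tk {dX} => [|k] tk; first by rewrite (_ : 0%:R = 0 :> R)// oppr0 !mul0r mulr0.
  have X0 : t ^+ k != 0 by rewrite expf_neq0.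
  rewrite [k.+1.-1]/= (exprS t k); move: (k.+1%:R : R) (t ^+ k) X0 => c X X0.
  by field; rewrite t0 X0.
have dk : is_derive t 1 (fun t => ker 1 t z) (ker 2 t z * (edot z z * (- 2%:R * t ^- 2 / t))).
  apply: (@is_derive1_comp _ (bump 1) (fun t => edot z z / t ^+ 2)); first exact: is_derive_bump.
apply: (is_derive_eq (is_derive_mul (is_derive_const (- 2) t 1) (is_derive_mul (dt n) dk))).
have X0 : t ^+ n != 0 by rewrite expf_neq0.
by rewrite mul0r addr0 /lap_ker; move: (t ^+ n) (n%:R : R) X0 => X c X0; field; rewrite t0 X0.
Qed.

End euclidean_kernel.

(** * The Sobolev inequality *)

Section real_integrals.
Context d {T : measurableType d} {R : realType} (mu : {measure set T -> \bar R}).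
Implicit Types f g : T -> R.
Local Notation L f := (mu.-integrable setT (EFin \o f)).

Lemma EFin_Rintegral f : L f -> (\int[mu]_x (f x)%:E)%E = (\int[mu]_x f x)%:E.
Proof. by move=> Lf; rewrite /Rintegral fineK//; exact: (integrable_fin_num measurableT Lf). Qed.

Lemma integrable_measurable f : L f -> measurable_fun setT f.
Proof. by move=> Lf; apply/measurable_EFinP; exact: (measurable_int mu Lf). Qed.

Lemma ge0_integrable f : measurable_fun setT f -> (forall x, 0 <= f x) ->
  (\int[mu]_x (f x)%:E < +oo)%E -> L f.
Proof.
move=> mf f0 fi; apply/integrableP; split; first exact/measurable_EFinP.
by under eq_integral do rewrite /= ger0_norm//.
Qed.

Lemma measurable_powR_fun f (a : R) : measurable_fun setT f ->
  measurable_fun setT (fun x => f x `^ a).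
Proof. by move=> mf; exact: (measurableT_comp (measurable_powR a) mf). Qed.

Lemma holder_Rintegral f g (a b : R) : L f -> L g ->
  (forall x, 0 <= f x) -> (forall x, 0 <= g x) -> 0 < a -> 0 < b -> a + b = 1 ->
  L (fun x => f x `^ a * g x `^ b) /\
  \int[mu]_x (f x `^ a * g x `^ b) <= (\int[mu]_x f x) `^ a * (\int[mu]_x g x) `^ b.
Proof.
move=> Lf Lg f0 g0 a0 b0 ab.
have H := @holder_poweR _ _ _ mu (EFin \o f) (EFin \o g) a b (measurable_int mu Lf)
  (measurable_int mu Lg) f0 g0 a0 b0 ab.
have mh : measurable_fun setT (fun x => f x `^ a * g x `^ b).
  by apply: measurable_funM; apply: measurable_powR_fun; exact: integrable_measurable.
have {}H : (\int[mu]_x (f x `^ a * g x `^ b)%:E <=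
    ((\int[mu]_x f x) `^ a * (\int[mu]_x g x) `^ b)%:E)%E.
  by move: H; rewrite /= EFin_Rintegral// EFin_Rintegral// !poweR_EFin -EFinM.
have h0 x : 0 <= f x `^ a * g x `^ b by rewrite mulr_ge0// powR_ge0.
have Lh : L (fun x => f x `^ a * g x `^ b).
  by apply: ge0_integrable => //; apply: le_lt_trans H _; rewrite ltry.
by split => //; rewrite -lee_fin -EFin_Rintegral.
Qed.

Lemma Rintegral_le f g : L f -> L g -> (forall x, f x <= g x) ->
  \int[mu]_x f x <= \int[mu]_x g x.
Proof. by move=> Lf Lg fg; apply: le_Rintegral => // x _; exact: fg. Qed.

Lemma Rintegral_sum (I : Type) (s : seq I) (F : I -> T -> R) : (forall i, L (F i)) ->
  \int[mu]_x (\sum_(i <- s) F i x) = \sum_(i <- s) \int[mu]_x F i x.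
Proof.
move=> LF; have Ls (r : seq I) : L (fun x => \sum_(i <- r) F i x).
  elim: r => [|i r IH].
    by under eq_fun do rewrite big_nil; exact: integrable0.
  by under eq_fun do rewrite big_cons; exact: (integrableD measurableT (LF i) IH).
elim: s => [|i s IH].
  rewrite big_nil; under eq_Rintegral do rewrite big_nil.
  by rewrite /Rintegral integral0.
rewrite big_cons -IH -(RintegralD measurableT (LF i) (Ls s)).
by apply: eq_Rintegral => x _; rewrite big_cons.
Qed.

Lemma cauchy_schwarz_Rintegral f g : measurable_fun setT f -> measurable_fun setT g ->
  L (fun x => f x ^+ 2) -> L (fun x => g x ^+ 2) ->
  L (fun x => `|f x * g x|) /\
  \int[mu]_x `|f x * g x| <= (\int[mu]_x f x ^+ 2) `^ 2^-1 * (\int[mu]_x g x ^+ 2) `^ 2^-1.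
Proof.
move=> mf mg Lf Lg.
have E : (fun x => `|f x * g x|) = (fun x => (f x ^+ 2) `^ 2^-1 * (g x ^+ 2) `^ 2^-1).
  by apply/funext => x; rewrite !powR12_sqrt ?sqr_ge0// !sqrtr_sqr normrM.
rewrite E; apply: holder_Rintegral => //; try (by move=> x; exact: sqr_ge0).
by field.
Qed.

End real_integrals.

Lemma ler_powR_base (R : realType) (a x y : R) : 0 <= a -> 0 <= x -> x <= y -> x `^ a <= y `^ a.
Proof. by move=> a0 x0 xy; apply: ge0_ler_powR; rewrite ?nnegrE// (le_trans x0). Qed.

Section sobolev.
Context {R : realType} {n : nat}.
Implicit Types (Z : 'rV[R]_n -> R) (x : 'rV[R]_n).
Local Notation mu := (@lebesgue_rV R n).
Local Notation leb := (@lebesgue_measure R).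

Lemma updE x i s : upd x i s = (s - x ord0 i) *: delta_mx ord0 i + x.
Proof.
apply/rowP => j; rewrite !mxE eqxx /=; case: eqVneq => [->|_].
  by rewrite mulr1 subrK.
by rewrite mulr0 add0r.
Qed.

Lemma upd_id x i : upd x i (x ord0 i) = x.
Proof. by rewrite updE subrr scale0r add0r. Qed.

Lemma is_derive_upd (f : 'rV[R]_n -> R) x i s df :
  is_derive (upd x i s) (delta_mx ord0 i) f df ->
  is_derive s 1 (fun s => f (upd x i s)) df.
Proof.
move=> fd; under eq_fun do rewrite updE scalerBl -addrA.
apply/is_derive_line; rewrite addrA -scalerBl -updE; exact: fd.
Qed.

Lemma continuous_upd (f : 'rV[R]_n -> R) x i : continuous f ->
  continuous (fun s => f (upd x i s)).
Proof.
move=> cf s; apply/cvgrPdist_lt => e e0.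
have /cont_rVP/(_ e e0)[d d0 df] := cf (upd x i s).
exists d => // t /= st; rewrite distrC; apply: df.
apply/rV_norm_ltP => // j; rewrite !mxE; case: eqVneq => _; last by rewrite subrr normr0.
by rewrite distrC.
Qed.

(** The fundamental theorem of calculus along the line through [x] in direction [i], started at
    [- (r + 1)], where [f] vanishes. One function [Theta] will dominate all the partial derivatives,
    so that the grid lines inequality applies to a single function. *)
Lemma line_bound (f : 'rV[R]_n -> R) (Theta : 'rV[R]_n -> R) r x i : 0 < r ->
  class_C 1 setT f -> supp_in r f -> measurable_fun setT Theta ->
  (forall y, `|partial i f y| <= Theta y) ->
  (`|f x|%:E <= marginal i (EFin \o Theta) x)%E.
Proof.
move=> r0 Cf sf mT fT.
have T0 y : 0 <= Theta y by exact: le_trans (fT y).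
have m0 : (0 <= marginal i (EFin \o Theta) x)%E.
  by apply: integral_ge0 => s _; rewrite lee_fin.
have [xi|xi] := leP (x ord0 i) (- (r + 1)).
  rewrite sf ?normr0//; apply: lt_le_trans (coord_le_norm x i).
  by rewrite ler0_norm; lra.
pose phi s := f (upd x i s).
pose dphi s := partial i f (upd x i s).
have phid (s : R) : is_derive s 1 phi (dphi s).
  by apply: is_derive_upd; exact: (class_C_derive i Cf).
have cdphi : continuous dphi.
  by apply: continuous_upd => y; exact: (class_C_cont (class_C_partial i Cf)).
have ca s : {for s, continuous phi} by exact: is_derive_cont (phid s).
have phi0 : phi (- (r + 1)) = 0.
  apply: sf; apply: lt_le_trans (coord_le_norm _ i).
  by rewrite mxE eqxx ler0_norm; lra.
have phix : phi (x ord0 i) = f x by rewrite /phi upd_id.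
have LR : derivable_oo_LRcontinuous phi (- (r + 1)) (x ord0 i).
  split; first by move=> s _; have [] := phid s.
    by apply: cvg_at_right_filter; exact: ca.
  by apply: cvg_at_left_filter; exact: ca.
have D' : {in `](- (r + 1)), (x ord0 i)[, phi^`()%classic =1 dphi}.
  by move=> s _; rewrite derive1E; have [_ ->] := phid s.
have F : (\int[leb]_(s in `[(- (r + 1))%R, x ord0 i]) (dphi s)%:E)%E = (f x)%:E.
  by rewrite (continuous_FTC2 xi (continuous_subspaceT cdphi) LR D') phi0 phix sube0.
have mdphi : measurable_fun setT (EFin \o dphi).
  by apply/measurable_EFinP; exact: continuous_measurable_fun.
have mTx : measurable_fun setT (fun s => (Theta (upd x i s))%:E).
  apply/measurable_EFinP; apply: (measurableT_comp mT).
  exact: (measurableT_comp (measurable_upd i) (measurable_pair1 x)).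
rewrite -abse_EFin -F; apply: le_trans (le_abse_integral _ _ _) _ => //.
  exact: measurable_funTS.
apply: (@le_trans _ _ (\int[leb]_(s in `[(- (r + 1))%R, x ord0 i]) (Theta (upd x i s))%:E)%E).
  apply: ge0_le_integral => //.
  - by apply: measurableT_comp => //; exact: measurable_funTS.
  - exact: measurable_funTS.
  - by move=> s _; rewrite abse_EFin lee_fin fT.
by apply: ge0_subset_integral => //; move=> s _; rewrite lee_fin.
Qed.

Lemma class_C_powR_comp (H h : R -> R) Z : continuous h -> (forall t : R, is_derive t 1 H (h t)) ->
  class_C 1 setT Z -> class_C 1 setT (H \o Z).
Proof.
move=> ch Hd CZ.
have cZ x : {for x, continuous Z} by exact: (class_C_cont CZ).
apply: (@class_CS _ _ _ _ _ (fun i x => h (Z x) * partial i Z x)) => //.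
- exact: openT.
- by move=> x _; apply: continuous_comp; [exact: cZ|exact: is_derive_cont (Hd _)].
- by move=> i x _; apply: is_derive_comp1 => //; exact: (class_C_derive i CZ).
- move=> i; apply: class_CM; [exact: openT| |exact: class_C_partial].
  by split => // x _; apply: continuous_comp; [exact: cZ|exact: ch].
Qed.

Lemma partial_comp1 (H : R -> R) (db : R) Z x i : class_C 1 setT Z ->
  is_derive (Z x) 1 H db -> partial i (H \o Z) x = db * partial i Z x.
Proof.
move=> CZ Hd; apply: partial_is_derive; apply: is_derive_comp1 => //.
exact: (class_C_derive i CZ).
Qed.

Lemma lee_prod_ord (f g : 'I_n -> \bar R) : (forall i, (0 <= f i)%E) ->
  (forall i, (f i <= g i)%E) -> (\prod_(i < n) f i <= \prod_(i < n) g i)%E.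
Proof.
move=> f0 fg; suff [] : (0 <= \prod_(i < n) f i)%E /\
  (\prod_(i < n) f i <= \prod_(i < n) g i)%E by [].
apply: (big_ind2 (fun a b => (0 <= a)%E /\ (a <= b)%E)) => //.
move=> a b c e [a0 ab] [c0 ce]; split; first exact: mule_ge0.
exact: lee_pmul.
Qed.

Section sobolev_statement.
Variables (kap r : R).
Hypotheses (n2 : (2 <= n)%N) (kap1 : 1 < kap) (kapn : kap * (n%:R - 2) <= n%:R) (r0 : 0 < r).

Let N : R := n%:R.
(** Chosen so that [gam * N / (N - 1) = 2 * kap]: the inequality from L^1 gradients to L^(N/(N-1)),
    applied to [|Z|^gam], produces the power [2 * kap] of [Z]. *)
Let gam := 2 * kap * (N - 1) / N.
Let a := gam - 1.
(** With this exponent the power [1 + p - N * p] of the function itself in [gridlines] is zero, and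
    only marginals remain. *)
Let p := (N - 1)^-1.

Let N2 : 2 <= N. Proof. by rewrite /N ler_nat. Qed.
Let N0 : N != 0. Proof. by apply/negP => /eqP N0; move: N2; rewrite N0; lra. Qed.
Let N1 : N - 1 != 0. Proof. by apply/negP => /eqP N0'; move: N2; lra. Qed.
Let kap0 : 0 < kap. Proof. by rewrite (lt_trans _ kap1). Qed.

Let a0 : 0 < a.
Proof.
rewrite /a subr_gt0 /gam ltr_pdivlMr ?mul1r; last by move: N2; lra.
have : (kap - 1) * (N - 1) > 0 by rewrite mulr_gt0; move: N2 kap1; lra.
by move: N2; nra.
Qed.

(** A restatement of [kap * (N - 2) <= N]; this is how the critical exponent enters the Sobolev
    inequality. *)
Let akap : a <= kap.
Proof.
rewrite /a lerBlDr /gam ler_pdivrMr; last by move: N2; lra.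
by move: kapn; rewrite -/N; nra.
Qed.

Let p0 : 0 <= p. Proof. by rewrite invr_ge0; move: N2; lra. Qed.

Let p1N : 1 + p - N * p = 0.
Proof. by rewrite /p; field; exact: N1. Qed.

Let p1 : 1 + p = N / (N - 1).
Proof. by rewrite /p; field; exact: N1. Qed.

(** The grid lines inequality is applied to the gradient of [H(Z)], where [H] has derivative
    [|s|^a]: it is C^1 and [|H(s)|] is at least a multiple of [|s|^gam]. By Cauchy-Schwarz the
    gradient of [H(Z)] in L^1 costs the square root of the integral [A] of [|Z|^(2a)]; as
    [a <= kap], Hoelder's inequality on the bounded support bounds [A] by a power of [X] small
    enough to be divided out. *)
Lemma sobolev_inequality : exists2 C : R, 0 < C &
  forall Z, class_C 1 setT Z -> supp_in r Z ->
  (\int[mu]_x (`|Z x| `^ (2 * kap))) `^ kap^-1 <=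
  C * \int[mu]_x (\sum_(i < n) partial i Z x ^+ 2).
Proof.
pose h (s : R) := `|s| `^ a.
have ch : continuous h by exact: powR_abs_continuous.
have [H H0 Hd] := antiderivative ch.
pose D : R := 2 `^ a.
have D0 : 0 < D by exact: powR_gt0.
have hge s : `|s| * h s <= 2 * D * `|H s|.
  have he t : h (- t) = h t by rewrite /h normrN.
  have h0 t : 0 <= h t by exact: powR_ge0.
  have hi t u : 0 <= t -> t <= u -> h t <= h u.
    move=> t0 tu; rewrite /h; apply: ge0_ler_powR; rewrite ?nnegrE ?(ltW a0)//.
    by rewrite !ger0_norm// (le_trans t0).
  have hd t : 0 <= t -> h t <= D * h (t / 2).
    move=> t0; rewrite /h /D -powRM// normrM (@ger0_norm _ 2^-1) ?invr_ge0//.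
    by rewrite mulrCA divff// mulr1.
  exact: (even_weight_ge he h0 (ltW D0) hi hd H0 Hd).
pose V : R := (2 * (r + 1)) ^+ n.
have V0 : 0 < V by rewrite exprn_gt0// mulr_gt0// addr_gt0.
pose th := a / kap.
have th0 : 0 < th by rewrite divr_gt0.
have th1 : th <= 1 by rewrite ler_pdivrMr// mul1r akap.
pose K1 := V `^ (1 - th).
have K10 : 0 < K1 by exact: powR_gt0.
pose K2 := 2 * D * (N * K1 `^ 2^-1).
have Np : 0 < N by rewrite (lt_le_trans _ N2).
have K20 : 0 < K2 by rewrite !mulr_gt0// powR_gt0.
exists (K2 ^+ 2) => [|Z CZ sZ]; first by rewrite exprn_gt0.
have cZ : continuous Z by move=> x; exact: (class_C_cont CZ).
have cdZ i : continuous (partial i Z) by move=> x; exact: (class_C_cont (class_C_partial i CZ)).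
have sdZ i : supp_in r (partial i Z) by exact: supp_in_partial.
have CHZ := class_C_powR_comp ch Hd CZ.
have sHZ : supp_in r (H \o Z) by move=> x /sZ /= ->.
have dHZ i x : partial i (H \o Z) x = h (Z x) * partial i Z x by exact: partial_comp1.
pose Th y := \sum_(i < n) `|partial i (H \o Z) y|.
have LTh : L1 Th.
  apply: L1_sum => i; apply: L1_norm; apply: (@L1_continuous _ _ r).
    by move=> x; exact: (class_C_cont (class_C_partial i CHZ)).
  exact: supp_in_partial.
have mTh := L1_measurable LTh.
have Th0 y : 0 <= Th y by apply: sumr_ge0.
have cont_comp (b : R -> R) : continuous b -> continuous (b \o Z).
  by move=> cb x; apply: continuous_comp; [exact: cZ|exact: cb].
have LpZ c : 0 < c -> L1 (fun x => `|Z x| `^ c).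
  move=> c0; apply: (@L1_continuous _ _ r); first exact/(cont_comp (fun s => `|s| `^ c))/powR_abs_continuous.
  by move=> x /sZ ->; rewrite normr0 powR0 ?gt_eqF.
have LdZ i : L1 (fun x => partial i Z x ^+ 2).
  apply: (@L1_continuous _ _ r).
    by under eq_fun do rewrite expr2; move=> x; apply: continuousM; exact: cdZ.
  by move=> x /(sdZ i) ->; rewrite expr0n.
have LD : L1 (fun x => \sum_(i < n) partial i Z x ^+ 2) by exact: L1_sum.
pose X := \int[mu]_x (`|Z x| `^ (2 * kap)).
pose Dd := \int[mu]_x (\sum_(i < n) partial i Z x ^+ 2).
pose T := \int[mu]_x Th x.
pose A := \int[mu]_x h (Z x) ^+ 2.
have X0 : 0 <= X by apply: Rintegral_ge0 => x _; exact: powR_ge0.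
have Dd0 : 0 <= Dd by apply: Rintegral_ge0 => x _; apply: sumr_ge0 => i _; exact: sqr_ge0.
have A0 : 0 <= A by apply: Rintegral_ge0 => x _; exact: sqr_ge0.
have T0 : 0 <= T by apply: Rintegral_ge0 => x _; exact: Th0.
have hsq x : h (Z x) ^+ 2 = `|Z x| `^ (2 * a).
  by rewrite -powR_mulrn ?powR_ge0// -powRrM mulrC.
have Lh2 : L1 (fun x => h (Z x) ^+ 2).
  by under eq_fun do rewrite hsq; apply: LpZ; rewrite mulr_gt0.
have kap20 : 0 < 2 * kap by rewrite mulr_gt0.
(* Interpolation with weight [th = a / kap] on a cube of measure [V]. At the critical exponent
   [th = 1], where Hoelder's inequality would have a zero weight, the two integrals coincide. *)
have AX : A <= K1 * X `^ th.
  have AE : A = \int[mu]_x (`|Z x| `^ (2 * kap)) `^ th.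
    apply: eq_Rintegral => x _; rewrite hsq -powRrM; congr (_ `^ _).
    by rewrite /th; field; rewrite gt_eqF.
  have [th_1|thn1] := eqVneq th 1.
    rewrite AE th_1 /K1 th_1 subrr powRr0 mul1r powRr1//.
    by under eq_Rintegral do rewrite powRr1 ?powR_ge0//.
  have th1' : 0 < 1 - th by rewrite subr_gt0 lt_neqAle thn1.
  have L1c : L1 (\1_(cube (0 : 'rV[R]_n) (r + 1)) : _ -> R).
    apply: ge0_integrable => //; first exact: measurable_indic (measurable_cube _ _).
    rewrite integral_indic ?setIT//; last exact: measurable_cube.
    by rewrite -[X in (X < _)%E]/(lebesgue_rV _) lebesgue_cube ?ltry// addr_gt0.
  have [_ HH] := @holder_Rintegral _ _ _ mu (fun x => `|Z x| `^ (2 * kap))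
    (\1_(cube (0 : 'rV[R]_n) (r + 1))) th (1 - th) (LpZ _ kap20) L1c
    (fun x => powR_ge0 _ _) (fun x => ler0n _ _) th0 th1' (subrKC _ _).
  have Vi : \int[mu]_x \1_(cube (0 : 'rV[R]_n) (r + 1)) x = V.
    rewrite /Rintegral integral_indic ?setIT//; last exact: measurable_cube.
    by rewrite -[X in fine X]/(lebesgue_rV _) lebesgue_cube ?addr_gt0.
  rewrite Vi -/X -/K1 [X `^ th * _]mulrC in HH; apply: le_trans HH.
  rewrite AE le_eqVlt; apply/orP; left; apply/eqP; apply: eq_Rintegral => x _.
  have [xr|xr] := ltP r `|x|; first by rewrite sZ// normr0 powR0 ?gt_eqF// powR0 ?gt_eqF// mul0r.
  rewrite indicE mem_set ?powR1 ?mulr1// /cube/= subr0.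
  by rewrite (le_lt_trans xr)// ltrDl.
have TA : T <= N * (A `^ 2^-1 * Dd `^ 2^-1).
  rewrite /T /Th; have LdH i : L1 (fun x => `|partial i (H \o Z) x|).
    apply: L1_norm; apply: (@L1_continuous _ _ r); last exact: supp_in_partial.
    by move=> x; exact: (class_C_cont (class_C_partial i CHZ)).
  rewrite Rintegral_sum// mulr_natl -[X in _ *+ X]card_ord -sumr_const; apply: ler_sum => i _.
  have [_] := cauchy_schwarz_Rintegral (L1_measurable (LpZ a a0)) (continuousT_measurable_rV (cdZ i)) Lh2 (LdZ i).
  under eq_Rintegral do rewrite -/(h _) -dHZ; move/le_trans; apply.
  apply: ler_wpM2l; first exact: powR_ge0.
  rewrite ge0_ler_powR ?nnegrE//; first by apply: Rintegral_ge0 => x _; exact: sqr_ge0.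
  apply: (Rintegral_le (LdZ i) LD) => x; rewrite (bigD1 i)//= lerDl.
  by apply: sumr_ge0 => j _; exact: sqr_ge0.
have p10 : 0 < 1 + p by rewrite ltr_wpDr.
have XT : X `^ (1 + p)^-1 <= 2 * D * T.
  have c0 : 0 <= 1 + p - n%:R * p by rewrite -/N p1N.
  have mETh : measurable_fun setT (EFin \o Th) by exact/measurable_EFinP.
  have gl := gridlines mETh Th0 p0 c0.
  have iT : (\int[mu]_x (EFin \o Th) x)%E = T%:E by rewrite EFin_Rintegral.
  rewrite iT poweR_EFin -/N p1N in gl.
  (* Since [1 + p = N * p], the power [1 + p] of [|H(Z)|] is a product of [N] powers [p], one for
     the line bound in each direction. *)
  have pt x : ((`|Z x| `^ (2 * kap))%:E <= ((2 * D) `^ (1 + p))%:E *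
      ((EFin \o Th) x `^ 0 * \prod_(i < n) marginal i (EFin \o Th) x `^ p))%E.
    rewrite poweRe0 mul1e.
    apply: (@le_trans _ _ (((2 * D) `^ (1 + p))%:E * (`|H (Z x)| `^ (1 + p))%:E)%E).
      rewrite -EFinM lee_fin -powRM ?mulr_ge0 ?(ltW D0)//.
      have -> : `|Z x| `^ (2 * kap) = (`|Z x| * h (Z x)) `^ (1 + p).
        have [->|zn0] := eqVneq (Z x) 0.
          by rewrite normr0 mul0r !powR0 ?gt_eqF.
        have -> : `|Z x| * h (Z x) = `|Z x| `^ (1 + a).
          by rewrite powRD ?powRr1// normr_eq0 zn0 implybT.
        rewrite -powRrM; congr (_ `^ _); rewrite p1 /a /gam.
        by field; rewrite N0 N1.
      apply: ge0_ler_powR; rewrite ?nnegrE ?(ltW p10)// mulr_ge0// ?powR_ge0// mulr_ge0// ltW//.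
    apply: lee_wpmul2l; first by rewrite lee_fin powR_ge0.
    have -> : ((`|H (Z x)| `^ (1 + p))%:E = \prod_(i < n) (`|H (Z x)|%:E `^ p))%E.
      rewrite (_ : 1 + p = p * n%:R); last by rewrite [p * _]mulrC; apply/subr0_eq; exact: p1N.
      rewrite powRrM powR_mulrn ?powR_ge0// poweR_EFin.
      rewrite big_const_ord; elim: (n) => [|k IH] /=; first by rewrite expr0.
      by rewrite exprS EFinM IH.
    apply: lee_prod_ord => i; first exact: poweR_ge0.
    have m0 : (0 <= marginal i (EFin \o Th) x)%E by exact: marginal_ge0.
    apply: gt0_ler_poweR; rewrite ?in_itv/= ?leey ?andbT ?lee_fin//.
    have tT y : `|partial i (H \o Z) y| <= Th y.
      by rewrite /Th (bigD1 i)//= lerDl; apply: sumr_ge0.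
    exact: (@line_bound (H \o Z) Th r x i r0 CHZ sHZ mTh tT).
  have : (X%:E <= ((2 * D) `^ (1 + p))%:E * (T `^ (1 + p))%:E)%E.
    rewrite -(EFin_Rintegral (LpZ _ kap20)).
    have mP : measurable_fun setT (fun x => ((EFin \o Th) x `^ 0 * \prod_(i < n) marginal i (EFin \o Th) x `^ p)%E).
      apply: emeasurable_funM; first exact: (measurableT_comp (measurable_poweR _) mETh).
      apply: emeasurable_prod => i _; apply: (measurableT_comp (measurable_poweR _)).
      exact: measurable_marginal.
    have P0 x : (0 <= (EFin \o Th) x `^ 0 * \prod_(i < n) marginal i (EFin \o Th) x `^ p)%E.
      by rewrite mule_ge0 ?poweR_ge0// prode_ge0// => i _; exact: poweR_ge0.
    pose Pf := fun x => ((EFin \o Th) x `^ 0 * \prod_(i < n) marginal i (EFin \o Th) x `^ p)%E.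
    rewrite -/Pf in mP P0 gl.
    have k0 : (0 <= ((2 * D) `^ (1 + p))%:E)%E by rewrite lee_fin powR_ge0.
    have IZ : (\int[mu]_x (((2 * D) `^ (1 + p))%:E * Pf x) = ((2 * D) `^ (1 + p))%:E * \int[mu]_x Pf x)%E.
      by apply: ge0_integralZl => // x _; exact: P0.
    apply: (@le_trans _ _ (((2 * D) `^ (1 + p))%:E * \int[mu]_x Pf x)%E); last exact: lee_wpmul2l.
    rewrite -IZ; apply: (@ge0_le_integral _ _ _ mu setT measurableT (fun x => (`|Z x| `^ (2 * kap))%:E)).
    - by move=> x _; rewrite lee_fin powR_ge0.
    - exact: (measurable_int mu (LpZ _ kap20)).
    - exact: (emeasurable_funM (measurable_cst _) mP).
    - by move=> x _; exact: pt.
  rewrite -EFinM lee_fin -powRM// ?mulr_ge0// ?(ltW D0)// => XX.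
  have DT0 : 0 <= 2 * D * T by rewrite !mulr_ge0// ltW.
  have := @ler_powR_base R (1 + p)^-1 _ _ _ X0 XX.
  rewrite invr_ge0 (ltW p10) => /(_ isT).
  by move/le_trans; apply; rewrite -powRrM mulfV ?gt_eqF// powRr1.
have XK : X `^ (1 + p)^-1 <= K2 * (X `^ (th / 2) * Dd `^ 2^-1).
  apply: le_trans XT _.
  have A2 : A `^ 2^-1 <= K1 `^ 2^-1 * X `^ (th / 2).
    apply: (le_trans (ler_powR_base _ A0 AX)); first by rewrite invr_ge0.
    by rewrite powRM ?powR_ge0 ?(ltW K10)// -powRrM.
  apply: (@le_trans _ _ (2 * D * (N * (K1 `^ 2^-1 * X `^ (th / 2) * Dd `^ 2^-1)))); last first.
    by rewrite le_eqVlt -/N -/Dd /K2 !mulrA eqxx.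
  have D20 : 0 <= 2 * D by rewrite mulr_ge0// ltW.
  apply: (ler_wpM2l D20); apply: (le_trans TA); apply: (ler_wpM2l (ler0n _ n)).
  exact: (ler_wpM2r (powR_ge0 _ _) A2).
rewrite -/X -/Dd; have [->|Xn0] := eqVneq X 0.
  by rewrite powR0 ?invr_eq0 ?gt_eqF// mulr_ge0 ?sqr_ge0.
have Xp : 0 < X by rewrite lt0r Xn0.
(* The exponents match: dividing by [X ^ (th / 2)] leaves [X ^ (1 / (2 * kap))] on the left. This is
   why [X = 0] was set apart. *)
have E1 : X `^ (1 + p)^-1 = X `^ (2 * kap)^-1 * X `^ (th / 2).
  rewrite -powRD; last by rewrite Xn0 implybT.
  congr (_ `^ _); rewrite p1 /th /a /gam.
  by field; rewrite N0 N1 gt_eqF.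
have XK' : X `^ (2 * kap)^-1 <= K2 * Dd `^ 2^-1.
  move: XK; rewrite E1 mulrCA mulrC ler_pM2l ?powR_gt0//.
have := lerXn2r 2 (_ : X `^ (2 * kap)^-1 \in Num.nneg) (_ : K2 * Dd `^ 2^-1 \in Num.nneg) XK'.
rewrite !nnegrE powR_ge0 mulr_ge0 ?powR_ge0 ?(ltW K20)// => /(_ isT isT).
have sqE (y e : R) : (y `^ e) ^+ 2 = y `^ (e * 2) by rewrite -powR_mulrn ?powR_ge0// -powRrM.
rewrite exprMn !sqE mulVf// powRr1//.
by rewrite (_ : (2 * kap)^-1 * 2 = kap^-1)//; field; rewrite gt_eqF.
Qed.

End sobolev_statement.

End sobolev.

(** * Mollification *)

Section translation.
Context {R : realType} {n : nat}.
Implicit Types (f g k : 'rV[R]_n -> R) (a x : 'rV[R]_n) (r : R).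
Local Notation mu := (@lebesgue_rV R n).

Lemma L1_fin f : measurable_fun setT f -> (\int[mu]_x `|f x|%:E < +oo)%E -> L1 f.
Proof. by move=> mf fi; apply/integrableP; split => //; exact/measurable_EFinP. Qed.

Let affine_ge0 a r f : 0 < r -> (forall x, 0 <= f x) -> L1 f ->
  L1 (fun x => f (a + r *: x)) /\
  r ^+ n * \int[mu]_x f (a + r *: x) = \int[mu]_x f x.
Proof.
move=> r0 f0 Lf; have mf := L1_measurable Lf.
have E := @ge0_integral_affine R n a r (EFin \o f) r0 (measurable_int mu Lf) f0.
have mT : measurable_fun setT (fun x => f (a + r *: x)).
  exact: (measurableT_comp mf (measurable_rV_affine a r)).
have rn0 : 0 < r ^+ n by exact: exprn_gt0.
have iE : (\int[mu]_x (f (a + r *: x))%:E = (r ^- n * \int[mu]_x f x)%:E)%E.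
  rewrite EFinM -EFin_Rintegral// -E muleA -EFinM mulVf ?gt_eqF// mul1e.
  by [].
have LT : L1 (fun x => f (a + r *: x)) by apply: ge0_integrable => //; rewrite iE ltry.
split => //; rewrite /Rintegral iE /= mulrA mulfV ?mul1r//.
by rewrite gt_eqF.
Qed.

Lemma L1_affine a r f : 0 < r -> L1 f -> L1 (fun x => f (a + r *: x)).
Proof.
move=> r0 Lf; apply: L1_fin.
  exact: (measurableT_comp (L1_measurable Lf) (measurable_rV_affine a r)).
have [L _] := affine_ge0 a r0 (fun x => normr_ge0 (f x)) (L1_norm Lf).
by rewrite EFin_Rintegral// ltry.
Qed.

Lemma Rintegral_affine a r f : 0 < r -> L1 f ->
  r ^+ n * \int[mu]_x f (a + r *: x) = \int[mu]_x f x.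
Proof.
move=> r0 Lf; have Ln := L1_norm Lf; have Lb := L1B Ln Lf.
have [LA EA] := affine_ge0 a r0 (fun x => normr_ge0 (f x)) Ln.
have b0 x : 0 <= `|f x| - f x by rewrite subr_ge0 ler_norm.
have [LB EB] := affine_ge0 a r0 b0 Lb.
(* Both [|f|] and [|f| - f] are nonnegative, which reduces the formula to the case already
   proved. *)
have fE x : f x = `|f x| - (`|f x| - f x) by rewrite subKr.
transitivity (r ^+ n * (\int[mu]_x `|f (a + r *: x)| - \int[mu]_x (`|f (a + r *: x)| - f (a + r *: x)))).
  by rewrite -RintegralB//; congr (_ * _); apply: eq_Rintegral => x _; exact: fE.
by rewrite mulrBr EA EB -RintegralB//; apply: eq_Rintegral => x _; rewrite -fE.
Qed.

Lemma L1_shift a f : L1 f -> L1 (fun x => f (x - a)).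
Proof.
move=> Lf; have := L1_affine (- a) (@ltr01 R) Lf.
by under eq_fun do rewrite scale1r addrC.
Qed.

Lemma Rintegral_shift a f : L1 f -> \int[mu]_x f (x - a) = \int[mu]_x f x.
Proof.
move=> Lf; rewrite -(Rintegral_affine (- a) (@ltr01 R) Lf) expr1n mul1r.
by apply: eq_Rintegral => x _; rewrite scale1r addrC.
Qed.

Lemma L1_cube x r : 0 < r -> L1 (\1_(cube x r) : 'rV[R]_n -> R).
Proof.
move=> r0; apply: ge0_integrable.
- exact: measurable_indic (measurable_cube _ _).
- by move=> y; exact: ler0n.
rewrite integral_indic ?setIT//; last exact: measurable_cube.
by rewrite -[X in (X < _)%E]/(lebesgue_rV _) lebesgue_cube ?ltry.
Qed.

Lemma Rintegral_cube x r : 0 < r -> \int[mu]_y \1_(cube x r) y = (2 * r) ^+ n.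
Proof.
move=> r0; rewrite /Rintegral integral_indic ?setIT//; last exact: measurable_cube.
by rewrite -[X in fine X]/(lebesgue_rV _) lebesgue_cube.
Qed.

(** The integral of the translates [f (h e_i + y)] is constant in [h], and its derivative at 0,
    taken under the integral sign, is the integral of the partial derivative. *)
Lemma Rintegral_partial0 r f i : class_C 1 setT f -> supp_in r f ->
  \int[mu]_x partial i f x = 0.
Proof.
move=> Cf sf; have cf x : {for x, continuous f} by exact: class_C_cont Cf I.
have cdf : continuous (partial i f) by move=> x; exact: (class_C_cont (class_C_partial i Cf)).
have sdf := supp_in_partial i sf.
have Lf : L1 f by exact: L1_continuous cf sf.
have [C C0 HC] := supp_in_bounded cdf sdf.
set e := delta_mx ord0 i : 'rV[R]_n.
have e1 : `|e| <= 1.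
  by apply/rV_norm_leP => // j; rewrite mxE eqxx /=; case: eqP => _; rewrite ?normr1 ?normr0.
(* Translating by at most 1 keeps the support inside the cube of radius [s], whose indicator is the
   integrable majorant. *)
pose s := `|r| + 2; have s0 : 0 < s by rewrite ltr_wpDl.
have L h : L1 (fun x => f (h *: e + x)).
  have := L1_shift (- (h *: e)) Lf.
  by under eq_fun do rewrite opprK addrC.
have D : is_derive (0 : R) 1 (fun h : R => \int[mu]_y f (h *: e + y)) (\int[mu]_y partial i f (0 *: e + y)).
  apply: (@is_derive_under R n (fun h y => f (h *: e + y)) (fun h y => partial i f (h *: e + y))
    (fun y => C * \1_(cube 0 s) y) 0 (-1) 1).
  - by rewrite oppr_lt0 ltr01.
  - by move=> h _; exact: L.
  - move=> h y _; apply/is_derive_line.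
    exact: (class_C_derive i Cf).
  - exact: L1Z (L1_cube _ s0).
  - move=> h y /andP[h1 h2]; have hn : `|h| <= 1 by rewrite ler_norml !ltW.
    have [ys|ys] := ltP `|y| s.
      by rewrite indicE mem_set ?mulr1// /cube/= subr0.
    rewrite sdf ?normr0 ?mulr_ge0 ?ler0n ?(ltW C0)//.
    have : `|y| <= `|h *: e + y| + `|h *: e|.
      by rewrite -[X in `|X| <= _](addKr (h *: e)) addrC (le_trans (ler_normB _ _)).
    have he : `|h *: e| <= 1 by rewrite normrZ mulr_ile1.
    have := ler_norm r; rewrite /s in ys; lra.
have D' : is_derive (0 : R) 1 (fun h : R => \int[mu]_y f (h *: e + y)) 0.
  apply: (is_derive_ext (f := fun=> \int[mu]_y f y)) => h; rewrite -(Rintegral_shift (- (h *: e)) Lf).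
  by apply: eq_Rintegral => y _; rewrite opprK addrC.
have [_ <-] := D'; have [_ ->] := D.
by apply: eq_Rintegral => y _; rewrite scale0r add0r.
Qed.

Lemma partialM m (U : set 'rV[R]_n) f g i x : class_C m.+1 U f -> class_C m.+1 U g -> U x ->
  partial i (fun x => f x * g x) x = f x * partial i g x + partial i f x * g x.
Proof.
move=> Cf Cg Ux; apply: partial_is_derive.
by apply: is_derive_mul; [exact: (class_C_derive i Cf Ux)|exact: (class_C_derive i Cg Ux)].
Qed.

Lemma partialZ m (U : set 'rV[R]_n) (c : R) f i x : class_C m.+1 U f -> U x ->
  partial i (fun x => c * f x) x = c * partial i f x.
Proof.
move=> Cf Ux; apply: partial_is_derive.
have := is_derive_mul (is_derive_const c x (delta_mx ord0 i)) (class_C_derive i Cf Ux).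
by rewrite mul0r addr0.
Qed.

Lemma supp_inM r f g : supp_in r g -> supp_in r (fun x => f x * g x).
Proof. by move=> sg x /sg ->; rewrite mulr0. Qed.

Lemma integration_by_parts_rV r f g i : class_C 1 setT f -> class_C 1 setT g ->
  supp_in r g ->
  \int[mu]_x (partial i f x * g x) = - \int[mu]_x (f x * partial i g x).
Proof.
move=> Cf Cg sg; have Cfg := class_CM openT Cf Cg.
have C0M (h1 h2 : 'rV[R]_n -> R) : continuous h1 -> continuous h2 -> continuous (fun x => h1 x * h2 x).
  by move=> ch ck x; apply: continuousM; [exact: ch|exact: ck].
have cf : continuous f by move=> x; exact: (class_C_cont Cf).
have cg : continuous g by move=> x; exact: (class_C_cont Cg).
have cdf : continuous (partial i f) by move=> x; exact: (class_C_cont (class_C_partial i Cf)).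
have cdg : continuous (partial i g) by move=> x; exact: (class_C_cont (class_C_partial i Cg)).
have L := L1_continuous (C0M _ _ cdf cg) (supp_inM _ sg).
have L' := L1_continuous (C0M _ _ cf cdg) (supp_inM _ (supp_in_partial i sg)).
apply/eqP; rewrite -addr_eq0 -RintegralD//; apply/eqP.
rewrite -[RHS](Rintegral_partial0 i Cfg (supp_inM _ sg)).
by apply: eq_Rintegral => x _; rewrite (partialM i Cf Cg)// addrC.
Qed.

End translation.

Section convolution.
Context {R : realType} {n : nat}.
Implicit Types (f g k : 'rV[R]_n -> R) (a x : 'rV[R]_n) (r : R).
Local Notation mu := (@lebesgue_rV R n).

Variables (k : 'rV[R]_n -> R) (r : R).
Hypotheses (ck : continuous k) (sk : supp_in r k).

Let Lk : L1 k. Proof. exact: L1_continuous ck sk. Qed.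

Lemma convL1 f x : L1 f -> L1 (fun y => f y * k (x - y)).
Proof.
by have [C _ HC] := supp_in_bounded ck sk; move=> Lf; apply: conv_L1 HC => //; exact: L1_measurable.
Qed.

Lemma convD f g x : L1 f -> L1 g -> conv k (fun y => f y + g y) x = conv k f x + conv k g x.
Proof.
move=> Lf Lg; rewrite /conv -RintegralD//; [|exact: convL1..].
by apply: eq_Rintegral => y _; rewrite mulrDl.
Qed.

Lemma convZ (c : R) f x : L1 f -> conv k (fun y => c * f y) x = c * conv k f x.
Proof.
move=> Lf; rewrite /conv -RintegralZl//; last exact: convL1.
by apply: eq_Rintegral => y _; rewrite mulrA.
Qed.

Lemma convB f g x : L1 f -> L1 g -> conv k (fun y => f y - g y) x = conv k f x - conv k g x.
Proof.
move=> Lf Lg; rewrite /conv -RintegralB//; [|exact: convL1..].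
by apply: eq_Rintegral => y _; rewrite mulrBl.
Qed.

Lemma conv_scalek (c : R) f x : L1 f -> conv (fun z => c * k z) f x = c * conv k f x.
Proof.
move=> Lf; rewrite /conv -RintegralZl//; last exact: convL1.
by apply: eq_Rintegral => y _; rewrite mulrCA.
Qed.

Hypothesis k0 : forall z, 0 <= k z.

Lemma conv_ge0 f x : (forall y, 0 <= f y) -> 0 <= conv k f x.
Proof. by move=> f0; apply: Rintegral_ge0 => y _; exact: mulr_ge0. Qed.

Lemma conv_le f g x : L1 f -> L1 g -> (forall y, f y <= g y) -> conv k f x <= conv k g x.
Proof.
move=> Lf Lg fg; apply: Rintegral_le; [exact: convL1..|] => y.
exact: ler_wpM2r.
Qed.

Lemma conv_abs f x : L1 f -> `|conv k f x| <= conv k (fun y => `|f y|) x.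
Proof.
move=> Lf; rewrite /conv; apply: (le_trans (le_normr_Rintegral measurableT (convL1 x Lf))).
by rewrite le_eqVlt; apply/orP; left; apply/eqP; apply: eq_Rintegral => y _; rewrite normrM [`|k _|]ger0_norm.
Qed.

Let ge0_case f : L1 f -> (forall y, 0 <= f y) ->
  L1 (conv k f) /\ \int[mu]_x conv k f x = (\int[mu]_x f x) * \int[mu]_x k x.
Proof.
move=> Lf f0; have mf := L1_measurable Lf; have mk := L1_measurable Lk.
have [C C0 HC] := supp_in_bounded ck sk.
have E : (\int[mu]_x (conv k f x)%:E = ((\int[mu]_x f x) * \int[mu]_x k x)%:E)%E.
  transitivity (\int[mu]_x \int[mu]_y (f y * k (x - y))%:E)%E.
    by apply: eq_integral => x _; rewrite EFin_Rintegral//; exact: convL1.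
  rewrite (@fubini_tonelli _ _ _ _ R mu mu (fun z => (f z.2 * k (z.1 - z.2))%:E)).
  - transitivity (\int[mu]_y ((f y)%:E * (\int[mu]_x k x)%:E))%E.
      apply: eq_integral => y _; rewrite -(Rintegral_shift y Lk).
      have Ly := L1_shift y Lk.
      have mLy := measurable_int mu Ly; rewrite -EFin_Rintegral//.
      transitivity (\int[mu]_x ((f y)%:E * (EFin \o (fun x => k (x - y))) x))%E.
        by apply: eq_integral => x _; rewrite -EFinM.
      by apply: ge0_integralZl => //; [move=> x _; rewrite lee_fin|rewrite lee_fin].
    under eq_integral do rewrite -EFinM mulrC.
    have := L1Z (\int[mu]_x k x) Lf => LZ.
    by rewrite EFin_Rintegral// RintegralZl// mulrC.
  - apply/measurable_EFinP; apply: measurable_funM.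
      exact: (measurableT_comp mf measurable_snd).
    apply: (measurableT_comp mk); apply: measurable_fun_rV => i.
    rewrite (_ : _ \o _ = fun z : 'rV[R]_n * 'rV[R]_n => rV_coord i z.1 - rV_coord i z.2); last first.
      by apply/funext => z; rewrite /= /rV_coord !mxE.
    apply: measurable_funB; apply: measurableT_comp => //; exact: measurable_rV_coord.
  - by move=> z; rewrite lee_fin mulr_ge0.
have mc : measurable_fun setT (conv k f).
  by apply: continuousT_measurable_rV; exact: continuous_conv Lf ck HC.
split; last by rewrite /Rintegral E.
by apply: ge0_integrable => //; [move=> x; exact: conv_ge0|rewrite E ltry].
Qed.

Lemma L1_conv f : L1 f -> L1 (conv k f).
Proof.
move=> Lf; have [C _ HC] := supp_in_bounded ck sk.
have [L _] := ge0_case (L1_norm Lf) (fun y => normr_ge0 (f y)).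
apply: L1_le L; last by move=> x; exact: conv_abs.
by apply: continuousT_measurable_rV; exact: continuous_conv Lf ck HC.
Qed.

Lemma Rintegral_conv f : L1 f -> (forall y, 0 <= f y) ->
  \int[mu]_x conv k f x = (\int[mu]_x f x) * \int[mu]_x k x.
Proof. by move=> Lf f0; have [] := ge0_case Lf f0. Qed.

Lemma Rintegral_conv_abs f : L1 f ->
  \int[mu]_x `|conv k f x| <= (\int[mu]_x `|f x|) * \int[mu]_x k x.
Proof.
move=> Lf; have Ln := L1_norm Lf; rewrite -Rintegral_conv//.
by apply: Rintegral_le; [exact/L1_norm/L1_conv|exact: L1_conv|move=> x; exact: conv_abs].
Qed.

Hypothesis k1 : \int[mu]_x k x = 1.
Hypothesis ke : forall z, k (- z) = k z.

Lemma Rintegral_kernel x : \int[mu]_y k (x - y) = 1.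
Proof.
rewrite -k1 -(Rintegral_shift x Lk); apply: eq_Rintegral => y _.
by rewrite -ke opprB.
Qed.

Lemma L1_kernel x : L1 (fun y => k (x - y)).
Proof.
have := L1_shift x Lk; congr (L1 _); apply/funext => y.
by rewrite -ke opprB.
Qed.

(** Jensen's inequality for the probability density [k (x - y)], obtained from Hoelder's inequality
    with weights [1/s] and [1 - 1/s] after splitting [k = k^(1/s) * k^(1 - 1/s)]. *)
Lemma conv_jensen (s : R) f x : 1 <= s -> L1 f -> (forall y, 0 <= f y) ->
  L1 (fun y => f y `^ s) -> conv k f x `^ s <= conv k (fun y => f y `^ s) x.
Proof.
move=> s1 Lf f0 Ls; have s0 : 0 < s by exact: lt_le_trans s1.
have [->|sn1] := eqVneq s 1.
  rewrite powRr1 ?conv_ge0//; apply: conv_le => //; last by move=> y; rewrite powRr1.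
  by move: Lf; congr (L1 _); apply/funext => y; rewrite powRr1.
have s1' : s^-1 < 1 by rewrite invf_lt1// lt_neqAle eq_sym sn1.
have := @holder_Rintegral _ _ _ mu (fun y => f y `^ s * k (x - y)) (fun y => k (x - y)) s^-1 (1 - s^-1)
  (convL1 x Ls) (L1_kernel x) (fun y => mulr_ge0 (powR_ge0 _ _) (k0 _)) (fun y => k0 _).
rewrite invr_gt0 s0 subr_gt0 s1' subrKC => /(_ isT isT erefl) [_].
have -> : \int[mu]_y ((f y `^ s * k (x - y)) `^ s^-1 * k (x - y) `^ (1 - s^-1)) = conv k f x.
  apply: eq_Rintegral => y _; rewrite powRM ?powR_ge0// -powRrM mulfV ?gt_eqF// powRr1// -mulrA.
  congr (_ * _); have [->|kn0] := eqVneq (k (x - y)) 0.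
    by rewrite powR0 ?mul0r// gt_eqF// invr_gt0.
  by rewrite -powRD ?kn0 ?implybT// subrKC powRr1.
rewrite Rintegral_kernel powR1 mulr1 => H.
have := ler_powR_base (ltW s0) (conv_ge0 x f0) H.
by rewrite -powRrM mulVf ?gt_eqF// powRr1//; apply: conv_ge0 => y; exact: powR_ge0.
Qed.

End convolution.

(** * From L^1 convergence to almost everywhere convergence *)

Section ae_subsequence.
Context d {T : measurableType d} {R : realType} (mu : {measure set T -> \bar R}).

Import HBSimple.

Lemma sfun_sum_indic (g : {sfun T >-> R}) : exists S : seq R,
  forall x, g x = \sum_(y <- S) y * \1_(g @^-1` [set y]) x.
Proof.
exists (finmap.enum_fset (fset_set (range g))) => x.
by rewrite [LHS]fimfunE fsbig_finite//=; exact: fimfunP.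
Qed.

Lemma nneseries_cvg0 (u : nat -> R) : (forall k, 0 <= u k) ->
  (\sum_(0 <= k <oo) (u k)%:E < +oo)%E -> u k @[k --> \oo] --> (0 : R).
Proof.
move=> u0 us.
have tc := nneseries_tail_cvg us (fun k _ => u0 k : (0 <= (u k)%:E)%E).
have /fine_cvgP[fn /cvgrPdist_le/= fc] := tc.
apply/cvgrPdist_le => /= e e0; move: fn (fc e e0); apply: filterS2 => N tf.
rewrite !sub0r !normrN => H; rewrite ger0_norm//; apply: le_trans H; apply: le_trans (ler_norm _).
rewrite -lee_fin fineK//.
have := @nneseries_lim_ge R (fun k => (u k)%:E) xpredT N N.+1 (fun k _ _ => u0 k).
by rewrite big_nat1.
Qed.

(** Indices are chosen with errors at most [2^-(k+1)]; the sum of the errors is then integrable,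
    hence finite almost everywhere, and its terms tend to 0. The condition [k <= s k] suffices,
    instead of strict growth, to carry other limits to the subsequence. *)
Lemma L1_cvg_ae_subseq (F : nat -> T -> R) (f : T -> R) :
  (forall m, mu.-integrable setT (EFin \o (fun x => F m x - f x))) ->
  (\int[mu]_x `|F m x - f x|)%R @[m --> \oo] --> (0 : R) ->
  exists2 s : nat -> nat, (forall k, (k <= s k)%N) &
    {ae mu, forall x, F (s k) x @[k --> \oo] --> f x}.
Proof.
move=> LF /cvgrPdist_le/= H.
have /choice[s sP] k : exists m, (k <= m)%N /\ \int[mu]_x `|F m x - f x| <= 1 / (2 ^ k.+1)%:R.
  have e0 : 0 < 1 / (2 ^ k.+1)%:R :> R by rewrite divr_gt0// ltr0n expn_gt0.
  have [M _ HM] := H _ e0; exists (maxn k M); split; first exact: leq_maxl.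
  have := HM (maxn k M) (leq_maxr _ _).
  by rewrite sub0r normrN; apply: le_trans; exact: ler_norm.
exists s => [k|]; first by have [] := sP k.
have LN k : mu.-integrable setT (EFin \o (fun x => `|F (s k) x - f x|)).
  by have := integrable_abse (LF (s k)); congr (integrable _ _ _); apply/funext => x.
have mN k : measurable_fun setT (fun x => `|F (s k) x - f x|%:E) by exact: (measurable_int mu (LN k)).
pose S x := (\sum_(0 <= k <oo) `|F (s k) x - f x|%:E)%E.
have S0 x : (0 <= S x)%E by apply: nneseries_ge0.
have mS : measurable_fun setT S by apply: ge0_emeasurable_sum => //.
have LS : mu.-integrable setT S.
  apply/integrableP; split => //.
  under eq_integral do rewrite gee0_abs//.
  rewrite integral_nneseries//.
  apply: (@le_lt_trans _ _ 1%:E); last by rewrite ltry.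
  apply: le_trans (epsilon_trick0 xpredT (@ler01 R)).
  apply: lee_nneseries => [k _ _|k _]; first exact: integral_ge0.
  by rewrite EFin_Rintegral// lee_fin; have [] := sP k.
have := integrable_ae measurableT LS; apply: filterS => x /(_ I) Sx.
have : S x \is a fin_num -> (S x < +oo)%E by rewrite ge0_fin_numE.
move=> /(_ Sx) {}Sx.
have := nneseries_cvg0 (fun k => normr_ge0 (F (s k) x - f x)) Sx.
move=> /cvgrPdist_le/= c0; apply/cvgrPdist_le => /= e e0.
by apply: filterS (c0 e e0) => k; rewrite sub0r normrN normr_id distrC.
Qed.

End ae_subsequence.

(** * The averaging kernel and density of mollifications in L^1 *)

Section mollifier.
Context {R : realType} {n : nat}.
Implicit Types (f g : 'rV[R]_n -> R) (x z : 'rV[R]_n) (t : R).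
Local Notation mu := (@lebesgue_rV R n).

Definition moll_mass : R := \int[mu]_x (- 2 * ker 1 1 x).
(** The averages use [ker 1], which is nonpositive, hence the factor [-2]. The kernel [pmoll] is
    built from [ker 0] with the same constant, not normalized on its own, so that the derivative of
    [moll t] in [t] is exactly [t] times the Laplacian of [pmoll t]. *)
Definition moll t z : R := moll_mass^-1 * (- 2 * (t ^- n * ker 1 t z)).
Definition pmoll t z : R := moll_mass^-1 * (t ^- n * ker 0 t z).

Let cker j t : continuous (@ker R n j t).
Proof. by move=> z; exact: (class_C_cont (class_C_ker 0 j t)). Qed.

Let L1_ker1 t : 0 < t -> L1 (fun z : 'rV[R]_n => - 2 * ker 1 t z).
Proof. by move=> t0; apply: L1Z; apply: L1_continuous (@cker 1 t) _; exact: supp_in_ker. Qed.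

Lemma moll_mass_gt0 : 0 < moll_mass.
Proof.
(* On the cube of radius [1 / (n + 1)] the squared Euclidean norm is at most [1/2], and the kernel
   is then at least [exp(-2)]. *)
pose d : R := n.+1%:R^-1; have d0 : 0 < d by rewrite invr_gt0.
pose m := expR (- 2) : R.
have Lc := L1Z m (L1_cube (0 : 'rV[R]_n) d0).
apply: (@lt_le_trans _ _ (\int[mu]_x (m * \1_(cube (0 : 'rV[R]_n) d) x))).
  rewrite RintegralZl//; last exact: L1_cube.
  by rewrite Rintegral_cube// mulr_gt0 ?expR_gt0// exprn_gt0// mulr_gt0.
apply: (Rintegral_le Lc (L1_ker1 ltr01)) => x; rewrite indicE.
have k1 : 0 <= - 2 * ker 1 1 x by rewrite mulNr oppr_ge0 pmulr_rle0// ker1_le0.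
have [|_] := boolP (x \in _); last by rewrite mulr0.
rewrite inE /cube/= subr0 => xd; rewrite mulr1 /ker expr1n divr1.
have e0 := edot_ge0 x.
have e12 : edot x x <= 2^-1.
  apply: (le_trans (edot_le_norm x)).
  have x2 : `|x| ^+ 2 <= d ^+ 2 by rewrite ler_pXn2r ?nnegrE// ltW.
  apply: (@le_trans _ _ (n%:R * d ^+ 2)); first by rewrite ler_wpM2l.
  have N0 : 0 <= n%:R :> R by [].
  rewrite /d exprVn -natr1 ler_pdivrMr; last by rewrite exprn_gt0// ltr_wpDl.
  by have := sqr_ge0 (n%:R : R); rewrite !expr2; nra.
have lt1 : edot x x < 1 by lra.
rewrite mulNr -mulrN bump1E//.
have i0 : 0 < 1 - edot x x by lra.
have i1 : (1 - edot x x)^-1 <= 2 by rewrite -[2]invrK lef_pV2 ?posrE//; lra.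
have i2 : 1 <= (1 - edot x x) ^- 2 by rewrite invf_ge1 ?exprn_gt0// expr2; nra.
have em : m <= expR (- (1 - edot x x)^-1) by rewrite ler_expR lerN2.
apply: (le_trans em); have := expR_gt0 (- (1 - edot x x)^-1); nra.
Qed.

Let mass0 : moll_mass != 0. Proof. by rewrite gt_eqF// moll_mass_gt0. Qed.

Lemma class_C_kerM m j t (a : R) : class_C m setT (fun z : 'rV[R]_n => a * ker j t z).
Proof. by apply: class_CM openT _ _; [exact: (class_C_cst _ _ openT)|exact: class_C_ker]. Qed.

Lemma mollE t : moll t = (fun z => (moll_mass^-1 * (- 2 * t ^- n)) * ker 1 t z).
Proof. by apply/funext => z; rewrite /moll !mulrA. Qed.

Lemma pmollE t : pmoll t = (fun z => (moll_mass^-1 * t ^- n) * ker 0 t z).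
Proof. by apply/funext => z; rewrite /pmoll !mulrA. Qed.

Lemma class_C_moll m t : class_C m setT (moll t).
Proof. by rewrite mollE; exact: class_C_kerM. Qed.

Lemma class_C_pmoll m t : class_C m setT (pmoll t).
Proof. by rewrite pmollE; exact: class_C_kerM. Qed.

Lemma continuous_moll t : continuous (moll t).
Proof. by move=> x; exact: (class_C_cont (class_C_moll 0 t)). Qed.

Lemma supp_in_moll t : 0 < t -> supp_in t (moll t).
Proof. by move=> t0 z tz; rewrite /moll ker_eq0 ?(ltW tz)// !mulr0. Qed.

Lemma supp_in_pmoll t : 0 < t -> supp_in t (pmoll t).
Proof. by move=> t0 z tz; rewrite /pmoll ker_eq0 ?(ltW tz)// !mulr0. Qed.

Lemma moll_eq0 t z : 0 < t -> t <= `|z| -> moll t z = 0.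
Proof. by move=> t0 tz; rewrite /moll ker_eq0// !mulr0. Qed.

Lemma moll_ge0 t z : 0 < t -> 0 <= moll t z.
Proof.
move=> t0; rewrite /moll mulr_ge0// ?invr_ge0 ?(ltW moll_mass_gt0)//.
by rewrite mulNr oppr_ge0 pmulr_rle0// pmulr_rle0 ?ker1_le0// invr_gt0 exprn_gt0.
Qed.

Lemma moll_even t z : moll t (- z) = moll t z.
Proof. by rewrite /moll ker_even. Qed.

Lemma Rintegral_moll t : 0 < t -> \int[mu]_x moll t x = 1.
Proof.
move=> t0; have Lm : L1 (moll t) by apply: L1_continuous (@continuous_moll t) _; exact: supp_in_moll.
rewrite -(Rintegral_affine 0 t0 Lm).
have tn0 : t ^+ n != 0 by rewrite expf_neq0// gt_eqF.
transitivity (t ^+ n * \int[mu]_x ((moll_mass^-1 * t ^- n) * (- 2 * ker 1 1 x))).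
  congr (_ * _); apply: eq_Rintegral => x _.
  have := ker_scale 1 1 x (lt0r_neq0 t0); rewrite mulr1 => kE.
  by rewrite add0r /moll kE; ring.
rewrite RintegralZl//; last exact: L1_ker1.
rewrite -/moll_mass; field; rewrite mass0.
by rewrite tn0.
Qed.

Lemma is_derive_moll t z : t != 0 ->
  is_derive t 1 (fun t => moll t z) (t * (moll_mass^-1 * (t ^- n * lap_ker 0 t z))).
Proof.
move=> t0; have D := is_derive_ker_scale z t0.
have := is_derive_mul (is_derive_const moll_mass^-1 t 1) D.
by rewrite mul0r addr0 mulrCA.
Qed.

Definition approximable f := forall t : nat -> R, (forall m, 0 < t m) ->
  t m @[m --> \oo] --> 0 -> (\int[mu]_x `|conv (moll (t m)) f x - f x|)%R @[m --> \oo] --> (0 : R).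

Let Lconv t f : 0 < t -> L1 f -> L1 (conv (moll t) f).
Proof.
move=> t0 Lf; apply: (L1_conv (@continuous_moll t) (supp_in_moll t0)) => // z.
exact: moll_ge0.
Qed.

Lemma approximable_comb (c : R) f g : L1 f -> L1 g -> approximable f -> approximable g ->
  approximable (fun x => f x + c * g x).
Proof.
move=> Lf Lg Af Ag t t0 tc.
have H : (\int[mu]_x `|conv (moll (t m)) f x - f x| + `|c| * \int[mu]_x `|conv (moll (t m)) g x - g x|)%R
    @[m --> \oo] --> (0 : R).
  rewrite -[X in _ --> X]addr0 -[X in _ --> _ + X](mulr0 `|c|).
  by apply: cvgD; [exact: Af|apply: cvgMr; exact: Ag].
apply: (squeeze_cvgr _ (cvg_cst 0) H); apply: nearW => m.
have [cm sm] := (@continuous_moll (t m), supp_in_moll (t0 m)).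
rewrite Rintegral_ge0//=.
have L1f := L1_norm (L1B (Lconv (t0 m) Lf) Lf).
have L1g := L1_norm (L1B (Lconv (t0 m) Lg) Lg).
rewrite -RintegralZl// -RintegralD//; last exact: L1Z.
apply: Rintegral_le; last 1 first.
- move=> x; rewrite (convD cm sm)//; last exact: L1Z.
  rewrite (convZ cm sm)// -normrM.
  by apply: le_trans (ler_normD _ _); rewrite le_eqVlt; apply/orP; left; apply/eqP; congr (`|_|); ring.
- apply/L1_norm/L1B; last by apply: L1D => //; exact: L1Z.
  by apply: Lconv => //; apply: L1D => //; exact: L1Z.
- by apply: L1D => //; exact: L1Z.
Qed.

(** A three-term estimate: mollification does not increase the L^1 norm, so the error for [f - h] is
    controlled by [f - h] itself, at every radius. *)
Lemma approximable_closed f : L1 f ->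
  (forall e, 0 < e -> exists h, [/\ L1 h, approximable h & \int[mu]_x `|f x - h x| <= e]) ->
  approximable f.
Proof.
move=> Lf Hf t t0 tc; apply/cvgrPdist_le => /= e e0.
have e3 : 0 < e / 3 by lra.
have [h [Lh Ah fh]] := Hf _ e3.
have /cvgrPdist_le/= /(_ _ e3) := Ah t t0 tc.
apply: filterS => m; rewrite !sub0r !normrN => H.
have [cm sm] := (@continuous_moll (t m), supp_in_moll (t0 m)).
rewrite ger0_norm; last exact: Rintegral_ge0.
have {}H := le_trans (ler_norm _) H.
have Lfh := L1B Lf Lh.
have Lc := L1_norm (Lconv (t0 m) Lfh).
have Ld := L1_norm (L1B (Lconv (t0 m) Lh) Lh).
have Lp := L1D Lc Ld.
have C := Rintegral_conv_abs cm sm (fun z => moll_ge0 z (t0 m)) Lfh.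
rewrite Rintegral_moll// mulr1 in C.
apply: (@le_trans _ _ (\int[mu]_x (`|conv (moll (t m)) (fun y => f y - h y) x| +
   `|conv (moll (t m)) h x - h x| + `|f x - h x|))).
  apply: Rintegral_le; last 1 first.
  - move=> x; rewrite (convB cm sm)//.
    set a := conv _ f x; set b := conv _ h x.
    rewrite (_ : a - f x = (a - b) + (b - h x) - (f x - h x)); last by ring.
    by apply: (le_trans (ler_normB _ _)); rewrite lerD2r ler_normD.
  - exact/L1_norm/L1B/Lf/Lconv.
  - by apply: L1D => //; exact: L1_norm.
rewrite RintegralD//; last exact: L1_norm.
rewrite RintegralD//; lra.
Qed.

(** Mollification preserves the integral, so the L^1 distance is twice the integral of the positive
    part [F m] of [f - conv f]. This part is dominated by [f], vanishes outside [O], and vanishes at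
    a point of [O] as soon as the radius is small; the boundary of [O] never has to be
    considered. *)
Lemma approximable_open (O : set 'rV[R]_n) r : 0 < r -> open O -> O `<=` cube 0 r ->
  approximable (\1_O : _ -> R).
Proof.
move=> r0 oO Or t t0 tc; set f : 'rV[R]_n -> R := \1_O.
have mO := open_measurable_rV oO.
have mf : measurable_fun setT f by exact: measurable_indic.
have Lf : L1 f.
  apply: L1_le (L1_cube 0 r0) => // x; rewrite /f !indicE normr_nat ler_nat.
  by have [|//] := boolP (x \in O); rewrite inE => /Or xO; rewrite mem_set.
have f0 x : 0 <= f x by rewrite /f indicE.
have c0 m x : 0 <= conv (moll (t m)) f x by apply: conv_ge0 => // z; exact: moll_ge0.
pose F m x := Num.max (f x - conv (moll (t m)) f x) 0.
have F0 m x : 0 <= F m x by rewrite le_max lexx orbT.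
have Fl m x : `|F m x| <= f x by rewrite ger0_norm// ge_max f0 andbT lerBlDr lerDl.
have mF m : measurable_fun setT (F m).
  apply: measurable_maxr => //; apply: measurable_funB => //.
  exact: (L1_measurable (Lconv (t0 m) Lf)).
have FL m : L1 (F m) by exact: L1_le (Fl m) Lf.
have Fc : {ae mu, forall x, F m x @[m --> \oo] --> (0 : R)}.
  apply: aeW => x; have [xO|xO] := pselect (O x); last first.
    have fx : f x = 0 by rewrite /f indicE memNset.
    have FE m : F m x = 0 by apply/le_anti; rewrite F0 andbT (le_trans (ler_norm _))// (le_trans (Fl _ _))// fx.
    by under eq_fun do rewrite FE; exact: cvg_cst.
  have [e e0 He] := (open_rVP O).1 oO x xO.
  apply/cvgrPdist_le => /= e1 e10.
  move/cvgrPdist_lt : tc => /(_ e e0); apply: filterS => m; rewrite !sub0r !normrN gtr0_norm// => te.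
  suff -> : F m x = 0 by rewrite normr0 ltW.
  rewrite /F; suff -> : conv (moll (t m)) f x = 1.
    by rewrite /f indicE mem_set// subrr maxxx.
  rewrite -[RHS](Rintegral_kernel (@continuous_moll (t m)) (supp_in_moll (t0 m)) (Rintegral_moll (t0 m)) (@moll_even (t m)) x).
  apply: eq_Rintegral => y _; have [xy|xy] := ltP `|x - y| (t m); last by rewrite moll_eq0// mulr0.
  rewrite /f indicE mem_set ?mul1r//; apply: He.
  by rewrite distrC (lt_trans xy).
have m0 : measurable_fun setT (fun _ : 'rV[R]_n => 0 : R) by exact: measurable_cst.
have [_ Fi _] := @dominated_cvg_Rintegral _ _ R mu F (fun=> 0) f mF m0 Lf Fc Fl.
have E m : \int[mu]_x `|conv (moll (t m)) f x - f x| = 2 * \int[mu]_x F m x.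
  have I0 : \int[mu]_x (conv (moll (t m)) f x - f x) = 0.
    rewrite RintegralB//; last exact: Lconv.
    rewrite (Rintegral_conv (@continuous_moll (t m)) (supp_in_moll (t0 m)))//.
      by rewrite Rintegral_moll// mulr1 subrr.
    by move=> z; exact: moll_ge0.
  have Lb := L1B (Lconv (t0 m) Lf) Lf.
  have L2 := L1Z 2 (FL m).
  transitivity (\int[mu]_x (2 * F m x) + \int[mu]_x (conv (moll (t m)) f x - f x)); last first.
    by rewrite I0 addr0 RintegralZl//; exact: FL.
  rewrite -RintegralD//.
  apply: eq_Rintegral => x _; rewrite /F.
  set a := conv _ _ _; case: (leP (f x - a) 0) => fa.
    by rewrite ger0_norm ?mulr0 ?add0r//; lra.
  by rewrite ler0_norm; lra.
under eq_fun do rewrite E.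
have z0 : \int[mu]_(_ in [set: 'rV[R]_n]) 0 = 0 :> R by rewrite /Rintegral integral0.
have : (2 * \int[mu]_x F m x)%R @[m --> \oo] --> 2 * \int[mu]_(_ in [set: 'rV[R]_n]) 0.
  by apply: cvgMr; exact: Fi.
by rewrite z0 mulr0.
Qed.

(** Puts the sigma-algebra in the form required by Dynkin's lemma, with the open sets as generating
    family stable under intersection. *)
Lemma measurable_rV_open : @measurable _ 'rV[R]_n = <<s (@open 'rV[R]_n) >>.
Proof.
apply/seteqP; split; last first.
  by apply: smallest_sub; [exact: sigma_algebra_measurable|exact: open_measurable_rV].
rewrite /measurable/=; apply: smallest_sub; first exact: smallest_sigma_algebra.
rewrite -bigcup_seq/= => B [i _ [Y mY <-]].
have SA := sigma_algebra_image (D := setT) (rV_coord i) (smallest_sigma_algebra [set: 'rV[R]_n] (@open 'rV[R]_n)).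
have mY' : <<s (@RGenOInfty.G R) >> Y.
  by have := RGenOInfty.measurableE R; rewrite /measurable/= => <-.
suff : image_set_system setT (rV_coord i) <<s (@open 'rV[R]_n) >> Y by [].
move: Y mY' {mY}; apply: smallest_sub => // Y [a ->].
rewrite /image_set_system /= setTI; apply: sub_sigma_algebra.
apply/open_rVP => x /=; rewrite in_itv/= andbT => ax.
exists (rV_coord i x - a); first by rewrite subr_gt0.
move=> y yx; rewrite in_itv/= andbT.
have := le_lt_trans (coord_le_norm (y - x) i) yx; rewrite !mxE /rV_coord.
by rewrite ltr_norml => /andP[]; lra.
Qed.

Let approximable_ext f g : f =1 g -> approximable f -> approximable g.
Proof. by move/funext => ->. Qed.

Let indI (A B : set 'rV[R]_n) : \1_(A `&` B) = (\1_A \* \1_B : _ -> R).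
Proof. by apply/funext => x; rewrite indicI. Qed.

Let L1_capcube (A : set 'rV[R]_n) r : measurable A -> 0 < r ->
  L1 (\1_(A `&` cube 0 r) : _ -> R).
Proof.
move=> mA r0; apply: L1_le (L1_cube 0 r0).
  exact: measurable_indic (measurableI _ _ mA (measurable_cube _ _)).
move=> x; rewrite !indicE normr_nat ler_nat.
by have [|//] := boolP (x \in A `&` _); rewrite inE => -[_ xr]; rewrite mem_set.
Qed.

(** Dynkin's lemma: the sets with this property contain the open sets and are stable under
    complements and disjoint unions. The intersection with a fixed cube keeps every indicator
    integrable, complements included. *)
Lemma approximable_capcube (A : set 'rV[R]_n) r : measurable A -> 0 < r ->
  approximable (\1_(A `&` cube 0 r) : _ -> R).
Proof.
move=> mA r0; move: mA; rewrite measurable_rV_open.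
apply: (dynkin_induction measurable_rV_open (P := fun A => approximable (\1_(A `&` cube 0 r) : _ -> R))).
- by move=> O1 O2 o1 o2; exact: openI.
- by rewrite setTI; apply: (approximable_open r0) => //; exact: open_cube.
- move=> O oO; apply: (approximable_open r0); last by move=> x [].
  by apply: openI => //; exact: open_cube.
- move=> S mS PS.
  apply: (@approximable_ext (fun x => \1_(cube 0 r) x + (-1) * \1_(S `&` cube 0 r) x)).
    move=> x; rewrite !indI /= !indicE in_setC.
    by case: (x \in S); case: (x \in cube _ _); rewrite /= ?mulr0 ?mul0r ?mulr1; lra.
  apply: approximable_comb => //; [exact: L1_cube|exact: L1_capcube|].
  by apply: (approximable_open r0) => //; exact: open_cube.
- move=> F mF tF PF.
  pose G m := \big[setU/set0]_(i < m) F i.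
  have mG m : measurable (G m) by apply: bigsetU_measurable.
  have mU : measurable (\bigcup_k F k) by exact: bigcupT_measurable.
  have PG m : approximable (\1_(G m `&` cube 0 r) : _ -> R).
    elim: m => [|m IH].
      by apply: (approximable_open r0); rewrite /G big_ord0 set0I//; exact: open0.
    apply: (@approximable_ext (fun x => \1_(G m `&` cube 0 r) x + 1 * \1_(F m `&` cube 0 r) x)); last first.
      by apply: approximable_comb => //; exact: L1_capcube.
    move=> x; rewrite /G big_ord_recr/= -/(G m) !indI /= !indicE mul1r in_setU -mulrDl.
    case: (boolP (x \in G m)) => xG; case: (boolP (x \in F m)) => xF; rewrite ?addr0 ?add0r//.
      move: xG xF; rewrite !inE /G -bigcup_mkord => -[k /= km Fkx] Fmx.
      have := tF k m I I (ex_intro _ x (conj Fkx Fmx)) => kmE.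
      by move: km; rewrite kmE ltnn.
  apply: (@approximable_closed (\1_(\bigcup_k F k `&` cube 0 r))); first exact: L1_capcube.
  have [_ _ D] : [/\ L1 (\1_(\bigcup_k F k `&` cube 0 r) : _ -> R),
     \int[mu]_x \1_(G m `&` cube 0 r) x @[m --> \oo] --> \int[mu]_x \1_(\bigcup_k F k `&` cube 0 r) x &
     (\int[mu]_x `|\1_(G m `&` cube 0 r) x - \1_(\bigcup_k F k `&` cube 0 r) x|)%R @[m --> \oo] --> (0:R)].
    apply: (@dominated_cvg_Rintegral _ _ R mu (fun m => \1_(G m `&` cube 0 r)) _ (\1_(cube 0 r))).
    + by move=> m; exact: (L1_measurable (L1_capcube (mG m) r0)).
    + exact: (L1_measurable (L1_capcube mU r0)).
    + exact: L1_cube.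
    + apply: aeW => x; rewrite !indI.
      under eq_fun do rewrite indI /=.
      apply: cvgMl; have [xU|xU] := pselect ((\bigcup_k F k) x); last first.
        rewrite [X in _ --> X]indicE memNset//.
        have E m : \1_(G m) x = 0 :> R.
          rewrite indicE memNset// /G -bigcup_mkord => -[k _ Fk]; apply: xU.
          by exists k.
        by under eq_fun do rewrite E; exact: cvg_cst.
      rewrite [X in _ --> X]indicE mem_set//; case: xU => k _ Fkx.
      apply: cvg_near_cst; exists k.+1 => // m /= km.
      by rewrite indicE mem_set// /G -bigcup_mkord; exists k.
    + move=> m x; rewrite !indicE normr_nat ler_nat.
      by have [|//] := boolP (x \in _ `&` _); rewrite inE => -[_ xr]; rewrite mem_set.
  move=> e e0; move/cvgrPdist_le : D => /(_ e e0)[m _ /(_ m (leqnn m))/=].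
  rewrite sub0r normrN => H.
  exists (\1_(G m `&` cube 0 r)); split; [exact: L1_capcube|exact: PG|].
  apply: le_trans H; apply: le_trans (ler_norm _).
  by rewrite le_eqVlt; apply/orP; left; apply/eqP; apply: eq_Rintegral => x _; rewrite distrC.
Qed.

Lemma approximable_indic (A : set 'rV[R]_n) : measurable A -> L1 (\1_A : _ -> R) ->
  approximable (\1_A : _ -> R).
Proof.
move=> mA LA; apply: approximable_closed => //.
have [_ _ D] : [/\ L1 (\1_A : _ -> R),
   \int[mu]_x \1_(A `&` cube 0 m.+1%:R) x @[m --> \oo] --> \int[mu]_x \1_A x &
   (\int[mu]_x `|\1_(A `&` cube 0 m.+1%:R) x - \1_A x|)%R @[m --> \oo] --> (0:R)].
  apply: (@dominated_cvg_Rintegral _ _ R mu (fun m => \1_(A `&` cube 0 m.+1%:R)) _ (\1_A)) => //.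
  - by move=> m; apply: L1_measurable; apply: L1_capcube.
  - apply: aeW => x; apply: cvg_near_cst.
    have [k _ Hk] := near_infty_natSinv_lt (PosNum (@ltr01 R)).
    exists (Num.trunc `|x|) => // m /= km.
    rewrite indI /= [X in _ * X]indicE mem_set ?mulr1//.
    rewrite /cube /= subr0; apply: (lt_le_trans (truncnS_gt _)).
    by rewrite ler_nat ltnS.
  - move=> m x; rewrite !indicE normr_nat ler_nat.
    by have [|//] := boolP (x \in _ `&` _); rewrite inE => -[xA _]; rewrite mem_set.
move=> e e0; move/cvgrPdist_le : D => /(_ e e0)[m _ /(_ m (leqnn m))/=].
rewrite sub0r normrN => H.
exists (\1_(A `&` cube 0 m.+1%:R)); split; [exact: L1_capcube|exact: approximable_capcube|].
apply: le_trans H; apply: le_trans (ler_norm _).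
by rewrite le_eqVlt; apply/orP; left; apply/eqP; apply: eq_Rintegral => x _; rewrite distrC.
Qed.

Lemma approximable0 : approximable (fun=> 0).
Proof.
apply: (@approximable_ext (\1_set0)); first by move=> x; rewrite indic0.
by apply: (approximable_open ltr01) => //; exact: open0.
Qed.

Lemma L1_approximable f : L1 f -> approximable f.
Proof.
move=> Lf; apply: approximable_closed => // e e0.
have [g [Lg _ /fine_cvgP[gfin /cvgrPdist_le/= gc]]] := approximation_sfun_integrable measurableT Lf.
have [m _ Hm] := gc e e0; have {Hm gc}:= Hm m (leqnn m).
rewrite sub0r normrN => H.
pose gm : 'rV[R]_n -> R := HBSimple.SimpleFun.sort (g m).
have Lgm : L1 gm by exact: Lg.
exists gm; split => //.
  have [S gE] : exists S : seq R, forall x, gm x = \sum_(y <- S) y * \1_(gm @^-1` [set y]) x.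
    exact: sfun_sum_indic (g m).
  apply: (@approximable_ext (fun x => \sum_(y <- S) y * \1_(gm @^-1` [set y]) x)).
    by move=> x; rewrite gE.
  (* Only nonzero values are claimed: the level set of 0 may have infinite measure, and it
     contributes nothing to the sum. *)
  have Ly y : y != 0 -> L1 (\1_(gm @^-1` [set y]) : _ -> R).
    move=> y0; apply: (@L1_le _ _ _ (fun x => `|y|^-1 * `|gm x|)); last exact/L1Z/L1_norm.
      apply: measurable_indic; rewrite -[X in measurable X]setTI.
      exact: (L1_measurable Lgm).
    move=> x; rewrite indicE; have [|_] := boolP (x \in _).
      by rewrite inE /= => ->; rewrite normr1 mulVf// normr_eq0.
    by rewrite normr0 mulr_ge0// invr_ge0.
  have LZ y : L1 (fun x => y * \1_(gm @^-1` [set y]) x).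
    have [->|y0] := eqVneq y 0; last exact/L1Z/Ly.
    rewrite (_ : (fun=> _) = (fun x => 0 * gm x)); first exact: L1Z.
    by apply/funext => x; rewrite !mul0r.
  elim: S {gE} => [|y S IH].
    by apply: approximable_ext approximable0 => x; rewrite big_nil.
  have [y0|y0] := eqVneq y 0.
    by apply: approximable_ext IH => x; rewrite big_cons y0 mul0r add0r.
  apply: (@approximable_ext (fun x => \sum_(j <- S) j * \1_(gm @^-1` [set j]) x + y * \1_(gm @^-1` [set y]) x)).
    by move=> x; rewrite big_cons addrC.
  apply: approximable_comb => //; [by apply: L1_sum|exact: Ly|].
  apply: approximable_indic; last exact: Ly.
  rewrite -[X in measurable X]setTI; exact: (L1_measurable Lgm).
apply: le_trans H; exact: ler_norm.
Qed.

End mollifier.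

(** * Fatou's lemma and dominated convergence for real integrals *)

Section limits.
Context d {T : measurableType d} {R : realType} (mu : {measure set T -> \bar R}).
Local Notation L f := (mu.-integrable setT (EFin \o f)).

Lemma cvg_subseq (u : nat -> R) (l : R) (s : nat -> nat) : (forall k, (k <= s k)%N) ->
  u m @[m --> \oo] --> l -> u (s m) @[m --> \oo] --> l.
Proof.
move=> ks /cvgrPdist_le/= uc; apply/cvgrPdist_le => /= e e0.
have [N _ HN] := uc e e0; exists N => // m /= Nm.
by apply: HN => /=; rewrite (leq_trans Nm).
Qed.

Lemma limn_einf_ub (u : nat -> \bar R) (c : \bar R) : (forall m, (u m <= c)%E) -> (limn_einf u <= c)%E.
Proof.
move=> uc; rewrite limn_einf_lim; apply: lime_le; first exact: is_cvg_einfs.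
apply: nearW => m; apply: le_trans (uc m).
by apply: ereal_inf_lbound; exists m => /=.
Qed.

Lemma fatou_Rintegral (F : nat -> T -> R) (f : T -> R) (B : nat -> R) (b : R) :
  (forall m, L (F m)) -> (forall m x, 0 <= F m x) -> measurable_fun setT f -> (forall x, 0 <= f x) ->
  {ae mu, forall x, F m x @[m --> \oo] --> f x} ->
  (forall m, \int[mu]_x F m x <= B m) -> B m @[m --> \oo] --> b ->
  L f /\ \int[mu]_x f x <= b.
Proof.
move=> LF F0 mf f0 Fc FB Bb.
have mF m : measurable_fun setT (fun x => (F m x)%:E) by exact: (measurable_int mu (LF m)).
have le_e e : 0 < e -> (\int[mu]_x (f x)%:E <= (b + e)%:E)%E.
  move=> e0; have /cvgrPdist_le/= /(_ e e0)[N _ HN] := Bb.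
  have -> : (\int[mu]_x (f x)%:E = \int[mu]_x limn_einf (fun m => (F (m + N)%N x)%:E))%E.
    apply: ge0_ae_eq_integral => //.
    - exact/measurable_EFinP.
    - apply: (eq_measurable_fun (fun x => - limn_esup (fun m => - (F (m + N)%N x)%:E))%E).
        move=> x _; rewrite -limn_einfN; congr limn_einf; apply/funext => m /=.
        by rewrite opprK.
      apply: measurableT_comp => //; apply: measurable_fun_limn_esup => m.
      exact: (measurableT_comp _ (mF (m + N)%N)).
    - by move=> x _; rewrite lee_fin.
    - move=> x _; rewrite limn_einf_lim; apply: lime_ge; first exact: is_cvg_einfs.
      by apply: nearW => m; apply: le_ereal_inf_tmp => _ [k _ <-]; rewrite lee_fin.
    - apply: filterS Fc => x Fx _.
      have c : (F (m + N)%N x)%:E @[m --> \oo] --> (f x)%:E.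
        apply/cvg_EFin; first exact: nearW.
          by apply: (@cvg_subseq (fun m => F m x) (f x) (fun m => m + N)%N) => // k; exact: leq_addr.
      by have [-> _] := cvg_limn_einf_sup c.
  apply: le_trans (fatou mu measurableT (fun m => mF (m + N)%N) (fun m x _ => F0 (m + N)%N x : (0 <= (F (m + N)%N x)%:E)%E)) _.
  apply: limn_einf_ub => m; rewrite EFin_Rintegral// lee_fin (le_trans (FB _))//.
  by have := HN (m + N)%N (leq_addl _ _); rewrite distrC => /(le_trans (ler_norm _)); rewrite lerBlDl.
have Lf : L f.
  by apply: ge0_integrable => //; apply: le_lt_trans (le_e 1 ltr01) _; rewrite ltry.
by split => //; apply/ler_addgt0Pr => e e0; rewrite -lee_fin -EFin_Rintegral// le_e.
Qed.

(** The majorants [D0 m] vary and converge in L^1. Truncating [S m] at the limit majorant [f]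
    restores ordinary dominated convergence, and the truncation costs at most [|D0 m - f|].
    Mollified quantities are dominated in this way, by mollified majorants. *)
Lemma dominated_seq_Rintegral (S D0 : nat -> T -> R) (s f : T -> R) :
  (forall m, L (S m)) -> (forall m, L (D0 m)) -> measurable_fun setT s -> L f ->
  (forall m x, 0 <= S m x <= D0 m x) -> (forall x, 0 <= s x <= f x) ->
  {ae mu, forall x, S m x @[m --> \oo] --> s x} ->
  (\int[mu]_x `|D0 m x - f x|)%R @[m --> \oo] --> (0 : R) ->
  L s /\ \int[mu]_x S m x @[m --> \oo] --> \int[mu]_x s x.
Proof.
move=> LS LD ms Lf SD sf Sc Dc.
pose U m x := Num.min (S m x) (f x).
have f0 x : 0 <= f x by case/andP: (sf x) => /le_trans; exact.
have mU m : measurable_fun setT (U m).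
  by apply: measurable_minr; [exact: (integrable_measurable (LS m))|exact: (integrable_measurable Lf)].
have Ub m x : `|U m x| <= f x.
  rewrite ger0_norm; first by rewrite ge_min lexx orbT.
  by rewrite le_min f0 andbT; case/andP: (SD m x).
have Uc : {ae mu, forall x, U m x @[m --> \oo] --> s x}.
  apply: filterS Sc => x Sx.
  have -> : s x = Num.min (s x) (f x) by rewrite min_l//; case/andP: (sf x).
  apply/cvgrPdist_le => /= e e0; move/cvgrPdist_le: Sx => /(_ e e0); apply: filterS => m.
  apply: le_trans; rewrite /U; case: (leP (s x) (f x)) => h1; case: (leP (S m x) (f x)) => h2 //.
  - by rewrite !ler0_norm; lra.
  - by rewrite !ger0_norm; lra.
  - by rewrite subrr normr0.
have [Ls Ui _] := dominated_cvg_Rintegral mU ms Lf Uc Ub.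
split => //; apply: (squeeze_cvgr (f := fun m => \int[mu]_x U m x)
  (h := fun m => \int[mu]_x U m x + \int[mu]_x `|D0 m x - f x|)) => //; last first.
  by rewrite -[X in _ --> X]addr0; apply: cvgD.
have LU m : L (U m).
  apply: (@le_integrable _ _ _ mu setT measurableT (EFin \o U m) (EFin \o f)) => //.
    exact/measurable_EFinP.
  by move=> x _; rewrite /= lee_fin (le_trans (Ub m x))// ler_norm.
apply: nearW => m; apply/andP; split.
  by apply: Rintegral_le => // x; rewrite ge_min lexx.
have LB : L (fun x => `|D0 m x - f x|).
  have := integrable_abse (integrableB measurableT (LD m) Lf).
  by congr (integrable _ _ _); apply/funext => x.
have LUB : L (fun x => U m x + `|D0 m x - f x|).
  have := integrableD measurableT (LU m) LB.
  by congr (integrable _ _ _); apply/funext => x.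
rewrite -RintegralD//; apply: Rintegral_le => // x.
rewrite /U; have /andP[_ h1] := SD m x; have := ler_norm (D0 m x - f x).
case: (leP (S m x) (f x)) => _; last by lra.
by rewrite lerDl.
Qed.

End limits.

Section cutoff.
Context {R : realType} {n : nat}.
Implicit Types (x z : 'rV[R]_n) (t r : R).
Local Notation mu := (@lebesgue_rV R n).

Lemma ker0_le1 t z : ker 0 t z <= 1.
Proof.
rewrite /ker /bump expr0 mul1r /flat /bump_poly/=; case: ifP => // s0.
by rewrite hornerE mul1r -[leRHS]expR0 ler_expR oppr_le0 invr_ge0 ltW//.
Qed.

Lemma ker0_lower t z : 0 < t -> edot z z <= t ^+ 2 / 2 -> expR (- 2) <= ker 0 t z.
Proof.
move=> t0 h; rewrite /ker /bump expr0 mul1r /flat /bump_poly/=.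
have e12 : edot z z / t ^+ 2 <= 2^-1 by rewrite ler_pdivrMr ?exprn_gt0// mulrC.
have -> : 0 < 1 - edot z z / t ^+ 2 by lra.
by rewrite hornerE mul1r ler_expR lerN2 -[2]invrK lef_pV2 ?posrE//; lra.
Qed.

(** The origin of the ratio [4 * n + 4] by which radii shrink: on this smaller cube
    [|z|^2 <= (r / 2)^2 / 2], so the cutoff [ker 0 (r / 2)] is bounded below there. *)
Lemma ker0_lower_cube r z : 0 < r -> `|z| < r / (4 * n%:R + 4) -> expR (- 2) <= ker 0 (r / 2) z.
Proof.
move=> r0 zr; have N0 : 0 <= n%:R :> R by [].
apply: ker0_lower; first by rewrite divr_gt0.
apply: (le_trans (edot_le_norm z)).
have D0 : 0 < 4 * n%:R + 4 :> R by rewrite ltr_wpDl ?mulr_ge0.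
have z2 : `|z| ^+ 2 <= (r / (4 * n%:R + 4)) ^+ 2.
  by rewrite ler_pXn2r ?nnegrE// ltW// divr_gt0.
apply: (@le_trans _ _ (n%:R * (r / (4 * n%:R + 4)) ^+ 2)); first by rewrite ler_wpM2l.
have i0 : 0 < (4 * n%:R + 4 : R)^-1 by rewrite invr_gt0.
set i := (4 * n%:R + 4 : R)^-1 in i0 *.
have iE : n%:R * i = 4^-1 - i by rewrite /i; field; rewrite gt_eqF.
have -> : n%:R * (r * i) ^+ 2 = (n%:R * i) * i * r ^+ 2 by ring.
rewrite iE expr_div_n; have r2 : 0 < r ^+ 2 by rewrite exprn_gt0.
have ii : (4^-1 - i) * i <= 8^-1 by have := sqr_ge0 (i - 8^-1); rewrite expr2; nra.
have -> : r ^+ 2 / 2 ^+ 2 / 2 = 8^-1 * r ^+ 2 by field.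
by rewrite ler_pM2r.
Qed.

Lemma partial_ker_bounded j t : 0 < t -> exists2 C : R, 0 < C & forall i z, `|partial i (@ker R n j t) z| <= C.
Proof.
move=> t0; have [C C0 HC] := @ker_bounded R n j.+1.
exists (C * (2 / t)) => [|i z]; first by rewrite !mulr_gt0// invr_gt0.
rewrite partial_ker/=; have [tz|tz] := leP t `|z|.
  by rewrite ker_eq0// mul0r normr0 !mulr_ge0// ?invr_ge0 ltW.
rewrite [in leLHS]normrM; apply: ler_pM => //; first exact: HC.
rewrite !normrM ger0_norm// [`|_^-1|]gtr0_norm ?invr_gt0 ?exprn_gt0//.
rewrite ler_pdivrMr ?exprn_gt0// (_ : 2 / t * t ^+ 2 = 2 * t); last by field; rewrite gt_eqF.
by rewrite ler_pM2l// (le_trans (coord_le_norm z i))// ltW.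
Qed.

End cutoff.

(** * Bounds for mollified functions *)

Section regularization.
Context {R : realType} {n : nat}.
Implicit Types (f g w : 'rV[R]_n -> R) (x z : 'rV[R]_n) (t r s : R).
Local Notation mu := (@lebesgue_rV R n).

Lemma L1_conv_moll t f : 0 < t -> L1 f -> L1 (conv (moll t) f).
Proof.
move=> t0 Lf; apply: (L1_conv (@continuous_moll R n t) (supp_in_moll t0)) => // z.
exact: moll_ge0.
Qed.

Lemma conv_moll_abs t f x : 0 < t -> L1 f -> `|conv (moll t) f x| <= conv (moll t) (fun y => `|f y|) x.
Proof.
move=> t0; apply: (conv_abs (@continuous_moll R n t) (supp_in_moll t0)) => z.
exact: moll_ge0.
Qed.

Lemma conv_moll_le t f g x : 0 < t -> L1 f -> L1 g -> (forall y, f y <= g y) ->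
  conv (moll t) f x <= conv (moll t) g x.
Proof.
move=> t0; apply: (conv_le (@continuous_moll R n t) (supp_in_moll t0)) => z.
exact: moll_ge0.
Qed.

Lemma conv_moll_ge0 t f x : 0 < t -> (forall y, 0 <= f y) -> 0 <= conv (moll t) f x.
Proof. by move=> t0; apply: conv_ge0 => z; exact: moll_ge0. Qed.

Lemma conv_moll_jensen t s f x : 0 < t -> 1 <= s -> L1 f -> (forall y, 0 <= f y) ->
  L1 (fun y => f y `^ s) -> conv (moll t) f x `^ s <= conv (moll t) (fun y => f y `^ s) x.
Proof.
move=> t0; apply: (conv_jensen (@continuous_moll R n t) (supp_in_moll t0)).
- by move=> z; exact: moll_ge0.
- exact: Rintegral_moll.
- exact: moll_even.
Qed.

Lemma Rintegral_conv_moll t f : 0 < t -> L1 f -> (forall y, 0 <= f y) ->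
  \int[mu]_x conv (moll t) f x = \int[mu]_x f x.
Proof.
move=> t0 Lf f0; rewrite (Rintegral_conv (@continuous_moll R n t) (supp_in_moll t0))//.
  by rewrite Rintegral_moll// mulr1.
by move=> z; exact: moll_ge0.
Qed.

Lemma powR_abs2 (a : R) : `|a| `^ 2 = a ^+ 2.
Proof. by rewrite powR_mulrn// real_normK// num_real. Qed.

Lemma conv_moll_sqr t f x : 0 < t -> L1 f -> L1 (fun y => f y ^+ 2) ->
  conv (moll t) f x ^+ 2 <= conv (moll t) (fun y => f y ^+ 2) x.
Proof.
move=> t0 Lf Lf2; have L2 : L1 (fun y => `|f y| `^ 2) by under eq_fun do rewrite powR_abs2.
have := conv_moll_jensen x t0 (_ : 1 <= 2) (L1_norm Lf) (fun y => normr_ge0 (f y)) L2.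
rewrite ler1n => /(_ isT).
rewrite -powR_abs2 => H; apply: (@le_trans _ _ (conv (moll t) (fun y => `|f y| `^ 2) x)).
  apply: le_trans H; apply: ler_powR_base => //; exact: conv_moll_abs.
by rewrite le_eqVlt; apply/orP; left; apply/eqP; congr conv; apply/funext => y; rewrite powR_abs2.
Qed.

Lemma ae_moll_subseq f (t : nat -> R) : L1 f -> (forall m, 0 < t m) -> t m @[m --> \oo] --> 0 ->
  exists2 s : nat -> nat, (forall k, (k <= s k)%N) &
    {ae mu, forall x, conv (moll (t (s k))) f x @[k --> \oo] --> f x}.
Proof.
move=> Lf t0 tc; apply: (@L1_cvg_ae_subseq _ _ R mu (fun m => conv (moll (t m)) f) f).
  by move=> m; exact: (L1B (L1_conv_moll (t0 m) Lf) Lf).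
exact: L1_approximable.
Qed.

Lemma conv_cut k f t r x : (forall z, t <= `|z| -> k z = 0) -> `|x| + t <= r ->
  conv k (fun y => \1_(cube 0 r) y * f y) x = conv k f x.
Proof.
move=> sk xr; apply: eq_Rintegral => y _.
have [xy|xy] := ltP `|x - y| t; last by rewrite sk// !mulr0.
rewrite indicE mem_set ?mul1r// /cube/= subr0.
have : `|y| <= `|x| + `|x - y| by rewrite -[y in leLHS](subKr x) (le_trans (ler_normB _ _)).
lra.
Qed.

End regularization.

(** * Weak equations *)

Section weak_equations.
Context {R : realType} {n : nat}.
Implicit Types (f g w : 'rV[R]_n -> R) (G : 'I_n -> 'rV[R]_n -> R) (x z : 'rV[R]_n) (t r s : R).
Local Notation mu := (@lebesgue_rV R n).

(* The distributional gradient and the distributional Poisson equation on the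
   cube of radius [r], tested against the translates of the kernels only. *)
Definition kernel_gradient r w G := forall i t x, 0 < t -> `|x| + t <= r ->
  conv (partial i (ker 1 t)) w x = conv (ker 1 t) (G i) x.

Definition kernel_poisson j r w g := forall t x, 0 < t -> `|x| + t <= r ->
  conv (lap_ker j t) w x = - conv (ker j t) g x.

Lemma cvg_comp_continuous (h : R -> R) (u : nat -> R) (l : R) : continuous h ->
  u m @[m --> \oo] --> l -> h (u m) @[m --> \oo] --> h l.
Proof. by move=> ch uc; exact: (cvg_comp _ _ uc (ch l)). Qed.

Lemma Rintegral_comb (a b : R) f g : L1 f -> L1 g ->
  L1 (fun x => a * f x + b * g x) /\
  \int[mu]_x (a * f x + b * g x) = a * \int[mu]_x f x + b * \int[mu]_x g x.
Proof.
move=> Lf Lg; have La := L1Z a Lf; have Lb := L1Z b Lg; split; first exact: L1D.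
by rewrite RintegralD// !RintegralZl.
Qed.

Lemma cker j t : continuous (@ker R n j t).
Proof. by move=> z; exact: (class_C_cont (class_C_ker 0 j t)). Qed.

Lemma partial_moll i t z : partial i (@moll R n t) z =
  (@moll_mass R n)^-1 * (- 2 * t ^- n) * partial i (ker 1 t) z.
Proof. by rewrite mollE; exact: (partialZ _ i (class_C_ker 1 1 t) (I : setT z)). Qed.

Lemma conv_mollE t f x : 0 < t -> L1 f ->
  conv (moll t) f x = (@moll_mass R n)^-1 * (- 2 * t ^- n) * conv (ker 1 t) f x.
Proof. by move=> t0 Lf; rewrite mollE (conv_scalek (@cker 1 t) (supp_in_ker 1 t0)). Qed.

Lemma class_C_conv_moll m t f : 0 < t -> L1 f -> class_C m setT (conv (moll t) f).
Proof. by move=> t0 Lf; exact: (class_C_conv Lf (class_C_moll m t) (supp_in_moll t0)). Qed.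

Lemma continuous_partial_ker i j t : continuous (partial i (@ker R n j t)).
Proof. by move=> z; exact: (class_C_cont (class_C_partial i (class_C_ker 1 j t))). Qed.

Lemma partial_conv_moll i t w G r x : 0 < t -> L1 w -> L1 (G i) -> kernel_gradient r w G ->
  `|x| + t <= r -> partial i (conv (moll t) w) x = conv (moll t) (G i) x.
Proof.
move=> t0 Lw LG H xr.
rewrite (partial_conv i x Lw (class_C_moll 1 t) (supp_in_moll t0)).
rewrite conv_mollE// -(H i t x t0 xr).
rewrite (_ : partial i (moll t) = (fun z => (@moll_mass R n)^-1 * (- 2 * t ^- n) * partial i (ker 1 t) z)).
  apply: conv_scalek => //; first exact: continuous_partial_ker.
  by apply: supp_in_partial; exact: supp_in_ker.
by apply/funext => z; exact: partial_moll.
Qed.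

Lemma lap_conv_moll t w g r x : 0 < t -> L1 w -> L1 g -> kernel_poisson 1 r w g ->
  `|x| + t <= r -> \sum_i partial i (partial i (conv (moll t) w)) x = - conv (moll t) g x.
Proof.
move=> t0 Lw Lg H xr.
have sk := supp_in_moll t0 : supp_in t (@moll R n t).
have E i : partial i (partial i (conv (moll t) w)) x = conv (partial i (partial i (moll t))) w x.
  rewrite (_ : partial i (conv (moll t) w) = conv (partial i (moll t)) w).
    exact: (partial_conv i x Lw (class_C_partial i (class_C_moll 2 t)) (supp_in_partial i sk)).
  by apply/funext => y; exact: (partial_conv i y Lw (class_C_moll 1 t) sk).
have PP i : partial i (partial i (@moll R n t)) =
    (fun z => (@moll_mass R n)^-1 * (- 2 * t ^- n) * partial i (partial i (ker 1 t)) z).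
  rewrite (_ : partial i (moll t) = (fun z => (@moll_mass R n)^-1 * (- 2 * t ^- n) * partial i (ker 1 t) z)).
    by apply/funext => z; exact: (partialZ _ i (class_C_partial i (class_C_ker 2 1 t)) (I : setT z)).
  by apply/funext => z; exact: partial_moll.
have cpp i : continuous (partial i (partial i (@ker R n 1 t))).
  by move=> z; exact: (class_C_cont (class_C_partial i (class_C_partial i (class_C_ker 2 1 t)))).
have spp i : supp_in t (partial i (partial i (@ker R n 1 t))).
  by do 2 apply: supp_in_partial; exact: supp_in_ker.
transitivity ((@moll_mass R n)^-1 * (- 2 * t ^- n) * conv (lap_ker 1 t) w x).
  under eq_bigr => i _ do rewrite E PP (conv_scalek (cpp i) (spp i))//.
  rewrite -mulr_sumr; congr (_ * _); rewrite /conv -Rintegral_sum.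
    by apply: eq_Rintegral => y _; rewrite lap_kerE mulr_sumr.
  by move=> i; exact: (convL1 (cpp i) (spp i)).
by rewrite H// conv_mollE// mulrN.
Qed.

Variables (kap : R).
Hypotheses (n2 : (2 <= n)%N) (kap1 : 1 < kap) (kapn : kap * (n%:R - 2) <= n%:R).

(** The Sobolev inequality for smooth functions is applied to a cutoff times the mollifications of
    [w], and Fatou's lemma passes to the limit. The kernel tests give exactly the gradient of the
    mollifications on the support of the cutoff. *)
Lemma sobolev_weak r : 0 < r -> exists2 C : R, 0 < C & forall w G,
  L1 w -> L1 (fun x => w x ^+ 2) -> (forall i, L1 (G i)) -> (forall i, L1 (fun x => G i x ^+ 2)) ->
  kernel_gradient r w G ->
  L1 (fun x => \1_(cube 0 (r / (4 * n%:R + 4))) x * `|w x| `^ (2 * kap)) /\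
  \int[mu]_x (\1_(cube 0 (r / (4 * n%:R + 4))) x * `|w x| `^ (2 * kap)) <=
    (C * (\int[mu]_x w x ^+ 2 + \sum_i \int[mu]_x G i x ^+ 2)) `^ kap.
Proof.
move=> r0; have r20 : 0 < r / 2 by rewrite divr_gt0.
have kap0 : 0 < kap by rewrite (lt_trans _ kap1).
have k20 : 0 < 2 * kap by rewrite mulr_gt0.
have [C C0 HS] := sobolev_inequality n2 kap1 kapn r20.
have [C1 C10 HC1] := @partial_ker_bounded R n 0 _ r20.
pose eta : 'rV[R]_n -> R := ker 0 (r / 2).
have eta0 x : 0 <= eta x by exact: ker0_ge0.
have eta1 x : eta x <= 1 by exact: ker0_le1.
have Ceta m : class_C m setT eta by exact: class_C_ker.
pose c := expR (- 2) `^ (2 * kap) : R.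
have c0 : 0 < c by rewrite powR_gt0// expR_gt0.
pose K := 2 + 2 * n%:R * C1 ^+ 2.
have K0 : 0 < K by rewrite /K ltr_wpDr// mulr_ge0 ?sqr_ge0// mulr_ge0.
exists (C * K * c `^ (- kap^-1)); first by rewrite !mulr_gt0// powR_gt0.
move=> w G Lw Lw2 LG LG2 HG.
(* Radii at most [r / 2], so that at the points where [eta] is nonzero, [|x| < r / 2], the kernels
   stay inside the cube of radius [r]. *)
pose t m : R := r / 2 / m.+1%:R.
have t0 m : 0 < t m by rewrite divr_gt0.
have tr m : t m <= r / 2 by rewrite ler_pdivrMr// ler_peMr ?(ltW r20)// ler1n.
have tc : t m @[m --> \oo] --> 0.
  rewrite -[X in _ --> X](mulr0 (r / 2)); apply: cvgMr; exact: cvg_harmonic.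
have [s _ Wc] := ae_moll_subseq Lw t0 tc.
pose W k := conv (moll (t (s k))) w.
pose Z k x := eta x * W k x.
have CW k m : class_C m setT (W k) by exact: class_C_conv_moll.
have CZ k m : class_C m setT (Z k) by exact: (class_CM openT (Ceta m) (CW k m)).
have sZ k : supp_in (r / 2) (Z k).
  by move=> x xr; rewrite /Z /eta ker_eq0 ?mul0r// ltW.
pose E := \int[mu]_x w x ^+ 2 + \sum_i \int[mu]_x G i x ^+ 2.
have E0 : 0 <= E.
  apply: addr_ge0; first by apply: Rintegral_ge0 => x _; exact: sqr_ge0.
  by apply: sumr_ge0 => i _; apply: Rintegral_ge0 => x _; exact: sqr_ge0.
have LcG k i : L1 (conv (moll (t (s k))) (fun x => G i x ^+ 2)) by exact: L1_conv_moll.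
have Lcw k : L1 (conv (moll (t (s k))) (fun x => w x ^+ 2)) by exact: L1_conv_moll.
(* By Jensen the squares of the mollified functions are at most the mollified squares, whose
   integrals equal those of [G i ^+ 2] and [w ^+ 2]: the bound is uniform in [k]. *)
have dZ k x i : partial i (Z k) x ^+ 2 <= 2 * conv (moll (t (s k))) (fun x => G i x ^+ 2) x +
    2 * C1 ^+ 2 * conv (moll (t (s k))) (fun x => w x ^+ 2) x.
  have g0 : 0 <= conv (moll (t (s k))) (fun x => G i x ^+ 2) x.
    by apply: conv_moll_ge0 => // y; exact: sqr_ge0.
  have w0 : 0 <= conv (moll (t (s k))) (fun x => w x ^+ 2) x.
    by apply: conv_moll_ge0 => // y; exact: sqr_ge0.
  rewrite (partialM i (Ceta 1%N) (CW k 1%N))//.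
  have [xr|xr] := leP (r / 2) `|x|.
    rewrite /eta ker_eq0// partial_ker/= ker_eq0// !mul0r addr0 expr0n/=.
    by rewrite addr_ge0// mulr_ge0// mulr_ge0// sqr_ge0.
  rewrite (partial_conv_moll (t0 _) Lw (LG i) HG); last by have := tr (s k); lra.
  have A := conv_moll_sqr x (t0 (s k)) (LG i) (LG2 i).
  have B := conv_moll_sqr x (t0 (s k)) Lw Lw2.
  set a := conv _ (G i) x in A *; rewrite -/(W k x) in B; set b := W k x in B *.
  set d := partial i eta x.
  have d2 : d ^+ 2 <= C1 ^+ 2.
    by rewrite -[d ^+ 2]real_normK ?num_real// ler_pXn2r ?nnegrE ?(ltW C10)//; exact: HC1.
  have e2 : eta x ^+ 2 <= 1 by rewrite expr_le1.
  have ab : (eta x * a + d * b) ^+ 2 <= 2 * (eta x ^+ 2 * a ^+ 2) + 2 * (d ^+ 2 * b ^+ 2).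
    by have := sqr_ge0 (eta x * a - d * b); rewrite !expr2; lra.
  have h1 := ler_pM (sqr_ge0 (eta x)) (sqr_ge0 a) e2 A.
  have h2 := ler_pM (sqr_ge0 d) (sqr_ge0 b) d2 B.
  by apply: (le_trans ab); rewrite -[2 * _ ^+ 2 * _]mulrA; lra.
have LdZ k i : L1 (fun x => partial i (Z k) x ^+ 2).
  have cd : continuous (partial i (Z k)) by move=> x; exact: (class_C_cont (class_C_partial i (CZ k 1%N))).
  apply: (@L1_continuous _ _ (r / 2)).
    by move=> x; rewrite /continuous_at; under eq_fun do rewrite expr2; rewrite expr2; apply: continuousM; exact: cd.
  by move=> x xr; rewrite (supp_in_partial i (sZ k))// expr0n.
have grad k : \int[mu]_x (\sum_i partial i (Z k) x ^+ 2) <= K * E.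
  rewrite (Rintegral_sum _ (LdZ k)).
  have S1 i : \int[mu]_x (partial i (Z k) x ^+ 2) <= 2 * \int[mu]_x G i x ^+ 2 + 2 * C1 ^+ 2 * \int[mu]_x w x ^+ 2.
    rewrite -(Rintegral_conv_moll (t0 (s k)) (LG2 i)); last by move=> y; exact: sqr_ge0.
    rewrite -(Rintegral_conv_moll (t0 (s k)) Lw2); last by move=> y; exact: sqr_ge0.
    have [LL <-] := Rintegral_comb 2 (2 * C1 ^+ 2) (LcG k i) (Lcw k).
    by apply: (Rintegral_le (LdZ k i) LL) => x; exact: dZ.
  apply: (le_trans (ler_sum _ (fun i _ => S1 i))).
  rewrite big_split/= -mulr_sumr sumr_const card_ord -mulr_natl /K /E.
  set x1 := \sum_i _; set x2 := \int[mu]_x _.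
  have x10 : 0 <= x1 by apply: sumr_ge0 => i _; apply: Rintegral_ge0 => x _; exact: sqr_ge0.
  have x20 : 0 <= x2 by apply: Rintegral_ge0 => x _; exact: sqr_ge0.
  have N0 : 0 <= n%:R * C1 ^+ 2 by rewrite mulr_ge0// sqr_ge0.
  by rewrite -!mulrA; nra.
pose F k x := `|Z k x| `^ (2 * kap).
have LF k : L1 (F k).
  apply: (@L1_continuous _ _ (r / 2)).
    move=> x; apply: (@continuous_comp _ _ _ (Z k) (fun s : R => `|s| `^ (2 * kap))).
      exact: (class_C_cont (CZ k 0%N)).
    exact: powR_abs_continuous.
  by move=> x xr; rewrite /F (sZ k)// normr0 powR0// gt_eqF.
pose f x := `|eta x * w x| `^ (2 * kap).
have mw := L1_measurable Lw.
have meta : measurable_fun setT eta by apply: continuousT_measurable_rV; exact: cker.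
have mf : measurable_fun setT f.
  apply: (measurableT_comp (measurable_powR _)); apply: measurableT_comp => //.
  exact: measurable_funM.
have Fc : {ae mu, forall x, F k x @[k --> \oo] --> f x}.
  apply: filterS Wc => x Wx.
  apply: (cvg_comp_continuous (powR_abs_continuous k20)).
  by apply: cvgMr; exact: Wx.
have FB k : \int[mu]_x F k x <= (C * (K * E)) `^ kap.
  have X0 : 0 <= \int[mu]_x F k x by apply: Rintegral_ge0 => x _; exact: powR_ge0.
  have := HS (Z k) (CZ k 1%N) (sZ k); rewrite -/(F k) => H.
  have H1 : (\int[mu]_x F k x) `^ kap^-1 <= C * (K * E).
    by apply: (le_trans H); rewrite ler_pM2l.
  have := ler_powR_base (ltW kap0) (powR_ge0 _ _) H1.
  by rewrite -powRrM mulVf ?gt_eqF// powRr1.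
have [Lf If] := fatou_Rintegral LF (fun k x => powR_ge0 _ _) mf (fun x => powR_ge0 _ _) Fc FB (cvg_cst _).
have le1 x : c * (\1_(cube 0 (r / (4 * n%:R + 4))) x * `|w x| `^ (2 * kap)) <= f x.
  rewrite indicE; have [|_] := boolP (x \in _); last by rewrite mul0r mulr0 powR_ge0.
  rewrite inE /cube/= subr0 => xr; rewrite mul1r /c -powRM ?expR_ge0//.
  apply: ler_powR_base; rewrite ?(ltW k20) ?mulr_ge0 ?expR_ge0//.
  by rewrite normrM ler_wpM2r// ger0_norm// ker0_lower_cube.
have m1 : measurable_fun setT (fun x => \1_(cube 0 (r / (4 * n%:R + 4))) x * `|w x| `^ (2 * kap)).
  apply: measurable_funM; first exact: measurable_indic (measurable_cube _ _).
  by apply: (measurableT_comp (measurable_powR _)); exact: measurableT_comp.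
have L2 : L1 (fun x => \1_(cube 0 (r / (4 * n%:R + 4))) x * `|w x| `^ (2 * kap)).
  apply: (@L1_le _ _ _ (fun x => c^-1 * f x)) => //; last exact: L1Z.
  move=> x; rewrite ger0_norm; last by rewrite mulr_ge0 ?powR_ge0// indicE.
  by rewrite ler_pdivlMl.
split => //.
have : c * \int[mu]_x (\1_(cube 0 (r / (4 * n%:R + 4))) x * `|w x| `^ (2 * kap)) <= (C * (K * E)) `^ kap.
  apply: le_trans If; rewrite -RintegralZl//; apply: Rintegral_le => //; exact: L1Z.
rewrite -ler_pdivlMl// => /le_trans; apply.
rewrite le_eqVlt; apply/orP; left; apply/eqP.
rewrite -/E (_ : C * K * c `^ (- kap^-1) * E = c `^ (- kap^-1) * (C * (K * E))); last by ring.
rewrite [in RHS]powRM ?powR_ge0//; last by rewrite !mulr_ge0// ltW.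
by rewrite -powRrM mulNr mulVf ?gt_eqF// powRN powRr1 ?(ltW c0).
Qed.

End weak_equations.

(** * The Brezis-Kato estimate *)

Section truncated_weight.
Context {R : realType}.
Implicit Types (s t a L : R).

Lemma powR_interp (y a s b : R) : 0 <= y -> 0 < a -> a <= s -> s <= b -> y `^ s <= y `^ a + y `^ b.
Proof.
move=> y0 a0 as_ sb; have s0 : 0 < s by exact: lt_le_trans as_.
have [->|yn0] := eqVneq y 0; first by rewrite powR0 ?gt_eqF// addr_ge0// powR_ge0.
have [y1|y1] := leP y 1; last by rewrite ler_wpDl ?powR_ge0// ler_powR// ltW.
rewrite ler_wpDr ?powR_ge0//.
have -> : s = a + (s - a) by rewrite subrKC.
rewrite powRD ?yn0 ?implybT// ler_piMr ?powR_ge0//.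
apply: (@le_trans _ _ (1 `^ (s - a))); last by rewrite powR1.
by apply: ler_powR_base => //; rewrite subr_ge0.
Qed.

(** The weight of the Brezis-Kato test function. Truncation at [L] makes it bounded, so that the
    quantities to be absorbed are finite beforehand, while the comparison constants, such as the
    doubling constant [2 ^ a], do not depend on [L]. *)
Lemma truncated_weight a L : 0 < a -> 0 < L ->
  let h := fun s => (Num.min `|s| L) `^ a in
  exists H F : R -> R,
  [/\ continuous h,
      (forall s : R, is_derive s 1 H (h s)),
      (forall s : R, is_derive s 1 F (h s ^+ 2)) &
      [/\ forall s, `|H s| <= `|s| * h s,
          forall s, `|s| * h s <= 2 * 2 `^ a * `|H s| &
          forall s, `|F s| <= h s * `|H s|]].
Proof.
move=> a0 L0 h.
have m0 s : 0 <= Num.min `|s| L by rewrite le_min normr_ge0 ltW.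
have ch : continuous h.
  have -> : h = (fun s => `|s| `^ a) \o (fun s => Num.min `|s| L).
    by apply/funext => s /=; rewrite ger0_norm.
  move=> s; apply: continuous_comp; last exact: powR_abs_continuous.
  apply/cvgrPdist_le => /= e e0.
  have /cvgrPdist_le/(_ e e0) := @norm_continuous _ R s.
  apply: filterS => y; apply: le_trans.
  case: (leP `|s| L) => h1; case: (leP `|y| L) => h2 //.
  - have s1 : `|s| - L <= 0 by lra.
    have s2 : `|s| - `|y| <= 0 by lra.
    by rewrite (ler0_norm s1) (ler0_norm s2); lra.
  - have s1 : 0 <= L - `|y| by lra.
    have s2 : 0 <= `|s| - `|y| by lra.
    by rewrite (ger0_norm s1) (ger0_norm s2); lra.
  - by rewrite subrr normr0.
have ch2 : continuous (fun s => h s ^+ 2).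
  by move=> s; rewrite /continuous_at; under eq_fun do rewrite expr2; rewrite expr2; apply: continuousM; exact: ch.
have [H H0 Hd] := antiderivative ch; have [F F0 Fd] := antiderivative ch2.
have he s : h (- s) = h s by rewrite /h normrN.
have h0 s : 0 <= h s by exact: powR_ge0.
have hi s t : 0 <= s -> s <= t -> h s <= h t.
  move=> s0 st; apply: ler_powR_base => //; first exact: ltW.
  have := ger0_norm (le_trans s0 st) => ->; rewrite ger0_norm//.
  by rewrite le_min !ge_min lexx st /= orbT.
have hd s : 0 <= s -> h s <= 2 `^ a * h (s / 2).
  move=> s0; rewrite /h -powRM//; apply: ler_powR_base => //; first exact: ltW.
  rewrite [`|s / 2|]normrM (@ger0_norm _ 2^-1) ?invr_ge0//.
  case: (leP (`|s| / 2) L) => h1; rewrite ge_min.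
    by rewrite mulrCA divff// mulr1 lexx.
  by apply/orP; right; lra.
exists H, F; split => //; split.
- exact: (even_weight_le he h0 hi H0 Hd).
- exact: (even_weight_ge he h0 (powR_ge0 _ _) hi hd H0 Hd).
- exact: (even_weight_sq he h0 hi H0 Hd F0 Fd).
Qed.

End truncated_weight.

Section continuity_products.
Context {R : realType} {n : nat}.
Implicit Types (f g : 'rV[R]_n -> R).

Lemma contM f g : continuous f -> continuous g -> continuous (fun x => f x * g x).
Proof. by move=> cf cg x; apply: continuousM; [exact: cf|exact: cg]. Qed.

Lemma contD f g : continuous f -> continuous g -> continuous (fun x => f x + g x).
Proof. by move=> cf cg x; apply: continuousD; [exact: cf|exact: cg]. Qed.

Lemma contX f m : continuous f -> continuous (fun x => f x ^+ m).
Proof.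
move=> cf; elim: m => [|m IH] x.
  by under eq_fun do rewrite expr0; exact: cst_continuous.
by under eq_fun do rewrite exprS; exact: (contM cf IH).
Qed.

Lemma cont_norm f : continuous f -> continuous (fun x => `|f x|).
Proof. by move=> cf x; apply: continuous_comp; [exact: cf|exact: norm_continuous]. Qed.

Lemma cont_comp (h : R -> R) f : continuous h -> continuous f -> continuous (h \o f).
Proof. by move=> ch cf x; apply: continuous_comp; [exact: cf|exact: ch]. Qed.

Lemma class_CX k m (U : set 'rV[R]_n) f : open U -> class_C k U f -> class_C k U (fun x => f x ^+ m).
Proof.
move=> oU Cf; elim: m => [|m IH].
  by apply: (class_C_ext oU _ (class_C_cst k 1 oU)) => x _; rewrite expr0.
by apply: (class_C_ext oU _ (class_CM oU Cf IH)) => x _; rewrite exprS.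
Qed.

Lemma is_derive_pow (V : normedModType R) (f : V -> R) (x v : V) (df : R) m : is_derive x v f df ->
  is_derive x v (fun y => f y ^+ m.+1) (m.+1%:R * f x ^+ m * df).
Proof.
move=> D; elim: m => [|m IH].
  by rewrite expr0 !mul1r; apply: is_derive_ext D => y; rewrite expr1.
have := is_derive_mul D IH.
rewrite (_ : f x * _ + _ = m.+2%:R * f x ^+ m.+1 * df).
  by apply: is_derive_ext => y; rewrite -exprS.
by rewrite [RHS]mulrAC -natr1 mulrDl !exprS; ring.
Qed.

End continuity_products.

(** * A Caccioppoli inequality for smooth solutions *)

Section caccioppoli.
Context {R : realType} {n : nat}.
Implicit Types (W g : 'rV[R]_n -> R) (x z : 'rV[R]_n).
Local Notation mu := (@lebesgue_rV R n).
Variables (kap r : R) (m : nat).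
Hypotheses (n2 : (2 <= n)%N) (kap1 : 1 < kap) (kapn : kap * (n%:R - 2) <= n%:R) (r0 : 0 < r).

Let eta : 'rV[R]_n -> R := ker 0 (r / 2).

(** With [u = e h a] and [v = M d H], the hypothesis on [F] bounds the cross term by [|u| |v|]; what
    remains is [3 |u|^2 - 10 |u| |v| + 9 |v|^2 >= 0], true because [100 < 108]. This fixes the
    constants 4 and 10. *)
Lemma caccioppoli_pointwise (k : nat) (e d a H F h M : R) : `|F| <= h * `|H| -> 0 <= h -> 0 <= M ->
  (e ^+ k.+1 * (h * a) + M * e ^+ k * d * H) ^+ 2 <=
  4 * (a * (e ^+ (k.+1 + k.+1) * (h ^+ 2 * a) + 2 * M * e ^+ (k.+1 + k) * d * F)) +
  10 * M ^+ 2 * d ^+ 2 * ((e ^+ k) ^+ 2 * H ^+ 2).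
Proof.
move=> FH h0 M0; set P := e ^+ k; rewrite !exprD (exprS e k) -/P.
set u := e * h * a; set v := M * d * H.
have uF : - (`|u| * `|v|) <= M * e * d * F * a.
  have : `|M * e * d * F * a| <= `|u| * `|v|.
    have -> : `|M * e * d * F * a| = M * `|e| * `|d| * `|a| * `|F| by rewrite !normrM (ger0_norm M0); ring.
    have -> : `|u| * `|v| = M * `|e| * `|d| * `|a| * (h * `|H|).
      by rewrite !normrM (ger0_norm M0) (ger0_norm h0); ring.
    by apply: ler_wpM2l; rewrite ?mulr_ge0.
  by rewrite ler_norml => /andP[].
have u2 := real_normK (num_real u); have v2 := real_normK (num_real v).
have uv : u * v <= `|u| * `|v| by rewrite -normrM ler_norm.
have key : (u + v) ^+ 2 <= 4 * (u ^+ 2 + 2 * (M * e * d * F * a)) + 10 * v ^+ 2.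
  have := sqr_ge0 (`|u| * 5 - `|v| * 9 * 2^-1); have := sqr_ge0 (`|u| - `|v| * (5 / 3)).
  rewrite sqrrD; rewrite !sqrrB => q1 q2.
  by move: uF uv; set X := M * e * d * F * a; nra.
have K' := ler_wpM2l (sqr_ge0 P) key.
rewrite -subr_ge0 in K'; rewrite -subr_ge0; apply: le_trans K' _.
rewrite le_eqVlt; apply/orP; left; apply/eqP.
by rewrite /u /v; ring.
Qed.

(** The equation is tested with [Phi = eta^(2m+4) F(W)] and the Sobolev inequality is applied to
    [Z = eta^(m+2) H(W)]. Since [H' = h] and [F' = h^2], the square of the gradient of [Z] is
    controlled by the product of the gradients of [W] and [Phi], up to a cutoff term with two powers
    of [eta] less. *)
Lemma caccioppoli : exists2 C : R, 0 < C & forall W g (H F h : R -> R),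
  class_C 2 setT W -> continuous g -> continuous h ->
  (forall x, `|x| < r / 2 -> \sum_i partial i (partial i W) x = - g x) ->
  (forall s : R, is_derive s 1 H (h s)) -> (forall s : R, is_derive s 1 F (h s ^+ 2)) ->
  (forall s, 0 <= h s) -> (forall s, `|F s| <= h s * `|H s|) ->
  [/\ L1 (fun x => `|eta x ^+ m.+2 * H (W x)| `^ (2 * kap)),
      L1 (fun x => eta x ^+ (m.+2 + m.+2) * (`|g x| * `|F (W x)|) + (eta x ^+ m.+1) ^+ 2 * H (W x) ^+ 2) &
      \int[mu]_x `|eta x ^+ m.+2 * H (W x)| `^ (2 * kap) <=
      (C * \int[mu]_x (eta x ^+ (m.+2 + m.+2) * (`|g x| * `|F (W x)|) +
          (eta x ^+ m.+1) ^+ 2 * H (W x) ^+ 2)) `^ kap].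
Proof.
have r20 : 0 < r / 2 by rewrite divr_gt0.
have kap0 : 0 < kap by rewrite (lt_trans _ kap1).
have k20 : 0 < 2 * kap by rewrite mulr_gt0.
have [C C0 HS] := sobolev_inequality n2 kap1 kapn r20.
have [C1 C10 HC1] := @partial_ker_bounded R n 0 _ r20.
pose M : R := m.+2%:R.
pose K : R := 4 + 10 * M ^+ 2 * C1 ^+ 2 * n%:R.
have K4 : 4 <= K by rewrite /K lerDl mulr_ge0// mulr_ge0 ?sqr_ge0// mulr_ge0 ?sqr_ge0.
exists (C * K); first by rewrite mulr_gt0// (lt_le_trans _ K4).
move=> W g H F h CW cg ch HW Hd Fd h0 FH.
have CW1 := class_CW CW.
have cW : continuous W by move=> x; exact: (class_C_cont CW1).
have cH : continuous H by move=> s; exact: is_derive_cont (Hd s).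
have cF : continuous F by move=> s; exact: is_derive_cont (Fd s).
have ch2 : continuous (fun s => h s ^+ 2).
  by move=> s; rewrite /continuous_at; under eq_fun do rewrite expr2; rewrite expr2; apply: continuousM; exact: ch.
have ceta : continuous eta by exact: cker.
have eta0 x : 0 <= eta x by exact: ker0_ge0.
have eta_0 x : r / 2 <= `|x| -> eta x = 0 by move=> xr; rewrite /eta ker_eq0.
have Ceta : class_C 1 setT eta by exact: class_C_ker.
have cHW : continuous (H \o W) by exact: cont_comp.
have cFW : continuous (F \o W) by exact: cont_comp.
have CHW : class_C 1 setT (H \o W) by exact: (class_C_powR_comp ch Hd).
have CFW : class_C 1 setT (F \o W) by exact: (class_C_powR_comp ch2 Fd).
pose Z x := eta x ^+ m.+2 * H (W x).
pose Phi x := eta x ^+ (m.+2 + m.+2) * F (W x).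
have CZ : class_C 1 setT Z by exact: (class_CM openT (class_CX m.+2 openT Ceta) CHW).
have CPhi : class_C 1 setT Phi by exact: (class_CM openT (class_CX (m.+2 + m.+2) openT Ceta) CFW).
have sZ : supp_in (r / 2) Z by move=> x xr; rewrite /Z eta_0 ?expr0n ?mul0r// ltW.
have sPhi : supp_in (r / 2) Phi by move=> x xr; rewrite /Phi eta_0 ?addSn ?expr0n ?mul0r// ltW.
have deta i x : is_derive x (delta_mx ord0 i) eta (partial i eta x) by exact: class_C_derive Ceta I.
have dHW i x : is_derive x (delta_mx ord0 i) (H \o W) (h (W x) * partial i W x).
  exact: (is_derive_comp1 (Hd (W x)) (class_C_derive i CW1 I)).
have dFW i x : is_derive x (delta_mx ord0 i) (F \o W) (h (W x) ^+ 2 * partial i W x).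
  exact: (is_derive_comp1 (Fd (W x)) (class_C_derive i CW1 I)).
have dZ i x : partial i Z x = eta x ^+ m.+2 * (h (W x) * partial i W x) +
    M * eta x ^+ m.+1 * partial i eta x * H (W x).
  by apply: partial_is_derive; exact: (is_derive_mul (is_derive_pow m.+1 (deta i x)) (dHW i x)).
have dPhi i x : partial i Phi x = eta x ^+ (m.+2 + m.+2) * (h (W x) ^+ 2 * partial i W x) +
    2 * M * eta x ^+ (m.+2 + m.+1) * partial i eta x * F (W x).
  have -> : 2 * M * eta x ^+ (m.+2 + m.+1) = (m.+1 + m.+1).+2%:R * eta x ^+ (m.+1 + m.+1).+1.
    by rewrite addSn; congr (_ * _); rewrite /M -!natr1 natrD -!natr1; ring.
  have := is_derive_mul (is_derive_pow (m.+1 + m.+1).+1 (deta i x)) (dFW i x).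
  by rewrite -addSn -addnS; exact: partial_is_derive.
pose P x := (eta x ^+ m.+1) ^+ 2 * H (W x) ^+ 2.
pose Q x := eta x ^+ (m.+2 + m.+2) * (`|g x| * `|F (W x)|).
have LP : L1 P.
  apply: (@L1_continuous _ _ (r / 2)).
    apply: contM; first by apply: contX; exact: contX.
    by apply: contX; exact: cHW.
  by move=> x xr; rewrite /P eta_0 ?expr0n ?mul0r// ltW.
have LQ : L1 Q.
  apply: (@L1_continuous _ _ (r / 2)).
    apply: contM; first exact: contX.
    by apply: contM; apply: cont_norm => //; exact: cFW.
  by move=> x xr; rewrite /Q eta_0 ?addSn ?expr0n ?mul0r// ltW.
have P0 x : 0 <= P x by rewrite mulr_ge0// sqr_ge0.
have Q0 x : 0 <= Q x by rewrite mulr_ge0 ?exprn_ge0// mulr_ge0.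
have LPQ := L1D LQ LP.
have LF : L1 (fun x => `|Z x| `^ (2 * kap)).
  apply: (@L1_continuous _ _ (r / 2)).
    by apply: (@cont_comp _ _ (fun s : R => `|s| `^ (2 * kap)) Z); [exact: powR_abs_continuous|move=> x; exact: (class_C_cont CZ)].
  by move=> x xr; rewrite sZ// normr0 powR0// gt_eqF.
split => //.
have cdW i : continuous (partial i W) by move=> x; exact: (class_C_cont (class_C_partial i CW)).
have cddW i : continuous (partial i (partial i W)).
  by move=> x; exact: (class_C_cont (class_C_partial i (class_C_partial i CW))).
have cdPhi i : continuous (partial i Phi) by move=> x; exact: (class_C_cont (class_C_partial i CPhi)).
have cPhi : continuous Phi by move=> x; exact: (class_C_cont CPhi).
have LI i : L1 (fun x => partial i W x * partial i Phi x).
  apply: (@L1_continuous _ _ (r / 2)); first exact: contM.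
  by move=> x xr; rewrite (supp_in_partial i sPhi)// mulr0.
have LJ i : L1 (fun x => partial i (partial i W) x * Phi x).
  apply: (@L1_continuous _ _ (r / 2)); first exact: contM.
  by move=> x xr; rewrite sPhi// mulr0.
have LdZ i : L1 (fun x => partial i Z x ^+ 2).
  apply: (@L1_continuous _ _ (r / 2)).
    by apply: contX => x; exact: (class_C_cont (class_C_partial i CZ)).
  by move=> x xr; rewrite (supp_in_partial i sZ)// expr0n.
have M0 : 0 <= M by [].
have pt i x : partial i Z x ^+ 2 <= 4 * (partial i W x * partial i Phi x) + (10 * M ^+ 2 * C1 ^+ 2) * P x.
  rewrite dZ dPhi; apply: (le_trans (caccioppoli_pointwise _ _ _ _ (FH (W x)) (h0 (W x)) M0)).
  rewrite lerD2l; apply: (ler_wpM2r (P0 x)); apply: ler_wpM2l; first by rewrite mulr_ge0// sqr_ge0.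
  by rewrite -[leLHS]real_normK ?num_real// ler_pXn2r ?nnegrE ?(ltW C10)//; exact: HC1.
have grad : \int[mu]_x (\sum_i partial i Z x ^+ 2) <= K * \int[mu]_x (Q x + P x).
  rewrite (Rintegral_sum _ LdZ).
  have S1 i : \int[mu]_x partial i Z x ^+ 2 <= 4 * \int[mu]_x (partial i W x * partial i Phi x) +
      (10 * M ^+ 2 * C1 ^+ 2) * \int[mu]_x P x.
    have [LL <-] := Rintegral_comb 4 (10 * M ^+ 2 * C1 ^+ 2) (LI i) LP.
    by apply: (Rintegral_le (LdZ i) LL) => x; exact: pt.
  apply: (le_trans (ler_sum _ (fun i _ => S1 i))).
  rewrite big_split/= -mulr_sumr sumr_const card_ord -[_ *+ n]mulr_natr.
  (* Integration by parts moves the derivative of [Phi] onto [W]; the equation then holds wherever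
     [Phi] is nonzero. *)
  have IP : \sum_i \int[mu]_x (partial i W x * partial i Phi x) <= \int[mu]_x Q x.
    have -> : \sum_i \int[mu]_x (partial i W x * partial i Phi x) =
        - \int[mu]_x (\sum_i partial i (partial i W) x * Phi x).
      rewrite (Rintegral_sum _ LJ) -sumrN; apply: eq_bigr => i _.
      by rewrite (integration_by_parts_rV i (class_C_partial i CW) CPhi sPhi) opprK.
    have LS : L1 (fun x => \sum_i partial i (partial i W) x * Phi x) by exact: L1_sum.
    rewrite -mulN1r -RintegralZl//; apply: (Rintegral_le (L1Z (-1) LS) LQ).
    move=> x; have [xr|xr] := ltP `|x| (r / 2); last first.
      by rewrite big1 ?mulr0// => i _; rewrite /Phi eta_0// addSn expr0n mul0r mulr0.
    rewrite -mulr_suml HW// mulN1r -mulNr opprK /Phi /Q mulrCA ler_wpM2l ?exprn_ge0//.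
    by rewrite -normrM ler_norm.
  rewrite RintegralD// /K.
  have IQ0 : 0 <= \int[mu]_x Q x by apply: Rintegral_ge0.
  have IP0 : 0 <= \int[mu]_x P x by apply: Rintegral_ge0.
  have c0 : 0 <= 10 * M ^+ 2 * C1 ^+ 2 * n%:R by move: K4; rewrite /K lerDl.
  by rewrite mulrAC; nra.
have X0 : 0 <= \int[mu]_x `|Z x| `^ (2 * kap) by apply: Rintegral_ge0 => x _; exact: powR_ge0.
have H1 : (\int[mu]_x `|Z x| `^ (2 * kap)) `^ kap^-1 <= C * K * \int[mu]_x (Q x + P x).
  by apply: (le_trans (HS Z CZ sZ)); rewrite -mulrA ler_pM2l.
have := ler_powR_base (ltW kap0) (powR_ge0 _ _) H1.
by rewrite -powRrM mulVf ?gt_eqF// powRr1.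
Qed.

End caccioppoli.

Lemma absorb_algebra (R : realType) (E P H2 M c v : R) :
  E * (c * (1 + M) * H2) <= P * (c * (1 + M) * H2) ->
  E * (c * (1 + M + v) * H2) + P * H2 <= (1 + c * (1 + M)) * (P * H2) + c * (v * (E * H2)).
Proof. by lra. Qed.

Lemma absorb_half (R : realType) (Y C c J q e : R) : Y <= C * (c * J + q * (e * Y)) ->
  2 * C * q * e * Y <= 1 * Y -> Y <= 2 * C * c * J.
Proof. by rewrite mul1r; lra. Qed.

(** Divide by [Y ^ al], which leaves the power [1 / (kap * m)] of [Y], and raise to the power
    [kap * m]. *)
Lemma absorb_power (R : realType) (Y K X kap m al be q : R) : 0 <= Y -> 0 <= K -> 0 <= X ->
  0 < kap -> 0 < m -> kap^-1 = (kap * m)^-1 + al -> be * (kap * m) = q ->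
  Y `^ kap^-1 <= K * (Y `^ al * X `^ be) -> Y <= K `^ (kap * m) * X `^ q.
Proof.
move=> Y0 K0 X0 k0 m0 km bq YK.
have [->|Yn0] := eqVneq Y 0; first by rewrite mulr_ge0 ?powR_ge0.
have Yp : 0 < Y by rewrite lt0r Yn0.
have km0 : 0 < kap * m by exact: mulr_gt0.
have H : Y `^ (kap * m)^-1 <= K * X `^ be.
  have Ya : 0 < Y `^ al by exact: powR_gt0.
  rewrite -(ler_pM2l Ya); move: YK; rewrite km powRD; last by rewrite Yn0 implybT.
  by rewrite mulrC [X in _ <= X -> _]mulrCA.
have := ler_powR_base (ltW km0) (powR_ge0 _ _) H.
rewrite -powRrM mulVf ?gt_eqF// powRr1// => /le_trans; apply.
by rewrite powRM ?powR_ge0// -powRrM bq.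
Qed.

Lemma le_cancel (R : realType) (c x y k z : R) : 0 < c -> c * x <= y -> y <= k * z -> x <= c^-1 * k * z.
Proof. by move=> c0 cx yk; rewrite -mulrA ler_pdivlMl// (le_trans cx). Qed.

Section brezis_kato.
Context {R : realType} {n : nat}.
Implicit Types (w g : 'rV[R]_n -> R) (x z : 'rV[R]_n).
Local Notation mu := (@lebesgue_rV R n).
Variables (kap r A p : R) (m : nat).
Hypotheses (n2 : (2 <= n)%N) (kap1 : 1 < kap) (kapn : kap * (n%:R - 2) <= n%:R) (r0 : 0 < r).
Hypotheses (A0 : 0 <= A) (p1 : 1 < p) (pkap : p + 1 <= 2 * kap).

Let eta : 'rV[R]_n -> R := ker 0 (r / 2).
Let eta0 x : 0 <= eta x. Proof. exact: ker0_ge0. Qed.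
Let eta1 x : eta x <= 1. Proof. exact: ker0_le1. Qed.
Let ceta : continuous eta. Proof. exact: cker. Qed.
Let kap0 : 0 < kap. Proof. by rewrite (lt_trans _ kap1). Qed.
Let k20 : 0 < 2 * kap. Proof. by rewrite mulr_gt0. Qed.
Let p0 : 0 < p. Proof. by rewrite (lt_trans _ p1). Qed.
Let pp0 : 0 < p + 1. Proof. by rewrite addr_gt0. Qed.

Lemma Rintegral_scale (c : R) w : L1 w -> \int[mu]_x (c * w x) = c * \int[mu]_x w x.
Proof. by move=> Lw; rewrite RintegralZl. Qed.

Lemma measurable_abs_powR w (s : R) : measurable_fun setT w -> measurable_fun setT (fun x => `|w x| `^ s).
Proof. by move=> mw; apply: (measurableT_comp (measurable_powR _)); exact: measurableT_comp. Qed.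

Lemma L1_powR_interp w (s q : R) : L1 w -> L1 (fun x => `|w x| `^ q) -> 1 <= s -> s <= q ->
  L1 (fun x => `|w x| `^ s).
Proof.
move=> Lw Lq s1 sq; apply: L1_le (L1D (L1_norm Lw) Lq).
  exact: measurable_abs_powR (L1_measurable Lw).
move=> x; rewrite ger0_norm ?powR_ge0//.
have := powR_interp (normr_ge0 (w x)) (@ltr01 R) s1 sq.
by rewrite powRr1.
Qed.

Lemma conv_moll_comb t (a b : R) f g x : 0 < t -> L1 f -> L1 g ->
  conv (moll t) (fun y => a * f y + b * g y) x = a * conv (moll t) f x + b * conv (moll t) g x.
Proof.
move=> t0 Lf Lg; have [cm sm] := (@continuous_moll R n t, @supp_in_moll R n t t0).
by rewrite (convD cm sm)//; [rewrite !(convZ cm sm)|exact: L1Z|exact: L1Z].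
Qed.

(** A product of mollifications is not the mollification of a product. Jensen's inequality, at the
    exponent [p + 1] for [|w|] and [(p + 1) / p] for [|w|^p], still bounds it by mollifications of
    integrable functions, which converge in L^1. *)
Lemma conv_moll_mul_le t w g x : 0 < t -> L1 w -> L1 (fun y => w y ^+ 2) ->
  L1 (fun y => `|w y| `^ (2 * kap)) -> L1 g -> (forall y, `|g y| <= A * (`|w y| + `|w y| `^ p)) ->
  `|conv (moll t) g x| * `|conv (moll t) w x| <=
  A * conv (moll t) (fun y => w y ^+ 2) x + A * conv (moll t) (fun y => `|w y| `^ (p + 1)) x.
Proof.
move=> t0 Lw Lw2 Lk Lg gA; have Ln := L1_norm Lw.
have Lp : L1 (fun y => `|w y| `^ p) by apply: (L1_powR_interp Lw Lk); move: p1 pkap; lra.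
have Lpp : L1 (fun y => `|w y| `^ (p + 1)) by apply: (L1_powR_interp Lw Lk) => //; move: p1; lra.
set V := conv (moll t) (fun y => `|w y|) x.
set P := conv (moll t) (fun y => `|w y| `^ p) x.
set Q := conv (moll t) (fun y => `|w y| `^ (p + 1)) x.
have V0 : 0 <= V by exact: conv_moll_ge0.
have P0 : 0 <= P by apply: conv_moll_ge0 => // y; exact: powR_ge0.
have Q0 : 0 <= Q by apply: conv_moll_ge0 => // y; exact: powR_ge0.
have wV : `|conv (moll t) w x| <= V by exact: conv_moll_abs.
have gV : `|conv (moll t) g x| <= A * V + A * P.
  apply: (le_trans (conv_moll_abs _ t0 Lg)); rewrite -conv_moll_comb//.
  apply: conv_moll_le => //; first exact: L1_norm.
    by apply: L1D; exact: L1Z.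
  by move=> y; rewrite -mulrDr.
have VV : V * V <= conv (moll t) (fun y => w y ^+ 2) x.
  have L2 : L1 (fun y => `|w y| ^+ 2) by under eq_fun do rewrite real_normK ?num_real//.
  have := conv_moll_sqr x t0 Ln L2; rewrite -/V -expr2 => /le_trans; apply.
  by rewrite le_eqVlt; apply/orP; left; apply/eqP; congr conv; apply/funext => y; rewrite real_normK ?num_real.
have PV : P * V <= Q.
  have V1 : V `^ (p + 1) <= Q by apply: conv_moll_jensen => //; move: p1; lra.
  have P1 : P `^ ((p + 1) / p) <= Q.
    have E : (fun y => (`|w y| `^ p) `^ ((p + 1) / p)) = (fun y => `|w y| `^ (p + 1)).
      by apply/funext => y; rewrite -powRrM mulrCA mulfV ?mulr1// gt_eqF.
    rewrite /Q -E; apply: conv_moll_jensen => //.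
    - by rewrite ler_pdivlMr// mul1r lerDl.
    - by rewrite E.
  have V2 : V <= Q `^ (p + 1)^-1.
    have := @ler_powR_base R (p + 1)^-1 _ _ _ (powR_ge0 V (p + 1)) V1.
    by rewrite invr_ge0 (ltW pp0) -powRrM mulfV ?gt_eqF// powRr1//; apply.
  have P2 : P <= Q `^ (p / (p + 1)).
    have := @ler_powR_base R (p / (p + 1)) _ _ _ (powR_ge0 P _) P1.
    rewrite -powRrM (_ : (p + 1) / p * (p / (p + 1)) = 1); last by field; rewrite !gt_eqF.
    by rewrite powRr1//; apply; rewrite divr_ge0// ltW.
  apply: (le_trans (ler_pM P0 V0 P2 V2)).
  have [->|Qn0] := eqVneq Q 0; first by rewrite powR0 ?mul0r// gt_eqF// divr_gt0.
  have pE : p / (p + 1) + (p + 1)^-1 = 1.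
    by rewrite -[X in _ + X]mul1r -mulrDl divff// gt_eqF.
  rewrite -powRD; last by rewrite Qn0 implybT.
  by rewrite pE powRr1.
apply: (le_trans (ler_pM (normr_ge0 _) (normr_ge0 _) gV wV)).
rewrite mulrDl -!mulrA; apply: lerD; exact: ler_wpM2l.
Qed.

(** The smooth inequality is used for the mollifications of [w]. The left side passes to the limit
    by Fatou's lemma, the right side by [dominated_seq_Rintegral]; the bound [Kh] on the weight is
    what provides the majorants. *)
Lemma caccioppoli_limit : exists2 C : R, 0 < C & forall w g (H F h : R -> R) (Kh : R),
  L1 w -> L1 (fun y => w y ^+ 2) -> L1 (fun y => `|w y| `^ (2 * kap)) -> L1 g ->
  (forall y, `|g y| <= A * (`|w y| + `|w y| `^ p)) -> kernel_poisson 1 r w g ->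
  continuous h ->
  (forall s : R, is_derive s 1 H (h s)) -> (forall s : R, is_derive s 1 F (h s ^+ 2)) ->
  (forall s, 0 <= h s <= Kh) -> (forall s, `|H s| <= `|s| * h s) -> (forall s, `|F s| <= h s * `|H s|) ->
  [/\ L1 (fun x => `|eta x ^+ m.+2 * H (w x)| `^ (2 * kap)),
      L1 (fun x => eta x ^+ (m.+2 + m.+2) * (`|g x| * `|F (w x)|) + (eta x ^+ m.+1) ^+ 2 * H (w x) ^+ 2) &
      \int[mu]_x `|eta x ^+ m.+2 * H (w x)| `^ (2 * kap) <=
      (C * \int[mu]_x (eta x ^+ (m.+2 + m.+2) * (`|g x| * `|F (w x)|) +
          (eta x ^+ m.+1) ^+ 2 * H (w x) ^+ 2)) `^ kap].
Proof.
have [C C0 HC] := caccioppoli m n2 kap1 kapn r0.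
exists C => // w g H F h Kh Lw Lw2 Lk Lg gA HP ch Hd Fd hK Hh FH.
have Kh0 : 0 <= Kh by case/andP: (hK 0) => /le_trans; apply.
have h0 s : 0 <= h s by case/andP: (hK s).
have r20 : 0 < r / 2 by rewrite divr_gt0.
have cH : continuous H by move=> s; exact: is_derive_cont (Hd s).
have cF : continuous F by move=> s; exact: is_derive_cont (Fd s).
have Hb s : `|H s| <= Kh * `|s|.
  by apply: (le_trans (Hh s)); rewrite mulrC ler_wpM2r//; case/andP: (hK s).
have Fb s : `|F s| <= Kh ^+ 2 * `|s|.
  apply: (le_trans (FH s)); rewrite expr2 -mulrA; apply: ler_pM => //.
  by case/andP: (hK s).
have H2b s : H s ^+ 2 <= Kh ^+ 2 * s ^+ 2.
  rewrite -[H s ^+ 2]real_normK ?num_real// -[s ^+ 2]real_normK ?num_real// -exprMn.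
  by rewrite ler_pXn2r ?nnegrE ?mulr_ge0.
pose t k : R := r / 2 / k.+1%:R.
have t0 k : 0 < t k by rewrite divr_gt0.
have tr k : t k <= r / 2 by rewrite ler_pdivrMr// ler_peMr ?(ltW r20)// ler1n.
have tc : t k @[k --> \oo] --> 0.
  rewrite -[X in _ --> X](mulr0 (r / 2)); apply: cvgMr; exact: cvg_harmonic.
(* Two successive extractions give almost everywhere convergence for [w] and for [g] along the same
   radii. *)
have [s1 s1k Wc1] := ae_moll_subseq Lw t0 tc.
have [s2 s2k gc] := ae_moll_subseq Lg (fun k => t0 (s1 k)) (cvg_subseq s1k tc).
pose T k := t (s1 (s2 k)).
have T0 k : 0 < T k by exact: t0.
have Tr k : T k <= r / 2 by exact: tr.
have Tc : T k @[k --> \oo] --> 0 by exact: (cvg_subseq s2k (cvg_subseq s1k tc)).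
pose W k := conv (moll (T k)) w.
pose gk k := conv (moll (T k)) g.
have Wc : {ae mu, forall x, W k x @[k --> \oo] --> w x}.
  by apply: filterS Wc1 => x Wx; exact: (cvg_subseq s2k Wx).
have Lpp : L1 (fun y => `|w y| `^ (p + 1)) by apply: (L1_powR_interp Lw Lk) => //; move: p1; lra.
(* An integrable majorant of the limit integrand; its mollifications [D k] are majorants of the
   approximate integrands [S k]. *)
pose f x := (Kh ^+ 2 * (A + 1)) * w x ^+ 2 + (Kh ^+ 2 * A) * `|w x| `^ (p + 1).
have Lf : L1 f by apply: L1D; exact: L1Z.
pose D k := conv (moll (T k)) f.
have LD k : L1 (D k) by exact: L1_conv_moll.
have K20 : 0 <= Kh ^+ 2 by exact: sqr_ge0.
pose S k x := eta x ^+ (m.+2 + m.+2) * (`|gk k x| * `|F (W k x)|) + (eta x ^+ m.+1) ^+ 2 * H (W k x) ^+ 2.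
pose s x := eta x ^+ (m.+2 + m.+2) * (`|g x| * `|F (w x)|) + (eta x ^+ m.+1) ^+ 2 * H (w x) ^+ 2.
have res k : [/\ L1 (fun x => `|eta x ^+ m.+2 * H (W k x)| `^ (2 * kap)), L1 (S k) &
    \int[mu]_x `|eta x ^+ m.+2 * H (W k x)| `^ (2 * kap) <= (C * \int[mu]_x S k x) `^ kap].
  apply: (HC (W k) (gk k) H F h) => //.
  - exact: class_C_conv_moll.
  - by move=> x; exact: (class_C_cont (class_C_conv_moll 0 (T0 k) Lg)).
  - move=> x xr; apply: (lap_conv_moll (T0 k) Lw Lg HP).
    by have := Tr k; lra.
have bound (b G W' w2 wp : R) x : `|G| * `|W'| <= A * w2 + A * wp -> W' ^+ 2 <= w2 ->
    0 <= eta x ^+ (m.+2 + m.+2) * (`|G| * `|F W'|) + (eta x ^+ m.+1) ^+ 2 * H W' ^+ 2 <=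
    Kh ^+ 2 * (A + 1) * w2 + Kh ^+ 2 * A * wp.
  move=> GW W2; apply/andP; split.
    apply: addr_ge0; first by apply: mulr_ge0; [exact: exprn_ge0|exact: mulr_ge0].
    by apply: mulr_ge0; exact: sqr_ge0.
  have e1 : eta x ^+ (m.+2 + m.+2) * (`|G| * `|F W'|) <= Kh ^+ 2 * (A * w2 + A * wp).
    apply: (@le_trans _ _ (`|G| * `|F W'|)).
      by apply: ler_piMl; rewrite ?mulr_ge0// exprn_ile1.
    apply: (@le_trans _ _ (Kh ^+ 2 * (`|G| * `|W'|))); last exact: ler_wpM2l.
    by rewrite mulrCA; apply: ler_wpM2l.
  have e2 : (eta x ^+ m.+1) ^+ 2 * H W' ^+ 2 <= Kh ^+ 2 * w2.
    apply: (@le_trans _ _ (H W' ^+ 2)).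
      by apply: ler_piMl; rewrite ?sqr_ge0// -exprM exprn_ile1.
    by apply: (le_trans (H2b W')); exact: ler_wpM2l.
  by apply: (le_trans (lerD e1 e2)); rewrite le_eqVlt; apply/orP; left; apply/eqP; ring.
have SD k x : 0 <= S k x <= D k x.
  rewrite /D /f conv_moll_comb//; apply: (bound 0).
    exact: conv_moll_mul_le.
  exact: conv_moll_sqr.
have sf x : 0 <= s x <= f x.
  apply: (bound 0) => //; apply: (le_trans (ler_wpM2r (normr_ge0 (w x)) (gA x))).
  rewrite -mulrDr -mulrA; apply: ler_wpM2l => //; rewrite mulrDl -expr2 real_normK ?num_real// lerD2l.
  have [->|wn0] := eqVneq (w x) 0; first by rewrite normr0 mulr0 powR_ge0.
  rewrite powRD; last by rewrite normr_eq0 wn0 implybT.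
  by rewrite powRr1.
have mw := L1_measurable Lw.
have meta k : measurable_fun setT (fun x => eta x ^+ k).
  by apply: continuousT_measurable_rV; exact: contX.
have mHw : measurable_fun setT (fun x => H (w x)).
  exact: (measurableT_comp (continuous_measurable_fun cH) mw).
have mFw : measurable_fun setT (fun x => F (w x)).
  exact: (measurableT_comp (continuous_measurable_fun cF) mw).
have ms : measurable_fun setT s.
  apply: measurable_funD; apply: measurable_funM => //.
  - apply: measurable_funM; apply: measurableT_comp => //; exact: L1_measurable.
  - by apply: measurable_funX.
  - by apply: measurable_funX.
have Sc : {ae mu, forall x, S k x @[k --> \oo] --> s x}.
  apply: filterS2 Wc gc => x Wx gx.
  apply: cvgD; apply: cvgMr.
    apply: cvgM; first exact: (cvg_comp_continuous (@norm_continuous _ R) gx).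
    apply: (cvg_comp_continuous (@norm_continuous _ R)).
    exact: (cvg_comp_continuous cF Wx).
  apply: (@cvg_comp_continuous R (fun s => s ^+ 2)); last exact: (cvg_comp_continuous cH Wx).
  by move=> y; exact: exprn_continuous.
have Dc : (\int[mu]_x `|D k x - f x|)%R @[k --> \oo] --> (0 : R).
  exact: (L1_approximable Lf).
have LS k : L1 (S k) by have [] := res k.
have [Ls Ic] := dominated_seq_Rintegral LS LD ms Lf SD sf Sc Dc.
have Bc : (C * \int[mu]_x S k x) `^ kap @[k --> \oo] --> (C * \int[mu]_x s x) `^ kap.
  have I0 k : 0 <= C * \int[mu]_x S k x.
    by rewrite mulr_ge0 ?(ltW C0)//; apply: Rintegral_ge0 => x _; case/andP: (SD k x).
  have J0 : 0 <= C * \int[mu]_x s x.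
    by rewrite mulr_ge0 ?(ltW C0)//; apply: Rintegral_ge0 => x _; case/andP: (sf x).
  have H1 : (C * \int[mu]_x S k x)%R @[k --> \oo] --> C * \int[mu]_x s x by apply: cvgMr.
  have E k : (C * \int[mu]_x S k x) `^ kap = `|C * \int[mu]_x S k x| `^ kap by rewrite (ger0_norm (I0 k)).
  under eq_fun do rewrite E.
  rewrite -[X in X `^ kap](ger0_norm J0).
  exact: (cvg_comp_continuous (powR_abs_continuous kap0) H1).
pose Fk k x := `|eta x ^+ m.+2 * H (W k x)| `^ (2 * kap).
have Fc : {ae mu, forall x, Fk k x @[k --> \oo] --> `|eta x ^+ m.+2 * H (w x)| `^ (2 * kap)}.
  apply: filterS Wc => x Wx.
  apply: (cvg_comp_continuous (powR_abs_continuous k20)); apply: cvgMr.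
  exact: (cvg_comp_continuous cH Wx).
have LFk k : L1 (Fk k) by have [] := res k.
have mF : measurable_fun setT (fun x => `|eta x ^+ m.+2 * H (w x)| `^ (2 * kap)).
  by apply: measurable_abs_powR; exact: measurable_funM.
have FB k : \int[mu]_x Fk k x <= (C * \int[mu]_x S k x) `^ kap by have [] := res k.
have [LF IF] := fatou_Rintegral LFk (fun k x => powR_ge0 _ _) mF (fun x => powR_ge0 _ _) Fc FB Bc.
by split.
Qed.

Let D2 (a : R) : R := 2 * 2 `^ a.

(** The value for which the interpolation exponents [al] and [be] in [bk_level] add up to 1 when the
    cutoff has power [m + 2]. It grows without bound with [m], so a single step reaches any
    integrability. *)
Definition bk_exp : R := m.+1%:R * (1 - kap^-1).

Let a := bk_exp.
Let a0 : 0 < a.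
Proof. by rewrite /a /bk_exp mulr_gt0// subr_gt0 invf_lt1. Qed.

Let m2 : R := m.+2%:R.
Let m20 : 0 < m2. Proof. by []. Qed.

(** The potential [|w|^(p-1)] is split at the level [M]. Above [M], its smallness lets the term be
    absorbed in the left side [Y]. Below [M] it is bounded and leaves the integral of
    [eta^(2m+2) H(w)^2], which is interpolated between [Y] and the L^2 norm of [w]; the powers of
    the cutoff are chosen for this to be possible. The threshold [eps] is independent of [M], and
    [C] is independent of [L]. *)
Lemma bk_level : exists2 eps : R, 0 < eps & forall M : R, 1 <= M -> exists2 C : R, 0 < C & forall w g (L : R),
  L1 w -> L1 (fun y => w y ^+ 2) -> L1 (fun y => `|w y| `^ (2 * kap)) -> L1 g ->
  (forall y, `|g y| <= A * (`|w y| + `|w y| `^ p)) -> kernel_poisson 1 r w g ->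
  \int[mu]_x (\1_[set x | M < `|w x|] x * `|w x| `^ (2 * kap)) <= eps -> 0 < L ->
  L1 (fun x => \1_(cube 0 (r / (4 * n%:R + 4))) x * (`|w x| * Num.min `|w x| L `^ a) `^ (2 * kap)) /\
  \int[mu]_x (\1_(cube 0 (r / (4 * n%:R + 4))) x * (`|w x| * Num.min `|w x| L `^ a) `^ (2 * kap)) <=
    C * (\int[mu]_x w x ^+ 2) `^ (kap * (a + 1)).
Proof.
have [C1 C10 HC1] := caccioppoli_limit.
pose D := 2 * 2 `^ a : R.
have D0 : 0 < D by rewrite mulr_gt0// powR_gt0.
pose c2 := A * D.
have c20 : 0 <= c2 by rewrite mulr_ge0// ltW.
have ik1 : 0 < 1 - kap^-1 by rewrite subr_gt0 invf_lt1.
(* With this choice the coefficient of the absorbed term is [2 * C1 * c2 * e1 = 1 - e1 <= 1]. The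
   threshold below is [e1] raised to the Hoelder exponent dual to [kap]. *)
pose e1 := (2 * C1 * c2 + 1)^-1.
have Cc0 : 0 <= 2 * C1 * c2 by rewrite !mulr_ge0// ltW.
have e10 : 0 < e1 by rewrite invr_gt0 ltr_wpDl.
exists (e1 `^ (1 - kap^-1)^-1); first by rewrite powR_gt0.
move=> M M1; pose c1 := 1 + A * D * (1 + M `^ (p - 1)).
have c10 : 0 < c1 by rewrite ltr_pwDl// mulr_ge0// addr_ge0// powR_ge0.
pose be := (a + 1) / m2; pose al := (1 - m2^-1) / kap.
have be0 : 0 < be by rewrite divr_gt0// addr_gt0.
have im2 : m2^-1 < 1 by rewrite invf_lt1// ltr1n.
have al0 : 0 < al by rewrite divr_gt0// subr_gt0.
have m2E : m2 = m.+1%:R + 1 by rewrite /m2 -natr1.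
have albe : al + be = 1.
  rewrite /al /be /a /bk_exp (_ : m.+1%:R = m2 - 1); last by rewrite m2E addrK.
  by field; rewrite !gt_eqF.
(* On the smaller cube the cutoff is at least [exp(-2)] and [|H(s)|] is at least [|s| h(s) / D]. *)
pose cc := (expR (- 2) ^+ m.+2 / D) `^ (2 * kap).
have cc0 : 0 < cc by rewrite powR_gt0// divr_gt0// exprn_gt0// expR_gt0.
exists (cc^-1 * (2 * C1 * c1) `^ (kap * m2)).
  by rewrite mulr_gt0 ?invr_gt0// powR_gt0// !mulr_gt0.
move=> w g L Lw Lw2 Lk Lg gA HP wM L0.
have [H [F [ch Hd Fd [HE1 HE2 HE3]]]] := truncated_weight a0 L0.
set h := fun s => Num.min `|s| L `^ a in ch Hd Fd HE1 HE2 HE3.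
have mL s : 0 <= Num.min `|s| L by rewrite le_min normr_ge0 ltW.
have hK s : 0 <= h s <= L `^ a.
  rewrite powR_ge0/=; apply: ler_powR_base => //; first exact: ltW.
  by rewrite ge_min lexx orbT.
have ha s : h s <= `|s| `^ a.
  by apply: ler_powR_base => //; [exact: ltW|rewrite ge_min lexx].
have [LY LB YB] := HC1 w g H F h (L `^ a) Lw Lw2 Lk Lg gA HP ch Hd Fd hK HE1 HE3.
set Y := \int[mu]_x _ in YB; set B := \int[mu]_x _ in YB.
have mw := L1_measurable Lw.
have cH : continuous H by move=> s; exact: is_derive_cont (Hd s).
have meta k : measurable_fun setT (fun x => eta x ^+ k).
  by apply: continuousT_measurable_rV; exact: contX.
have mHw : measurable_fun setT (fun x => H (w x)).
  exact: (measurableT_comp (continuous_measurable_fun cH) mw).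
have Y0 : 0 <= Y by apply: Rintegral_ge0 => x _; exact: powR_ge0.
pose X := \int[mu]_x w x ^+ 2.
have X0 : 0 <= X by apply: Rintegral_ge0 => x _; exact: sqr_ge0.
pose Jf x := (eta x ^+ m.+1) ^+ 2 * H (w x) ^+ 2.
have Jf0 x : 0 <= Jf x by rewrite mulr_ge0// sqr_ge0.
pose v x := \1_[set x | M < `|w x|] x * `|w x| `^ (p - 1).
have mM : measurable [set x | M < `|w x|].
  have mn : measurable_fun setT (fun x => `|w x|) by exact: measurableT_comp.
  have := mn measurableT _ (measurable_itv `]M, +oo[).
  by rewrite setTI; congr measurable; apply/seteqP; split => x /=; rewrite in_itv/= andbT.
have v0 x : 0 <= v x by rewrite mulr_ge0 ?powR_ge0// indicE.
have mv : measurable_fun setT v.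
  by apply: measurable_funM; [exact: measurable_indic|exact: measurable_abs_powR].
pose Vf x := v x * (eta x ^+ m.+2 * H (w x)) ^+ 2.
have Vf0 x : 0 <= Vf x by rewrite mulr_ge0// sqr_ge0.
have mVf : measurable_fun setT Vf by apply: measurable_funM => //; apply: measurable_funX; exact: measurable_funM.
have mJf : measurable_fun setT Jf by apply: measurable_funM; apply: measurable_funX.
pose Ef x := \1_[set x | M < `|w x|] x * `|w x| `^ (2 * kap).
have Ef0 x : 0 <= Ef x by rewrite mulr_ge0 ?powR_ge0// indicE.
have LE : L1 Ef.
  apply: L1_le Lk.
    by apply: measurable_funM; [exact: measurable_indic|exact: measurable_abs_powR].
  move=> x; rewrite ger0_norm// /Ef indicE; case: (x \in _); first by rewrite mul1r.
  by rewrite mul0r powR_ge0.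
(* Holder's inequality: the large values of |w|^(p-1) have small L^kap' norm *)
have [LV VB] : L1 Vf /\ \int[mu]_x Vf x <= e1 * Y `^ kap^-1.
  have ik0 : 0 < kap^-1 by rewrite invr_gt0.
  have [LH HH] := holder_Rintegral LE LY Ef0 (fun x => powR_ge0 _ _) ik1 ik0 (subrK _ _).
  have le x : Vf x <= Ef x `^ (1 - kap^-1) * (`|eta x ^+ m.+2 * H (w x)| `^ (2 * kap)) `^ kap^-1.
    rewrite -powRrM mulfK ?gt_eqF// powR_abs2; apply: ler_wpM2r; first exact: sqr_ge0.
    rewrite /v /Ef indicE; have [|_] := boolP (x \in _); last by rewrite !mul0r powR_ge0.
    (* Here [p + 1 <= 2 * kap] is used, in the form [p - 1 <= 2 * kap - 2]; since [|w| > M >= 1],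
       the larger exponent gives the larger power. *)
    rewrite inE /= => Mw; rewrite !mul1r -powRrM; apply: ler_powR; first by rewrite (le_trans M1)// ltW.
    rewrite mulrBr mulr1 mulfK ?gt_eqF//.
    by rewrite -subr_ge0 (_ : _ - _ = 2 * kap - (p + 1)) ?subr_ge0//; ring.
  have LV : L1 Vf by apply: L1_le LH => // x; rewrite ger0_norm.
  split => //; apply: (le_trans (Rintegral_le LV LH le)).
  apply: (le_trans HH); apply: ler_wpM2r; first exact: powR_ge0.
  have -> : e1 = (e1 `^ (1 - kap^-1)^-1) `^ (1 - kap^-1).
    by rewrite -powRrM mulVf ?gt_eqF// powRr1// ltW.
  apply: ler_powR_base => //; first exact: ltW.
  by apply: Rintegral_ge0.
(* Holder's inequality: interpolation between the L^2 norm of w and Y *)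
have [LJ JB] : L1 Jf /\ \int[mu]_x Jf x <= Y `^ al * X `^ be.
  have [LH HH] := holder_Rintegral LY Lw2 (fun x => powR_ge0 _ _) (fun x => sqr_ge0 _) al0 be0 albe.
  have le x : Jf x <= (`|eta x ^+ m.+2 * H (w x)| `^ (2 * kap)) `^ al * (w x ^+ 2) `^ be.
    have [E0|E0] := eqVneq (eta x) 0; first by rewrite /Jf E0 expr0n expr0n mul0r mulr_ge0 ?powR_ge0.
    have [H0|H0] := eqVneq (H (w x)) 0; first by rewrite /Jf H0 expr0n mulr0 mulr_ge0 ?powR_ge0.
    have k2al : 2 * kap * al = 2 * m.+1%:R / m2.
      by rewrite /al (_ : m.+1%:R = m2 - 1); [field; rewrite !gt_eqF|rewrite m2E addrK].
    rewrite -powRrM k2al normrM powRM//.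
    have -> : `|eta x ^+ m.+2| `^ (2 * m.+1%:R / m2) = (eta x ^+ m.+1) ^+ 2.
      rewrite ger0_norm ?exprn_ge0// -powR_mulrn// -powRrM.
      rewrite mulrCA mulfV ?gt_eqF// mulr1 -exprM -powR_mulrn//.
      by rewrite natrM mulrC.
    rewrite /Jf -mulrA; apply: ler_wpM2l; first exact: sqr_ge0.
    have -> : H (w x) ^+ 2 = `|H (w x)| `^ (2 * m.+1%:R / m2) * `|H (w x)| `^ (2 / m2).
      rewrite -powRD; last by rewrite normr_eq0 H0 implybT.
      rewrite -powR_abs2; congr (_ `^ _); rewrite (_ : m.+1%:R = m2 - 1); last by rewrite m2E addrK.
      by field; rewrite gt_eqF.
    apply: ler_wpM2l; first exact: powR_ge0.
    have wn0 : w x != 0.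
      apply: contra_neq H0 => w0; apply/normr0_eq0/le_anti; rewrite normr_ge0 andbT.
      by apply: (le_trans (HE1 _)); rewrite w0 normr0 mul0r.
    have Hw : `|H (w x)| <= `|w x| `^ (a + 1).
      apply: (le_trans (HE1 _)); rewrite powRD; last by rewrite normr_eq0 wn0 implybT.
      by rewrite powRr1// mulrC; apply: (ler_wpM2r (normr_ge0 _) (ha _)).
    have b0 : 0 <= 2 / m2 by rewrite divr_ge0// ltW.
    apply: (le_trans (ler_powR_base b0 (normr_ge0 _) Hw)).
    rewrite -powR_abs2 -!powRrM le_eqVlt; apply/orP; left; apply/eqP; congr (_ `^ _).
    by rewrite /be; field; rewrite gt_eqF.
  have LJ : L1 Jf by apply: L1_le LH => // x; rewrite ger0_norm.
  by split; [exact: LJ|exact: (le_trans (Rintegral_le LJ LH le) HH)].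
have BB : B <= c1 * \int[mu]_x Jf x + c2 * \int[mu]_x Vf x.
  have [LL <-] := Rintegral_comb c1 c2 LJ LV.
  apply: (Rintegral_le LB LL) => x.
  have h1 : `|w x| * `|F (w x)| <= D * H (w x) ^+ 2.
    apply: (le_trans (ler_wpM2l (normr_ge0 _) (HE3 (w x)))).
    rewrite mulrA -[H (w x) ^+ 2]real_normK ?num_real// expr2 mulrA.
    by apply: ler_wpM2r => //; exact: HE2.
  have wp : `|w x| `^ p = `|w x| `^ (p - 1) * `|w x|.
    by rewrite mulrC mulr_powRB1.
  have vM : `|w x| `^ (p - 1) <= M `^ (p - 1) + v x.
    rewrite /v indicE; have [|] := boolP (x \in _).
      by rewrite mul1r lerDr powR_ge0.
    rewrite notin_setE /= => /negP; rewrite -leNgt => wxM; rewrite mul0r addr0.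
    by apply: ler_powR_base; rewrite ?subr_ge0 ?(ltW p1).
  have H20 : 0 <= H (w x) ^+ 2 by exact: sqr_ge0.
  have gF : `|g x| * `|F (w x)| <= c2 * (1 + M `^ (p - 1) + v x) * H (w x) ^+ 2.
    apply: (le_trans (ler_wpM2r (normr_ge0 _) (gA x))).
    have -> : A * (`|w x| + `|w x| `^ p) * `|F (w x)| =
        A * ((1 + `|w x| `^ (p - 1)) * (`|w x| * `|F (w x)|)) by rewrite wp; ring.
    have -> : c2 * (1 + M `^ (p - 1) + v x) * H (w x) ^+ 2 =
        A * ((1 + (M `^ (p - 1) + v x)) * (D * H (w x) ^+ 2)) by rewrite /c2; ring.
    apply: (ler_wpM2l A0).
    have q0 : 0 <= 1 + `|w x| `^ (p - 1) by rewrite addr_ge0// powR_ge0.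
    apply: (le_trans (ler_wpM2l q0 h1)); apply: ler_wpM2r; first exact: (mulr_ge0 (ltW D0) H20).
    by rewrite lerD2l.
  have eP : eta x ^+ (m.+2 + m.+2) <= (eta x ^+ m.+1) ^+ 2.
    by rewrite -exprM muln2 -addnn; apply: ler_wiXn2l => //; rewrite leq_add.
  apply: (le_trans (lerD (ler_wpM2l (exprn_ge0 _ (eta0 x)) gF) (lexx _))).
  have VE : Vf x = v x * (eta x ^+ (m.+2 + m.+2) * H (w x) ^+ 2).
    by rewrite /Vf exprMn -exprM muln2 addnn.
  have cM0 : 0 <= c2 * (1 + M `^ (p - 1)) by rewrite mulr_ge0// addr_ge0// powR_ge0.
  by rewrite VE; apply: (absorb_algebra _ (ler_wpM2r (mulr_ge0 cM0 H20) eP)).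
have Yk0 : 0 <= Y `^ kap^-1 by exact: powR_ge0.
have B0 : 0 <= B.
  apply: Rintegral_ge0 => x _; apply: addr_ge0; last exact: Jf0.
  by apply: mulr_ge0; [exact: exprn_ge0|exact: mulr_ge0].
have Y1 : Y `^ kap^-1 <= C1 * B.
  have := @ler_powR_base R kap^-1 _ _ _ Y0 YB; rewrite invr_ge0 (ltW kap0) => /(_ isT).
  by rewrite -powRrM mulfV ?gt_eqF// powRr1// mulr_ge0// ltW.
have Y2 : Y `^ kap^-1 <= 2 * C1 * c1 * (Y `^ al * X `^ be).
  have e1E : e1 * (2 * C1 * c2 + 1) = 1 by rewrite mulVf// gt_eqF// ltr_wpDl.
  have s1 : C1 * B <= C1 * (c1 * (Y `^ al * X `^ be) + c2 * (e1 * Y `^ kap^-1)).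
    rewrite ler_pM2l//; apply: (le_trans BB); apply: lerD; first by rewrite ler_pM2l.
    exact: ler_wpM2l.
  have s2 : 2 * C1 * c2 * e1 <= 1.
    have -> : 2 * C1 * c2 * e1 = 1 - e1 by rewrite -[X in _ = X - _]e1E; ring.
    by rewrite lerBlDr lerDl ltW.
  exact: (absorb_half (le_trans Y1 s1) (ler_wpM2r Yk0 s2)).
have Y3 : Y <= (2 * C1 * c1) `^ (kap * m2) * X `^ (kap * (a + 1)).
  apply: (absorb_power Y0 _ X0 kap0 m20 _ _ Y2).
  - by rewrite !mulr_ge0// ltW.
  - by rewrite /al; field; rewrite !gt_eqF.
  - by rewrite /be; field; rewrite gt_eqF.
have le1 x : cc * (\1_(cube 0 (r / (4 * n%:R + 4))) x * (`|w x| * Num.min `|w x| L `^ a) `^ (2 * kap)) <=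
    `|eta x ^+ m.+2 * H (w x)| `^ (2 * kap).
  rewrite indicE; have [|_] := boolP (x \in _); last by rewrite mul0r mulr0 powR_ge0.
  rewrite inE /cube/= subr0 => xr; rewrite mul1r /cc.
  have q0 : 0 <= expR (- 2) ^+ m.+2 :> R by apply: exprn_ge0; exact: expR_ge0.
  have q1 : 0 <= expR (- 2) ^+ m.+2 / D by exact: (divr_ge0 q0 (ltW D0)).
  have q2 : 0 <= `|w x| * Num.min `|w x| L `^ a by apply: mulr_ge0 => //; exact: powR_ge0.
  rewrite -(powRM _ q1 q2); apply: ler_powR_base; [exact: ltW|exact: mulr_ge0|].
  rewrite normrM -mulrA; apply: ler_pM => //.
  - by rewrite mulr_ge0// invr_ge0 ltW.
  - rewrite ger0_norm ?exprn_ge0//; apply: lerXn2r; rewrite ?nnegrE ?expR_ge0//.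
    exact: ker0_lower_cube.
  - by rewrite mulrC ler_pdivrMr// [leRHS]mulrC; exact: HE2.
have mG : measurable_fun setT (fun x => \1_(cube 0 (r / (4 * n%:R + 4))) x * (`|w x| * Num.min `|w x| L `^ a) `^ (2 * kap)).
  apply: measurable_funM; first exact: measurable_indic (measurable_cube _ _).
  apply: (measurableT_comp (measurable_powR _)); apply: measurable_funM; first exact: measurableT_comp.
  apply: (measurableT_comp (measurable_powR _)); apply: measurable_minr => //; exact: measurableT_comp.
have G0 x : 0 <= \1_(cube 0 (r / (4 * n%:R + 4))) x * (`|w x| * Num.min `|w x| L `^ a) `^ (2 * kap).
  by rewrite mulr_ge0 ?powR_ge0// indicE.
have LG : L1 (fun x => \1_(cube 0 (r / (4 * n%:R + 4))) x * (`|w x| * Num.min `|w x| L `^ a) `^ (2 * kap)).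
  apply: L1_le (L1Z cc^-1 LY) => // x.
  by rewrite ger0_norm// ler_pdivlMl.
split; first exact: LG.
have I1 := Rintegral_le (L1Z cc LG) LY le1.
rewrite (Rintegral_scale cc LG) in I1.
exact: (le_cancel cc0 I1 Y3).
Qed.

(** Fatou's lemma as the truncation level [L] runs through the integers: at each point the truncated
    integrand is eventually the untruncated one. *)
Lemma brezis_kato : exists2 eps : R, 0 < eps & forall M : R, 1 <= M -> exists2 C : R, 0 < C & forall w g,
  L1 w -> L1 (fun y => w y ^+ 2) -> L1 (fun y => `|w y| `^ (2 * kap)) -> L1 g ->
  (forall y, `|g y| <= A * (`|w y| + `|w y| `^ p)) -> kernel_poisson 1 r w g ->
  \int[mu]_x (\1_[set x | M < `|w x|] x * `|w x| `^ (2 * kap)) <= eps ->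
  L1 (fun x => \1_(cube 0 (r / (4 * n%:R + 4))) x * `|w x| `^ (2 * kap * (a + 1))) /\
  \int[mu]_x (\1_(cube 0 (r / (4 * n%:R + 4))) x * `|w x| `^ (2 * kap * (a + 1))) <=
    C * (\int[mu]_x w x ^+ 2) `^ (kap * (a + 1)).
Proof.
have [eps e0 He] := bk_level; exists eps => // M M1; have [C C0 HC] := He M M1.
exists C => // w g Lw Lw2 Lk Lg gA HP wM.
have Hk k := HC w g k.+1%:R Lw Lw2 Lk Lg gA HP wM (ltr0Sn _ k).
have mw := L1_measurable Lw.
pose Fk k x := \1_(cube 0 (r / (4 * n%:R + 4))) x * (`|w x| * Num.min `|w x| k.+1%:R `^ a) `^ (2 * kap).
apply: (@fatou_Rintegral _ _ R mu Fk _ (fun=> C * (\int[mu]_x w x ^+ 2) `^ (kap * (a + 1)))).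
- by move=> k; have [] := Hk k.
- by move=> k x; rewrite mulr_ge0 ?powR_ge0// indicE.
- by apply: measurable_funM; [exact: measurable_indic (measurable_cube _ _)|exact: measurable_abs_powR].
- by move=> x; rewrite mulr_ge0 ?powR_ge0// indicE.
- apply: aeW => x; apply: cvg_near_cst; exists (Num.trunc `|w x|) => // k /= km.
  have wk : `|w x| <= k.+1%:R.
    by apply: ltW; apply: (lt_le_trans (truncnS_gt _)); rewrite ler_nat ltnS.
  rewrite /Fk min_l//; congr (_ * _).
  have [->|wn0] := eqVneq (w x) 0.
    by rewrite normr0 mul0r !powR0// gt_eqF// mulr_gt0// addr_gt0.
  have E : `|w x| * `|w x| `^ a = `|w x| `^ (a + 1).
    rewrite powRD; last by rewrite normr_eq0 wn0 implybT.
    by rewrite powRr1// mulrC.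
  by rewrite E -powRrM [(a + 1) * _]mulrC.
- by move=> k; have [] := Hk k.
- exact: cvg_cst.
Qed.

End brezis_kato.

(** * Local regularity *)

Section C1_limit.
Context {R : realType}.

(** The sequences [a k + 2 B 2^-k] and [a k - 2 B 2^-k] are monotone, decreasing and increasing;
    they enclose the limit and give the rate. *)
Lemma geometric_cauchy (a : nat -> R) (B : R) : 0 <= B ->
  (forall k, `|a k - a k.+1| <= B * 2^-1 ^+ k) ->
  exists2 l : R, a k @[k --> \oo] --> l & forall k, `|a k - l| <= 2 * B * 2^-1 ^+ k.
Proof.
move=> B0 Ha.
have g0 k : 0 <= 2 * B * 2^-1 ^+ k by rewrite mulr_ge0 ?exprn_ge0// mulr_ge0.
have gc : (2 * B * 2^-1 ^+ k)%R @[k --> \oo] --> (0 : R).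
  rewrite -[X in _ --> X](mulr0 (2 * B)); apply: cvgMr; apply: cvg_expr.
  by rewrite ger0_norm ?invr_ge0// invf_lt1// ltr1n.
pose b k := a k + 2 * B * 2^-1 ^+ k; pose c k := a k - 2 * B * 2^-1 ^+ k.
have bS k : b k.+1 <= b k.
  by have := Ha k; rewrite /b ler_norml => /andP[]; rewrite exprS; set z := 2^-1 ^+ k; lra.
have cS k : c k <= c k.+1.
  by have := Ha k; rewrite /c ler_norml => /andP[]; rewrite exprS; set z := 2^-1 ^+ k; lra.
have bmono : nonincreasing_seq b by apply/nonincreasing_seqP.
have cmono : nondecreasing_seq c by apply/nondecreasing_seqP.
have cb k : c k <= b k by rewrite /c /b lerD2l (le_trans _ (g0 k))// oppr_le0.
have bc : cvgn b.
  apply: nonincreasing_is_cvgn => //; exists (c 0%N) => _ [k _ <-].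
  by apply: le_trans (cb k); exact: cmono.
have ac : a k @[k --> \oo] --> limn b.
  have -> : a = (fun k => b k - 2 * B * 2^-1 ^+ k) by apply/funext => k; rewrite /b addrK.
  by rewrite -[X in _ --> X]subr0; apply: cvgB.
exists (limn b) => // k; rewrite ler_norml; apply/andP; split.
  have : limn b <= b k by apply: nonincreasing_cvgn_ge.
  by rewrite /b; lra.
have cc : c k0 @[k0 --> \oo] --> limn b.
  by rewrite -[X in _ --> X]subr0; apply: cvgB.
have : c k <= limn b.
  by rewrite -(cvg_lim _ cc)//; apply: nondecreasing_cvgn_le => //; apply/cvg_ex; exists (limn b).
by rewrite /c; lra.
Qed.

Lemma cvg_unique_real (a : nat -> R) (l l' : R) : a k @[k --> \oo] --> l -> a k @[k --> \oo] --> l' -> l = l'.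
Proof. by move=> h1 h2; rewrite -(cvg_lim _ h1)// -(cvg_lim _ h2). Qed.

Context {n : nat}.
Implicit Types (f U : 'rV[R]_n -> R) (x y : 'rV[R]_n) (Q : set 'rV[R]_n).

Lemma line_mvt f Q x (h : R) i : class_C 1 Q f ->
  (forall s : R, `|s| <= `|h| -> Q (s *: delta_mx ord0 i + x)) ->
  exists2 s : R, `|s| <= `|h| &
    f (h *: delta_mx ord0 i + x) - f x = partial i f (s *: delta_mx ord0 i + x) * h.
Proof.
move=> Cf HQ; set e := delta_mx ord0 i in HQ *.
have D (s : R) : `|s| <= `|h| -> is_derive s 1 (fun s : R => f (s *: e + x)) (partial i f (s *: e + x)).
  by move=> sh; apply/is_derive_line; exact: (class_C_derive i Cf (HQ s sh)).
have [h0|h0|->] := ltgtP h 0; last by exists 0 => //; rewrite scale0r add0r subrr mulr0.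
- have [|c /andP[c1 c2] E] := @mvt_point R (fun s : R => f (s *: e + x)) (fun s => partial i f (s *: e + x)) h 0 h0.
    by move=> s /andP[s1 s2]; apply: D; rewrite !ler0_norm ?lerN2// ltW.
  exists c; first by rewrite !ler0_norm ?lerN2// ltW.
  move: E; rewrite scale0r add0r sub0r => E.
  by rewrite -opprB E mulrN opprK.
- have [|c /andP[c1 c2] E] := @mvt_point R (fun s : R => f (s *: e + x)) (fun s => partial i f (s *: e + x)) 0 h h0.
    by move=> s /andP[s1 s2]; apply: D; rewrite !ger0_norm// ltW.
  exists c; first by rewrite !ger0_norm// ltW.
  by move: E; rewrite scale0r add0r subr0.
Qed.

Lemma norm_delta_scale (s : R) i : `|s *: delta_mx ord0 i : 'rV[R]_n| <= `|s|.
Proof.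
apply/rV_norm_leP => // j; rewrite !mxE eqxx /=.
by case: eqP => _; rewrite ?mulr1 ?mulr0 ?normr0.
Qed.

(** The limit of the partial derivatives is identified by the mean value theorem: the difference
    quotients of all the [W k] are close to it uniformly in [k]. *)
Lemma C1_limit (W : nat -> 'rV[R]_n -> R) Q (B : R) : open Q -> 0 <= B ->
  (forall k, class_C 1 Q (W k)) ->
  (forall k x, Q x -> `|W k x - W k.+1 x| <= B * 2^-1 ^+ k) ->
  (forall k i x, Q x -> `|partial i (W k) x - partial i (W k.+1) x| <= B * 2^-1 ^+ k) ->
  exists U, [/\ class_C 1 Q U,
    forall x, Q x -> W k x @[k --> \oo] --> U x,
    forall x, Q x -> `|W 0%N x - U x| <= 2 * B &
    forall i x, Q x -> `|partial i (W 0%N) x - partial i U x| <= 2 * B].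
Proof.
move=> oQ B0 CW HW HdW.
have lim (a : nat -> 'rV[R]_n -> R) : (forall k x, Q x -> `|a k x - a k.+1 x| <= B * 2^-1 ^+ k) ->
    exists l : 'rV[R]_n -> R, forall x, Q x ->
      a k x @[k --> \oo] --> l x /\ forall k, `|a k x - l x| <= 2 * B * 2^-1 ^+ k.
  move=> Ha; have /choice[l Hl] x : exists lx : R, Q x ->
      a k x @[k --> \oo] --> lx /\ forall k, `|a k x - lx| <= 2 * B * 2^-1 ^+ k.
    have [Qx|nQx] := pselect (Q x); last by exists 0.
    have [l l1 l2] := geometric_cauchy B0 (fun k => Ha k x Qx).
    by exists l => _; split.
  by exists l.
have [U HU] := lim W HW.
have /choice[V HV] i : exists Vi : 'rV[R]_n -> R, forall x, Q x ->
    partial i (W k) x @[k --> \oo] --> Vi x /\ forall k, `|partial i (W k) x - Vi x| <= 2 * B * 2^-1 ^+ k.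
  exact: (lim (fun k => partial i (W k)) (fun k x => HdW k i x)).
have gc : (2 * B * 2^-1 ^+ k)%R @[k --> \oo] --> (0 : R).
  rewrite -[X in _ --> X](mulr0 (2 * B)); apply: cvgMr; apply: cvg_expr.
  by rewrite ger0_norm ?invr_ge0// invf_lt1// ltr1n.
have ulim (a : nat -> 'rV[R]_n -> R) (l : 'rV[R]_n -> R) :
    (forall k x, Q x -> {for x, continuous (a k)}) ->
    (forall k x, Q x -> `|a k x - l x| <= 2 * B * 2^-1 ^+ k) ->
    forall x, Q x -> {for x, continuous l}.
  move=> ca al x Qx; apply/cont_rVP => e e0.
  have e3 : 0 < e / 3 by rewrite divr_gt0.
  have /cvgrPdist_lt/(_ _ e3)[k _ /(_ k (leqnn k))/=] := gc.
  rewrite sub0r normrN => kb.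
  have {}kb := le_lt_trans (ler_norm _) kb.
  have [d d0 Hd] := (cont_rVP _ _).1 (ca k x Qx) _ e3.
  have [d1 d10 Hd1] := (open_rVP Q).1 oQ x Qx.
  exists (Num.min d d1) => [|y]; first by rewrite lt_min d0.
  rewrite lt_min => /andP[yd yd1].
  have := Hd y yd; have := al k x Qx; have := al k y (Hd1 y yd1).
  set p1 := a k y; set p2 := a k x => q1 q2 q3.
  have -> : l y - l x = - (p1 - l y) + (p1 - p2) + (p2 - l x) by ring.
  apply: (le_lt_trans (ler_normD _ _)); apply: (le_lt_trans (lerD (ler_normD _ _) (lexx _))).
  by rewrite normrN; lra.
have cU : forall x, Q x -> {for x, continuous U}.
  apply: (ulim W) => [k x Qx|k x Qx]; first exact: (class_C_cont (CW k) Qx).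
  by have [_] := HU x Qx.
have cV i : forall x, Q x -> {for x, continuous (V i)}.
  apply: (ulim (fun k => partial i (W k))) => [k x Qx|k x Qx].
    exact: (class_C_cont (class_C_partial i (CW k)) Qx).
  by have [_] := HV i x Qx.
have dU i x : Q x -> is_derive x (delta_mx ord0 i) U (V i x).
  move=> Qx; apply: is_derive_eps => e e0; have e2 : 0 < e / 2 by rewrite divr_gt0.
  have [d d0 Hd] := (cont_rVP _ _).1 (cV i x Qx) _ e2.
  have [d1 d10 Hd1] := (open_rVP Q).1 oQ x Qx.
  exists (Num.min d d1) => [|h h0]; first by rewrite lt_min d0.
  rewrite lt_min => /andP[hd hd1].
  have near s : `|s| <= `|h| -> `|s *: delta_mx ord0 i + x - x| <= `|h|.
    by move=> sh; rewrite addrK (le_trans (norm_delta_scale _ _)).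
  have Qs s : `|s| <= `|h| -> Q (s *: delta_mx ord0 i + x).
    by move=> sh; apply: Hd1; exact: le_lt_trans (near s sh) hd1.
  have Qh := Qs h (lexx _).
  have qb k : `|(W k (h *: delta_mx ord0 i + x) - W k x) - h * V i x| <= (2 * B * 2^-1 ^+ k + e / 2) * `|h|.
    have [s sh ->] := line_mvt (CW k) Qs.
    rewrite [h * _]mulrC -mulrBl normrM ler_wpM2r//.
    have := Hd _ (le_lt_trans (near s sh) hd); have [_ /(_ k)] := HV i _ (Qs s sh).
    set p1 := partial _ _ _; set p2 := V i _ => q1 q2.
    by rewrite -(subrKA p2); apply: (le_trans (ler_normD _ _)); lra.
  have lb : `|(U (h *: delta_mx ord0 i + x) - U x) - h * V i x| <= (0 + e / 2) * `|h|.
    have c1 : ((2 * B * 2^-1 ^+ k + e / 2) * `|h|)%R @[k --> \oo] --> (0 + e / 2) * `|h|.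
      by apply: cvgMl; apply: cvgD => //; exact: cvg_cst.
    have c2 : (`|(W k (h *: delta_mx ord0 i + x) - W k x) - h * V i x|)%R @[k --> \oo] -->
        `|(U (h *: delta_mx ord0 i + x) - U x) - h * V i x|.
      apply: cvg_norm; apply: cvgB; last exact: cvg_cst.
      by apply: cvgB; [have [] := HU _ Qh|have [] := HU x Qx].
    rewrite -(cvg_lim _ c1)// -(cvg_lim _ c2)//; apply: ler_lim.
    - by apply/cvg_ex; exists (`|(U (h *: delta_mx ord0 i + x) - U x) - h * V i x|).
    - by apply/cvg_ex; exists ((0 + e / 2) * `|h|).
    - exact: nearW.
  have hp : 0 < `|h| by rewrite normr_gt0.
  rewrite (_ : h^-1 * _ - _ = h^-1 * ((U (h *: delta_mx ord0 i + x) - U x) - h * V i x)); last first.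
    by rewrite [RHS]mulrBr mulKf.
  rewrite normrM normfV ltr_pdivrMl//; apply: (le_lt_trans lb).
  by rewrite add0r mulrC ltr_pM2l// gtr_pMr// invf_lt1// ltr1n.
exists U; split.
- by apply: (class_CS oQ cU dU) => i; split; [exact: cV|exact: I].
- by move=> x Qx; have [] := HU x Qx.
- by move=> x Qx; have [_ /(_ 0%N)] := HU x Qx; rewrite expr0 mulr1.
- move=> i x Qx; rewrite (partial_is_derive (dU i x Qx)).
  by have [_ /(_ 0%N)] := HV i x Qx; rewrite expr0 mulr1.
Qed.

(** Bounds a partial derivative by increments. For a quantity obtained by integrating in the scale
    [t], this avoids exchanging the derivatives in [t] and in [x]. *)
Lemma derive_bound f x i (df K : R) : is_derive x (delta_mx ord0 i) f df ->
  (exists2 d, 0 < d & forall h : R, `|h| < d -> `|f (h *: delta_mx ord0 i + x) - f x| <= K * `|h|) ->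
  `|df| <= K.
Proof.
move=> /is_derive_eps_conv D [d d0 Hd]; apply/ler_addgt0Pr => e e0.
have [d1 d10 Hd1] := D e e0.
pose h := Num.min d d1 / 2; have m0 : 0 < Num.min d d1 by rewrite lt_min d0.
have h0 : 0 < h by rewrite divr_gt0.
have hm : h < Num.min d d1 by rewrite gtr_pMr// invf_lt1// ltr1n.
move: hm; rewrite lt_min => /andP[hd hd1].
have hn0 : h != 0 by rewrite gt_eqF.
have := Hd1 h hn0; rewrite gtr0_norm// => /(_ hd1).
have := Hd h; rewrite gtr0_norm// => /(_ hd) Hh q.
set Z := f _ - f _ in Hh q.
have Zh : `|h^-1 * Z| <= K by rewrite normrM gtr0_norm ?invr_gt0// ler_pdivrMl// mulrC.
have -> : df = h^-1 * Z - (h^-1 * Z - df) by rewrite subKr.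
by apply: (le_trans (ler_normB _ _)); apply: lerD => //; exact: ltW.
Qed.

End C1_limit.

(** * Potential estimates through dyadic scales *)

Section potential.
Context {R : realType} {n : nat}.
Implicit Types (w g k : 'rV[R]_n -> R) (x y z : 'rV[R]_n) (t r : R).
Local Notation mu := (@lebesgue_rV R n).

Lemma conv_local_bound k g x (T K : R) : L1 g -> measurable_fun setT k -> (forall z, `|k z| <= K) ->
  (forall z, T <= `|z| -> k z = 0) ->
  `|conv k g x| <= K * \int[mu]_y (\1_(cube x T) y * `|g y|).
Proof.
move=> Lg mk kK sk; have Lc := conv_L1 x Lg mk kK.
have Lb : L1 (fun y => \1_(cube x T) y * `|g y|).
  apply: L1_le (L1_norm Lg).
    apply: measurable_funM; first exact: measurable_indic (measurable_cube _ _).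
    by apply: measurableT_comp => //; exact: L1_measurable.
  move=> y; rewrite normrM normr_id indicE ler_piMl//.
  by case: (_ \in _); rewrite ?normr1 ?normr0.
apply: (le_trans (le_normr_Rintegral measurableT Lc)).
rewrite -RintegralZl//; apply: (Rintegral_le (L1_norm Lc) (L1Z K Lb)) => y.
have K0 : 0 <= K by exact: le_trans (kK 0).
rewrite indicE normrM; have [|] := boolP (y \in cube x T).
  by move=> _; rewrite mul1r mulrC ler_wpM2r.
rewrite notin_setE /cube/= => /negP; rewrite -leNgt distrC => Ty.
by rewrite sk// normr0 mulr0 mul0r mulr0.
Qed.

Lemma lap_ker_continuous j t : continuous (@lap_ker R n j t).
Proof.
have -> : @lap_ker R n j t = (fun z => \sum_i partial i (partial i (ker j t)) z).
  by apply/funext => z; exact: lap_kerE.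
have C : class_C 0 setT (fun z => \sum_i partial i (partial i (@ker R n j t)) z).
  apply: (class_C_sum _ openT) => i.
  exact: (class_C_partial i (class_C_partial i (class_C_ker 2 j t))).
by move=> z; exact: (class_C_cont C).
Qed.

Lemma conv_pmollE t g x : 0 < t -> L1 g ->
  conv (pmoll t) g x = (@moll_mass R n)^-1 * t ^- n * conv (ker 0 t) g x.
Proof. by move=> t0 Lg; rewrite pmollE (conv_scalek (@cker R n 0 t) (supp_in_ker 0 t0)). Qed.

(** The derivative of the kernel in [t] is [t] times the Laplacian of [pmoll t]; on [w] the equation
    turns this Laplacian into a convolution with [g], without any regularity of [w]. *)
Lemma is_derive_conv_moll t w g r x : 0 < t -> L1 w -> L1 g -> kernel_poisson 0 r w g ->
  `|x| + t <= r ->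
  is_derive t 1 (fun t => conv (moll t) w x) (- t * conv (pmoll t) g x).
Proof.
move=> t0 Lw Lg HP xr; have [C C0 HC] := @lap_ker_bounded R n 0.
have M0 : 0 < (@moll_mass R n)^-1 by rewrite invr_gt0 moll_mass_gt0.
pose u := t / 2; pose v := t * 2.
have u0 : 0 < u by rewrite divr_gt0.
have uv : u < t < v by rewrite gtr_pMr// invf_lt1// ltr_pMr// ltr1n.
pose K := v * ((@moll_mass R n)^-1 * (u ^- n * (C / u ^+ 2))).
have L h : 0 < h -> L1 (fun y => w y * lap_ker 0 h (x - y)).
  move=> h0; apply: (conv_L1 x Lw); last by move=> z; exact: HC.
  exact: (continuousT_measurable_rV (@lap_ker_continuous 0 h)).
have := @is_derive_under R n (fun s y => w y * moll s (x - y))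
  (fun s y => w y * (s * ((@moll_mass R n)^-1 * (s ^- n * lap_ker 0 s (x - y)))))
  (fun y => K * `|w y|) t u v uv.
have -> : \int[mu]_y (w y * (t * ((@moll_mass R n)^-1 * (t ^- n * lap_ker 0 t (x - y))))) =
    - t * conv (pmoll t) g x.
  transitivity (t * ((@moll_mass R n)^-1 * t ^- n) * conv (lap_ker 0 t) w x).
    rewrite /conv -RintegralZl//; last exact: L.
    by apply: eq_Rintegral => y _; ring.
  by rewrite HP// conv_pmollE//; ring.
apply.
- move=> h /andP[uh hv]; have h0 : 0 < h by exact: lt_trans uh.
  exact: (convL1 (@continuous_moll R n h) (supp_in_moll h0) x Lw).
- move=> h y /andP[uh hv]; have h0 : 0 < h by exact: lt_trans uh.
  have := is_derive_mul (is_derive_const (w y) h 1) (is_derive_moll (x - y) (lt0r_neq0 h0)).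
  by rewrite mul0r addr0.
- by apply: L1Z; exact: L1_norm.
- move=> h y /andP[uh hv]; have h0 : 0 < h by exact: lt_trans uh.
  rewrite normrM mulrC; apply: ler_wpM2r => //.
  rewrite normrM normrM normrM gtr0_norm// (gtr0_norm M0) [`|h ^- n|]gtr0_norm; last first.
    by rewrite invr_gt0 exprn_gt0.
  apply: ler_pM; rewrite ?(ltW h0) ?(ltW hv)//.
    by rewrite mulr_ge0 ?(ltW M0)// mulr_ge0// invr_ge0 exprn_ge0// ltW.
  apply: (ler_wpM2l (ltW M0)); apply: ler_pM => //.
  - by rewrite invr_ge0 exprn_ge0// ltW.
  - by rewrite lef_pV2 ?posrE ?exprn_gt0//; apply: lerXn2r; rewrite ?nnegrE ltW.
  - apply: (le_trans (HC h (x - y) h0)); rewrite ler_pM2l//.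
    by rewrite lef_pV2 ?posrE ?exprn_gt0//; apply: lerXn2r; rewrite ?nnegrE ltW.
Qed.

(** The ratio is 4, so that the square roots of the scales are the powers [2^-j]. *)
Definition dyadic r j : R := r / 2 * 4^-1 ^+ j.

Lemma dyadic_gt0 r j : 0 < r -> 0 < dyadic r j.
Proof. by move=> r0; rewrite mulr_gt0 ?divr_gt0// exprn_gt0. Qed.

Lemma dyadicS r j : dyadic r j.+1 = dyadic r j / 4.
Proof. by rewrite /dyadic exprSr mulrA. Qed.

Lemma dyadic_le r j : 0 < r -> dyadic r j <= r / 2.
Proof. by move=> r0; rewrite ler_piMr ?divr_ge0 ?(ltW r0)// exprn_ile1// invf_le1// ler1n. Qed.

(** The mass of [|g|] in a cube of radius [s] is at most of order [s^(n - 1/2)]. Half a power is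
    lost with respect to bounded functions, and half a power of decay remains for the increments of
    the gradient. *)
Definition morrey r (Gam : R) g := forall j x, `|x| < r / 2 ->
  \int[mu]_y (\1_(cube x (dyadic r j)) y * `|g y|) <= Gam * ((4^-1 ^+ j) ^+ n * 2 ^+ j).

(* The mollifications of w at the scales of [dyadic] form a Cauchy sequence in C^1:
   their increments are potentials of g at one scale, small by the Morrey bound. *)
Lemma potential_C1 r : 0 < r -> exists2 C : R, 0 < C & forall w g (Gam : R),
  L1 w -> L1 g -> 0 <= Gam -> kernel_poisson 0 r w g -> morrey r Gam g ->
  exists U, [/\ class_C 1 (cube 0 (r / 2)) U,
    {ae mu, forall x, cube 0 (r / 2) x -> U x = w x},
    forall x, cube 0 (r / 2) x -> `|U x| <= C * (Gam + \int[mu]_y `|w y|) &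
    forall i x, cube 0 (r / 2) x -> `|partial i U x| <= C * (Gam + \int[mu]_y `|w y|)].
Proof.
move=> r0; set Q := cube 0 (r / 2).
have t00 : 0 < r / 2 by rewrite divr_gt0.
set m := (@moll_mass R n)^-1; have m0 : 0 < m by rewrite invr_gt0 moll_mass_gt0.
have [C0 C00 HC0] := @ker_bounded R n 0.
have [C1 C10 HC1] := @ker_bounded R n 1.
have [K0 K00 HK0] := supp_in_bounded (@continuous_moll R n (r / 2)) (supp_in_moll t00).
have [K1' K1'0 HK1'] := @partial_ker_bounded R n 1 _ t00.
pose K1 := `|m * (- 2 * (r / 2) ^- n)| * K1'.
have K10 : 0 <= K1 by rewrite mulr_ge0// ltW.
pose q0 := (r / 2) ^- n * 4 ^+ n : R; have q00 : 0 < q0 by rewrite mulr_gt0 ?invr_gt0 ?exprn_gt0.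
pose A0 := m * q0 * C0; have A00 : 0 <= A0 by apply: mulr_ge0; [apply: mulr_ge0; exact: ltW|exact: ltW].
have X2 j : 0 <= 2 ^+ j :> R by exact: exprn_ge0.
have X4 j : 0 <= 4 ^+ j :> R by exact: exprn_ge0.
pose A1 := m * q0 * (C1 * (2 * (4 / (r / 2)))).
have A10 : 0 <= A1.
  apply: mulr_ge0; first by apply: mulr_ge0; exact: ltW.
  by apply: mulr_ge0; [exact: ltW|apply: mulr_ge0 => //; apply: divr_ge0 => //; exact: ltW].
have rr0 : 0 <= (r / 2) ^+ 2 by exact: sqr_ge0.
pose A := (r / 2) ^+ 2 * (A0 + A1).
have AA : 0 <= A by rewrite mulr_ge0// addr_ge0.
exists (K0 + K1 + 2 * A); first by apply: ltr_wpDr; [exact: mulr_ge0|exact: ltr_wpDr].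
move=> w g Gam Lw Lg G0 HP Mg.
pose W j := conv (moll (dyadic r j)) w.
have d0 j := dyadic_gt0 j r0.
have dr j := dyadic_le j r0.
have dS j : dyadic r j.+1 <= dyadic r j by rewrite dyadicS ler_piMr ?(ltW (d0 j))// invf_le1// ler1n.
have CW j (l : nat) : class_C l setT (W j) by exact: class_C_conv_moll.
have oQ : open Q by exact: open_cube.
have Qn x : Q x -> `|x| < r / 2 by rewrite /Q /cube/= subr0.
(* The volume factors cancel: after normalization by [t ^- n], only the growth [2 ^+ j] of the
   potential at scale [j] is left. *)
have sc j : (dyadic r j.+1) ^- n * ((4^-1 ^+ j) ^+ n * 2 ^+ j) = q0 * 2 ^+ j.
  have dn : (4^-1 ^+ j) ^+ n != 0 :> R by rewrite expf_neq0// expf_neq0// invr_eq0.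
  rewrite /q0 /dyadic exprS; move: dn; set d := 4^-1 ^+ j => dn.
  rewrite exprMn invfM -!mulrA; congr (_ * _).
  by rewrite exprMn invfM exprVn invrK -mulrA mulKf.
have inv_le j t : dyadic r j.+1 <= t -> t ^- n <= (dyadic r j.+1) ^- n.
  move=> dt; rewrite lef_pV2 ?posrE ?exprn_gt0//; last exact: lt_le_trans dt.
  by apply: lerXn2r; rewrite ?nnegrE ?(ltW (d0 _))// (le_trans (ltW (d0 j.+1))).
have cpm t : measurable_fun setT (@pmoll R n t).
  by apply: continuousT_measurable_rV => z; exact: (class_C_cont (class_C_pmoll 0 t)).
have qb j t x : `|x| < r / 2 -> dyadic r j.+1 <= t <= dyadic r j ->
    `|conv (pmoll t) g x| <= A0 * Gam * 2 ^+ j.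
  move=> xr /andP[dt td]; have t0 : 0 < t by exact: lt_le_trans dt.
  have tn0 : 0 < t ^- n by rewrite invr_gt0 exprn_gt0.
  have := @conv_local_bound (pmoll t) g x (dyadic r j) (m * ((dyadic r j.+1) ^- n * C0)) Lg (cpm t).
  have b1 z : `|pmoll t z| <= m * ((dyadic r j.+1) ^- n * C0).
    rewrite /pmoll -/m [`|m * _|]normrM [`|t ^- n * _|]normrM (gtr0_norm m0) (gtr0_norm tn0); apply: (ler_wpM2l (ltW m0)).
    by apply: ler_pM => //; [exact: ltW|exact: inv_le|exact: HC0].
  have b2 z : dyadic r j <= `|z| -> pmoll t z = 0.
    by move=> dz; rewrite /pmoll ker_eq0 ?mulr0// (le_trans td).
  move=> /(_ b1 b2) /le_trans; apply.
  have mC : 0 <= m * ((dyadic r j.+1) ^- n * C0).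
    by rewrite mulr_ge0 ?(ltW m0)// mulr_ge0 ?(ltW C00)// invr_ge0 exprn_ge0// ltW.
  apply: (le_trans (ler_wpM2l mC (Mg j x xr))).
  rewrite le_eqVlt; apply/orP; left; apply/eqP.
  transitivity (m * C0 * Gam * ((dyadic r j.+1) ^- n * ((4^-1 ^+ j) ^+ n * 2 ^+ j))); first by ring.
  by rewrite sc /A0; ring.
have dpm t i z : partial i (@pmoll R n t) z = m * t ^- n * partial i (ker 0 t) z.
  by rewrite pmollE; exact: (partialZ _ i (class_C_ker 1 0 t) (I : setT z)).
(* One derivative of the kernel costs a factor [4 ^+ j]. Integrating against [t] over a scale
   contributes [16^-j], so that [2^-j] remains. *)
have dqb j t x i : `|x| < r / 2 -> dyadic r j.+1 <= t <= dyadic r j ->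
    `|partial i (conv (pmoll t) g) x| <= A1 * Gam * (2 ^+ j * 4 ^+ j).
  move=> xr /andP[dt td]; have t0 : 0 < t by exact: lt_le_trans dt.
  have tn0 : 0 < t ^- n by rewrite invr_gt0 exprn_gt0.
  rewrite (partial_conv i x Lg (class_C_pmoll 1 t) (supp_in_pmoll t0)).
  have mdp : measurable_fun setT (partial i (@pmoll R n t)).
    by apply: continuousT_measurable_rV => z; exact: (class_C_cont (class_C_partial i (class_C_pmoll 1 t))).
  have := @conv_local_bound (partial i (pmoll t)) g x (dyadic r j)
    (m * ((dyadic r j.+1) ^- n * (C1 * (2 / dyadic r j.+1)))) Lg mdp.
  have b1 z : `|partial i (pmoll t) z| <= m * ((dyadic r j.+1) ^- n * (C1 * (2 / dyadic r j.+1))).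
    rewrite dpm -mulrA !normrM (gtr0_norm m0) (gtr0_norm tn0); apply: (ler_wpM2l (ltW m0)).
    apply: ler_pM => //; [exact: ltW|exact: inv_le|].
    rewrite partial_ker/=; have [tz|tz] := leP t `|z|.
      rewrite ker_eq0// mul0r normr0; apply: mulr_ge0; first exact: ltW.
      by rewrite divr_ge0// ltW.
    rewrite normrM; apply: ler_pM => //; first exact: HC1.
    apply: (@le_trans _ _ (2 / t)); last by rewrite ler_pM2l// lef_pV2 ?posrE.
    rewrite normrM normrM (@ger0_norm _ 2)// [`|_^-1|]gtr0_norm ?invr_gt0 ?exprn_gt0//.
    rewrite ler_pdivrMr ?exprn_gt0// (_ : 2 / t * t ^+ 2 = 2 * t); last by field; rewrite gt_eqF.
    by rewrite ler_pM2l// (le_trans (coord_le_norm z i))// ltW.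
  have b2 z : dyadic r j <= `|z| -> partial i (pmoll t) z = 0.
    by move=> dz; rewrite dpm partial_ker/= ker_eq0 ?mul0r ?mulr0// (le_trans td).
  move=> /(_ b1 b2) /le_trans; apply.
  have mC : 0 <= m * ((dyadic r j.+1) ^- n * (C1 * (2 / dyadic r j.+1))).
    apply: mulr_ge0; first exact: ltW.
    apply: mulr_ge0; first by rewrite invr_ge0 exprn_ge0// ltW.
    by apply: mulr_ge0; [exact: ltW|rewrite divr_ge0// ltW].
  apply: (le_trans (ler_wpM2l mC (Mg j x xr))).
  rewrite le_eqVlt; apply/orP; left; apply/eqP.
  transitivity (m * (C1 * (2 / dyadic r j.+1)) * Gam * ((dyadic r j.+1) ^- n * ((4^-1 ^+ j) ^+ n * 2 ^+ j))); first by ring.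
  rewrite sc /A1 (_ : (dyadic r j.+1)^-1 = 4 / (r / 2) * 4 ^+ j); first by ring.
  by rewrite /dyadic exprS exprVn !invfM !invrK; ring.
have dW j t x : `|x| < r / 2 -> dyadic r j.+1 <= t <= dyadic r j ->
    is_derive t 1 (fun t => conv (moll t) w x) (- t * conv (pmoll t) g x).
  move=> xr /andP[dt td]; have t0 : 0 < t by exact: lt_le_trans dt.
  by apply: (is_derive_conv_moll t0 Lw Lg HP); have := dr j; lra.
have e16 j : dyadic r j * dyadic r j = (r / 2) ^+ 2 * (4^-1 ^+ j * 4^-1 ^+ j).
  by rewrite /dyadic; ring.
have p4 j : 0 <= 4^-1 ^+ j :> R by rewrite exprn_ge0.
have len j : dyadic r j - dyadic r j.+1 <= dyadic r j by rewrite gerBl ltW.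
have i24 j : 2^-1 ^+ j = 2 ^+ j * 4^-1 ^+ j :> R.
  by rewrite -exprMn; congr (_ ^+ _); field.
have HW j x : Q x -> `|W j x - W j.+1 x| <= A * Gam * 2^-1 ^+ j.
  move=> /Qn xr.
  have := @mvt_abs R (fun t => conv (moll t) w x) (fun t => - t * conv (pmoll t) g x)
    (dyadic r j.+1) (dyadic r j) (dyadic r j * (A0 * Gam * 2 ^+ j)) (dS j).
  move=> /(_ (fun t => dW j t x xr)) H.
  have A0G : 0 <= A0 * Gam * 2 ^+ j by apply: mulr_ge0 => //; exact: mulr_ge0.
  apply: (le_trans (H _)).
    move=> t /[dup] tt /andP[dt td]; have t0 : 0 < t by exact: lt_le_trans dt.
    by rewrite normrM normrN (gtr0_norm t0); apply: ler_pM => //; [exact: ltW|exact: qb].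
  apply: (@le_trans _ _ (dyadic r j * (A0 * Gam * 2 ^+ j) * dyadic r j)).
    by apply: ler_wpM2l => //; rewrite mulr_ge0// ltW.
  rewrite (_ : dyadic r j * _ * _ = (A0 * Gam * 2 ^+ j) * (dyadic r j * dyadic r j)); last by ring.
  rewrite e16 i24 /A.
  have f1 : 4^-1 ^+ j * 4^-1 ^+ j <= 4^-1 ^+ j :> R.
    by rewrite ler_piMr// exprn_ile1// invf_le1// ler1n.
  apply: (@le_trans _ _ ((A0 * Gam * 2 ^+ j) * ((r / 2) ^+ 2 * 4^-1 ^+ j))).
    by apply: (ler_wpM2l A0G); exact: ler_wpM2l.
  rewrite (_ : _ * (A0 + A1) * Gam * _ = A0 * Gam * 2 ^+ j * ((r / 2) ^+ 2 * 4^-1 ^+ j) +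
     A1 * Gam * 2 ^+ j * ((r / 2) ^+ 2 * 4^-1 ^+ j)); last by ring.
  by rewrite lerDl; apply: mulr_ge0; [apply: mulr_ge0 => //; exact: mulr_ge0|exact: mulr_ge0].
(* Increments in both variables: the mean value theorem in the scale [t], then along a line in [x]
   for the potential. *)
have HdW j i x : Q x -> `|partial i (W j) x - partial i (W j.+1) x| <= A * Gam * 2^-1 ^+ j.
  move=> Qx; have xr := Qn x Qx.
  have D : is_derive x (delta_mx ord0 i) (fun x => W j x + - 1 * W j.+1 x) (partial i (W j) x - partial i (W j.+1) x).
    have D2 := is_derive_mul (is_derive_const (-1) x (delta_mx ord0 i)) (class_C_derive i (CW j.+1 1%N) (I : setT x)).
    rewrite mul0r addr0 mulN1r in D2.
    exact: (is_derive_add (class_C_derive i (CW j 1%N) (I : setT x)) D2).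
  apply: (derive_bound D).
  have [d d00 Hd] := (open_rVP Q).1 oQ x Qx.
  exists d => // h hd.
  have Qs s : `|s| <= `|h| -> Q (s *: delta_mx ord0 i + x).
    move=> sh; apply: Hd; rewrite addrK; apply: le_lt_trans hd.
    by apply: le_trans (norm_delta_scale _ _) sh.
  set xh := h *: delta_mx ord0 i + x; have Qh : Q xh by exact: Qs.
  have xhr := Qn xh Qh.
  have Dt t : dyadic r j.+1 <= t <= dyadic r j ->
      is_derive t 1 (fun t => conv (moll t) w xh + -1 * conv (moll t) w x)
        (- t * (conv (pmoll t) g xh - conv (pmoll t) g x)).
    move=> tt; have D1 := dW j t xh xhr tt; have D2 := dW j t x xr tt.
    have D3 := is_derive_mul (is_derive_const (-1) t 1) D2.
    have := is_derive_add D1 D3.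
    by rewrite mul0r addr0 mulN1r -mulrBr.
  have := @mvt_abs R _ _ (dyadic r j.+1) (dyadic r j) (dyadic r j * (A1 * Gam * (2 ^+ j * 4 ^+ j) * `|h|)) (dS j) Dt.
  have A1G : 0 <= A1 * Gam * (2 ^+ j * 4 ^+ j) by apply: mulr_ge0; exact: mulr_ge0.
  have alg (b1 b2 b3 b4 : R) : b1 + -1 * b2 - (b3 + -1 * b4) = b1 + -1 * b3 - (b2 + -1 * b4) by ring.
  move=> H; rewrite /W alg.
  apply: (le_trans (H _)).
    move=> t /[dup] tt /andP[dt td]; have t0 : 0 < t by exact: lt_le_trans dt.
    rewrite normrM normrN (gtr0_norm t0); apply: ler_pM => //; first exact: ltW.
    have Cq : class_C 1 Q (conv (pmoll t) g).
      by apply: class_C_sub (class_C_conv Lg (class_C_pmoll 1 t) (supp_in_pmoll t0)).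
    have [s sh ->] := line_mvt Cq Qs.
    by rewrite normrM ler_wpM2r//; apply: dqb => //; exact/Qn/Qs.
  apply: (@le_trans _ _ (dyadic r j * (A1 * Gam * (2 ^+ j * 4 ^+ j) * `|h|) * dyadic r j)).
    by apply: ler_wpM2l => //; rewrite mulr_ge0 ?(ltW (d0 j))// mulr_ge0.
  rewrite (_ : dyadic r j * _ * _ = (A1 * Gam * (2 ^+ j * 4 ^+ j)) * (dyadic r j * dyadic r j) * `|h|); last by ring.
  rewrite ler_wpM2r// e16 i24.
  have f1 : 4 ^+ j * 4^-1 ^+ j = 1 :> R by rewrite -exprMn mulfV// expr1n.
  rewrite (_ : A1 * Gam * (2 ^+ j * 4 ^+ j) * _ = A1 * Gam * 2 ^+ j * ((r / 2) ^+ 2 * 4^-1 ^+ j) * (4 ^+ j * 4^-1 ^+ j)); last by ring.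
  rewrite f1 mulr1 /A.
  rewrite (_ : _ * (A0 + A1) * Gam * _ = A0 * Gam * 2 ^+ j * ((r / 2) ^+ 2 * 4^-1 ^+ j) +
     A1 * Gam * 2 ^+ j * ((r / 2) ^+ 2 * 4^-1 ^+ j)); last by ring.
  by rewrite lerDr; apply: mulr_ge0; [apply: mulr_ge0 => //; exact: mulr_ge0|exact: mulr_ge0].
have CWQ (l : nat) : class_C 1 Q (W l) by apply: class_C_sub (CW l 1%N).
have [U [CU cU bU bdU]] := C1_limit oQ (mulr_ge0 AA G0) CWQ HW HdW.
have Iw0 : 0 <= \int[mu]_y `|w y| by apply: Rintegral_ge0.
have dyad0 : dyadic r 0 = r / 2 by rewrite /dyadic expr0 mulr1.
exists U; split => //.
- have tc : dyadic r k @[k --> \oo] --> (0 : R).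
    rewrite -[X in _ --> X](mulr0 (r / 2)); apply: cvgMr; apply: cvg_expr.
    by rewrite ger0_norm ?invr_ge0// invf_lt1// ltr1n.
  have [s sk Wc] := ae_moll_subseq Lw d0 tc.
  apply: filterS Wc => x Wx Qx.
  exact: (cvg_unique_real (cvg_subseq sk (cU x Qx)) Wx).
- move=> x Qx; have := bU x Qx.
  have : `|W 0%N x| <= K0 * \int[mu]_y `|w y|.
    have Lc := convL1 (@continuous_moll R n (r / 2)) (supp_in_moll t00) x Lw.
    rewrite /W dyad0; apply: (le_trans (le_normr_Rintegral measurableT Lc)).
    rewrite -RintegralZl//; last exact: L1_norm.
    apply: (Rintegral_le (L1_norm Lc) (L1Z K0 (L1_norm Lw))) => y.
    by rewrite normrM mulrC ler_wpM2r.
  have -> : U x = W 0%N x - (W 0%N x - U x) by rewrite subKr.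
  set a1 := W 0%N x; set a2 := a1 - U x => h1 h2; rewrite subKr in h2; apply: (le_trans (ler_normB _ _)).
  set J := \int[mu]_y `|w y| in Iw0 h1 *.
  have h3 : 0 <= K1 * (Gam + J) by rewrite mulr_ge0// addr_ge0.
  have h4 : 0 <= K0 * Gam by rewrite mulr_ge0// ltW.
  have h5 : 0 <= A * J by rewrite mulr_ge0.
  by rewrite !mulrDl !mulrDr in h3 *; lra.
- move=> i x Qx; have := bdU i x Qx.
  have : `|partial i (W 0%N) x| <= K1 * \int[mu]_y `|w y|.
    have cdm : continuous (partial i (@moll R n (r / 2))).
      by move=> z; exact: (class_C_cont (class_C_partial i (class_C_moll 1 (r / 2)))).
    have Lc := convL1 cdm (supp_in_partial i (supp_in_moll t00)) x Lw.
    rewrite /W dyad0 (partial_conv i x Lw (class_C_moll 1 _) (supp_in_moll t00)).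
    apply: (le_trans (le_normr_Rintegral measurableT Lc)).
    rewrite -RintegralZl//; last exact: L1_norm.
    apply: (Rintegral_le (L1_norm Lc) (L1Z K1 (L1_norm Lw))) => y.
    rewrite normrM mulrC ler_wpM2r// partial_moll normrM /K1 -/m.
    by apply: ler_pM => //; rewrite mulrA.
  have -> : partial i U x = partial i (W 0%N) x - (partial i (W 0%N) x - partial i U x) by rewrite subKr.
  set a1 := partial i (W 0%N) x; set a2 := a1 - partial i U x => h1 h2; rewrite subKr in h2; apply: (le_trans (ler_normB _ _)).
  set J := \int[mu]_y `|w y| in Iw0 h1 *.
  have h3 : 0 <= K0 * (Gam + J) by rewrite mulr_ge0 ?(ltW K00)// addr_ge0.
  have h4 : 0 <= K1 * Gam by rewrite mulr_ge0.
  have h5 : 0 <= A * J by rewrite mulr_ge0.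
  by rewrite !mulrDl !mulrDr in h3 *; lra.
Qed.

End potential.

(** * The local estimate on the unit cube *)

Section local_estimate.
Context {R : realType} {n : nat}.
Implicit Types (w g f : 'rV[R]_n -> R) (G : 'I_n -> 'rV[R]_n -> R) (x z : 'rV[R]_n) (r t : R).
Local Notation mu := (@lebesgue_rV R n).

Definition cut r f : 'rV[R]_n -> R := fun x => \1_(cube 0 r) x * f x.

Lemma cut_in r f x : `|x| < r -> cut r f x = f x.
Proof. by move=> xr; rewrite /cut indicE mem_set ?mul1r// /cube/= subr0. Qed.

Lemma cut_out r f x : r <= `|x| -> cut r f x = 0.
Proof. by move=> xr; rewrite /cut indicE memNset ?mul0r// /cube/= subr0 => /(le_lt_trans xr); rewrite ltxx. Qed.

Lemma cutP r f x : {`|x| < r /\ cut r f x = f x} + {r <= `|x| /\ cut r f x = 0}.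
Proof.
have [xr|xr] := ltP `|x| r; [left|right]; split => //; first exact: cut_in.
exact: cut_out.
Qed.

Lemma measurable_cut r f : measurable_fun setT f -> measurable_fun setT (cut r f).
Proof. by move=> mf; apply: measurable_funM => //; exact: measurable_indic (measurable_cube _ _). Qed.

Lemma cut_norm_le r f x : `|cut r f x| <= `|f x|.
Proof. by case: (cutP r f x) => -[_ ->] //; rewrite normr0. Qed.

Lemma L1_cut r f : L1 f -> L1 (cut r f).
Proof.
move=> Lf; apply: L1_le (L1_norm Lf); first exact: (measurable_cut r (L1_measurable Lf)).
by move=> x; exact: cut_norm_le.
Qed.

Lemma cut_cut r s f : r <= s -> cut r (cut s f) = cut r f.
Proof.
move=> rs; apply/funext => x; case: (cutP r (cut s f) x) => -[xr ->].
  by rewrite cut_in ?(cut_in _ xr)// (lt_le_trans xr).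
by rewrite cut_out.
Qed.

Lemma lap_ker_eq0 j t z : 0 < t -> t <= `|z| -> lap_ker j t z = 0.
Proof. by move=> t0 tz; rewrite /lap_ker !ker_eq0// !mulr0 addr0. Qed.

Lemma kernel_poisson_cut j r s w g : s <= r -> kernel_poisson j r w g ->
  kernel_poisson j s (cut s w) (cut s g).
Proof.
move=> sr H t x t0 xs.
have e1 f := @conv_cut R n (lap_ker j t) f t s x (fun z tz => lap_ker_eq0 j t0 tz) xs.
have e2 f := @conv_cut R n (ker j t) f t s x (fun z tz => ker_eq0 j t0 tz) xs.
by rewrite /cut e1 e2; apply: H => //; exact: le_trans xs sr.
Qed.

Lemma cut_powR r f x (s : R) : 0 < s -> `|cut r f x| `^ s = cut r (fun x => `|f x| `^ s) x.
Proof.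
move=> s0; case: (cutP r f x) => -[xr ->].
  by rewrite cut_in.
by rewrite cut_out// normr0 powR0// gt_eqF.
Qed.

Lemma cube_holder w x t (s q : R) : 0 < t -> 0 < s -> s < q -> measurable_fun setT w ->
  L1 (fun y => `|w y| `^ q) ->
  L1 (fun y => \1_(cube x t) y * `|w y| `^ s) /\
  \int[mu]_y (\1_(cube x t) y * `|w y| `^ s) <=
    (\int[mu]_y `|w y| `^ q) `^ (s / q) * ((2 * t) ^+ n) `^ (1 - s / q).
Proof.
move=> t0 s0 sq mw Lq; have q0 : 0 < q by exact: lt_trans sq.
have a0 : 0 < s / q by rewrite divr_gt0.
have b0 : 0 < 1 - s / q by rewrite subr_gt0 ltr_pdivrMr// mul1r.
have [LH] := holder_Rintegral Lq (L1_cube x t0) (fun y => powR_ge0 _ _) (fun y => ler0n _ _) a0 b0 (subrKC _ _).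
rewrite (Rintegral_cube x t0) => HH.
have E y : \1_(cube x t) y * `|w y| `^ s = (`|w y| `^ q) `^ (s / q) * \1_(cube x t) y `^ (1 - s / q).
  rewrite -powRrM [q * _]mulrC divfK ?gt_eqF// indicE; case: (y \in _).
    by rewrite powR1 mul1r mulr1.
  by rewrite powR0 ?mul0r ?mulr0// gt_eqF.
split; first by move: LH; congr (L1 _); apply/funext => y; rewrite E.
by apply: le_trans HH; rewrite le_eqVlt; apply/orP; left; apply/eqP; apply: eq_Rintegral => y _; exact: E.
Qed.

(** Hoelder's inequality on a cube leaves the power [1 - e] of its volume; for [n * e <= 1/2] the
    lost factor [4^(j n e)] is at most [2^j], which is what [morrey] allows. *)
Lemma dyadic_gain j (e : R) : 0 <= e -> n%:R * e <= 2^-1 ->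
  ((4^-1 ^+ j) ^+ n) `^ (1 - e) <= (4^-1 ^+ j) ^+ n * 2 ^+ j :> R.
Proof.
move=> e0 ne; have d0 : 0 < (4^-1 ^+ j) ^+ n :> R by rewrite exprn_gt0// exprn_gt0.
rewrite powRD; last by rewrite (gt_eqF d0) implybT.
rewrite powRr1 ?(ltW d0)// ler_pM2l//.
have -> : ((4^-1 ^+ j) ^+ n) `^ (- e) = (4 ^+ j) `^ (n%:R * e) :> R.
  rewrite -exprM exprVn -(powR_inv1 (exprn_ge0 _ _))// -powRrM mulN1r opprK exprM.
  by rewrite powRrM powR_mulrn ?exprn_ge0.
have j1 : 1 <= 4 ^+ j :> R by rewrite exprn_ege1// ler1n.
apply: (le_trans (ler_powR j1 ne)).
rewrite (_ : 4 = 2 ^+ 2 :> R); last by rewrite -natrX.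
rewrite exprAC -powR_mulrn ?exprn_ge0// -powRrM mulfV// powRr1// exprn_ge0//.
Qed.

Variables (kap A p : R).
Hypotheses (n2 : (2 <= n)%N) (kap1 : 1 < kap) (kapn : kap * (n%:R - 2) <= n%:R).
Hypotheses (A0 : 0 <= A) (p1 : 1 < p) (pkap : p + 1 <= 2 * kap).

Let D : R := 4 * n%:R + 4.
Let D0 : 0 < D. Proof. by rewrite /D ltr_wpDl ?mulr_ge0. Qed.
Let D2 : 2 <= D. Proof. by rewrite /D; have : 0 <= n%:R :> R by []; lra. Qed.
(** Radius is lost three times: from 1 to [r1] in [sobolev_weak], from [r1] to [r2] in
    [brezis_kato], and from [r2] to half of it in [potential_C1]. *)
Let r1 : R := 1 / D.
Let r2 : R := r1 / D.
Let r10 : 0 < r1. Proof. by rewrite divr_gt0. Qed.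
Let r20 : 0 < r2. Proof. by rewrite divr_gt0. Qed.
Let r11 : r1 <= 2^-1. Proof. by rewrite /r1 ler_pdivrMr// ler_pdivlMl// mulr1. Qed.
Let r21 : r2 <= r1. Proof. by rewrite /r2 ler_pdivrMr// ler_peMr ?(ltW r10)// (le_trans _ D2)// ler1n. Qed.
Let r22 : 2 * r2 <= 1. Proof. by move: r21 r11; lra. Qed.
Let kap0 : 0 < kap. Proof. by rewrite (lt_trans _ kap1). Qed.
Let k20 : 0 < 2 * kap. Proof. by rewrite mulr_gt0. Qed.
Let p0 : 0 < p. Proof. by rewrite (lt_trans _ p1). Qed.

(** Integrability of [g] is not assumed. The Poisson equation is asked only on the cube of radius
    [r1], where the Sobolev inequality makes [|w|^p] integrable. *)
Definition local_data w G g : Prop :=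
  [/\ L1 w, L1 (fun x => w x ^+ 2), (forall i, L1 (G i)) & (forall i, L1 (fun x => G i x ^+ 2))] /\
  [/\ kernel_gradient 1 w G, (forall j, kernel_poisson j r1 w g), measurable_fun setT g &
      forall x, `|g x| <= A * (`|w x| + `|w x| `^ p)].

Definition core_radius : R := r2 / 2.

Lemma core_radius_gt0 : 0 < core_radius. Proof. by rewrite divr_gt0. Qed.

Lemma local_sobolev : exists2 C : R, 0 < C & forall w G g, local_data w G g ->
  L1 (cut r1 (fun x => `|w x| `^ (2 * kap))) /\
  \int[mu]_x cut r1 (fun x => `|w x| `^ (2 * kap)) x <=
    (C * (\int[mu]_x w x ^+ 2 + \sum_i \int[mu]_x G i x ^+ 2)) `^ kap.
Proof.
have [C C0 HC] := @sobolev_weak R n kap n2 kap1 kapn 1 ltr01.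
by exists C => // w G g [[Lw Lw2 LG LG2] [HG HP mg gA]]; exact: HC.
Qed.

(** One Brezis-Kato step puts [w] in L^q with [q >= 2 n p]; Hoelder's inequality on cubes then gives
    the Morrey bound for both terms [|w|] and [|w|^p] of the majorant of [g]. *)
Lemma local_C1 : exists2 eps : R, 0 < eps & forall M : R, 1 <= M -> exists2 C : R, 0 < C & forall w G g,
  local_data w G g ->
  \int[mu]_x (\1_[set x | M < `|cut r1 w x|] x * `|cut r1 w x| `^ (2 * kap)) <= eps ->
  exists U, [/\ class_C 1 (cube 0 core_radius) U,
    {ae mu, forall x, cube 0 core_radius x -> U x = w x},
    forall x, cube 0 core_radius x -> `|U x| <= C * ((\int[mu]_x w x ^+ 2) `^ 2^-1 + (\int[mu]_x w x ^+ 2) `^ (p / 2)) &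
    forall i x, cube 0 core_radius x -> `|partial i U x| <= C * ((\int[mu]_x w x ^+ 2) `^ 2^-1 + (\int[mu]_x w x ^+ 2) `^ (p / 2))].
Proof.
(* Large enough that [(m + 1) * (kap - 1) > n * p], hence [q >= 2 * n * p]: then
   [n * (s / q) <= 1/2] for every [s <= p], as [dyadic_gain] requires. *)
pose m := Num.trunc (n%:R * p / (kap - 1)).
have km0 : 0 < kap - 1 by rewrite subr_gt0.
have N0 : 0 < n%:R :> R by rewrite ltr0n; exact: leq_trans n2.
pose a := bk_exp kap m; pose q := 2 * kap * (a + 1).
have a0 : 0 < a by rewrite /a /bk_exp mulr_gt0// subr_gt0 invf_lt1.
have qh : q / 2 = kap * (a + 1) by rewrite /q; field.
have qnp : 2 * (n%:R * p) <= q.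
  have mb : n%:R * p / (kap - 1) < m.+1%:R by exact: truncnS_gt.
  rewrite ltr_pdivrMr// in mb.
  have -> : q = 2 * (m.+1%:R * (kap - 1)) + 2 * kap.
    by rewrite /q /a /bk_exp; field; rewrite gt_eqF.
  by move: mb k20; set X := _ * _; set Y := m.+1%:R * _; lra.
have N1 : 1 <= n%:R :> R by rewrite ler1n; exact: leq_trans n2.
have q0 : 0 < q by rewrite mulr_gt0// addr_gt0.
have pq : p < q.
  have : p <= n%:R * p by rewrite ler_peMl// ltW.
  by move: p0 qnp; set Y := n%:R * p; lra.
have q1 : 1 < q by exact: lt_trans pq.
have es s : 0 < s -> s <= p -> n%:R * (s / q) <= 2^-1.
  move=> s0 sp; rewrite mulrA ler_pdivrMr// ler_pdivlMl//.
  by apply: le_trans qnp; rewrite ler_pM2l// ler_pM2l.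
have [CL CL0 HL] := @potential_C1 R n r2 r20.
have [eps e0 Hbk] := @brezis_kato R n kap r1 A p m n2 kap1 kapn r10 A0 p1 pkap.
exists eps => // M M1; have [CB CB0 HB] := Hbk M M1.
exists (CL * (A + 1) * (CB `^ q^-1 + CB `^ (p / q))).
  by rewrite mulr_gt0 ?addr_gt0 ?powR_gt0// mulr_gt0// ltr_wpDl.
move=> w G g Hd wM; have [[Lw Lw2 LG LG2] [HG HP mg gA]] := Hd.
have [CS CS0 HS] := local_sobolev; have [LS _] := HS w G g Hd.
pose w1 := cut r1 w; pose g1 := cut r1 g.
have L1w : L1 w1 by exact: L1_cut.
have mw := L1_measurable Lw.
have w1sq x : w1 x ^+ 2 = cut r1 (fun x => w x ^+ 2) x.
  case: (ltP `|x| r1) => xr; first by rewrite /w1 !cut_in.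
  by rewrite /w1 !cut_out// expr0n.
have L1w2 : L1 (fun x => w1 x ^+ 2).
  by under eq_fun do rewrite w1sq; exact: L1_cut.
have L1k : L1 (fun x => `|w1 x| `^ (2 * kap)).
  by under eq_fun do rewrite /w1 cut_powR//.
have g1A x : `|g1 x| <= A * (`|w1 x| + `|w1 x| `^ p).
  rewrite /g1 /w1; case: (cutP r1 w x) => -[xr ->]; first by rewrite cut_in.
  by rewrite cut_out// normr0 mulr_ge0// addr_ge0// powR_ge0.
have L1p : L1 (fun x => `|w1 x| `^ p).
  by apply: (L1_powR_interp L1w L1k) => //; [exact: ltW|apply: le_trans pkap; rewrite lerDl].
have L1g : L1 g1.
  apply: (L1_le _ g1A); first exact: measurable_cut.
  by apply: L1Z; apply: L1D => //; exact: L1_norm.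
have [LQ QB] := HB w1 g1 L1w L1w2 L1k L1g g1A (kernel_poisson_cut (lexx r1) (HP 1%N)) wM.
rewrite -/q in LQ QB.
pose w2 := cut r2 w; pose g2 := cut r2 g.
have w2E : w2 = cut r2 w1 by rewrite /w1 cut_cut.
have g2E : g2 = cut r2 g1 by rewrite /g1 cut_cut.
have L2w : L1 w2 by exact: L1_cut.
have L2g : L1 g2 by rewrite g2E; exact: L1_cut.
have m2 := L1_measurable L2w.
have w2q x : `|w2 x| `^ q = \1_(cube 0 r2) x * `|w1 x| `^ q.
  by rewrite w2E cut_powR.
have L2q : L1 (fun x => `|w2 x| `^ q) by under eq_fun do rewrite w2q.
pose S := \int[mu]_x `|w2 x| `^ q; pose X := \int[mu]_x w x ^+ 2.
have S0 : 0 <= S by apply: Rintegral_ge0 => x _; exact: powR_ge0.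
have X0 : 0 <= X by apply: Rintegral_ge0 => x _; exact: sqr_ge0.
have SX : S <= CB * X `^ (q / 2).
  have -> : S = \int[mu]_x (\1_(cube 0 r2) x * `|w1 x| `^ q).
    by apply: eq_Rintegral => x _; exact: w2q.
  apply: (le_trans QB); rewrite (ler_pM2l CB0) qh.
  apply: ler_powR_base; first by rewrite mulr_ge0 ?(ltW kap0)// addr_ge0// ltW.
    by apply: Rintegral_ge0 => x _; exact: sqr_ge0.
  apply: (Rintegral_le L1w2 Lw2) => x; rewrite w1sq.
  by case: (cutP r1 (fun x => w x ^+ 2) x) => -[_ ->] //; exact: sqr_ge0.
have Spow s : 0 < s -> S `^ (s / q) <= CB `^ (s / q) * X `^ (s / 2).
  move=> s0; apply: (@le_trans _ _ ((CB * X `^ (q / 2)) `^ (s / q))).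
    by apply: ler_powR_base => //; rewrite divr_ge0// ltW.
  rewrite (powRM _ (ltW CB0) (powR_ge0 _ _)) -powRrM [q / 2 * _]mulrC mulrA divfK; last by rewrite gt_eqF.
  exact: lexx.
have small t s : 0 < s -> s <= p -> 0 < t -> 2 * t <= 1 -> ((2 * t) ^+ n) `^ (1 - s / q) <= 1.
  move=> s0 sp t0 t1; apply: (@le_trans _ _ (1 `^ (1 - s / q))); last by rewrite powR1.
  apply: ler_powR_base.
  - rewrite subr_ge0 ler_pdivrMr// mul1r; apply: ltW; exact: le_lt_trans pq.
  - by rewrite exprn_ge0// mulr_ge0// ltW.
  - by rewrite exprn_ile1// mulr_ge0// ltW.
have r2h : 2 * (r2 / 2) <= 1.
  by rewrite mulrCA divff// mulr1; apply: le_trans r21 (le_trans r11 _); rewrite invf_le1// ler1n.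
have morr j x s : 0 < s -> s <= p ->
    \int[mu]_y (\1_(cube x (dyadic r2 j)) y * `|w2 y| `^ s) <= S `^ (s / q) * ((4^-1 ^+ j) ^+ n * 2 ^+ j).
  move=> s0 sp; have sq : s < q by exact: le_lt_trans pq.
  have [_ H] := cube_holder x (dyadic_gt0 j r20) s0 sq m2 L2q.
  apply: (le_trans H); apply: ler_wpM2l; first exact: powR_ge0.
  have e0' : 0 <= s / q by rewrite divr_ge0// ltW.
  apply: le_trans (dyadic_gain j e0' (es s s0 sp)).
  rewrite /dyadic mulrA exprMn powRM; last 2 first.
  - by rewrite exprn_ge0// mulr_ge0// divr_ge0// ltW.
  - by rewrite exprn_ge0// exprn_ge0.
  rewrite ler_piMl ?powR_ge0//; apply: small => //.
  by rewrite divr_gt0.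
pose Gam := A * (S `^ q^-1 + S `^ (p / q)).
have G0 : 0 <= Gam by exact: (mulr_ge0 A0 (addr_ge0 (powR_ge0 _ _) (powR_ge0 _ _))).
have Lc x j s : 0 < s -> s <= p -> L1 (fun y => \1_(cube x (dyadic r2 j)) y * `|w2 y| `^ s).
  move=> s0 sp; have sq : s < q by exact: le_lt_trans pq.
  by have [] := cube_holder x (dyadic_gt0 j r20) s0 sq m2 L2q.
have Mor : morrey r2 Gam g2.
  move=> j x xr.
  have [LL EL] := Rintegral_comb A A (Lc x j 1 ltr01 (ltW p1)) (Lc x j p p0 (lexx _)).
  have Lg : L1 (fun y => \1_(cube x (dyadic r2 j)) y * `|g2 y|).
    apply: L1_le (L1_norm L2g).
      apply: measurable_funM; first exact: measurable_indic (measurable_cube _ _).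
      by apply: measurableT_comp => //; exact: L1_measurable.
    move=> y; rewrite normrM normr_id indicE ler_piMl//.
    by case: (_ \in _); rewrite ?normr1 ?normr0.
  apply: (@le_trans _ _ (A * \int[mu]_y (\1_(cube x (dyadic r2 j)) y * `|w2 y| `^ 1) +
     A * \int[mu]_y (\1_(cube x (dyadic r2 j)) y * `|w2 y| `^ p))).
    rewrite -EL; apply: (Rintegral_le Lg LL) => y.
    have g2A : `|g2 y| <= A * (`|w2 y| + `|w2 y| `^ p).
      rewrite g2E w2E; case: (cutP r2 w1 y) => -[yr ->]; first by rewrite cut_in.
      by rewrite (cut_out _ yr) normr0; exact: (mulr_ge0 A0 (addr_ge0 (lexx 0) (powR_ge0 _ _))).
    have i0 : 0 <= \1_(cube x (dyadic r2 j)) y :> R by rewrite indicE.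
    apply: (le_trans (ler_wpM2l i0 g2A)); rewrite powRr1// le_eqVlt; apply/orP; left; apply/eqP; ring.
  have h1 := morr j x 1 ltr01 (ltW p1); have h2 := morr j x p p0 (lexx _).
  rewrite mul1r in h1; rewrite /Gam -mulrDr -mulrA; apply: (ler_wpM2l A0).
  by rewrite mulrDl; apply: lerD.
have [U [CU aeU bU bdU]] := HL w2 g2 Gam L2w L2g G0 (kernel_poisson_cut r21 (HP 0%N)) Mor.
have Iw : \int[mu]_y `|w2 y| <= S `^ q^-1.
  have [_ H] := cube_holder 0 r20 ltr01 q1 m2 L2q.
  have <- : \int[mu]_y (\1_(cube 0 r2) y * `|w2 y| `^ 1) = \int[mu]_y `|w2 y|.
    apply: eq_Rintegral => y _; rewrite powRr1// /w2.
    rewrite -[LHS]/(cut r2 (fun y => `|cut r2 w y|) y); case: (ltP `|y| r2) => yr; first by rewrite (cut_in _ yr).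
    by rewrite (cut_out _ yr) (cut_out w yr) normr0.
  apply: (le_trans H); rewrite mul1r ler_piMr ?powR_ge0//.
  have := small r2 1 ltr01 (ltW p1) r20; rewrite mul1r; apply.
  exact: r22.
have fin : CL * (Gam + \int[mu]_y `|w2 y|) <= CL * (A + 1) * (CB `^ q^-1 + CB `^ (p / q)) * (X `^ 2^-1 + X `^ (p / 2)).
  rewrite -!mulrA (ler_pM2l CL0).
  apply: (@le_trans _ _ ((A + 1) * (S `^ q^-1 + S `^ (p / q)))).
    rewrite [leRHS]mulrDl mul1r -/Gam lerD2l; apply: (le_trans Iw).
    by rewrite lerDl powR_ge0.
  apply: (ler_wpM2l (addr_ge0 A0 ler01)).
  have h1 := Spow 1 ltr01; have h2 := Spow p p0; rewrite !mul1r in h1.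
  apply: (le_trans (lerD h1 h2)).
  have b1 : 0 <= CB `^ q^-1 * X `^ (p / 2) by exact: (mulr_ge0 (powR_ge0 _ _) (powR_ge0 _ _)).
  have b2 : 0 <= CB `^ (p / q) * X `^ 2^-1 by exact: (mulr_ge0 (powR_ge0 _ _) (powR_ge0 _ _)).
  rewrite mulrDl !mulrDr; apply: lerD; first by rewrite lerDl.
  by rewrite lerDr.
exists U; split; [exact: CU| | |].
- apply: filterS aeU => x Ux Qx; rewrite (Ux Qx) /w2 cut_in//.
  move: Qx; rewrite /cube/= subr0 /core_radius => /lt_le_trans; apply.
  by rewrite ler_piMr ?(ltW r20)// invf_le1// ler1n.
- by move=> x Qx; exact: le_trans (bU x Qx) fin.
- by move=> i x Qx; exact: le_trans (bdU i x Qx) fin.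
Qed.

(* Small data allow the truncation level M = 1. *)
Lemma local_C1_small e : 0 < e -> exists2 del : R, 0 < del & forall w G g, local_data w G g ->
  \int[mu]_x w x ^+ 2 + \sum_i \int[mu]_x G i x ^+ 2 <= del ->
  exists U, [/\ class_C 1 (cube 0 core_radius) U,
    {ae mu, forall x, cube 0 core_radius x -> U x = w x},
    forall x, cube 0 core_radius x -> `|U x| <= e &
    forall i x, cube 0 core_radius x -> `|partial i U x| <= e].
Proof.
move=> e0; have [eps eps0 Heps] := local_C1; have [C C0 HC] := Heps 1 (lexx _).
have [CS CS0 HS] := local_sobolev.
(* Energy below [d1] puts the Sobolev norm under the threshold [eps]. Energy below [e1 ^+ 2] with
   [e1 <= 1] makes both powers of the L^2 norm at most [e1], and [C * (e1 + e1) <= e]. *)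
pose d1 := eps `^ kap^-1 / CS; pose e1 := Num.min 1 (e / (2 * C)).
have e10 : 0 < e1 by rewrite lt_min ltr01 divr_gt0// mulr_gt0.
exists (Num.min d1 (e1 ^+ 2)).
  by rewrite lt_min divr_gt0 ?powR_gt0//= exprn_gt0.
move=> w G g Hd; rewrite le_min => /andP[E1 E2].
have [[Lw Lw2 LG LG2] _] := Hd.
have SG0 : 0 <= \sum_i \int[mu]_x G i x ^+ 2.
  by apply: sumr_ge0 => i _; apply: Rintegral_ge0 => x _; exact: sqr_ge0.
have X0 : 0 <= \int[mu]_x w x ^+ 2 by apply: Rintegral_ge0 => x _; exact: sqr_ge0.
have [LS IS] := HS w G g Hd.
have mw := L1_measurable Lw.
have wM : \int[mu]_x (\1_[set x | 1 < `|cut r1 w x|] x * `|cut r1 w x| `^ (2 * kap)) <= eps.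
  have cE x : `|cut r1 w x| `^ (2 * kap) = cut r1 (fun x => `|w x| `^ (2 * kap)) x by exact: cut_powR.
  have le x : \1_[set x | 1 < `|cut r1 w x|] x * `|cut r1 w x| `^ (2 * kap) <= cut r1 (fun x => `|w x| `^ (2 * kap)) x.
    by rewrite cE indicE; case: (_ \in _); rewrite ?mul1r// mul0r -cE powR_ge0.
  apply: (@le_trans _ _ (\int[mu]_x cut r1 (fun x => `|w x| `^ (2 * kap)) x)).
    apply: (Rintegral_le _ LS le); apply: (L1_le _ _ LS).
      apply: measurable_funM; last exact: (measurable_abs_powR _ (measurable_cut r1 mw)).
      apply: measurable_indic.
      have mn : measurable_fun setT (fun x => `|cut r1 w x|) by apply: measurableT_comp => //; exact: measurable_cut.
      have := mn measurableT _ (measurable_itv `]1, +oo[).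
      by rewrite setTI; congr measurable; apply/seteqP; split => x /=; rewrite in_itv/= andbT.
    by move=> x; rewrite ger0_norm ?le// mulr_ge0 ?powR_ge0// indicE.
  apply: (le_trans IS).
  have := @ler_powR_base R kap (CS * (\int[mu]_x w x ^+ 2 + \sum_i \int[mu]_x G i x ^+ 2)) (eps `^ kap^-1) (ltW kap0).
  rewrite -powRrM mulVf ?gt_eqF// powRr1 ?(ltW eps0)//; apply.
    by rewrite mulr_ge0 ?(ltW CS0)// addr_ge0.
  by move: E1; rewrite /d1 ler_pdivlMr// mulrC.
have [U [CU aeU bU bdU]] := HC w G g Hd wM.
have Xe : C * ((\int[mu]_x w x ^+ 2) `^ 2^-1 + (\int[mu]_x w x ^+ 2) `^ (p / 2)) <= e.
  have Xe1 : \int[mu]_x w x ^+ 2 <= e1 ^+ 2 by apply: le_trans E2; rewrite lerDl.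
  have h s : 1 <= s -> (\int[mu]_x w x ^+ 2) `^ (s / 2) <= e1.
    move=> s1; have s20 : 0 <= s / 2 by rewrite divr_ge0// (le_trans ler01).
    apply: (le_trans (ler_powR_base s20 X0 Xe1)).
    rewrite -powR_mulrn ?(ltW e10)// -powRrM mulrCA divff// mulr1.
    apply: ge1r_powR => //; rewrite e10/= /e1 ge_min lexx//.
  have h1 := h 1 (lexx _); have h2 := h p (ltW p1); rewrite mul1r in h1.
  have e1e : e1 <= e / (2 * C) by rewrite /e1 ge_min lexx orbT.
  rewrite ler_pdivlMr ?mulr_gt0// in e1e.
  have h3 : C * ((\int[mu]_x w x ^+ 2) `^ 2^-1 + (\int[mu]_x w x ^+ 2) `^ (p / 2)) <= C * (e1 + e1).
    by rewrite ler_pM2l// lerD.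
  by apply: (le_trans h3); rewrite (_ : C * (e1 + e1) = e1 * (2 * C))//; ring.
exists U; split => //.
- by move=> x Qx; exact: le_trans (bU x Qx) Xe.
- by move=> i x Qx; exact: le_trans (bdU i x Qx) Xe.
Qed.

(* Large data are absorbed by raising the truncation level M. *)
Lemma local_C1_exists w G g : local_data w G g ->
  exists2 U, class_C 1 (cube 0 core_radius) U &
    {ae mu, forall x, cube 0 core_radius x -> U x = w x}.
Proof.
move=> Hd; have [eps eps0 Heps] := local_C1.
have [CS CS0 HS] := local_sobolev; have [LS _] := HS w G g Hd.
have [[Lw _ _ _] _] := Hd.
have mw := L1_measurable Lw; have mc := measurable_cut r1 mw.
have cE x : `|cut r1 w x| `^ (2 * kap) = cut r1 (fun x => `|w x| `^ (2 * kap)) x by exact: cut_powR.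
pose F (k : nat) x := \1_[set x | k.+1%:R < `|cut r1 w x|] x * `|cut r1 w x| `^ (2 * kap).
have mF k : measurable_fun setT (F k).
  apply: measurable_funM; last exact: measurable_abs_powR.
  apply: measurable_indic.
  have mn : measurable_fun setT (fun x => `|cut r1 w x|) by exact: measurableT_comp.
  have := mn measurableT _ (measurable_itv `]k.+1%:R, +oo[).
  by rewrite setTI; congr measurable; apply/seteqP; split => x /=; rewrite in_itv/= andbT.
have F0 k x : 0 <= F k x by rewrite mulr_ge0 ?powR_ge0// indicE.
have Fb k x : `|F k x| <= cut r1 (fun x => `|w x| `^ (2 * kap)) x.
  rewrite ger0_norm// /F cE indicE; case: (_ \in _); rewrite ?mul1r//.
  by rewrite mul0r -cE powR_ge0.
have Fc : {ae mu, forall x, F k x @[k --> \oo] --> (0 : R)}.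
  apply: aeW => x; apply: cvg_near_cst; exists (Num.trunc `|cut r1 w x|) => // k /= km.
  rewrite /F indicE memNset ?mul0r//= => /ltW; apply/negP; rewrite -ltNge.
  by apply: (lt_le_trans (truncnS_gt _)); rewrite ler_nat ltnS.
have m0 : measurable_fun setT (fun _ : 'rV[R]_n => 0 : R) by exact: measurable_cst.
have [_ Fi _] := @dominated_cvg_Rintegral _ _ R mu F (fun=> 0) _ mF m0 LS Fc Fb.
have z0 : \int[mu]_(_ in [set: 'rV[R]_n]) 0 = 0 :> R by rewrite /Rintegral integral0.
rewrite z0 in Fi; move/cvgrPdist_le : Fi => /(_ _ eps0)[k _ /(_ k (leqnn k))/=].
rewrite sub0r normrN => /(le_trans (ler_norm _)) Fk.
have M1 : 1 <= k.+1%:R :> R by rewrite ler1n.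
have [C C0 HC] := Heps _ M1; have [U [CU aeU _ _]] := HC w G g Hd Fk.
by exists U.
Qed.

End local_estimate.

(** * Second derivatives *)

Section second_derivatives.
Context {R : realType} {n : nat}.
Implicit Types (f g k phi : 'rV[R]_n -> R) (x y z : 'rV[R]_n) (U V K : set 'rV[R]_n) (r s t : R).
Local Notation mu := (@lebesgue_rV R n).

(** A point of disagreement would have a whole cube of them, which has positive measure. *)
Lemma ae_eq_cont V f g : open V -> (forall x, V x -> {for x, continuous f}) ->
  (forall x, V x -> {for x, continuous g}) -> {ae mu, forall x, V x -> f x = g x} ->
  forall x, V x -> f x = g x.
Proof.
move=> oV cf cg [B [mB B0 AB]] x Vx; apply/eqP/negP => /negP fg.
have e0 : 0 < `|f x - g x| / 2 by rewrite divr_gt0// normr_gt0 subr_eq0.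
have [d1 d10 H1] := (cont_rVP f x).1 (cf x Vx) _ e0.
have [d2 d20 H2] := (cont_rVP g x).1 (cg x Vx) _ e0.
have [d3 d30 H3] := (open_rVP V).1 oV x Vx.
pose d := Num.min d1 (Num.min d2 d3).
have d0 : 0 < d by rewrite !lt_min d10 d20 d30.
have sub : cube x d `<=` B.
  move=> y; rewrite /cube/= !lt_min => /andP[y1 /andP[y2 y3]]; apply: AB => /= /(_ (H3 y y3)) E.
  have := H1 y y1; have := H2 y y2; rewrite E => h2 h1.
  have := ler_distD (g y) (f x) (g x); rewrite leNgt => /negP; apply.
  by rewrite [ltRHS]splitr ltrD// distrC.
have mc : measurable (cube x d) by exact: measurable_cube.
have : (mu (cube x d) <= 0)%E by rewrite -B0; apply: le_measure; rewrite ?inE.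
by rewrite lebesgue_cube// lee_fin leNgt exprn_gt0// mulr_gt0.
Qed.

Lemma class_C_zero_ext m U K f phi : open U -> closed K -> K `<=` U -> class_C m U f ->
  class_C m setT phi -> (forall x, ~ K x -> phi x = 0) -> class_C m setT (fun x => f x * phi x).
Proof.
move=> oU cK KU Cf Cp p0; apply: class_C_local => x _.
have [Ux|nUx] := pselect (U x).
  exists U; split => //; apply: (class_CM oU Cf); exact: (class_C_sub _ Cp).
have oK : open (~` K) by exact: closed_openC.
exists (~` K); split => //; first by move=> /KU.
by apply: (class_C_ext oK _ (class_C_cst m 0 oK)) => y /p0 ->; rewrite mulr0.
Qed.

Lemma partial_eq0 (V : set 'rV[R]_n) f i x : open V -> V x -> (forall y, V y -> f y = 0) -> partial i f x = 0.
Proof.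
move=> oV Vx f0; apply: partial_is_derive.
apply: (is_derive_near oV Vx _ (is_derive_const 0 x _)) => y Vy; by rewrite f0.
Qed.

Lemma partial_near V f g i x (df : R) : open V -> V x -> (forall y, V y -> f y = g y) ->
  is_derive x (delta_mx ord0 i) f df -> partial i f x = partial i g x.
Proof.
move=> oV Vx fg Df; rewrite (partial_is_derive Df); apply/esym/partial_is_derive.
exact: (is_derive_near oV Vx fg Df).
Qed.

Lemma partial_reflect k i x y : class_C 1 setT k ->
  is_derive y (delta_mx ord0 i) (fun y => k (x - y)) (- partial i k (x - y)).
Proof.
move=> Ck; apply: is_derive_eps => e e0.
have [d d0 H] := is_derive_eps_conv (class_C_derive i Ck (I : setT (x - y))) e0.
exists d => // h h0 hd; have h0' : - h != 0 by rewrite oppr_eq0.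
have := H (- h) h0'; rewrite normrN => /(_ hd).
rewrite invrN mulNr scaleNr.
rewrite (_ : - (h *: delta_mx ord0 i) + (x - y) = x - (h *: delta_mx ord0 i + y)); last by rewrite opprD addrCA.
by rewrite -opprD normrN opprK.
Qed.

Lemma class_C_reflect m k x : (forall m, class_C m setT k) -> class_C m setT (fun y => k (x - y)).
Proof.
move=> Ck; have cr (k' : 'rV[R]_n -> R) : class_C 0 setT k' -> forall y, {for y, continuous (fun y => k' (x - y))}.
  move=> ck' y; apply/cont_rVP => e e0.
  have [d d0 H] := (cont_rVP k' (x - y)).1 (class_C_cont ck' I) e e0.
  exists d => // z zy; apply: H.
  by rewrite opprB addrC addrA subrK distrC.
elim: m k Ck => [|m IH] k Ck; first by split=> // y _; exact: (cr k (Ck 0%N) y).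
apply: (@class_CS R n m setT _ (fun i y => -1 * partial i k (x - y))) => //; first exact: openT.
- by move=> y _; exact: (cr k (Ck 0%N) y).
- by move=> i y _; rewrite mulN1r; exact: partial_reflect (Ck 1%N).
- move=> i; apply: (class_CM openT (class_C_cst _ _ openT)); apply: IH => l.
  exact: class_C_partial (Ck l.+1).
Qed.

Lemma class_C_lap_ker m j t : class_C m setT (@lap_ker R n j t).
Proof.
apply: (@class_C_ext _ _ m setT (fun z => \sum_i partial i (partial i (ker j t)) z)) => //; first exact: openT.
  by move=> z _; rewrite lap_kerE.
apply: class_C_sum => [|i]; first exact: openT.
exact: class_C_partial (class_C_partial i (class_C_ker m.+2 j t)).
Qed.

Lemma L1_cut_cont r s f : 0 < s -> s < r -> (forall x, cube 0 r x -> {for x, continuous f}) ->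
  L1 (cut s f) /\ exists2 M : R, 0 <= M & forall x, `|cut s f x| <= M.
Proof.
move=> s0 sr cf.
have cK : compact [set y : 'rV[R]_n | `|y| <= s].
  have := @closed_cube_compact R n 0 s; congr compact; apply/seteqP; split => y /=; by rewrite subr0.
have KU : [set y : 'rV[R]_n | `|y| <= s] `<=` cube 0 r.
  by move=> y /= ys; rewrite /cube/= subr0; exact: le_lt_trans sr.
have mf : measurable_fun setT (cut s f).
  have E : cut s f = f \_ (cube 0 s).
    apply/funext => y; rewrite patchE /cut indicE mem_setE; case: ifP => _; by rewrite ?mul1r ?mul0r.
  rewrite E; apply/(measurable_restrictT _ (measurable_cube _ _)).
  apply: continuous_measurable_rV; first exact: open_cube.
  move=> y; rewrite /cube/= subr0 => ys; apply: cf; rewrite /cube/= subr0; exact: lt_trans sr.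
have [M [Mr HM]] : bounded_set (f @` [set y : 'rV[R]_n | `|y| <= s]).
  apply: compact_bounded; apply: continuous_compact => //.
  by apply: continuous_in_subspaceT => y; rewrite inE => ys; apply: cf; exact: KU.
have M1 : M < `|M| + 1 by rewrite (le_lt_trans (ler_norm _))// ltrDl.
have b x : `|cut s f x| <= `|M| + 1.
  case: (cutP s f x) => -[xs ->]; first by apply: (HM _ M1); exists x => //=; exact: ltW.
  by rewrite normr0 addr_ge0.
split; last by exists (`|M| + 1) => //; rewrite addr_ge0.
apply: (L1_le mf _ (L1Z (`|M| + 1) (L1_cube 0 s0))) => x.
rewrite indicE; case: (cutP s f x) => -[xs E].
  by rewrite mem_set ?mulr1// /cube/= subr0.
by rewrite E normr0 mulr_ge0// addr_ge0.
Qed.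

(** The cutoff is discontinuous, yet no boundary term appears: for [|x| + t <= rho] the kernel
    centered at [x] vanishes beyond [rho]. The larger radius [s] leaves room to differentiate in
    [x]. *)
Lemma conv_partial_cut k f i r0 s (rho : R) t x : class_C 1 (cube 0 r0) f -> (forall m, class_C m setT k) ->
  0 < t -> (forall z, t <= `|z| -> k z = 0) -> 0 < rho -> rho < s -> s < r0 -> `|x| + t <= rho ->
  conv k (cut rho (partial i f)) x = partial i (conv k (cut s f)) x.
Proof.
move=> Cf Ck t0 kt rho0 rs sr xt.
have s0 : 0 < s by exact: lt_trans rs.
have ck : continuous k by move=> z; exact: (class_C_cont (Ck 0%N) I).
have sk : supp_in t k by move=> z tz; apply: kt; exact: ltW.
have sdk := supp_in_partial i sk.
have Cdk m : class_C m setT (partial i k) by exact: class_C_partial (Ck m.+1).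
have cdk : continuous (partial i k) by move=> z; exact: (class_C_cont (Cdk 0%N) I).
have cf y : cube 0 r0 y -> {for y, continuous f} by exact: class_C_cont Cf.
have cdf y : cube 0 r0 y -> {for y, continuous (partial i f)} by exact: class_C_cont (class_C_partial i Cf).
have [Lf _] := L1_cut_cont s0 sr cf.
have [Ldf _] := L1_cut_cont s0 sr cdf.
rewrite (partial_conv i x Lf (Ck 1%N) sk).
have -> : conv k (cut rho (partial i f)) x = conv k (cut s (partial i f)) x.
  rewrite /cut !(@conv_cut R n k _ t)//; exact: le_trans xt (ltW rs).
pose phi y := k (x - y); pose K := [set y : 'rV[R]_n | `|y - x| <= t].
have far y : rho < `|y| -> t < `|x - y|.
  move=> ry; rewrite distrC; have := ler_normD (y - x) x; rewrite subrK; move: xt ry; lra.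
have KU : K `<=` cube 0 r0.
  move=> y; rewrite /K/= /cube/= subr0 => yx; have := ler_normD (y - x) x; rewrite subrK.
  by move: xt rs sr yx; lra.
have cK : closed K by apply: compact_closed; [exact: norm_hausdorff|exact: closed_cube_compact].
have pK y : ~ K y -> phi y = 0.
  by move=> /negP; rewrite -ltNge distrC => /ltW; exact: kt.
have Cphi : class_C 1 setT phi by exact: class_C_reflect.
have Cfp := class_C_zero_ext (@open_cube R n 0 r0) cK KU Cf Cphi pK.
have sfp : supp_in rho (fun y => f y * phi y).
  by move=> y /far ty; rewrite /phi kt ?mulr0// ltW.
have := Rintegral_partial0 i Cfp sfp.
have Ep y : partial i (fun y => f y * phi y) y =
    1 * (cut s (partial i f) y * k (x - y)) + -1 * (cut s f y * partial i k (x - y)).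
  have [ys|ys] := ltP `|y| s.
    have Uy : cube 0 r0 y by rewrite /cube/= subr0; exact: lt_trans sr.
    rewrite !cut_in//.
    rewrite (partialM i Cf (class_C_sub (@subsetT _ _) Cphi) Uy).
    rewrite (partial_is_derive (partial_reflect i x y (Ck 1%N))) /phi.
    clear; ring.
  have ry : rho < `|y| by exact: lt_le_trans ys.
  rewrite !cut_out// !mul0r !mulr0 addr0.
  have d0 : 0 < `|y| - rho by rewrite subr_gt0.
  have yy : cube y (`|y| - rho) y by rewrite /cube/= subrr normr0.
  have zz z : cube y (`|y| - rho) z -> f z * phi z = 0.
    rewrite /cube/= => zy; apply: sfp; have := ler_normD (y - z) z; rewrite subrK distrC; move: zy; lra.
  exact (partial_eq0 i (@open_cube R n y _) yy zz).
under eq_Rintegral do rewrite Ep.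
have La := convL1 ck sk x Ldf; have Lb := convL1 cdk sdk x Lf.
have [_ ->] := Rintegral_comb 1 (-1) La Lb.
by rewrite mul1r mulN1r => /eqP; rewrite subr_eq0 => /eqP.
Qed.

(** The equation is differentiated: [partial i f] solves the Poisson equation with right-hand side
    [partial i g], which is bounded and hence satisfies the Morrey condition. The C^1 function given
    by [potential_C1] equals [partial i f] almost everywhere, thus everywhere by continuity. *)
Lemma local_C2 r0 f g : 0 < r0 -> class_C 1 (cube 0 r0) f -> class_C 1 (cube 0 r0) g ->
  kernel_poisson 0 r0 (cut r0 f) (cut r0 g) -> class_C 2 (cube 0 (r0 / 4)) f.
Proof.
move=> r00 Cf Cg HP.
pose rho := r0 / 2; pose s := 3 * r0 / 4.
have rho0 : 0 < rho by rewrite divr_gt0.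
have rs : rho < s by rewrite /rho /s; move: r00; clear; lra.
have sr : s < r0 by rewrite /s; move: r00; clear; lra.
have q4 : r0 / 4 = rho / 2 by rewrite /rho; field.
have rhor : rho < r0 by exact: lt_trans sr.
have HPs := kernel_poisson_cut (ltW sr) HP; rewrite !cut_cut ?(ltW sr)// in HPs.
have oQ : open (cube (0 : 'rV[R]_n) (r0 / 4)) by exact: open_cube.
have QQ : cube (0 : 'rV[R]_n) (r0 / 4) `<=` cube 0 r0.
  by move=> y; rewrite /cube/= => /lt_trans; apply; rewrite q4; apply: lt_trans rhor; rewrite gtr_pMr// invf_lt1// ltr1n.
apply: (@class_CS R n 1 _ f (fun i => partial i f) oQ).
- by move=> x /QQ Qx; exact: class_C_cont Cf Qx.
- by move=> i x /QQ Qx; exact: class_C_derive Cf Qx.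
move=> i; have cdf y : cube 0 r0 y -> {for y, continuous (partial i f)} by exact: class_C_cont (class_C_partial i Cf).
have cdg y : cube 0 r0 y -> {for y, continuous (partial i g)} by exact: class_C_cont (class_C_partial i Cg).
have cg y : cube 0 r0 y -> {for y, continuous g} by exact: class_C_cont Cg.
have cf y : cube 0 r0 y -> {for y, continuous f} by exact: class_C_cont Cf.
have [Ldf _] := L1_cut_cont rho0 rhor cdf.
have [Ldg [M M0 HM]] := L1_cut_cont rho0 rhor cdg.
have s0 : 0 < s by exact: lt_trans rs.
have [Lf _] := L1_cut_cont s0 sr cf.
have [Lg _] := L1_cut_cont s0 sr cg.
have HP1 : kernel_poisson 0 rho (cut rho (partial i f)) (cut rho (partial i g)).
  move=> t x t0 xt.
  rewrite (conv_partial_cut i Cf (fun m => class_C_lap_ker m 0 t) t0 (fun z => lap_ker_eq0 0 t0) rho0 rs sr xt).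
  rewrite (conv_partial_cut i Cg (fun m => class_C_ker m 0 t) t0 (fun z => ker_eq0 0 t0) rho0 rs sr xt).
  have d0 : 0 < s - rho by rewrite subr_gt0.
  have sl : supp_in t (@lap_ker R n 0 t) by move=> z tz; apply: lap_ker_eq0 => //; exact: ltW.
  have D1 := class_C_derive i (class_C_conv Lf (class_C_lap_ker 1 0 t) sl) (I : setT x).
  rewrite -[RHS]mulN1r -(partialZ _ _ (class_C_conv Lg (class_C_ker 1 0 t) (supp_in_ker 0 t0)) (I : setT x)).
  have xx : cube x (s - rho) x by rewrite /cube/= subrr normr0.
  have zz y : cube x (s - rho) y -> conv (lap_ker 0 t) (cut s f) y = -1 * conv (ker 0 t) (cut s g) y.
    rewrite /cube/= => yx; rewrite mulN1r; apply: HPs => //.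
    have := ler_normD (y - x) x; rewrite subrK; move: yx xt; clear; lra.
  exact (partial_near (@open_cube R n x _) xx zz D1).
have [C C0 HC] := @potential_C1 R n rho rho0.
have Mor : morrey rho (M * rho ^+ n) (cut rho (partial i g)).
  move=> j x xr; have j0 := @dyadic_gt0 R rho j rho0.
  have Lc := L1_cube x j0.
  apply: (@le_trans _ _ (\int[mu]_y (M * \1_(cube x (dyadic rho j)) y))).
    have le y : \1_(cube x (dyadic rho j)) y * `|cut rho (partial i g) y| <= M * \1_(cube x (dyadic rho j)) y.
      by rewrite mulrC; apply: ler_wpM2r; rewrite ?indicE.
    apply: (Rintegral_le _ (L1Z M Lc) le); apply: (L1_le _ _ (L1Z M Lc)).
      apply: measurable_funM; first exact: measurable_indic (measurable_cube _ _).
      by apply: measurableT_comp => //; exact: L1_measurable.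
    by move=> y; rewrite ger0_norm ?le// mulr_ge0// indicE.
  rewrite (Rintegral_scale M Lc) (Rintegral_cube x j0) /dyadic -[leRHS]mulrA; apply: (ler_wpM2l M0).
  rewrite (_ : 2 * (rho / 2 * 4^-1 ^+ j) = rho * 4^-1 ^+ j); last by field.
  rewrite exprMn; apply: ler_wpM2l; first by rewrite exprn_ge0// ltW.
  by rewrite ler_peMr ?exprn_ege1 ?ler1n// exprn_ge0// exprn_ge0.
have [|V [CV aeV _ _]] := HC _ _ (M * rho ^+ n) Ldf Ldg _ HP1 Mor.
  by apply: (mulr_ge0 M0); rewrite exprn_ge0// ltW.
rewrite -q4 in CV aeV.
apply: (class_C_ext oQ _ CV).
apply: (ae_eq_cont oQ).
- by move=> x Qx; exact: class_C_cont CV Qx.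
- by move=> x /QQ; exact: cdf.
- apply: filterS aeV => x Vx Qx; rewrite (Vx Qx) cut_in//.
  move: Qx; rewrite /cube/= subr0 => /lt_trans; apply; by rewrite q4 gtr_pMr// invf_lt1// ltr1n.
Qed.

End second_derivatives.

(** * The conformal change of unknown *)

Section conformal_factor.
Context {R : realType} {n : nat}.
Implicit Types (x y z X : 'rV[R]_n) (f g k phi psi : 'rV[R]_n -> R) (U V K : set 'rV[R]_n) (b t : R).
Local Notation mu := (@lebesgue_rV R n).
Local Notation ball := (@hball R n).

Definition cfac x : R := (1 - edot x x) / 2.

Lemma enorm_sqr x : enorm x ^+ 2 = edot x x.
Proof. by rewrite sqr_sqrtr// edot_ge0. Qed.

Lemma hballP x : ball x <-> edot x x < 1.
Proof.
by rewrite /hball/= -enorm_sqr expr_lt1// sqrtr_ge0.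
Qed.

Lemma cfac_gt0 x : ball x -> 0 < cfac x.
Proof. by move=> /hballP e1; rewrite divr_gt0// subr_gt0. Qed.

Lemma cfac_le1 x : cfac x <= 1.
Proof. by rewrite /cfac; have := edot_ge0 x; lra. Qed.

Lemma conformalE x : conformal x = (cfac x)^-1.
Proof. by rewrite /conformal enorm_sqr /cfac invf_div. Qed.

Lemma hvolE x : hvol x = (cfac x) ^- n.
Proof. by rewrite /hvol conformalE exprVn. Qed.

Lemma hgrad_dotE x (a c : 'rV[R]_n) : hgrad_dot x a c = cfac x ^+ 2 * edot a c.
Proof. by rewrite /hgrad_dot enorm_sqr. Qed.

Lemma continuous_edot : continuous (fun x => edot x x).
Proof. by move=> x; exact: (class_C_cont (class_C_edot 0 openT) (I : setT x)). Qed.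

Lemma open_hball : open ball.
Proof.
apply/open_rVP => x /hballP x1; have d0 : 0 < 1 - edot x x by rewrite subr_gt0.
have [d d1 H] := (cont_rVP _ x).1 (continuous_edot (x := x)) _ d0.
exists d => // y yx; apply/hballP; have := H y yx; have := ler_norm (edot y y - edot x x); lra.
Qed.

Lemma is_derive_cfac x i : is_derive x (delta_mx ord0 i) cfac (- x ord0 i).
Proof.
apply: (@is_derive_ext _ _ (fun x => 2^-1 + (- 2^-1) * edot x x)).
  by move=> y; rewrite /cfac; field.
have := is_derive_add (is_derive_const (2^-1) x (delta_mx ord0 i)) (is_derive_mul (is_derive_const (- 2^-1) x (delta_mx ord0 i)) (is_derive_edot x i)).
by congr is_derive; field.
Qed.

Lemma continuous_cfac : continuous cfac.
Proof.
have -> : cfac = (fun x => 2^-1 + - 2^-1 * edot x x) by apply/funext => y; rewrite /cfac; field.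
by apply: contD; [exact: cst_continuous|apply: contM; [exact: cst_continuous|exact: continuous_edot]].
Qed.

Lemma is_derive_cfac_pow b x i : ball x ->
  is_derive x (delta_mx ord0 i) (fun x => cfac x `^ b) (- b * x ord0 i * cfac x `^ (b - 1)).
Proof.
move=> bx; have := is_derive_comp1 (is_derive1_powR b (cfac_gt0 bx)) (is_derive_cfac x i).
by congr is_derive; ring.
Qed.

Lemma class_C_cfac_pow m b : class_C m ball (fun x => cfac x `^ b).
Proof.
have cc c x : ball x -> {for x, continuous (fun x => cfac x `^ c)}.
  move=> bx; exact: (continuous_comp (continuous_cfac (x := x)) (is_derive_cont (is_derive1_powR c (cfac_gt0 bx)))).
elim: m b => [|m IH] b; first by split=> // x; exact: cc.
apply: (@class_CS R n m ball _ (fun i x => - b * x ord0 i * cfac x `^ (b - 1)) open_hball).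
- by move=> x; exact: cc.
- by move=> i x; exact: is_derive_cfac_pow.
- move=> i; apply: (class_CM open_hball _ (IH _)).
  apply: (class_CM open_hball); [exact: class_C_cst open_hball|exact: class_C_coord open_hball].
Qed.

Lemma partial_cfac_powM m b f x i : class_C m.+1 ball f -> ball x ->
  partial i (fun x => cfac x `^ b * f x) x =
  cfac x `^ b * partial i f x - b * x ord0 i * cfac x `^ (b - 1) * f x.
Proof.
move=> Cf bx; rewrite (partialM i (class_C_cfac_pow m.+1 b) Cf bx).
by rewrite (partial_is_derive (is_derive_cfac_pow b i bx)); ring.
Qed.

Lemma measurable_cfac_pow b : measurable_fun setT (fun x => cfac x `^ b).
Proof.
exact: (measurableT_comp (measurable_powR b) (continuousT_measurable_rV continuous_cfac)).
Qed.

Lemma test_closed K : compact K -> closed (K : set 'rV[R]_n).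
Proof. by move=> cK; apply: compact_closed => //; exact: norm_hausdorff. Qed.

Lemma test_mul f phi : (forall m, class_C m ball f) -> test_function ball phi ->
  test_function ball (fun x => f x * phi x).
Proof.
move=> Cf [Cp [K [cK KU p0]]]; split.
  by move=> m; exact: (class_C_zero_ext open_hball (test_closed cK) KU (Cf m) (Cp m) p0).
by exists K; split => // x /p0 ->; rewrite mulr0.
Qed.

Lemma test_partial phi i : test_function ball phi -> test_function ball (partial i phi).
Proof.
move=> [Cp [K [cK KU p0]]]; split; first by move=> m; exact: class_C_partial (Cp m.+1).
exists K; split => // x nK; have oK : open (~` K) := closed_openC (test_closed cK).
exact: (partial_eq0 i oK nK p0).
Qed.

Lemma test_ker j t X : 0 < t -> [set y | `|y - X| <= t] `<=` ball ->
  test_function ball (fun y => ker j t (X - y)).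
Proof.
move=> t0 KU; split; first by move=> m; apply: class_C_reflect => l; exact: class_C_ker.
exists [set y | `|y - X| <= t]; split => //; first exact: closed_cube_compact.
by move=> y /= /negP; rewrite -ltNge distrC => /ltW; exact: ker_eq0.
Qed.

Lemma partial_ker_reflect j t X i y : partial i (fun y => ker j t (X - y)) y = - partial i (@ker R n j t) (X - y).
Proof. exact: (partial_is_derive (partial_reflect i X y (class_C_ker 1 j t))). Qed.

Lemma lap_ker_reflect j t X y :
  \sum_i partial i (partial i (fun y => ker j t (X - y))) y = @lap_ker R n j t (X - y).
Proof.
rewrite lap_kerE; apply: eq_bigr => i _.
have -> : partial i (fun y => ker j t (X - y)) = (fun y => -1 * partial i (@ker R n j t) (X - y)).
  by apply/funext => z; rewrite mulN1r partial_ker_reflect.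
have C1 : class_C 1 setT (fun y => partial i (@ker R n j t) (X - y)).
  by apply: class_C_reflect => l; exact: class_C_partial (class_C_ker l.+1 j t).
rewrite (partialZ (-1) i C1 (I : setT y)) mulN1r.
by rewrite (partial_is_derive (partial_reflect i X y (class_C_partial i (class_C_ker 2 j t)))) opprK.
Qed.

End conformal_factor.

(** * Solutions extended by zero outside the ball *)

Section ball_solution.
Context {R : realType} {n : nat}.
Implicit Types (u f phi psi : 'rV[R]_n -> R) (G : 'rV[R]_n -> 'rV[R]_n) (K : set 'rV[R]_n).
Local Notation mu := (@lebesgue_rV R n).
Local Notation ball := (@hball R n).

(** The density of the squared H^1 norm with respect to Lebesgue measure. The volume weight is
    written as a real power, to be combined with the fractional powers of [cfac] in the conformal
    change. *)
Definition energy u (D : 'I_n -> 'rV[R]_n -> R) x : R :=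
  (cfac x ^+ 2 * \sum_i D i x ^+ 2 + u x ^+ 2) * cfac x `^ (- n%:R).

(* A solution with its weak gradient, both extended by zero outside the ball, so
   that all the integrals range over the whole space. *)
Definition ball_solution (lam p : R) u (D : 'I_n -> 'rV[R]_n -> R) : Prop :=
  [/\ measurable_fun setT u, (forall i, measurable_fun setT (D i)),
      (forall x, ~ ball x -> u x = 0) & (forall i x, ~ ball x -> D i x = 0)] /\
  [/\ L1 (energy u D),
      (forall phi i, test_function ball phi ->
         \int[mu]_x (u x * partial i phi x) = - \int[mu]_x (D i x * phi x)) &
      (forall phi, test_function ball phi ->
         \int[mu]_x (\sum_i D i x * (cfac x `^ (2 - n%:R) * partial i phi x) -
            lam * (u x * (cfac x `^ (- n%:R) * phi x))) =
         \int[mu]_x (`|u x| `^ (p - 1) * u x * (cfac x `^ (- n%:R) * phi x)))].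

Lemma weak_solution_ext (lam p : R) u : weak_solution lam p u ->
  measurable_fun ball u /\
  exists u0 D, ball_solution lam p u0 D /\ forall x, ball x -> u0 x = u x.
Proof.
move=> [G [[WG fin] eqn]]; have [[mu0 lu] HG] := WG; split => //.
pose u0 := u \_ ball; pose D i := (rV_coord i \o G) \_ ball.
have mb : measurable ball by apply: open_measurable_rV; exact: open_hball.
have u0E x : ball x -> u0 x = u x by move=> bx; rewrite /u0 patchE mem_set.
have DE i x : ball x -> D i x = G x ord0 i by move=> bx; rewrite /D patchE mem_set.
have u00 x : ~ ball x -> u0 x = 0 by move=> bx; rewrite /u0 patchE memNset.
have D0 i x : ~ ball x -> D i x = 0 by move=> bx; rewrite /D patchE memNset.
have res f g : (forall x, ball x -> f x = g x) -> (forall x, ~ ball x -> f x = 0) ->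
    \int[mu]_x f x = \int[mu]_(x in ball) g x.
  move=> fg f0; rewrite [RHS]Rintegral_mkcond; apply: eq_Rintegral => x _.
  by rewrite patchE; case: ifPn => [/set_mem/fg|/negP]//; rewrite in_setE => /f0.
exists u0, D; split => //; split.
  split => //; first by apply/(measurable_restrictT _ mb).
  by move=> i; apply/(measurable_restrictT _ mb); have [[]] := HG i.
split.
- have mE : measurable_fun setT (energy u0 D).
    have mc := continuousT_measurable_rV (@continuous_cfac R n).
    apply: measurable_funM; last exact: measurable_cfac_pow.
      apply: measurable_funD; last by apply: measurable_funX; exact/(measurable_restrictT _ mb).
      apply: measurable_funM; first exact: measurable_funX.
      apply: measurable_sum => i; apply: measurable_funX; apply/(measurable_restrictT _ mb).
      by have [[]] := HG i.
  apply: (L1_fin mE); apply: le_lt_trans fin; rewrite [leRHS]integral_mkcond le_eqVlt; apply/orP; left; apply/eqP.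
  apply: eq_integral => x _; rewrite patchE; case: ifPn => [/set_mem bx|/negP nx].
    have c0 := cfac_gt0 bx; rewrite ger0_norm.
      rewrite /energy (u0E x bx) hgrad_dotE hvolE -(powR_invn _ (ltW c0)); congr (((_ * _ + _) * _)%:E).
      by apply: eq_bigr => i _; rewrite (DE i x bx) expr2.
    apply: (mulr_ge0 (addr_ge0 (mulr_ge0 (sqr_ge0 _) (sumr_ge0 _ _)) (sqr_ge0 _))); last exact: powR_ge0.
    by move=> i _; exact: sqr_ge0.
  have bx : ~ ball x by move=> bx; apply: nx; rewrite in_setE.
  rewrite /energy (u00 x bx) big1 ?mulr0 ?expr0n ?addr0 ?mul0r ?normr0//.
  by move=> i _; rewrite (D0 i x bx) expr0n.
- move=> phi i tphi; have [_ /(_ phi tphi)] := HG i.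
  rewrite (res _ (fun x => u x * partial i phi x)); first last.
  + by move=> x /u00 ->; rewrite mul0r.
  + by move=> x /u0E ->.
  move=> ->; congr (- _); apply/esym/res; first by move=> x /DE ->.
  by move=> x /D0 ->; rewrite mul0r.
- move=> phi tphi; have := eqn phi tphi.
  rewrite (res _ (fun x => (hgrad_dot x (G x) (grad phi x) - lam * u x * phi x) * hvol x)); first last.
  + move=> x bx; rewrite (u00 x bx) big1; first by rewrite mul0r mulr0 subrr.
    by move=> i _; rewrite (D0 i x bx) mul0r.
  + move=> x bx; have c0 := cfac_gt0 bx.
    rewrite (u0E x bx) hgrad_dotE hvolE -(powR_invn _ (ltW c0)) mulrBl; congr (_ - _); last by ring.
    rewrite mulrAC -powR_mulrn ?(ltW c0)// -powRD ?(gt_eqF c0) ?implybT// /edot mulr_sumr.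
    by apply: eq_bigr => i _; rewrite (DE i x bx) mxE mulrCA.
  move=> ->; apply/esym/res; last by move=> x bx; rewrite (u00 x bx) mulr0 mul0r.
  move=> x bx; have c0 := cfac_gt0 bx; rewrite (u0E x bx) hvolE -(powR_invn _ (ltW c0)); ring.
Qed.

End ball_solution.

Lemma weak_pow_algebra (R : realType) (X Y Z b : R) : 1 * X + - b * Z = - Y -> X = - Y + b * Z.
Proof. by move=> <-; ring. Qed.

(** After substituting [E = L - 2 * W], the coefficient of [W] is [2 * (al + 1) - N], which
    vanishes. This cancellation singles out the exponent [al = (n - 2) / 2]. *)
Lemma conformal_algebra (R : realType) (N al lam S1 S2 T W E L NL : R) : N = 2 * al + 2 ->
  S1 - al * S2 - lam * L = NL -> N * W + T = - S2 - (al + 1) * E -> E = L - 2 * W ->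
  S1 + al * T = (lam - al * (al + 1)) * L + NL.
Proof.
move=> -> <- h EE; have -> : T = - S2 - (al + 1) * E - (2 * al + 2) * W by rewrite -h; ring.
by rewrite EE; ring.
Qed.

(** * The equation satisfied by the new unknown *)

Section conformal_identities.
Context {R : realType} {n : nat}.
Implicit Types (x y z X : 'rV[R]_n) (f phi psi : 'rV[R]_n -> R) (K : set 'rV[R]_n) (b t : R).
Local Notation mu := (@lebesgue_rV R n).
Local Notation ball := (@hball R n).

Variables (lam p : R) (u : 'rV[R]_n -> R) (D : 'I_n -> 'rV[R]_n -> R).
Hypotheses (n2 : (2 <= n)%N) (HS : ball_solution lam p u D).

Let mu_u : measurable_fun setT u. Proof. by have [[]] := HS. Qed.
Let mD i : measurable_fun setT (D i). Proof. by have [[]] := HS. Qed.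
Let u0 x : ~ ball x -> u x = 0. Proof. by have [[_ _ + _] _] := HS; exact. Qed.
Let D0 i x : ~ ball x -> D i x = 0. Proof. by have [[_ _ _ +] _] := HS; exact. Qed.
Let LE : L1 (energy u D). Proof. by have [_ []] := HS. Qed.

Lemma energy_out x : ~ ball x -> energy u D x = 0.
Proof.
move=> bx; rewrite /energy (u0 bx) big1 ?mulr0 ?expr0n ?addr0 ?mul0r//.
by move=> i _; rewrite (D0 i bx) expr0n.
Qed.

Lemma energy_bound x : ball x -> cfac x ^+ 2 * \sum_i D i x ^+ 2 + u x ^+ 2 = cfac x `^ n%:R * energy u D x.
Proof.
move=> bx; rewrite /energy mulrCA -powRD; last by rewrite (gt_eqF (cfac_gt0 bx)) implybT.
by rewrite subrr powRr0 mulr1.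
Qed.

Lemma energy_ge0 x : 0 <= energy u D x.
Proof.
apply: (mulr_ge0 (addr_ge0 (mulr_ge0 (sqr_ge0 _) (sumr_ge0 _ _)) (sqr_ge0 _)) (powR_ge0 _ _)).
by move=> i _; exact: sqr_ge0.
Qed.

Let cn1 b x : ball x -> 0 <= b -> cfac x `^ b <= 1.
Proof.
move=> bx b0; rewrite -(powRr0 (cfac x)); apply: ger_powR => //.
by rewrite cfac_gt0// cfac_le1.
Qed.

Lemma energy_u x : u x ^+ 2 <= energy u D x.
Proof.
have [bx|nbx] := pselect (ball x); last by rewrite (u0 nbx) expr0n energy_ge0.
have h : u x ^+ 2 <= cfac x `^ n%:R * energy u D x.
  rewrite -(energy_bound bx) lerDr mulr_ge0 ?sqr_ge0// sumr_ge0// => i _; exact: sqr_ge0.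
by apply: (le_trans h); rewrite ler_piMl ?energy_ge0//; exact: cn1.
Qed.

(** The gradient enters the density with the weight [cfac^(2-n)], at least 1 for [n >= 2] as
    [cfac <= 1]. *)
Lemma energy_D i x : D i x ^+ 2 <= energy u D x.
Proof.
have [bx|nbx] := pselect (ball x); last by rewrite (D0 i nbx) expr0n energy_ge0.
have c0 := cfac_gt0 bx.
have h1 : D i x ^+ 2 <= \sum_i D i x ^+ 2.
  rewrite (bigD1 i)//= lerDl sumr_ge0// => j _; exact: sqr_ge0.
have h2 : cfac x ^+ 2 * D i x ^+ 2 <= cfac x `^ n%:R * energy u D x.
  rewrite -(energy_bound bx) -[leLHS]addr0; apply: lerD; last exact: sqr_ge0.
  by rewrite ler_pM2l// exprn_gt0.
have e : cfac x `^ n%:R = cfac x ^+ 2 * cfac x `^ (n%:R - 2).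
  rewrite -powR_mulrn ?(ltW c0)// -powRD ?(gt_eqF c0) ?implybT//; congr powR; ring.
move: h2; rewrite e -mulrA ler_pM2l ?exprn_gt0// => /le_trans; apply.
by rewrite ler_piMl ?energy_ge0// cn1// subr_ge0 ler_nat.
Qed.

Lemma L1_test f phi : measurable_fun setT f -> (forall x, f x ^+ 2 <= energy u D x) ->
  test_function ball phi -> L1 (fun x => f x * phi x).
Proof.
move=> mf fE [Cp [K [cK KU p0]]].
have cp : continuous phi by move=> x; exact: (class_C_cont (Cp 0%N) I).
have [r r0 Kr] := compact_cube cK.
have sp : supp_in r phi.
  by move=> x rx; apply: p0 => /Kr; rewrite /cube/= subr0 => /ltW; rewrite leNgt rx.
have [M M0 HM] := supp_in_bounded cp sp.
have Lp := L1_continuous cp sp.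
apply: (L1_le _ _ (L1D (L1Z M LE) (L1_norm Lp))).
  by apply: measurable_funM => //; exact: continuousT_measurable_rV.
move=> x; rewrite normrM.
have h : `|f x| <= energy u D x + 1.
  have := fE x; rewrite -[f x ^+ 2]real_normK ?num_real//.
  by have := sqr_ge0 (`|f x| - 1); rewrite sqrrB; have := normr_ge0 (f x); lra.
apply: (le_trans (ler_wpM2r (normr_ge0 (phi x)) h)).
rewrite mulrDl mul1r lerD2r [leRHS]mulrC; apply: ler_wpM2l; [exact: energy_ge0|exact: HM].
Qed.

Let L1u phi : test_function ball phi -> L1 (fun x => u x * phi x).
Proof. exact: L1_test mu_u energy_u. Qed.
Let L1D' i phi : test_function ball phi -> L1 (fun x => D i x * phi x).
Proof. exact: (L1_test (mD i) (energy_D i)). Qed.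

Let weak i phi : test_function ball phi ->
  \int[mu]_x (u x * partial i phi x) = - \int[mu]_x (D i x * phi x).
Proof. by have [_ [_ H _]] := HS; exact: H. Qed.

Let tpow b phi : test_function ball phi -> test_function ball (fun x => cfac x `^ b * phi x).
Proof. by apply: test_mul => m; exact: class_C_cfac_pow. Qed.

Let tcoord i phi : test_function ball phi -> test_function ball (fun x => x ord0 i * phi x).
Proof. by apply: test_mul => m; apply: class_C_coord; exact: open_hball. Qed.

Let eqint f g : (forall x, ball x -> f x = g x) -> 
  \int[mu]_x (u x * f x) = \int[mu]_x (u x * g x).
Proof.
move=> fg; apply: eq_Rintegral => x _; have [/fg ->|nbx] := pselect (ball x) => //.
by rewrite (u0 nbx) !mul0r.
Qed.

Let combu (a c : R) f g : test_function ball f -> test_function ball g ->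
  \int[mu]_x (u x * (a * f x + c * g x)) = a * \int[mu]_x (u x * f x) + c * \int[mu]_x (u x * g x).
Proof.
move=> tf tg; have [_ <-] := Rintegral_comb a c (L1u tf) (L1u tg).
by apply: eq_Rintegral => x _; ring.
Qed.

Lemma weak_pow b i psi : test_function ball psi ->
  \int[mu]_x (u x * (cfac x `^ b * partial i psi x)) =
  - (\int[mu]_x (D i x * (cfac x `^ b * psi x))) + b * \int[mu]_x (u x * (cfac x `^ (b - 1) * (x ord0 i * psi x))).
Proof.
move=> tp; have := weak i (tpow b tp).
rewrite (@eqint _ (fun x => 1 * (cfac x `^ b * partial i psi x) + (- b) * (cfac x `^ (b - 1) * (x ord0 i * psi x)))); last first.
  move=> x bx; have [Cp _] := tp.
  by rewrite (partial_cfac_powM b i (class_C_sub (@subsetT _ _) (Cp 1%N)) bx); ring.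
rewrite (combu _ _ (tpow b (test_partial i tp)) (tpow (b - 1) (tcoord i tp))).
exact: weak_pow_algebra.
Qed.

Let al : R := (n%:R - 2) / 2.

(* The Poisson equation for conf_u has no first order term: with v = conf_u,
   - Lap v = cfac^-2 (lam - n (n - 2) / 4) v + cfac^(-al-2) |u|^(p-1) u. *)
Definition conf_u x := cfac x `^ (- al) * u x.
Definition conf_D i x := cfac x `^ (- al) * D i x + al * x ord0 i * cfac x `^ (- al - 1) * u x.

Lemma L1_conf_u psi : test_function ball psi -> L1 (fun x => conf_u x * psi x).
Proof.
by move=> /(tpow (- al))/L1u; congr L1; apply/funext => x; rewrite /conf_u; ring.
Qed.

Lemma conf_gradient i psi : test_function ball psi ->
  \int[mu]_x (conf_u x * partial i psi x) = - \int[mu]_x (conf_D i x * psi x).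
Proof.
move=> tp; have E1 : \int[mu]_x (conf_u x * partial i psi x) = \int[mu]_x (u x * (cfac x `^ (- al) * partial i psi x)).
  by apply: eq_Rintegral => x _; rewrite /conf_u; ring.
have [_ E2] := Rintegral_comb 1 al (L1D' i (tpow (- al) tp)) (L1u (tpow (- al - 1) (tcoord i tp))).
have E3 : \int[mu]_x (conf_D i x * psi x) = \int[mu]_x (1 * (D i x * (cfac x `^ (- al) * psi x)) +
    al * (u x * (cfac x `^ (- al - 1) * (x ord0 i * psi x)))).
  by apply: eq_Rintegral => x _; rewrite /conf_D; ring.
rewrite E1 E3 E2 (weak_pow _ _ tp); ring.
Qed.

Let sum_int (F : 'I_n -> 'rV[R]_n -> R) : (forall i, L1 (F i)) ->
  \int[mu]_x \sum_i F i x = \sum_i \int[mu]_x F i x.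
Proof. by move=> LF; exact: Rintegral_sum. Qed.

(** Three relations between integrals eliminate the first order terms: the equation of [u] tested
    with [cfac^al psi], an integration by parts of the functions [x_i psi], and the identity
    [|x|^2 = 1 - 2 cfac]. *)
Lemma conf_poisson psi : test_function ball psi ->
  \int[mu]_x (conf_u x * \sum_i partial i (partial i psi) x) =
  - ((lam - al * (al + 1)) * \int[mu]_x (u x * (cfac x `^ (- al - 2) * psi x)) +
     \int[mu]_x (`|u x| `^ (p - 1) * u x * (cfac x `^ (- al - 2) * psi x))).
Proof.
move=> tp; have [Cp _] := tp.
pose S1 := \sum_i \int[mu]_x (D i x * (cfac x `^ (- al) * partial i psi x)).
pose S2 := \sum_i \int[mu]_x (D i x * (cfac x `^ (- al - 1) * (x ord0 i * psi x))).
pose T := \sum_i \int[mu]_x (u x * (cfac x `^ (- al - 1) * (x ord0 i * partial i psi x))).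
pose W := \int[mu]_x (u x * (cfac x `^ (- al - 1) * psi x)).
pose E := \int[mu]_x (u x * (cfac x `^ (- al - 2) * (edot x x * psi x))).
pose L := \int[mu]_x (u x * (cfac x `^ (- al - 2) * psi x)).
have lap : \int[mu]_x (conf_u x * \sum_i partial i (partial i psi) x) = - (S1 + al * T).
  have -> : \int[mu]_x (conf_u x * \sum_i partial i (partial i psi) x) =
      \int[mu]_x \sum_i (u x * (cfac x `^ (- al) * partial i (partial i psi) x)).
    by apply: eq_Rintegral => x _; rewrite /conf_u mulr_sumr; apply: eq_bigr => i _; ring.
  rewrite sum_int; last by move=> i; exact: (L1u (tpow _ (test_partial i (test_partial i tp)))).
  rewrite /S1 /T mulr_sumr -big_split/= -sumrN; apply: eq_bigr => i _.
  rewrite (weak_pow (- al) i (test_partial i tp)); ring.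
have [_ [_ _ /(_ _ (tpow al tp)) eqn]] := HS.
rewrite lap; congr (- _); apply: (@conformal_algebra R n%:R al lam S1 S2 T W E L); first by rewrite /al; field.
- have LF i : L1 (fun x => 1 * (D i x * (cfac x `^ (- al) * partial i psi x)) +
      - al * (D i x * (cfac x `^ (- al - 1) * (x ord0 i * psi x)))).
    by have [] := Rintegral_comb 1 (- al) (L1D' i (tpow (- al) (test_partial i tp)))
      (L1D' i (tpow (- al - 1) (tcoord i tp))).
  have [_ CI] := Rintegral_comb 1 (- lam) (L1_sum (index_enum _) LF) (L1u (tpow (- al - 2) tp)).
  rewrite (sum_int LF) in CI.
  have -> : \int[mu]_x (`|u x| `^ (p - 1) * u x * (cfac x `^ (- al - 2) * psi x)) =
     \int[mu]_x (`|u x| `^ (p - 1) * u x * (cfac x `^ (- n%:R) * (cfac x `^ al * psi x))).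
    apply: eq_Rintegral => x _; have [bx|nbx] := pselect (ball x); last by rewrite (u0 nbx) !mulr0 !mul0r.
    rewrite [cfac x `^ (- n%:R) * _]mulrA -powRD; last by rewrite (gt_eqF (cfac_gt0 bx)) implybT.
    by congr (_ * (_ `^ _ * _)); rewrite /al; field.
  rewrite -eqn; apply: (etrans _ (etrans (esym CI) _)).
    rewrite mul1r mulNr; congr (_ - _); rewrite /S1 /S2 mulr_sumr -sumrB; apply: eq_bigr => i _.
    have [_ ->] := Rintegral_comb 1 (- al) (L1D' i (tpow (- al) (test_partial i tp)))
      (L1D' i (tpow (- al - 1) (tcoord i tp))).
    by rewrite mul1r mulNr.
  apply: eq_Rintegral => x _; have [bx|nbx] := pselect (ball x); last first.
    rewrite (u0 nbx) !mul0r !mulr0 addr0 subr0 mul1r; apply: eq_bigr => i _.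
    by rewrite (D0 i nbx) !mul0r !mulr0 addr0.
  have cq : cfac x != 0 by rewrite gt_eqF// cfac_gt0.
  rewrite mul1r mulNr; congr (_ - _); last first.
    suff -> : cfac x `^ (- al - 2) = cfac x `^ (- n%:R) * cfac x `^ al by congr (_ * (_ * _)); rewrite -mulrA.
    by rewrite -powRD ?cq ?implybT//; congr (_ `^ _); rewrite /al; field.
  apply: eq_bigr => i _.
  rewrite (partial_cfac_powM al i (class_C_sub (@subsetT _ _) (Cp 1%N)) bx).
  have -> : cfac x `^ (- al) = cfac x `^ (2 - n%:R) * cfac x `^ al.
    by rewrite -powRD ?cq ?implybT//; congr (_ `^ _); rewrite /al; field.
  have -> : cfac x `^ (- al - 1) = cfac x `^ (2 - n%:R) * cfac x `^ (al - 1).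
    by rewrite -powRD ?cq ?implybT//; congr (_ `^ _); rewrite /al; field.
  ring.
(* The second relation is [weak_pow] at the exponent [- al - 1] for the test function [x_i psi],
   summed over [i]; the derivative of [x_i] produces the [n] copies of [W]. *)
- have Ei i : \int[mu]_x (u x * (cfac x `^ (- al - 1) * (x ord0 i * partial i psi x))) + W =
     - (\int[mu]_x (D i x * (cfac x `^ (- al - 1) * (x ord0 i * psi x)))) -
     (al + 1) * \int[mu]_x (u x * (cfac x `^ (- al - 2) * (x ord0 i * (x ord0 i * psi x)))).
    have := weak_pow (- al - 1) i (tcoord i tp).
    rewrite (_ : - al - 1 - 1 = - al - 2); last by ring.
    rewrite [X in _ = _ + X -> _](_ : _ = - ((al + 1) * \int[mu]_x (u x * (cfac x `^ (- al - 2) * (x ord0 i * (x ord0 i * psi x)))))); last by ring.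
    move=> <-; rewrite /W.
    have [_ C] := Rintegral_comb 1 1 (L1u (tpow (- al - 1) (tcoord i (test_partial i tp)))) (L1u (tpow (- al - 1) tp)).
    rewrite !mul1r in C; rewrite -C; apply: eq_Rintegral => x _.
    have [bx|nbx] := pselect (ball x); last by rewrite (u0 nbx) !mul0r !mulr0 addr0.
    rewrite (partialM i (class_C_coord 1 i open_hball) (class_C_sub (@subsetT _ _) (Cp 1%N)) bx).
    rewrite (partial_is_derive (is_derive_coord x i i)) eqxx /=; ring.
  have -> : n%:R * W + T = \sum_i (\int[mu]_x (u x * (cfac x `^ (- al - 1) * (x ord0 i * partial i psi x))) + W).
    by rewrite [LHS]addrC big_split/= sumr_const card_ord mulr_natl.
  rewrite (eq_bigr _ (fun i _ => Ei i)) sumrB sumrN -mulr_sumr; congr (_ - _ * _).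
  rewrite -sum_int; last by move=> i; exact: (L1u (tpow _ (tcoord i (tcoord i tp)))).
  apply: eq_Rintegral => x _; rewrite /edot -mulr_sumr; congr (_ * _); rewrite -mulr_sumr; congr (_ * _).
  by rewrite mulr_suml; apply: eq_bigr => i _; rewrite mulrA.
(* The third relation is pointwise: [|x|^2 = 1 - 2 * cfac x] on the ball. *)
- rewrite /E (@eqint _ (fun x => 1 * (cfac x `^ (- al - 2) * psi x) + - 2 * (cfac x `^ (- al - 1) * psi x))).
    by rewrite (combu _ _ (tpow _ tp) (tpow _ tp)) mul1r mulNr.
  move=> x bx; have cq : cfac x != 0 by rewrite gt_eqF// cfac_gt0.
  have -> : cfac x `^ (- al - 1) = cfac x `^ (- al - 2) * cfac x.
    by rewrite -[X in _ * X]powRr1 ?(ltW (cfac_gt0 bx))// -powRD ?cq ?implybT//; congr (_ `^ _); ring.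
  by rewrite /cfac; field.
Qed.

End conformal_identities.

(** * Rescaling around a point *)

Section scaling.
Context {R : realType} {n : nat}.
Implicit Types (x y z : 'rV[R]_n) (f k : 'rV[R]_n -> R) (c r t s b : R).
Local Notation mu := (@lebesgue_rV R n).
Local Notation ball := (@hball R n).

Lemma ratio_pow_le s b : 3 / 4 <= s <= 5 / 4 -> s `^ b <= 2 `^ `|b|.
Proof.
move=> /andP[s1 s2]; have s0 : 0 < s by move: s1; lra.
have [b0|b0] := leP 0 b.
  by rewrite ger0_norm//; apply: ler_powR_base => //; [exact: ltW|move: s2; lra].
have -> : s `^ b = s^-1 `^ (- b) by rewrite -[s^-1]powR_inv1 ?(ltW s0)// -powRrM mulN1r opprK.
rewrite ltr0_norm//; apply: ler_powR_base; first by rewrite oppr_ge0 ltW.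
  by rewrite invr_ge0 ltW.
by rewrite invf_ple ?posrE// (le_trans _ s1)// ler_pdivlMr//; lra.
Qed.

Lemma ratio_powE (a c b : R) : 0 < a -> 0 < c -> c `^ (- b) * a `^ b = (a / c) `^ b.
Proof.
move=> a0 c0; rewrite powRM ?(ltW a0) ?invr_ge0 ?(ltW c0)// mulrC; congr (_ * _).
by rewrite -[c^-1]powR_inv1 ?(ltW c0)// -powRrM mulN1r.
Qed.

(* Up to a dimensional constant, the Euclidean size of a hyperbolic ball of fixed
   radius around x. *)
Definition local_scale x : R := cfac x / (6 * n%:R).

Hypothesis n2 : (2 <= n)%N.

Let N1 : 1 <= n%:R :> R. Proof. by rewrite ler1n; exact: leq_trans n2. Qed.
Let N0 : 0 < n%:R :> R. Proof. exact: lt_le_trans N1. Qed.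

Lemma local_scale_gt0 x : ball x -> 0 < local_scale x.
Proof. by move=> bx; rewrite divr_gt0 ?cfac_gt0// mulr_gt0. Qed.

Lemma local_scale_small x : ball x -> local_scale x * (6 * n%:R) = cfac x.
Proof. by move=> bx; rewrite divfK// gt_eqF// mulr_gt0. Qed.

Lemma edot_affine x z r : edot (x + r *: z) (x + r *: z) = edot x x + 2 * r * edot x z + r ^+ 2 * edot z z.
Proof.
rewrite /edot !mulr_sumr -!big_split/=; apply: eq_bigr => i _; rewrite !mxE; ring.
Qed.

Lemma edot_unit_le x z : ball x -> `|z| <= 1 -> `|edot x z| <= n%:R.
Proof.
move=> /hballP bx z1; apply: (le_trans (ler_norm_sum _ _ _)).
apply: (@le_trans _ _ (\sum_(i < n) 1)); last by rewrite sumr_const card_ord.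
apply: ler_sum => i _; rewrite normrM -[1]mulr1; apply: ler_pM => //.
  rewrite -(ler_pXn2r (n := 2))// ?nnegrE// expr1n real_normK ?num_real//.
  exact: le_trans (edot_coord_le x i) (ltW bx).
by move/(rV_norm_leP z ler01) : z1; exact.
Qed.

(** The variation of [cfac] over the cube is at most [3/2 * r * N], which is a quarter of [q0] when
    [q0 = 6 * N * r]; this is the reason for the factor 6 in [local_scale]. *)
Lemma scaling_bound (q0 q r N e0 e ez exz : R) : 1 <= N -> q0 = r * (6 * N) -> 0 < r -> q0 <= 1 ->
  q0 = (1 - e0) / 2 -> q = (1 - e) / 2 -> e = e0 + 2 * r * exz + r ^+ 2 * ez ->
  `|exz| <= N -> 0 <= ez -> ez <= N -> 3 / 4 * q0 <= q <= 5 / 4 * q0.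
Proof.
move=> N1' qr r0 q1 h1 h2 h3 h4 h5 h6.
have hN : r * `|exz| <= r * N by rewrite ler_pM2l.
have ha : - (r * N) <= r * exz <= r * N by rewrite -ler_norml normrM (gtr0_norm r0).
have r1 : r <= 1 by apply: le_trans q1; rewrite qr ler_peMr ?(ltW r0)//; lra.
have hb : r ^+ 2 * ez <= r * N.
  rewrite expr2 -mulrA ler_pM2l//; apply: le_trans h6; rewrite ler_piMl//.
have hc : 0 <= r ^+ 2 * ez by rewrite mulr_ge0// sqr_ge0.
move/andP : ha => [a1 a2]; rewrite h2 h3; have : q0 = 6 * (r * N) by rewrite qr; ring.
move: a1 a2 hb hc h1; set A := r * exz; set B := r ^+ 2 * ez; set C := r * N.
rewrite (_ : 2 * r * exz = 2 * A); last by rewrite /A mulrA.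
by move=> *; apply/andP; split; lra.
Qed.

Lemma cfac_scale x z : ball x -> `|z| <= 1 ->
  3 / 4 * cfac x <= cfac (x + local_scale x *: z) <= 5 / 4 * cfac x.
Proof.
move=> bx z1.
apply: (@scaling_bound (cfac x) _ (local_scale x) n%:R (edot x x) (edot (x + local_scale x *: z) (x + local_scale x *: z)) (edot z z) (edot x z)) => //.
- by rewrite local_scale_small.
- exact: local_scale_gt0.
- exact: cfac_le1.
- exact: edot_affine.
- exact: edot_unit_le.
- exact: edot_ge0.
- by apply: (le_trans (edot_le_norm z)); rewrite ler_piMr ?(ltW N0)// expr_le1.
Qed.

Lemma ball_scale x z : ball x -> `|z| <= 1 -> ball (x + local_scale x *: z).
Proof.
move=> bx z1; have /andP[h _] := cfac_scale bx z1.
have : 0 < cfac (x + local_scale x *: z) by apply: lt_le_trans h; rewrite mulr_gt0 ?cfac_gt0.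
by rewrite /cfac pmulr_lgt0 ?invr_gt0// subr_gt0 => /hballP.
Qed.

Lemma scale_inv x y r : 0 < r -> y = x + r *: (r^-1 *: (y - x)).
Proof. by move=> r0; rewrite scalerA divff ?gt_eqF// scale1r addrC subrK. Qed.

Lemma norm_scale_inv x y r (d : R) : 0 < r -> (`|r^-1 *: (y - x)| < d) = (`|y - x| < r * d).
Proof.
by move=> r0; rewrite mx_normZ gtr0_norm ?invr_gt0// mulrC ltr_pdivrMr// [d * r]mulrC.
Qed.

Definition loc x r c f : 'rV[R]_n -> R := cut 1 (fun z => c * f (x + r *: z)).

Lemma measurable_loc x r c f : measurable_fun setT f -> measurable_fun setT (loc x r c f).
Proof.
move=> mf; apply: measurable_cut; apply: measurable_funM => //.
exact: (measurableT_comp mf (measurable_rV_affine x r)).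
Qed.

(** A change of variables in which the cut of [loc] is invisible, because [|z| + t <= 1]. The factor
    [d] is the homogeneity of the kernel: 1 for [ker], [r^-1] for its partial derivatives, [r^-2]
    for its Laplacian. *)
Lemma conv_loc x r c f k k1 t (d : R) z : 0 < r -> c != 0 -> d != 0 ->
  (forall y, t <= `|y| -> k y = 0) -> (forall y, k1 (r *: y) = d * k y) -> `|z| + t <= 1 ->
  L1 (fun y => loc x r c f y * k (z - y)) ->
  conv k (loc x r c f) z = c / (r ^+ n * d) * conv k1 f (x + r *: z).
Proof.
move=> r0 c0 d0 kt kd zt Lz.
pose Th y := f y * k1 (x + r *: z - y).
have ThE y : Th (x + r *: y) = d / c * (loc x r c f y * k (z - y)).
  rewrite /Th opprD addrACA subrr add0r -scalerBr kd /loc.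
  case: (cutP 1 (fun z => c * f (x + r *: z)) y) => -[y1 ->]; first by field.
  rewrite mul0r mulr0 (kt (z - y)) ?mulr0//.
  have := ler_normD (y - z) z; rewrite subrK distrC; move: zt y1; lra.
have La : L1 (fun y => Th (x + r *: y)) by under eq_fun do rewrite ThE; exact: L1Z.
have LT : L1 Th.
  have r0' : 0 < r^-1 by rewrite invr_gt0.
  have := L1_affine (- (r^-1 *: x)) r0' La; congr L1; apply/funext => y.
  by rewrite scalerDr scalerN !scalerA divff ?gt_eqF// !scale1r addrA subrr add0r.
have := Rintegral_affine x r0 LT; rewrite /conv => <-.
under [X in _ = _ * (_ * X)]eq_Rintegral do rewrite ThE.
rewrite (Rintegral_scale (d / c) Lz); field.
by rewrite c0 d0/= expf_neq0// gt_eqF.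
Qed.

End scaling.

Lemma sq_sum_bound (R : realType) (a b c e : R) : 0 <= c -> 0 <= e ->
  `|a| <= c -> `|b| <= e -> (a + b) ^+ 2 <= 2 * c ^+ 2 + 2 * e ^+ 2.
Proof.
move=> c0 e0 ac be.
have h1 : a ^+ 2 <= c ^+ 2 by rewrite -real_normK ?num_real// ler_pXn2r// nnegrE.
have h2 : b ^+ 2 <= e ^+ 2 by rewrite -[b ^+ 2]real_normK ?num_real// ler_pXn2r// nnegrE.
have := sqr_ge0 (a - b); rewrite sqrrB sqrrD; lra.
Qed.

Lemma abs_mul_bound (R : realType) (r q s d c : R) : 0 < r -> r <= q -> 0 <= s -> s <= c ->
  `|r * (s * d)| <= c * (q * `|d|).
Proof.
move=> r0 rq s0 sc; rewrite !normrM (gtr0_norm r0) (ger0_norm s0) mulrCA.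
have c0 : 0 <= c := le_trans s0 sc; have q0 : 0 <= q := le_trans (ltW r0) rq.
apply: ler_pM => //; first by rewrite mulr_ge0// ltW.
by apply: ler_wpM2r.
Qed.

Lemma abs_mul_bound1 (R : realType) (a y m s d c : R) : 0 <= a -> `|y| <= 1 -> 0 <= m -> m <= 1 ->
  0 <= s -> s <= c -> `|a * y * (m * (s * d))| <= a * c * `|d|.
Proof.
move=> a0 y1 m0 m1 s0 sc; rewrite !normrM (ger0_norm a0) (ger0_norm m0) (ger0_norm s0).
have c0 : 0 <= c := le_trans s0 sc.
rewrite -mulrA -[leRHS]mulrA; apply: (ler_wpM2l a0); rewrite !mulrA; apply: ler_wpM2r => //.
rewrite -[leRHS]mul1r; apply: ler_pM; rewrite ?mulr_ge0//.
by rewrite -[leRHS]mulr1; apply: ler_pM.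
Qed.

Lemma sq_bound_algebra (R : realType) (P Q q d S v : R) : d ^+ 2 <= S ->
  2 * (P * (q * `|d|)) ^+ 2 + 2 * (Q * `|v|) ^+ 2 <= (2 * P ^+ 2 + 2 * Q ^+ 2) * (q ^+ 2 * S + v ^+ 2).
Proof.
move=> dS; rewrite !exprMn !real_normK ?num_real//.
have P0 := sqr_ge0 P; have Q0 := sqr_ge0 Q; have q0 := sqr_ge0 q; have v0 := sqr_ge0 v.
have qS : q ^+ 2 * d ^+ 2 <= q ^+ 2 * S by rewrite ler_wpM2l.
have S0 : 0 <= S by exact: le_trans (sqr_ge0 d) dS.
have X1 : P ^+ 2 * (q ^+ 2 * d ^+ 2) <= P ^+ 2 * (q ^+ 2 * S) by exact: ler_wpM2l.
have X2 : 0 <= P ^+ 2 * v ^+ 2 by rewrite mulr_ge0.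
have X3 : 0 <= Q ^+ 2 * (q ^+ 2 * S) by rewrite mulr_ge0// mulr_ge0.
have -> : (2 * P ^+ 2 + 2 * Q ^+ 2) * (q ^+ 2 * S + v ^+ 2) = 2 * (P ^+ 2 * (q ^+ 2 * S)) + 2 * (P ^+ 2 * v ^+ 2) + 2 * (Q ^+ 2 * (q ^+ 2 * S)) + 2 * (Q ^+ 2 * v ^+ 2) by ring.
move: X1 X2 X3; lra.
Qed.

Lemma sum_cst_algebra (R : realType) n (a c K J : R) :
  a * K * J + \sum_(i < n) c * K * J = (a + n%:R * c) * K * J.
Proof. by rewrite sumr_const card_ord -mulr_natl; ring. Qed.

(** * The rescaled solution and its local data *)

Section rescaled_problem.
Context {R : realType} {n : nat}.
Implicit Types (x y z : 'rV[R]_n) (f k : 'rV[R]_n -> R).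
Local Notation mu := (@lebesgue_rV R n).
Local Notation ball := (@hball R n).
Local Notation al := ((n%:R - 2) / 2 : R).

Variables (lam p kap : R) (u : 'rV[R]_n -> R) (D : 'I_n -> 'rV[R]_n -> R).
Hypotheses (n2 : (2 <= n)%N) (kap1 : 1 < kap) (kapn : kap * (n%:R - 2) <= n%:R).
Hypotheses (p1 : 1 < p) (pkap : p + 1 <= 2 * kap).
Hypothesis HS : ball_solution lam p u D.

Let N1 : 1 <= n%:R :> R. Proof. by rewrite ler1n; exact: leq_trans n2. Qed.
Let N0 : 0 < n%:R :> R. Proof. exact: lt_le_trans N1. Qed.
Let mu_u : measurable_fun setT u. Proof. by have [[]] := HS. Qed.
Let mD i : measurable_fun setT (D i). Proof. by have [[]] := HS. Qed.
Let LE : L1 (energy u D). Proof. by have [_ []] := HS. Qed.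
Let al0 : 0 <= al. Proof. by rewrite divr_ge0// subr_ge0 ler_nat. Qed.
Let p0 : 0 < p. Proof. exact: lt_trans p1. Qed.

Definition conf_coef : R := lam - al * (al + 1).
(* Independent of the center x: this is what makes the local estimate uniform. *)
Definition growth_const : R := `|conf_coef| + 2 `^ `|al * p - al - 2|.
Definition coef_lin x z : R := local_scale x ^+ 2 * conf_coef * cfac (x + local_scale x *: z) `^ (- 2).
(** The powers of [cfac] at the center and at the moving point have total degree [-2], which the
    factor [local_scale x ^+ 2] compensates: the coefficient is bounded uniformly in [x]. *)
Definition coef_pow x z : R :=
  local_scale x ^+ 2 * cfac x `^ (al - al * p) * cfac (x + local_scale x *: z) `^ (al * p - al - 2).
(** The factor [cfac x ^ al] undoes the conformal weight at the center: the result is [u] at the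
    rescaled point, up to a power of a ratio between 3/4 and 5/4, so that its size is that of
    [u]. *)
Definition loc_u x : 'rV[R]_n -> R := loc x (local_scale x) (cfac x `^ al) (conf_u u).
Definition loc_D x i : 'rV[R]_n -> R := loc x (local_scale x) (local_scale x * cfac x `^ al) (conf_D u D i).
Definition loc_g x z : R := coef_lin x z * loc_u x z + coef_pow x z * (`|loc_u x z| `^ (p - 1) * loc_u x z).

Lemma growth_const_ge0 : 0 <= growth_const. Proof. by rewrite addr_ge0 ?powR_ge0. Qed.

Section fixed_center.
Variable x : 'rV[R]_n.
Hypothesis bx : ball x.
Let q0 := cfac x.
Let r := local_scale x.
Let q00 : 0 < q0. Proof. exact: cfac_gt0. Qed.
Let r0 : 0 < r. Proof. exact: local_scale_gt0. Qed.
Let rq : r <= q0 / 6.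
Proof.
rewrite /r /local_scale; apply: (ler_wpM2l (ltW q00)); rewrite lef_pV2 ?posrE ?mulr_gt0// ler_peMr//.
Qed.
Let pt z := x + r *: z.
Let near z (z1 : `|z| <= 1) : 3 / 4 * q0 <= cfac (pt z) <= 5 / 4 * q0. Proof. exact: cfac_scale. Qed.
Let bpt z (z1 : `|z| <= 1) : ball (pt z). Proof. exact: ball_scale. Qed.
Let qpos z (z1 : `|z| <= 1) : 0 < cfac (pt z). Proof. exact: cfac_gt0 (bpt z1). Qed.
Let ratio z b (z1 : `|z| <= 1) : (cfac (pt z) / q0) `^ b <= 2 `^ `|b|.
Proof.
by apply: ratio_pow_le; have /andP[h1 h2] := near z1; rewrite ler_pdivlMr// ler_pdivrMr// h1 h2.
Qed.

Let wE z : `|z| < 1 -> loc_u x z = (cfac (pt z) / q0) `^ (- al) * u (pt z).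
Proof.
move=> z1; rewrite /loc_u /loc cut_in// /conf_u mulrA -/r -/(pt z) -/q0; congr (_ * _).
by rewrite -[in q0 `^ al](opprK al) ratio_powE// qpos// ltW.
Qed.

Let w_out z : 1 <= `|z| -> loc_u x z = 0. Proof. by move=> z1; rewrite /loc_u /loc cut_out. Qed.
Let D_out i z : 1 <= `|z| -> loc_D x i z = 0. Proof. by move=> z1; rewrite /loc_D /loc cut_out. Qed.

Let DE i z : `|z| < 1 -> loc_D x i z = r * ((cfac (pt z) / q0) `^ (- al) * D i (pt z)) +
   al * pt z ord0 i * ((6 * n%:R)^-1 * ((cfac (pt z) / q0) `^ (- al - 1) * u (pt z))).
Proof.
move=> z1; have qz := qpos (ltW z1).
rewrite /loc_D /loc cut_in// /conf_D -/r -/(pt z) -/q0.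
rewrite -(ratio_powE (- al) qz q00) opprK -(ratio_powE (- al - 1) qz q00).
have -> : q0 `^ (- (- al - 1)) = q0 `^ al * q0.
  rewrite opprB opprK addrC powRD; last by rewrite (gt_eqF q00) implybT.
  by rewrite powRr1// ltW.
have -> : r = q0 / (6 * n%:R) by [].
by field; rewrite gt_eqF.
Qed.

Let e1 : 'rV[R]_n -> R := fun y => \1_(cube x r) y * energy u D y.

Let Le1 : L1 e1.
Proof.
apply: (L1_le _ _ LE).
  apply: measurable_funM; last exact: L1_measurable.
  exact: measurable_indic (measurable_cube _ _).
move=> y; rewrite normrM (ger0_norm (energy_ge0 u D y)) ler_piMl ?energy_ge0// indicE.
by case: (_ \in _); rewrite ?normr1 ?normr0.
Qed.

Definition energy_const : R := (2 `^ al) ^+ 2 + n%:R * (2 * (2 `^ al) ^+ 2 + 2 * (al * 2 `^ (al + 1)) ^+ 2).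

Let e1E z : `|z| < 1 -> e1 (pt z) = energy u D (pt z).
Proof.
move=> z1; rewrite /e1 indicE mem_set ?mul1r// /cube/= /pt addrAC subrr add0r mx_normZ gtr0_norm//.
by rewrite gtr_pMr.
Qed.

Let Fz z : `|z| < 1 ->
  loc_u x z ^+ 2 <= (2 `^ al) ^+ 2 * u (pt z) ^+ 2 /\
  forall i, loc_D x i z ^+ 2 <= (2 * (2 `^ al) ^+ 2 + 2 * (al * 2 `^ (al + 1)) ^+ 2) *
    (cfac (pt z) ^+ 2 * \sum_i D i (pt z) ^+ 2 + u (pt z) ^+ 2).
Proof.
move=> z1; have z1' := ltW z1; have a2 : 0 <= 2 `^ al :> R by exact: powR_ge0.
split.
  rewrite (wE z1) exprMn; apply: ler_wpM2r; first exact: sqr_ge0.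
  rewrite ler_pXn2r ?nnegrE ?powR_ge0//.
  by have := ratio (- al) z1'; rewrite normrN (ger0_norm al0).
move=> i; set q := cfac (pt z).
have qz : 0 < q by exact: qpos.
have rlq : r <= q.
  have /andP[h _] := near z1'; apply: le_trans rq _; apply: le_trans h; move: q00; lra.
set S := \sum_i _.
have S0 : 0 <= S by apply: sumr_ge0 => j _; exact: sqr_ge0.
have DS : D i (pt z) ^+ 2 <= S.
  rewrite /S (bigD1 i)//= lerDl sumr_ge0// => j _; exact: sqr_ge0.
have yi : `|pt z ord0 i| <= 1.
  rewrite -(ler_pXn2r (n := 2))// ?nnegrE// expr1n real_normK ?num_real//.
  by apply: le_trans (edot_coord_le _ i) _; move/hballP : (bpt z1') => /ltW.
have b1 : `|r * ((q / q0) `^ (- al) * D i (pt z))| <= 2 `^ al * (q * `|D i (pt z)|).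
  apply: (abs_mul_bound _ r0 rlq (powR_ge0 _ _)).
  by have := ratio (- al) z1'; rewrite normrN (ger0_norm al0).
have b2 : `|al * pt z ord0 i * ((6 * n%:R)^-1 * ((q / q0) `^ (- al - 1) * u (pt z)))| <= al * 2 `^ (al + 1) * `|u (pt z)|.
  apply: (abs_mul_bound1 _ al0 yi _ _ (powR_ge0 _ _)).
  - by rewrite invr_ge0 mulr_ge0.
  - rewrite invf_le1 ?mulr_gt0//; move: N1; lra.
  - by have := ratio (- al - 1) z1'; rewrite -opprD normrN (ger0_norm (addr_ge0 al0 ler01)).
rewrite (DE i z1); apply: le_trans (sq_sum_bound _ _ b1 b2) _.
- by rewrite mulr_ge0 ?powR_ge0// mulr_ge0// ltW.
- by rewrite mulr_ge0// mulr_ge0// powR_ge0.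
exact: sq_bound_algebra.
Qed.


(** The weight [cfac^n] becomes the Jacobian [r^n] of the rescaling, because [cfac] is at most
    [5/4 * 6 * n * r] on the cube; hence the constant [15 / 2 * n]. *)
Let energy_pt z : `|z| < 1 ->
  cfac (pt z) ^+ 2 * \sum_i D i (pt z) ^+ 2 + u (pt z) ^+ 2 <= (15 / 2 * n%:R) ^+ n * (r ^+ n * e1 (pt z)).
Proof.
move=> z1; have z1' := ltW z1; rewrite (energy_bound u D (bpt z1')) (e1E z1) [leRHS]mulrA; apply: ler_wpM2r; first exact: energy_ge0.
have E : 15 / 2 * n%:R * r = 5 / 4 * q0 by rewrite /q0 -(local_scale_small n2 bx) -/r; field.
have /andP[_ h] := near z1'; rewrite powR_mulrn; last exact: ltW (qpos z1').
rewrite -exprMn E; apply: lerXn2r; rewrite ?nnegrE//; first exact: ltW (qpos z1').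
exact: (mulr_ge0 (divr_ge0 (ler0n _ _) (ler0n _ _)) (ltW q00)).
Qed.

Let Le1z : L1 (fun z => e1 (pt z)). Proof. exact: L1_affine. Qed.

Let mw : measurable_fun setT (loc_u x).
Proof. by apply: measurable_loc; apply: measurable_funM => //; exact: measurable_cfac_pow. Qed.

Let mcoord i : measurable_fun setT (fun y : 'rV[R]_n => y ord0 i).
Proof. exact: measurable_rV_coord. Qed.

Let mGw i : measurable_fun setT (loc_D x i).
Proof.
apply: measurable_loc; apply: measurable_funD; first by apply: measurable_funM => //; exact: measurable_cfac_pow.
apply: measurable_funM => //; apply: measurable_funM; last exact: measurable_cfac_pow.
by apply: measurable_funM.
Qed.

Let Fle c f : measurable_fun setT f -> 0 <= c -> (forall z, 1 <= `|z| -> f z = 0) ->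
  (forall z, `|z| < 1 -> f z ^+ 2 <= c * (cfac (pt z) ^+ 2 * \sum_i D i (pt z) ^+ 2 + u (pt z) ^+ 2)) ->
  [/\ L1 (fun z => f z ^+ 2), L1 f &
     forall z, f z ^+ 2 <= c * (15 / 2 * n%:R) ^+ n * r ^+ n * e1 (pt z)].
Proof.
move=> mf c0 f0 fb.
have K0 : 0 <= (15 / 2 * n%:R) ^+ n :> R by rewrite exprn_ge0// mulr_ge0// divr_ge0.
have rn0 : 0 <= r ^+ n by rewrite exprn_ge0// ltW.
have b z : f z ^+ 2 <= c * (15 / 2 * n%:R) ^+ n * r ^+ n * e1 (pt z).
  have [z1|z1] := ltP `|z| 1.
    apply: (le_trans (fb z z1)); rewrite -[leRHS]mulrA -[leRHS]mulrA; apply: (ler_wpM2l c0).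
    exact: energy_pt.
  rewrite (f0 z z1) expr0n; apply: (mulr_ge0 (mulr_ge0 (mulr_ge0 c0 K0) rn0)).
  by rewrite /e1 mulr_ge0 ?energy_ge0// indicE.
have Lf2 : L1 (fun z => f z ^+ 2).
  apply: (L1_le _ _ (L1Z (c * (15 / 2 * n%:R) ^+ n * r ^+ n) Le1z)); first exact: measurable_funX.
  by move=> z; rewrite ger0_norm ?sqr_ge0.
split => //; apply: (L1_le mf _ (L1D Lf2 (L1_cube 0 ltr01))) => z.
have [z1|z1] := ltP `|z| 1.
  rewrite indicE mem_set/=; last by rewrite /cube/= subr0.
  have := sqr_ge0 (`|f z| - 1); rewrite sqrrB real_normK ?num_real//; have := normr_ge0 (f z); lra.
by rewrite (f0 z z1) normr0 addr_ge0 ?sqr_ge0// indicE.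
Qed.

Let c1 : R := 2 * (2 `^ al) ^+ 2 + 2 * (al * 2 `^ (al + 1)) ^+ 2.
Let c10 : 0 <= c1. Proof. by rewrite addr_ge0// mulr_ge0// sqr_ge0. Qed.

Let Lw : [/\ L1 (fun z => loc_u x z ^+ 2), L1 (loc_u x) &
     forall z, loc_u x z ^+ 2 <= (2 `^ al) ^+ 2 * (15 / 2 * n%:R) ^+ n * r ^+ n * e1 (pt z)].
Proof.
apply: (Fle mw (sqr_ge0 _) w_out) => z /Fz[h _]; apply: (le_trans h); apply: ler_wpM2l; first exact: sqr_ge0.
by rewrite lerDr mulr_ge0 ?sqr_ge0// sumr_ge0// => i _; exact: sqr_ge0.
Qed.

Let LG i : [/\ L1 (fun z => loc_D x i z ^+ 2), L1 (loc_D x i) &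
     forall z, loc_D x i z ^+ 2 <= c1 * (15 / 2 * n%:R) ^+ n * r ^+ n * e1 (pt z)].
Proof. by apply: (Fle (mGw i) c10 (@D_out i)) => z /Fz[_ h]; exact: h. Qed.

Lemma local_energy : \int[mu]_z loc_u x z ^+ 2 + \sum_i \int[mu]_z loc_D x i z ^+ 2 <=
  energy_const * (15 / 2 * n%:R) ^+ n * \int[mu]_y (\1_(cube x (local_scale x)) y * energy u D y).
Proof.
have I : r ^+ n * \int[mu]_z e1 (pt z) = \int[mu]_y e1 y by exact: Rintegral_affine.
have [Lw2 _ bw] := Lw.
have h1 : \int[mu]_z loc_u x z ^+ 2 <= (2 `^ al) ^+ 2 * (15 / 2 * n%:R) ^+ n * \int[mu]_y e1 y.
  rewrite -I mulrA -(Rintegral_scale _ Le1z); apply: (Rintegral_le Lw2 (L1Z _ Le1z)) => z; exact: bw.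
have h2 i : \int[mu]_z loc_D x i z ^+ 2 <= c1 * (15 / 2 * n%:R) ^+ n * \int[mu]_y e1 y.
  have [LG2 _ bG] := LG i.
  rewrite -I mulrA -(Rintegral_scale _ Le1z); apply: (Rintegral_le LG2 (L1Z _ Le1z)) => z; exact: bG.
apply: (le_trans (lerD h1 (ler_sum _ (fun i _ => h2 i)))).
rewrite [leRHS](_ : _ = ((2 `^ al) ^+ 2 + n%:R * c1) * (15 / 2 * n%:R) ^+ n * \int[mu]_y e1 y)//.
by rewrite sum_cst_algebra.
Qed.

Let inball z t : `|z| + t <= 1 -> [set y | `|y - (x + r *: z)| <= r * t] `<=` ball.
Proof.
move=> zt y /= yt; rewrite (scale_inv x y r0); apply: ball_scale => //.
rewrite mx_normZ gtr0_norm ?invr_gt0// ler_pdivrMl// mulr1.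
have -> : y - x = (y - (x + r *: z)) + r *: z by rewrite opprD addrA subrK.
apply: (le_trans (ler_normD _ _)); rewrite mx_normZ (gtr0_norm r0).
apply: (le_trans (lerD yt (lexx _))); by rewrite -mulrDr -[leRHS]mulr1 ler_pM2l// addrC.
Qed.

Let partial_ker_scale j i t y : partial i (@ker R n j (r * t)) (r *: y) = r^-1 * partial i (@ker R n j t) y.
Proof.
rewrite !partial_ker ker_scale ?gt_eqF// !mxE.
have [->|t0] := eqVneq t 0; first by rewrite mulr0 expr0n/= invr0 !mulr0.
by field; rewrite t0 gt_eqF.
Qed.

Let lap_ker_scale j t y : t != 0 -> @lap_ker R n j (r * t) (r *: y) = r ^- 2 * @lap_ker R n j t y.
Proof.
move=> t0; rewrite /lap_ker !ker_scale ?gt_eqF//.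
have -> : edot (r *: y) (r *: y) = r ^+ 2 * edot y y.
  by rewrite /edot mulr_sumr; apply: eq_bigr => i _; rewrite !mxE; ring.
by field; rewrite t0 gt_eqF.
Qed.

Let q0a : q0 `^ al != 0. Proof. by rewrite gt_eqF// powR_gt0. Qed.

Lemma local_gradient : kernel_gradient 1 (loc_u x) (loc_D x).
Proof.
move=> i t z t0 zt; have [_ L1w _] := Lw; have [_ L1G _] := LG i.
have rt0 : 0 < r * t by rewrite mulr_gt0.
have tk := test_ker 1 rt0 (inball zt).
have sk := supp_in_ker (n := n) 1 t0.
have kt0 y : t <= `|y| -> partial i (@ker R n 1 t) y = 0.
  by move=> ty; rewrite partial_ker ker_eq0// mul0r.
have Lk1 := convL1 (@continuous_partial_ker R n i 1 t) (supp_in_partial i sk) z L1w.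
have Lk2 := convL1 (@cker R n 1 t) sk z L1G.
rewrite (conv_loc r0 q0a (lt0r_neq0 (_ : 0 < r^-1)) kt0 (partial_ker_scale 1 i t) zt Lk1); last by rewrite invr_gt0.
have k1 y : ker 1 (r * t) (r *: y) = 1 * ker 1 t y by rewrite ker_scale ?gt_eqF// mul1r.
rewrite (conv_loc r0 (mulf_neq0 (lt0r_neq0 r0) q0a) (oner_neq0 _) (fun y => ker_eq0 1 t0) k1 zt Lk2).
have := conf_gradient n2 HS i tk.
have -> : \int[mu]_y (conf_u u y * partial i (fun y => ker 1 (r * t) (x + r *: z - y)) y) =
    - conv (partial i (@ker R n 1 (r * t))) (conf_u u) (x + r *: z).
  rewrite /conv -mulN1r -Rintegral_scale; last first.
    have := L1_conf_u HS (test_partial i tk).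
    move=> /(L1Z (-1)); congr L1; apply/funext => y.
    by rewrite partial_ker_reflect; ring.
  by apply: eq_Rintegral => y _; rewrite partial_ker_reflect; ring.
move=> /oppr_inj ->; rewrite /conv.
by field; rewrite expf_neq0 ?gt_eqF.
Qed.

Let f1 y := cfac y `^ (- al - 2) * u y.
Let f2 y := cfac y `^ (- al - 2) * (`|u y| `^ (p - 1) * u y).
(** The amplitude of the right-hand side: it carries [r^2] with respect to the amplitude of [loc_u],
    which balances the factor [r^-2] of the Laplacian of a rescaled kernel. *)
Let cc : R := r ^+ 2 * q0 `^ al.
Let cc0 : cc != 0. Proof. exact: mulf_neq0 (expf_neq0 2 (lt0r_neq0 r0)) q0a. Qed.

Let powq z (a b : R) (z1 : `|z| <= 1) : cfac (pt z) `^ a * cfac (pt z) `^ b = cfac (pt z) `^ (a + b).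
Proof. by rewrite powRD// (gt_eqF (qpos z1)) implybT. Qed.

Let powq0 (a b : R) : q0 `^ a * q0 `^ b = q0 `^ (a + b).
Proof. by rewrite powRD// (gt_eqF q00) implybT. Qed.

Let r_le z (z1 : `|z| <= 1) : r ^+ 2 * cfac (pt z) `^ (- 2) <= 1.
Proof.
have /andP[h _] := near z1; have rlq : r <= cfac (pt z).
  by apply: le_trans rq _; apply: le_trans h; move: q00; lra.
have qz := qpos z1.
rewrite powR_invn ?(ltW qz)// -exprVn -exprMn; apply: exprn_ile1.
  by rewrite mulr_ge0 ?(ltW r0)// invr_ge0 ltW.
by rewrite ler_pdivrMr// mul1r.
Qed.

Let linE z : `|z| < 1 -> r ^+ 2 * cfac (pt z) `^ (- 2) * loc_u x z = loc x r cc f1 z.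
Proof.
move=> z1; have z1' := ltW z1; rewrite (wE z1) -(ratio_powE (- al) (qpos z1') q00) opprK.
rewrite /loc cut_in// /f1 /cc -/(pt z).
have -> : cfac (pt z) `^ (- al - 2) = cfac (pt z) `^ (- al) * cfac (pt z) `^ (- 2) by rewrite (powq _ _ z1').
ring.
Qed.

Let powE z : `|z| < 1 -> coef_pow x z * (`|loc_u x z| `^ (p - 1) * loc_u x z) = loc x r cc f2 z.
Proof.
move=> z1; have z1' := ltW z1; have qz := qpos z1'; rewrite (wE z1) -(ratio_powE (- al) qz q00) opprK.
rewrite /loc cut_in// /f2 /cc -/(pt z) /coef_pow -/r -/q0 -/(pt z) !normrM !(ger0_norm (powR_ge0 _ _)).
rewrite (powRM (p - 1) (mulr_ge0 (powR_ge0 _ _) (powR_ge0 _ _)) (normr_ge0 _)) (powRM (p - 1) (powR_ge0 _ _) (powR_ge0 _ _)) -!powRrM.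
set q := cfac (pt z); have -> : q `^ (- al - 2) = q `^ (al * p - al - 2) * q `^ (- al * (p - 1)) * q `^ (- al).
  by rewrite !(powq _ _ z1'); congr powR; ring.
have -> : q0 `^ al = q0 `^ (al - al * p) * q0 `^ (al * (p - 1)) * q0 `^ al.
  by rewrite !powq0; congr powR; ring.
have -> : q0 `^ (al - al * p) * q0 `^ (al * (p - 1)) * q0 `^ al = q0 `^ al.
  by rewrite !powq0; congr powR; ring.
have E : q0 `^ (al - al * p) * q0 `^ (al * (p - 1)) = 1 by rewrite powq0 -[RHS](powRr0 q0); congr powR; ring.
transitivity (r ^+ 2 * (q0 `^ (al - al * p) * q0 `^ (al * (p - 1))) * (q `^ (al * p - al - 2) * q `^ (- al * (p - 1)) * q `^ (- al)) * q0 `^ al * (`|u (pt z)| `^ (p - 1) * u (pt z))).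
  ring.
by rewrite E; ring.
Qed.

Let pow_le z (z1 : `|z| <= 1) : `|coef_pow x z| <= 2 `^ `|al * p - al - 2|.
Proof.
have qz := qpos z1; rewrite ger0_norm; last by rewrite /coef_pow mulr_ge0 ?powR_ge0// mulr_ge0 ?powR_ge0 ?sqr_ge0.
have -> : coef_pow x z = (r / q0) ^+ 2 * (cfac (pt z) / q0) `^ (al * p - al - 2).
  rewrite -(ratio_powE _ qz q00) /coef_pow -/r -/q0 -/(pt z).
  have -> : q0 `^ (- (al * p - al - 2)) = q0 `^ (al - al * p) * q0 ^+ 2.
    by rewrite -powR_mulrn ?(ltW q00)// powq0; congr powR; ring.
  by field; rewrite gt_eqF.
rewrite -[leRHS]mul1r; apply: ler_pM; rewrite ?sqr_ge0 ?powR_ge0//; last exact: ratio.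
apply: exprn_ile1; first by rewrite divr_ge0// ltW.
by rewrite ler_pdivrMr// mul1r; apply: le_trans rq _; move: q00; lra.
Qed.

Let lin_out z : 1 <= `|z| -> loc x r cc f1 z = 0. Proof. by move=> z1; rewrite /loc cut_out. Qed.
Let pow_out z : 1 <= `|z| -> loc x r cc f2 z = 0. Proof. by move=> z1; rewrite /loc cut_out. Qed.

Let gE z : loc_g x z = conf_coef * loc x r cc f1 z + 1 * loc x r cc f2 z.
Proof.
have [z1|z1] := ltP `|z| 1.
  rewrite -linE// -powE// /loc_g /coef_lin -/r -/(pt z); ring.
by rewrite /loc_g (w_out z1) lin_out// pow_out// !mulr0 addr0.
Qed.

Let mf2 : measurable_fun setT f2.
Proof.
apply: measurable_funM; first exact: measurable_cfac_pow.
by apply: measurable_funM => //; exact: measurable_abs_powR.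
Qed.

Let mf1 : measurable_fun setT f1.
Proof. by apply: measurable_funM => //; exact: measurable_cfac_pow. Qed.

Let abs_pow (a : R) : `| `|a| `^ (p - 1) * a| = `|a| `^ p.
Proof. by rewrite normrM (ger0_norm (powR_ge0 _ _)) mulrC mulr_powRB1. Qed.

Let lin_bound z : `|loc x r cc f1 z| <= `|loc_u x z|.
Proof.
have [z1|z1] := ltP `|z| 1; last by rewrite lin_out// normr0.
rewrite -linE// normrM ler_piMl// ger0_norm; first exact: r_le (ltW z1).
exact: (mulr_ge0 (sqr_ge0 _) (powR_ge0 _ _)).
Qed.

Let pow_bound z : `|loc x r cc f2 z| <= 2 `^ `|al * p - al - 2| * `|loc_u x z| `^ p.
Proof.
have [z1|z1] := ltP `|z| 1; last by rewrite pow_out// normr0 mulr_ge0 ?powR_ge0.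
by rewrite -powE// normrM abs_pow; apply: ler_wpM2r; [exact: powR_ge0|exact: pow_le (ltW z1)].
Qed.

Lemma local_growth z : `|loc_g x z| <= growth_const * (`|loc_u x z| + `|loc_u x z| `^ p).
Proof.
rewrite gE mul1r; apply: (le_trans (ler_normD _ _)); rewrite normrM.
have h1 := ler_wpM2l (normr_ge0 conf_coef) (lin_bound z); have h2 := pow_bound z.
apply: (le_trans (lerD h1 h2)); rewrite /growth_const.
set P := 2 `^ _; set a := `|loc_u x z|; set b := a `^ p.
have P0 : 0 <= P by exact: powR_ge0.
have a0 : 0 <= a by exact: normr_ge0. have b0 : 0 <= b by exact: powR_ge0.
have n0 : 0 <= `|conf_coef| by exact: normr_ge0.
rewrite mulrDl !mulrDr; have := mulr_ge0 n0 b0; have := mulr_ge0 P0 a0; lra.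
Qed.

Lemma measurable_loc_g : measurable_fun setT (loc_g x).
Proof.
have -> : loc_g x = (fun z => conf_coef * loc x r cc f1 z + 1 * loc x r cc f2 z) by apply/funext => z; exact: gE.
by apply: measurable_funD; apply: measurable_funM => //; exact: measurable_loc.
Qed.

Let r1 : R := 1 / (4 * n%:R + 4).

(** Obtained from [local_gradient] and the Sobolev inequality alone, ahead of [local_poisson], whose
    right-hand side would otherwise not be known to be integrable against a kernel. *)
Let Lpow : L1 (cut r1 (fun z => `|loc_u x z| `^ p)).
Proof.
have [C C0 HC] := sobolev_weak n2 kap1 kapn (ltr01 : 0 < (1 : R)).
have [Lw2 L1w _] := Lw.
have [LS _] := HC _ _ L1w Lw2 (fun i => let: And3 _ h _ := LG i in h) (fun i => let: And3 h _ _ := LG i in h) local_gradient.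
have k0 : 0 < 2 * kap by rewrite mulr_gt0// (lt_trans ltr01).
have LS' : L1 (fun z => `|cut r1 (loc_u x) z| `^ (2 * kap)).
  by under eq_fun do rewrite cut_powR//.
have := L1_powR_interp (L1_cut r1 L1w) LS' (ltW p1).
have -> : (fun z => `|cut r1 (loc_u x) z| `^ p) = cut r1 (fun z => `|loc_u x z| `^ p).
  by apply/funext => z; rewrite cut_powR.
by apply; apply: le_trans pkap; rewrite lerDl.
Qed.

Lemma local_poisson j : kernel_poisson j r1 (loc_u x) (loc_g x).
Proof.
move=> t z t0 ztr; have [_ L1w _] := Lw.
have r11 : r1 <= 1 by rewrite /r1 ler_pdivrMr ?mul1r; move: N1; lra.
have zt := le_trans ztr r11.
have rt0 : 0 < r * t by rewrite mulr_gt0.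
have tk := test_ker j rt0 (inball zt).
have sk := supp_in_ker (n := n) j t0.
have sl : supp_in t (@lap_ker R n j t) by move=> y ty; apply: lap_ker_eq0 => //; exact: ltW.
have Lk1 := convL1 (@lap_ker_continuous R n j t) sl z L1w.
have d0 : r ^- 2 != 0 by rewrite invr_eq0 expf_neq0// gt_eqF.
rewrite (conv_loc r0 q0a d0 (fun y => lap_ker_eq0 j t0) (fun y => lap_ker_scale j y (lt0r_neq0 t0)) zt Lk1).
have L1lin : L1 (loc x r cc f1).
  exact: (L1_le (measurable_loc _ _ _ mf1) lin_bound (L1_norm L1w)).
have Lk2 := convL1 (@cker R n j t) sk z L1lin.
have [B B0 HB] := @ker_bounded R n j.
have Lk3 : L1 (fun y => loc x r cc f2 y * ker j t (z - y)).
  apply: (L1_le _ _ (L1Z (2 `^ `|al * p - al - 2| * B) Lpow)).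
    apply: measurable_funM; first exact: measurable_loc.
    apply: measurable_comp_sub; exact: continuousT_measurable_rV (@cker R n j t).
  move=> y; case: (cutP r1 (fun z => `|loc_u x z| `^ p) y) => -[yr ->].
    by rewrite normrM mulrAC; apply: (ler_pM (normr_ge0 _) (normr_ge0 _) (pow_bound y) (HB _ _ t0)).
  rewrite (ker_eq0 j t0) ?mulr0 ?normr0//.
  have := ler_normD (y - z) z; rewrite subrK distrC; move: ztr yr; lra.
have k1 y : ker j (r * t) (r *: y) = 1 * @ker R n j t y by rewrite ker_scale ?gt_eqF// mul1r.
have e2 := conv_loc r0 cc0 (oner_neq0 _) (fun y => ker_eq0 j t0) k1 zt Lk2.
have e3 := conv_loc r0 cc0 (oner_neq0 _) (fun y => ker_eq0 j t0) k1 zt Lk3.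
have -> : conv (ker j t) (loc_g x) z = conf_coef * conv (ker j t) (loc x r cc f1) z + 1 * conv (ker j t) (loc x r cc f2) z.
  have [_ <-] := Rintegral_comb conf_coef 1 Lk2 Lk3; apply: eq_Rintegral => y _; rewrite gE; ring.
rewrite e2 e3.
have := conf_poisson n2 HS tk.
have -> : \int[mu]_y (conf_u u y * \sum_i partial i (partial i (fun y => ker j (r * t) (x + r *: z - y))) y) =
    conv (lap_ker j (r * t)) (conf_u u) (x + r *: z).
  by apply: eq_Rintegral => y _; rewrite lap_ker_reflect.
have -> : \int[mu]_y (u y * (cfac y `^ (- al - 2) * ker j (r * t) (x + r *: z - y))) =
    conv (ker j (r * t)) f1 (x + r *: z).
  by apply: eq_Rintegral => y _; rewrite /f1; ring.
have -> : \int[mu]_y (`|u y| `^ (p - 1) * u y * (cfac y `^ (- al - 2) * ker j (r * t) (x + r *: z - y))) =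
    conv (ker j (r * t)) f2 (x + r *: z).
  by apply: eq_Rintegral => y _; rewrite /f2; ring.
move=> ->; rewrite -/conf_coef /cc.
by field; rewrite ?expf_neq0 ?gt_eqF.
Qed.

Lemma rescaled_local_data : local_data growth_const p (loc_u x) (loc_D x) (loc_g x).
Proof.
have [Lw2 L1w _] := Lw; split.
  by split => // i; have [] := LG i.
split; [exact: local_gradient|exact: local_poisson|exact: measurable_loc_g|exact: local_growth].
Qed.

End fixed_center.
End rescaled_problem.

(** * From local to global *)

Section signed_power.
Context {R : realType}.
Variable p : R.
Hypothesis p1 : 1 < p.

Let H (s : R) := `|s| `^ (p - 1) * s.

(** At 0 the difference quotient is [|h|^(p-1)], which tends to 0 as [p > 1]; negative arguments
    follow from oddness. *)
Lemma is_derive_signed_pow (s : R) : is_derive s 1 H (p * `|s| `^ (p - 1)).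
Proof.
have p10 : 0 < p - 1 by rewrite subr_gt0.
have pos (t : R) : 0 < t -> is_derive t 1 H (p * `|t| `^ (p - 1)).
  move=> t0; rewrite gtr0_norm//; have := is_derive1_powR p t0; apply: near_eq_is_derive; near=> y; have y0 : 0 < y by near: y; apply: open_nbhs_nbhs; split; [exact: open_gt|exact: t0].
  by rewrite /H gtr0_norm// mulrC mulr_powRB1 ?(ltW y0)// (lt_trans ltr01).
have [s0|s0|->] := ltgtP s 0; last 1 first.
- apply: is_derive_eps => e e0; rewrite normr0 powR0 ?gt_eqF// mulr0.
  have /cvgrPdist_lt/(_ e e0) := @powR_abs_continuous R (p - 1) p10 0.
  rewrite normr0 powR0 ?gt_eqF// => -[d /= d0 dH]; exists d => // h h0 hd.
  have := dH h; rewrite /= sub0r normrN => /(_ hd); rewrite sub0r normrN.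
  by rewrite /H addr0 mulr0 !subr0 /GRing.scale/= mulr1 mulrCA mulVf// mulr1.
- have h := is_derive_opp_arg (pos (- s) (_ : 0 < - s)); rewrite oppr_gt0 in h; have := h s0.
  rewrite normrN; congr is_derive; apply/funext => t; by rewrite /H normrN mulrN opprK.
- exact: pos.
Unshelve. all: by end_near. Qed.

Lemma class_C1_signed_pow n (U : set 'rV[R]_n) (f : 'rV[R]_n -> R) : open U -> class_C 1 U f ->
  class_C 1 U (fun z => `|f z| `^ (p - 1) * f z).
Proof.
move=> oU Cf; have p10 : 0 < p - 1 by rewrite subr_gt0.
have cf x : U x -> {for x, continuous f} by exact: class_C_cont Cf.
have ca x : U x -> {for x, continuous (fun z => `|f z| `^ (p - 1))}.
  by move=> Ux; exact: (continuous_comp (cf x Ux) (@powR_abs_continuous R (p - 1) p10 (f x))).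
apply: (@class_CS R n 0 U _ (fun i z => p * `|f z| `^ (p - 1) * partial i f z) oU).
- by move=> x Ux; exact: cvgM (ca x Ux) (cf x Ux).
- by move=> i x Ux; exact: (is_derive_comp1 (is_derive_signed_pow (f x)) (class_C_derive i Cf Ux)).
- move=> i; apply: (class_CM oU _ (class_C_partial i Cf)).
  by apply: (class_CM oU (class_C_cst 0 p oU)); split => // x; exact: ca.
Qed.

End signed_power.

(** * Affine maps, null sets and gluing *)

Section affine_maps.
Context {R : realType} {n : nat}.
Implicit Types (a x y z : 'rV[R]_n) (f g : 'rV[R]_n -> R) (r d : R) (U V W : set 'rV[R]_n).
Local Notation mu := (@lebesgue_rV R n).

Lemma is_derive_affine a r f z i (df : R) : is_derive (a + r *: z) (delta_mx ord0 i) f df ->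
  is_derive z (delta_mx ord0 i) (fun z => f (a + r *: z)) (r * df).
Proof.
move=> /is_derive_line0 h; apply/is_derive_line0.
have hr : is_derive (0 : R) 1 (fun s : R => r * s) r.
  have := is_derive_mul (is_derive_const r (0 : R) (1 : R)) (is_derive_id (0 : R) 1).
  by congr is_derive; rewrite mul0r addr0 mulr1.
have h0 : is_derive (r * 0) 1 (fun s : R => f (s *: delta_mx ord0 i + (a + r *: z))) df by rewrite mulr0.
have := @is_derive1_comp _ (fun s : R => f (s *: delta_mx ord0 i + (a + r *: z))) (fun s : R => r * s) 0 df r h0 hr.
congr is_derive; last by rewrite mulrC.
 apply/funext => s /=; congr f.
by rewrite scalerDr scalerA addrCA.
Qed.

Lemma class_C_affine m a r V W f : open W -> (forall z, W z -> V (a + r *: z)) ->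
  class_C m V f -> class_C m W (fun z => f (a + r *: z)).
Proof.
move=> oW WV; have cc g : class_C 0 V g -> forall z, W z -> {for z, continuous (fun z => g (a + r *: z))}.
  move=> Cg z Wz; apply/cont_rVP => e e0.
  have [d d0 H] := (cont_rVP g _).1 (class_C_cont Cg (WV z Wz)) e e0.
  have r1 : 0 < `|r| + 1 by rewrite ltr_wpDl.
  exists (d / (`|r| + 1)); first exact: divr_gt0.
  move=> y; rewrite ltr_pdivlMr// => yz; apply: H.
  rewrite opprD addrACA subrr add0r -scalerBr mx_normZ mulrC; apply: le_lt_trans yz.
  by rewrite ler_wpM2l// lerDl.
elim: m f => [|m IH] f Cf; first by split => // z; exact: cc Cf z.
apply: (@class_CS R n m W _ (fun i z => r * partial i f (a + r *: z)) oW).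
- exact: cc (class_C_le (leq0n _) Cf).
- by move=> i z Wz; exact: is_derive_affine (class_C_derive i Cf (WV z Wz)).
- by move=> i; apply: (class_CM oW (class_C_cst m r oW)); exact: IH (class_C_partial i Cf).
Qed.

Lemma ae_affine a r (P : 'rV[R]_n -> Prop) : 0 < r -> {ae mu, forall z, P z} ->
  {ae mu, forall z, P (a + r *: z)}.
Proof.
move=> r0 [B [mB B0 PB]].
exists ((fun z => a + r *: z) @^-1` B); split => //.
- by rewrite -[X in measurable X]setTI; exact: (measurable_rV_affine a r measurableT mB).
- have mC : measurable ((fun z : 'rV[R]_n => a + r *: z) @^-1` B).
    by rewrite -[X in measurable X]setTI; exact: (measurable_rV_affine a r measurableT mB).
  have := @ge0_integral_affine R n a r (fun z => (\1_B z)%:E) r0.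
  have mi : measurable_fun setT (fun z : 'rV[R]_n => (\1_B z)%:E : \bar R).
    by apply/measurable_EFinP; exact: measurable_indic.
  have -> : (\int[mu]_z (\1_B z)%:E)%E = 0%E by rewrite integral_indic// setIT; exact: B0.
  have -> : (\int[mu]_z (\1_B (a + r *: z))%:E)%E = mu ((fun z => a + r *: z) @^-1` B).
    have -> : (fun z : 'rV[R]_n => (\1_B (a + r *: z))%:E : \bar R) = (fun z => (\1_((fun z => a + r *: z) @^-1` B) z)%:E).
      by apply/funext => z; rewrite !indicE.
    by rewrite integral_indic// setIT.
  move=> /(_ mi) h; have {}h := h (fun z => ltac:(by rewrite lee_fin indicE)).
  have rn : r ^+ n != 0 by rewrite expf_neq0// gt_eqF.
  by move/eqP : h; rewrite mule_eq0 eqe (negbTE rn)/= => /eqP.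
- by move=> z /= nP; apply: PB.
Qed.

(** Lindelof's argument: each point lies in a rational cube contained in a good neighbourhood, and
    there are countably many rational cubes, so the exceptional set is a countable union of
    negligible sets. *)
Lemma ae_local (O : set 'rV[R]_n) (P : 'rV[R]_n -> Prop) :
  (forall x, O x -> exists2 d, 0 < d & {ae mu, forall y, cube x d y -> P y}) ->
  {ae mu, forall y, O y -> P y}.
Proof.
move=> H; pose N (q : 'rV[rat]_n * nat) := cube (map_mx ratr q.1 : 'rV[R]_n) q.2.+1%:R^-1 `&` ~` [set y | P y].
pose F (k : nat) := if (unpickle k : option ('rV[rat]_n * nat)) is Some q
  then (if `[< mu.-negligible (N q) >] then N q else set0) else set0.
have nF k : mu.-negligible (F k).
  by rewrite /F; case: unpickle => [q|]; [case: asboolP => // _|]; exact: negligible_set0.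
apply: negligibleS (negligible_bigcup nF) => y /= /not_implyP[Oy nPy].
have [d d0 [B [mB B0 PB]]] := H y Oy; have [q [qy qd]] := rational_cube y d0.
exists (pickle q) => //; rewrite /F pickleK; case: asboolP => //= -[].
exists B; split => // z [qz nPz]; apply: PB => /= /(_ (qd z qz)); exact: nPz.
Qed.

(** The value at [x] is taken from the local function chosen at [x]. Two local functions agree
    almost everywhere with [f] on the overlap of their cubes, hence agree there by continuity, so
    nothing depends on the choice. *)
Lemma class_C_glue m (O : set 'rV[R]_n) f : open O ->
  (forall x, O x -> exists (w : 'rV[R]_n -> R) d, [/\ 0 < d, cube x d `<=` O, class_C m (cube x d) w &
     {ae mu, forall y, cube x d y -> w y = f y}]) ->
  exists2 v, class_C m O v & {ae mu, forall y, O y -> v y = f y}.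
Proof.
move=> oO H.
have H' x : exists Vd : ('rV[R]_n -> R) * R, O x -> [/\ 0 < Vd.2, cube x Vd.2 `<=` O,
    class_C m (cube x Vd.2) Vd.1 & {ae mu, forall y, cube x Vd.2 y -> Vd.1 y = f y}].
  have [Ox|nOx] := pselect (O x); last by exists (f, 0).
  by have [V [d Hd]] := H x Ox; exists (V, d).
have [Vd VdP] := choice H'; pose v x := (Vd x).1 x.
have vE x : O x -> forall y, cube x (Vd x).2 y -> v y = (Vd x).1 y.
  move=> Ox y xy; have [dx0 xO CVx aex] := VdP x Ox; have Oy := xO y xy.
  have [dy0 yO CVy aey] := VdP y Oy.
  have o2 : open (cube x (Vd x).2 `&` cube y (Vd y).2) by apply: openI; exact: open_cube.
  rewrite /v; apply: (@ae_eq_cont R n _ (Vd y).1 (Vd x).1 o2).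
  - by move=> z [_ yz]; exact: class_C_cont CVy yz.
  - by move=> z [xz _]; exact: class_C_cont CVx xz.
  - by apply: filterS2 aex aey => z hx hy [xz yz]; rewrite (hx xz) (hy yz).
  - by split => //; rewrite /cube/= subrr normr0.
exists v.
  apply: class_C_local => x Ox; have [d0 xO CV _] := VdP x Ox.
  exists (cube x (Vd x).2); split; [exact: open_cube|by rewrite /cube/= subrr normr0|].
  by apply: (class_C_ext (@open_cube R n x _) _ CV) => y /(vE x Ox).
apply: ae_local => x Ox; have [d0 xO CV aeV] := VdP x Ox; exists (Vd x).2 => //.
by apply: filterS aeV => y Vy xy; rewrite (vE x Ox y xy) (Vy xy).
Qed.

Lemma measurable_cut_cont r f : (forall x, cube 0 r x -> {for x, continuous f}) ->
  measurable_fun setT (cut r f).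
Proof.
move=> cf; have -> : cut r f = f \_ (cube 0 r).
  apply/funext => y; rewrite patchE /cut indicE mem_setE; case: ifP => _; by rewrite ?mul1r ?mul0r.
apply/(measurable_restrictT _ (measurable_cube _ _)).
by apply: continuous_measurable_rV => //; exact: open_cube.
Qed.

Lemma conv_ae k f g x : measurable_fun setT k -> measurable_fun setT f -> measurable_fun setT g ->
  {ae mu, forall y, f y = g y} -> conv k f x = conv k g x.
Proof.
move=> mk mf mg fg; rewrite /conv /Rintegral; congr fine; apply: ae_eq_integral => //.
- by apply/measurable_EFinP; apply: measurable_funM => //; exact: measurable_comp_sub.
- by apply/measurable_EFinP; apply: measurable_funM => //; exact: measurable_comp_sub.
- by apply: filterS fg => y -> _.
Qed.

End affine_maps.

(** * Regularity and decay on the ball *)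

Section global_solution.
Context {R : realType} {n : nat}.
Implicit Types (x y z : 'rV[R]_n) (U f : 'rV[R]_n -> R) (d e : R).
Local Notation mu := (@lebesgue_rV R n).
Local Notation ball := (@hball R n).
Local Notation al := ((n%:R - 2) / 2 : R).
Local Notation rho := (@core_radius R n).

Variables (lam p kap : R) (u : 'rV[R]_n -> R) (D : 'I_n -> 'rV[R]_n -> R).
Hypotheses (n2 : (2 <= n)%N) (kap1 : 1 < kap) (kapn : kap * (n%:R - 2) <= n%:R).
Hypotheses (p1 : 1 < p) (pkap : p + 1 <= 2 * kap).
Hypothesis HS : ball_solution lam p u D.

Let N1 : 1 <= n%:R :> R. Proof. by rewrite ler1n; exact: leq_trans n2. Qed.
Let N0 : 0 < n%:R :> R. Proof. exact: lt_le_trans N1. Qed.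
Let D2 : 1 <= 4 * n%:R + 4 :> R. Proof. by move: N1; lra. Qed.
Let D0 : 0 < 4 * n%:R + 4 :> R. Proof. exact: lt_le_trans D2. Qed.

Let rho0 : 0 < rho. Proof. exact: core_radius_gt0. Qed.

Let rho_r1 : rho <= 1 / (4 * n%:R + 4).
Proof.
have h : 0 <= 1 / (4 * n%:R + 4) :> R by rewrite divr_ge0// ltW.
rewrite /core_radius ler_pdivrMr// ler_pdivrMr//; apply: (le_trans (_ : _ <= 1 / (4 * n%:R + 4) * 1)); first by rewrite mulr1.
by rewrite -[leRHS]mulrA; apply: ler_wpM2l => //; move: D2; lra.
Qed.

Let rho1 : rho <= 1.
Proof. by apply: le_trans rho_r1 _; rewrite ler_pdivrMr// mul1r. Qed.

Let data x := @rescaled_local_data R n lam p kap u D n2 kap1 kapn p1 pkap HS x.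

Let cube_sub x d : ball x -> d <= 1 -> cube x (local_scale x * d) `<=` ball.
Proof.
move=> bx d1 y; have r0 := local_scale_gt0 n2 bx.
rewrite /cube/= -norm_scale_inv// => yd; rewrite (scale_inv x y r0); apply: ball_scale => //.
exact: le_trans (ltW yd) d1.
Qed.

(* Recovers the solution near x from the rescaled one. *)
Definition unscale x U y : R :=
  cfac x `^ (- al) * (cfac y `^ al * U (- ((local_scale x)^-1 *: x) + (local_scale x)^-1 *: y)).

Let argE x y : - ((local_scale x)^-1 *: x) + (local_scale x)^-1 *: y = (local_scale x)^-1 *: (y - x).
Proof. by rewrite scalerBr addrC. Qed.

Let arg_cube x y d : ball x -> cube x (local_scale x * d) y -> cube 0 d (- ((local_scale x)^-1 *: x) + (local_scale x)^-1 *: y).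
Proof. by move=> bx; rewrite argE /cube/= subr0 norm_scale_inv// local_scale_gt0. Qed.

Let unscale_class m x U d : ball x -> d <= 1 -> class_C m (cube 0 d) U ->
  class_C m (cube x (local_scale x * d)) (unscale x U).
Proof.
move=> bx d1 CU; have oQ : open (cube x (local_scale x * d)) by exact: open_cube.
apply: (class_CM oQ (class_C_cst m _ oQ)); apply: (class_CM oQ).
  exact: class_C_sub (cube_sub bx d1) (class_C_cfac_pow m al).
by apply: (class_C_affine oQ _ CU) => y; exact: arg_cube.
Qed.

Let unscale_ae x U d : ball x -> d <= 1 -> {ae mu, forall z, cube 0 d z -> U z = loc_u u x z} ->
  {ae mu, forall y, cube x (local_scale x * d) y -> unscale x U y = u y}.
Proof.
move=> bx d1 aeU; have r0 := local_scale_gt0 n2 bx; have ri : 0 < (local_scale x)^-1 by rewrite invr_gt0.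
apply: filterS (ae_affine (- ((local_scale x)^-1 *: x)) ri aeU) => y h xy.
have cy := arg_cube bx xy; have qy := cfac_gt0 (cube_sub bx d1 xy); have q0 := cfac_gt0 bx.
rewrite /unscale (h cy) argE /loc_u /loc cut_in; last first.
  by move: cy; rewrite argE /cube/= subr0 => /lt_le_trans; apply.
rewrite -(scale_inv x y r0) /conf_u !powRN.
by field; rewrite !gt_eqF// powR_gt0.
Qed.

Let unscale_center x U : ball x -> unscale x U x = U 0.
Proof.
move=> bx; have q0 := cfac_gt0 bx; rewrite /unscale argE subrr scaler0 mulrA powRN mulVf ?mul1r//.
by rewrite gt_eqF// powR_gt0.
Qed.

(** The inverse of [local_scale x] is [6 * n / cfac x], so multiplication by [cfac x], which gives
    the size of the hyperbolic gradient, leaves a bound without any power of [cfac]. *)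
Let unscale_partial x U d i : ball x -> 0 < d -> class_C 1 (cube 0 d) U ->
  cfac x * partial i (unscale x U) x = - al * x ord0 i * U 0 + 6 * n%:R * partial i U 0.
Proof.
move=> bx d0 CU; have q0 := cfac_gt0 bx; have r0 := local_scale_gt0 n2 bx.
have z0 : - ((local_scale x)^-1 *: x) + (local_scale x)^-1 *: x = 0 by rewrite argE subrr scaler0.
have DU : is_derive (- ((local_scale x)^-1 *: x) + (local_scale x)^-1 *: x) (delta_mx ord0 i) U (partial i U 0).
  by rewrite z0; apply: class_C_derive CU _; rewrite /cube/= subrr normr0.
have Dq := is_derive_cfac_pow al i bx.
have := is_derive_mul (is_derive_const (cfac x `^ (- al)) x _) (is_derive_mul Dq (is_derive_affine DU)).
move=> /partial_is_derive ->; rewrite z0 mul0r addr0.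
have -> : (local_scale x)^-1 = 6 * n%:R / cfac x by rewrite /local_scale invf_div.
have -> : cfac x `^ (al - 1) = cfac x `^ al / cfac x.
  rewrite powRD; last by rewrite (gt_eqF q0) implybT.
  by rewrite powR_inv1 ?(ltW q0).
rewrite powRN; field.
by rewrite !gt_eqF// powR_gt0.
Qed.

Let coef_class m x b : ball x ->
  class_C m (cube 0 1) (fun z => cfac (x + local_scale x *: z) `^ b).
Proof.
move=> bx; have oQ : open (cube (0 : 'rV[R]_n) 1) by exact: open_cube.
apply: (class_C_affine oQ _ (class_C_cfac_pow m b)) => z; rewrite /cube/= subr0 => z1.
by apply: ball_scale => //; exact: ltW.
Qed.

(** The right-hand side is C^1 together with [U], because [p > 1]. The kernel equations do not
    distinguish [U] from [loc_u], which agree almost everywhere on the cube. *)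
Let local_class2 x U : ball x -> class_C 1 (cube 0 rho) U ->
  {ae mu, forall z, cube 0 rho z -> U z = loc_u u x z} -> class_C 2 (cube 0 (rho / 4)) U.
Proof.
move=> bx CU aeU.
pose g z := coef_lin lam x z * U z + coef_pow p x z * (`|U z| `^ (p - 1) * U z).
have oQ : open (cube (0 : 'rV[R]_n) rho) by exact: open_cube.
have Q1 : cube (0 : 'rV[R]_n) rho `<=` cube 0 1 by move=> z; rewrite /cube/= => /lt_le_trans; apply.
have Cg : class_C 1 (cube 0 rho) g.
  have C1 b c : class_C 1 (cube 0 rho) (fun z => c * cfac (x + local_scale x *: z) `^ b).
    exact: (class_CM oQ (class_C_cst 1 c oQ) (class_C_sub Q1 (coef_class 1 b bx))).
  exact: (class_CD oQ (class_CM oQ (C1 _ _) CU) (class_CM oQ (C1 _ _) (class_C1_signed_pow p1 oQ CU))).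
apply: (local_C2 rho0 CU Cg).
have [[Lw _ _ _] [_ HP mg _]] := data bx.
have := kernel_poisson_cut rho_r1 (HP 0%N).
have mU : measurable_fun setT (cut rho U) by apply: measurable_cut_cont => z; exact: class_C_cont CU.
have mG : measurable_fun setT (cut rho g) by apply: measurable_cut_cont => z; exact: class_C_cont Cg.
have aeU' : {ae mu, forall z, cut rho (loc_u u x) z = cut rho U z}.
  apply: filterS aeU => z h; case: (cutP rho U z) => -[zr ->]; last by rewrite cut_out.
  by rewrite cut_in// h// /cube/= subr0.
have aeg : {ae mu, forall z, cut rho (loc_g lam p u x) z = cut rho g z}.
  apply: filterS aeU => z h; case: (cutP rho g z) => -[zr ->]; last by rewrite cut_out.
  by rewrite cut_in// /loc_g /g h// /cube/= subr0.
move=> H t z t0 zt; have := H t z t0 zt.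
rewrite (conv_ae z _ (measurable_cut rho (L1_measurable Lw)) mU aeU'); last first.
  exact: continuousT_measurable_rV (@lap_ker_continuous R n 0 t).
rewrite (conv_ae z _ (measurable_cut rho mg) mG aeg)//.
exact: continuousT_measurable_rV (@cker R n 0 t).
Qed.

Lemma class_C2_representative : exists2 v, class_C 2 ball v & {ae mu, forall x, ball x -> v x = u x}.
Proof.
apply: (class_C_glue open_hball) => x bx.
have [U CU aeU] := local_C1_exists n2 kap1 kapn (growth_const_ge0 (n := n) lam p) p1 pkap (data bx).
have C2 := local_class2 bx CU aeU.
have r41 : rho / 4 <= 1 by move: rho1; lra.
exists (unscale x U), (local_scale x * (rho / 4)); split.
- by rewrite mulr_gt0 ?local_scale_gt0// divr_gt0.
- exact: cube_sub.
- exact: unscale_class.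
- apply: unscale_ae => //; apply: filterS aeU => z h; rewrite /cube/= => z4; apply: h.
  by apply: (lt_le_trans z4); move: rho0; lra.
Qed.

(** Dominated convergence: every point of the ball leaves the set [cfac < d] when [d] decreases to
    0, and outside the ball, which the set contains, the density is zero. *)
Lemma energy_tail e : 0 < e -> exists2 d, 0 < d &
  \int[mu]_y (\1_[set y | cfac y < d] y * energy u D y) <= e.
Proof.
move=> e0; have [_ [LE _ _]] := HS.
pose F (k : nat) (y : 'rV[R]_n) := \1_[set y : 'rV[R]_n | cfac y < k.+1%:R^-1] y * energy u D y.
have mE := L1_measurable LE.
have E0 := energy_ge0 u D.
have mF k : measurable_fun setT (F k).
  apply: measurable_funM => //; apply: measurable_indic.
  have := continuousT_measurable_rV (@continuous_cfac R n) measurableT (measurable_itv `]-oo, k.+1%:R^-1[).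
  by rewrite setTI; congr measurable; apply/seteqP; split => y /=; rewrite in_itv.
have Fb k y : `|F k y| <= energy u D y.
  rewrite normrM (ger0_norm (E0 y)) ler_piMl// indicE; case: (_ \in _); by rewrite ?normr1 ?normr0.
have Fc : {ae mu, forall y, F k y @[k --> \oo] --> (0 : R)}.
  apply: aeW => y; have [by_|nby] := pselect (ball y); last first.
    by apply: cvg_near_cst; near=> k; rewrite /F (energy_out HS nby) mulr0.
  have qy := cfac_gt0 by_.
  apply: cvg_near_cst; exists (Num.trunc (cfac y)^-1) => // k /= km.
  rewrite /F indicE memNset ?mul0r//= => /ltW; apply/negP; rewrite -ltNge.
  rewrite invf_plt ?posrE//; apply: (lt_le_trans (truncnS_gt _)); by rewrite ler_nat ltnS.
have m0 : measurable_fun setT (fun _ : 'rV[R]_n => 0 : R) by exact: measurable_cst.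
have [_ Fi _] := @dominated_cvg_Rintegral _ _ R mu F (fun=> 0) _ mF m0 LE Fc Fb.
have z0 : \int[mu]_(_ in [set: 'rV[R]_n]) 0 = 0 :> R by rewrite /Rintegral integral0.
rewrite z0 in Fi; move/cvgrPdist_le : Fi => /(_ _ e0)[k _ /(_ k (leqnn k))/=].
rewrite sub0r normrN => /(le_trans (ler_norm _)) Fk.
by exists k.+1%:R^-1 => //; rewrite invr_gt0.
Unshelve. all: by end_near. Qed.

Lemma decay v e : class_C 2 ball v -> {ae mu, forall x, ball x -> v x = u x} -> 0 < e ->
  exists2 d, 0 < d & forall x, ball x -> cfac x < d ->
    `|v x| <= e /\ forall i, `|cfac x * partial i v x| <= (al + 6 * n%:R) * e.
Proof.
move=> Cv aev e0.
have [del del0 Hdel] := local_C1_small n2 kap1 kapn (growth_const_ge0 (n := n) lam p) p1 pkap e0.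
have al0 : 0 <= al by rewrite divr_ge0// subr_ge0 ler_nat.
have CE0 : 0 <= @energy_const R n.
  by rewrite /energy_const addr_ge0 ?sqr_ge0// mulr_ge0// addr_ge0// mulr_ge0// sqr_ge0.
pose K := @energy_const R n * (15 / 2 * n%:R) ^+ n + 1.
have K0 : 0 < K by rewrite ltr_wpDl// mulr_ge0// exprn_ge0// mulr_ge0// divr_ge0.
have dK : 0 < del / K by rewrite divr_gt0.
have [d d0 Hd] := energy_tail dK.
have [_ [LE _ _]] := HS; have E0 := energy_ge0 u D.
have Lind (A : set 'rV[R]_n) : measurable A -> L1 (fun y => \1_A y * energy u D y).
  move=> mA; apply: (L1_le _ _ LE).
    by apply: measurable_funM; [exact: measurable_indic|exact: L1_measurable].
  by move=> y; rewrite normrM (ger0_norm (E0 y)) ler_piMl// indicE; case: (_ \in _); rewrite ?normr1 ?normr0.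
(* Half of [d], because [cfac] exceeds its value at the center by a factor at most 5/4 on the cube
   of radius [local_scale x]; that cube then lies in the set [cfac < d]. *)
exists (d / 2); first by rewrite divr_gt0.
move=> x bx xd; have r0 := local_scale_gt0 n2 bx.
have sub : \int[mu]_y (\1_(cube x (local_scale x)) y * energy u D y) <= \int[mu]_y (\1_[set y | cfac y < d] y * energy u D y).
  have ms : measurable [set y : 'rV[R]_n | cfac y < d].
    have := continuousT_measurable_rV (@continuous_cfac R n) measurableT (measurable_itv `]-oo, d[).
    by rewrite setTI; congr measurable; apply/seteqP; split => y /=; rewrite in_itv.
  apply: (Rintegral_le (Lind _ (measurable_cube _ _)) (Lind _ ms)) => y.
  apply: ler_wpM2r => //; rewrite !indicE; have [/set_mem yx|] := boolP (y \in cube x (local_scale x)); last by rewrite ler0n.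
  rewrite mem_set//=; have yz := scale_inv x y r0.
  move: yx; rewrite /cube/= -[X in _ < X]mulr1 -norm_scale_inv// => /ltW z1.
  have /andP[_] := cfac_scale n2 bx z1; rewrite -yz; move: xd (cfac_gt0 bx); lra.
have LL := local_energy n2 HS bx.
have small : \int[mu]_z loc_u u x z ^+ 2 + \sum_i \int[mu]_z loc_D u D x i z ^+ 2 <= del.
  apply: (le_trans LL); apply: (@le_trans _ _ (K * (del / K))); last by rewrite mulrC divfK// gt_eqF.
  apply: ler_pM.
  - by rewrite mulr_ge0// exprn_ge0// mulr_ge0// divr_ge0.
  - by apply: Rintegral_ge0 => y _; rewrite mulr_ge0// indicE.
  - by rewrite lerDl.
  - exact: le_trans sub Hd.
have [U [CU aeU bU bdU]] := Hdel _ _ _ (data bx) small.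
have c0 : cube (0 : 'rV[R]_n) rho 0 by rewrite /cube/= subrr normr0.
have oQ : open (cube x (local_scale x * rho)) by exact: open_cube.
have cx : cube x (local_scale x * rho) x by rewrite /cube/= subrr normr0 mulr_gt0.
have CR := unscale_class bx rho1 CU.
have vr : forall y, cube x (local_scale x * rho) y -> v y = unscale x U y.
  apply: (ae_eq_cont oQ).
  - by move=> y /(cube_sub bx rho1); exact: class_C_cont Cv.
  - by move=> y; exact: class_C_cont CR.
  - by apply: filterS2 aev (unscale_ae bx rho1 aeU) => y h1 h2 Qy; rewrite (h2 Qy) (h1 (cube_sub bx rho1 Qy)).
split; first by rewrite (vr x cx) unscale_center//; exact: bU.
move=> i; have -> : partial i v x = partial i (unscale x U) x.
  exact: (partial_near oQ cx vr (class_C_derive i Cv bx)).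
rewrite (unscale_partial i bx rho0 CU) [leRHS]mulrDl; apply: (le_trans (ler_normD _ _)); apply: lerD.
  rewrite normrM; apply: ler_pM => //; last exact: bU.
  rewrite normrM normrN (ger0_norm al0) ler_piMr//.
  rewrite -(ler_pXn2r (n := 2))// ?nnegrE// expr1n real_normK ?num_real//.
  by apply: le_trans (edot_coord_le _ i) _; move/hballP : bx => /ltW.
rewrite normrM ger0_norm; last by rewrite mulr_ge0// ltW.
by apply: ler_wpM2l; [rewrite mulr_ge0// ltW|exact: bdU].
Qed.

End global_solution.

(** For [n > 2], [kap] is half of the critical exponent [2n / (n - 2)], and [p + 1 <= 2 * kap] is
    the bound on [p]. For [n = 2] the condition [kap * (n - 2) <= n] holds for every [kap], and
    [(p + 1) / 2] is enough. *)
Lemma sobolev_exponent (R : realType) (n : nat) (p : R) : (2 <= n)%N -> 1 < p ->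
  ((2 < n)%N -> p <= (n%:R + 2) / (n%:R - 2)) ->
  exists kap : R, [/\ 1 < kap, kap * (n%:R - 2) <= n%:R & p + 1 <= 2 * kap].
Proof.
rewrite leq_eqVlt => /orP[/eqP <- p1 _|n2 p1 /(_ n2) hp].
  exists ((p + 1) / 2); rewrite subrr mulr0 ler0n; split => //; move: p1; lra.
have d0 : 0 < n%:R - 2 :> R by rewrite subr_gt0 ltr_nat.
exists (n%:R / (n%:R - 2)); split.
- by rewrite ltr_pdivlMr// mul1r gtrBl.
- by rewrite divfK// gt_eqF.
- apply: (le_trans (lerD hp (lexx 1))); rewrite le_eqVlt; apply/orP; left; apply/eqP.
  by field; rewrite gt_eqF.
Qed.

(** Because [(1 - |x|^2) / 2 <= 1 - |x|], points with [|x| > 1 - d] satisfy [cfac x < d]. *)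
Lemma hinfty_cfac (R : realType) (n : nat) (P : 'rV[R]_n -> Prop) (d : R) : 0 < d ->
  (forall x, hball x -> cfac x < d -> P x) -> hinfty P.
Proof.
move=> d0 H; exists (1 - d) => /=; first by rewrite gtrBl.
move=> x /= /andP[dx x1]; apply: H => //; rewrite /cfac -enorm_sqr.
by have := sqr_ge0 (1 - enorm x); rewrite sqrrB; move: dx; lra.
Qed.

(** The set [cfac >= d] is a compact subset of the ball, on which [v] is bounded by continuity. *)
Lemma bounded_on_ball (R : realType) (n : nat) (v : 'rV[R]_n -> R) (d M : R) : 0 < d ->
  (forall x, hball x -> {for x, continuous v}) ->
  (forall x, hball x -> cfac x < d -> `|v x| <= M) ->
  exists M', forall x, hball x -> `|v x| <= M'.
Proof.
move=> d0 cv vM; pose K := ~` [set x : 'rV[R]_n | cfac x < d].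
have oK : open [set x : 'rV[R]_n | cfac x < d].
  apply/open_rVP => x /= xd; have e0 : 0 < d - cfac x by rewrite subr_gt0.
  have [r r0 H] := (cont_rVP _ x).1 (continuous_cfac (x := x)) _ e0.
  exists r => // y yx; have := H y yx; have := ler_norm (cfac y - cfac x); lra.
have KB : K `<=` hball.
  move=> x /= /negP; rewrite -leNgt /cfac => h; apply/hballP; move: h d0; lra.
have cK : compact K.
  apply: (subclosed_compact (open_closedC oK) (@closed_cube_compact R n 0 1)) => x /KB /hballP x1 /=.
  rewrite subr0 -(ler_pXn2r (n := 2))// ?nnegrE// expr1n.
  exact: le_trans (norm_sqr_le_edot x) (ltW x1).
have [M1 [M1r HM]] : bounded_set (v @` K).
  apply: compact_bounded; apply: continuous_compact => //.
  by apply: continuous_in_subspaceT => y; rewrite inE => /KB; exact: cv.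
exists (Num.max M (`|M1| + 1)) => x bx; rewrite le_max.
have [xd|xd] := ltP (cfac x) d; first by rewrite vM.
apply/orP; right; apply: (HM (`|M1| + 1)); first by rewrite (le_lt_trans (ler_norm _))// ltrDl.
by exists x => //=; apply/negP; rewrite -leNgt.
Qed.

Theorem theorem4p1 (R : realType) (N : nat) (lam p : R) (u : 'rV[R]_N -> R)
  (hN : (2 <= N)%N)
  (hlam : lam < ((N%:R - 1) / 2) ^+ 2)
  (hp1 : 1 < p)
  (hp : (2 < N)%N -> p <= (N%:R + 2) / (N%:R - 2))
  (hu : H1 u)
  (hsol : weak_solution lam p u) :
  (exists v : 'rV[R]_N -> R,
    [/\ {ae lebesgue_rV, forall x, hball x -> v x = u x},
        class_C 2 hball v,
        v x @[x --> hinfty] --> (0 : R)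
      & hgrad_dot x (grad v x) (grad v x) @[x --> hinfty] --> (0 : R)]) /\
  Linfty u.
Proof.
have [mu [u0 [D [HS u0E]]]] := weak_solution_ext hsol.
have [kap [kap1 kapn pkap]] := sobolev_exponent hN hp1 hp.
have [v Cv aev0] := class_C2_representative hN kap1 kapn hp1 pkap HS.
have aev : {ae lebesgue_rV, forall x, hball x -> v x = u x}.
  by apply: filterS aev0 => x h bx; rewrite (h bx) u0E.
have dec := decay hN kap1 kapn hp1 pkap HS Cv aev0.
split.
  exists v; split => //.
    apply/cvgrPdist_le => e e0; have [d d0 H] := dec e e0.
    by apply: (hinfty_cfac d0) => x bx xd; rewrite sub0r normrN; have [] := H x bx xd.
  apply/cvgrPdist_le => e e0.
  pose K : R := N%:R * (((N%:R - 2) / 2 + 6 * N%:R) ^+ 2) + 1.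
  have N0 : 0 <= N%:R * (((N%:R - 2) / 2 + 6 * N%:R) ^+ 2) :> R by rewrite mulr_ge0// sqr_ge0.
  have K0 : 0 < K by rewrite ltr_wpDl.
  (* As [e' <= 1], its square is at most [e / K], and [K] exceeds the number of coordinates times
     the squared constant of [decay]. *)
  pose e' := Num.min 1 (e / K).
  have e'0 : 0 < e' by rewrite lt_min ltr01 divr_gt0.
  have [d d0 H] := dec e' e'0.
  apply: (hinfty_cfac d0) => x bx xd; have [_ Hx] := H x bx xd.
  rewrite sub0r normrN hgrad_dotE /edot mulr_sumr ger0_norm; last first.
    by apply: sumr_ge0 => i _; rewrite mulr_ge0 ?sqr_ge0// -expr2 sqr_ge0.
  apply: (@le_trans _ _ (\sum_(i < N) (((N%:R - 2) / 2 + 6 * N%:R) * e') ^+ 2)).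
    apply: ler_sum => i _; rewrite -expr2 -exprMn !mxE -real_normK ?num_real//.
    by apply: lerXn2r; rewrite ?nnegrE//; exact: le_trans (Hx i).
  rewrite sumr_const card_ord exprMn -[leLHS]mulr_natl mulrA.
  have h1 : e' ^+ 2 <= e / K.
    apply: (@le_trans _ _ e'); last by rewrite /e' ge_min lexx orbT.
    by rewrite expr2 ler_piMr ?(ltW e'0)// /e' ge_min lexx.
  have h2 : N%:R * (((N%:R - 2) / 2 + 6 * N%:R) ^+ 2) <= K by rewrite /K lerDl.
  apply: (le_trans (ler_pM N0 (sqr_ge0 _) h2 h1)).
  by rewrite mulrC divfK// gt_eqF.
split => //.
(* Any positive bound near infinity would do; 1 is taken. *)
have [d d0 H] := dec 1 ltr01.
have [M HM] := bounded_on_ball d0 (fun x => class_C_cont Cv (x := x)) (fun x bx xd => (H x bx xd).1).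
by exists M; apply: filterS aev => x h bx; rewrite -(h bx); exact: HM.
Qed.
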